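(* Let $N\ge 3$, $2^*=2N/(N-2)$. Assume: (a) $V\in \mathcal{C}^1(\mathbb{R}^N,\mathbb{R})$, $V(x)\ge 0$ for all $x\in\mathbb{R}^N$, the finite limit $V_\infty:=\lim_{|y|\to\infty}V(y)$ exists, $V_\infty>0$, and $V(x)\le V_\infty$ for all $x\in\mathbb{R}^N$; (b) there exists $\theta\in[0,1)$ such that for all $x\in\mathbb{R}^N\setminus\{0\}$ the quantity $$N[V(x)-V(tx)]+[\nabla V(x)\cdot x-\nabla V(tx)\cdot(tx)]+\frac{(N-2)^3\theta}{4t^2|x|^2}(t^2-1)$$ is $\ge 0$ for all $t\ge 1$ and $\le 0$ for all $0<t<1$; (c) $f\in\mathcal{C}(\mathbb{R},\mathbb{R})$, there is a constant $\mathcal{C}_0>0$ with $|f(t)|\le \mathcal{C}_0(1+|t|^{2^*-1})$ for all $t\in\mathbb{R}$, $f(t)=o(t)$ as $t\to0$, $|f(t)|=o(|t|^{(N+2)/(N-2)})$ as $|t|\to+\infty$, and there exists $s_0>0$ such that $F(s_0)>\frac12V_\infty s_0^2$, where $F(t)=\int_0^tf(s)\,ds$. Then the problem $-\Delta u+V(x)u=f(u)$ in $\mathbb{R}^N$, $u\in H^1(\mathbb{R}^N)$, has a solution $\bar u\in H^1(\mathbb{R}^N)$ such that $$I(\bar u)=\inf_{\mathcal{M}}I=\inf_{u\in\Lambda}\max_{t>0}I(u_t)>0.$$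
   Context: Solutions are understood in the weak sense, i.e. as critical points of the energy functional on $H^1(\mathbb{R}^N)$ $$I(u)=\frac12\int_{\mathbb{R}^N}\left[|\nabla u|^2+V(x)u^2\right]dx-\int_{\mathbb{R}^N}F(u)\,dx.$$ The Pohožaev functional is $$\mathcal{P}(u)=\frac{N-2}{2}\|\nabla u\|_2^2+\frac12\int_{\mathbb{R}^N}[NV(x)+\nabla V(x)\cdot x]u^2\,dx-N\int_{\mathbb{R}^N}F(u)\,dx,$$ and $\mathcal{M}=\{u\in H^1(\mathbb{R}^N)\setminus\{0\}:\mathcal{P}(u)=0\}$. For $t>0$, $u_t(x):=u(x/t)$. Also $$\Lambda=\left\{u\in H^1(\mathbb{R}^N):\int_{\mathbb{R}^N}\left[\tfrac12V_\infty u^2-F(u)\right]dx<0\right\}.$$ *)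

(* Defs.v *)
From HB Require Import structures.
From mathcomp Require Import all_boot all_order all_algebra.
From mathcomp Require Import all_classical all_reals all_analysis.

Set Implicit Arguments.
Unset Strict Implicit.
Unset Printing Implicit Defensive.

Import Order.TTheory GRing.Theory Num.Theory.
Import numFieldNormedType.Exports.

Local Open Scope classical_set_scope.
Local Open Scope ring_scope.

(* Points of R^n are row vectors 'rV[R]_n, with the sigma-algebra generated by the
   coordinate maps; R is second countable, so these are the Borel sets. *)

Definition rV_coor (R : realType) (n : nat) (i : 'I_n) (x : 'rV[R]_n) : R :=
  x ord0 i.

Definition rV_display : measure_display. Proof. exact: default_measure_display. Qed.

Lemma rV_measurable0 (R : realType) (n : nat) :
  g_sigma_preimage (@rV_coor R n) set0.
Proof. exact: sigma_algebra0. Qed.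

Lemma rV_measurableC (R : realType) (n : nat) (A : set 'rV[R]_n) :
  g_sigma_preimage (@rV_coor R n) A -> g_sigma_preimage (@rV_coor R n) (~` A).
Proof. exact: sigma_algebraC. Qed.

Lemma rV_measurable_bigcup (R : realType) (n : nat) (F : (set 'rV[R]_n)^nat) :
  (forall i, g_sigma_preimage (@rV_coor R n) (F i)) ->
  g_sigma_preimage (@rV_coor R n) (\bigcup_i F i).
Proof. exact: sigma_algebra_bigcup. Qed.

HB.instance Definition _ (R : realType) (n : nat) :=
  @isMeasurable.Build rV_display 'rV[R]_n (g_sigma_preimage (@rV_coor R n))
    (@rV_measurable0 R n) (@rV_measurableC R n) (@rV_measurable_bigcup R n).

Lemma measurable_rV_coor (R : realType) (n : nat) (i : 'I_n) :
  measurable_fun [set: 'rV[R]_n] (@rV_coor R n i).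
Proof.
move=> _ Y mY; rewrite setTI; apply: sub_sigma_algebra => /=.
rewrite -bigcup_seq/=; exists i => /=; first by rewrite mem_index_enum.
by exists Y => //; rewrite setTI.
Qed.

Lemma measurable_fun_rV (d : measure_display) (T : measurableType d)
    (R : realType) (n : nat) (f : T -> 'rV[R]_n) :
  (forall i, measurable_fun [set: T] (fun t => f t ord0 i)) ->
  measurable_fun [set: T] f.
Proof.
move=> mf.
have H : g_sigma_preimage (fun i => @rV_coor R n i \o f) `<=` measurable.
  apply: smallest_sub; first exact: sigma_algebra_measurable.
  case: n => [|n] in f mf *; first by rewrite big_ord0.
  rewrite -bigcup_mkord_ord; apply: bigcup_sub => i Ii.
  by move=> A [B mB <-]; exact: mf.
by move=> _ A mA; apply: H; rewrite g_sigma_preimage_comp; exists A.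
Qed.

(* Lebesgue measure on R^n, as the n-fold product of Lebesgue measure on R
   transported along R * R^n ~ R^n.+1. *)

Definition rV_cons (R : realType) (n : nat) (p : R * 'rV[R]_n) : 'rV[R]_n.+1 :=
  \row_i (if unlift ord0 i is Some j then p.2 ord0 j else p.1).

Definition rV_uncons (R : realType) (n : nat) (x : 'rV[R]_n.+1) :
    R * 'rV[R]_n :=
  (x ord0 ord0, \row_j x ord0 (lift ord0 j)).

Lemma rV_consK (R : realType) (n : nat) :
  cancel (@rV_cons R n) (@rV_uncons R n).
Proof.
move=> [a x]; rewrite /rV_uncons mxE unlift_none; congr (_, _).
by apply/rowP => j; rewrite !mxE liftK.
Qed.

Lemma measurable_rV_cons (R : realType) (n : nat) :
  measurable_fun [set: R * 'rV[R]_n] (@rV_cons R n).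
Proof.
apply: measurable_fun_rV => i.
case: (unliftP ord0 i) => [j|] ->.
- rewrite (_ : (fun _ => _) = @rV_coor R n j \o snd); last first.
    by apply/funext => p; rewrite mxE liftK.
  by apply: measurableT_comp => //; exact: measurable_rV_coor.
- rewrite (_ : (fun _ => _) = fst) //.
  by apply/funext => p; rewrite mxE unlift_none.
Qed.

Lemma measurable_rV_uncons (R : realType) (n : nat) :
  measurable_fun [set: 'rV[R]_n.+1] (@rV_uncons R n).
Proof.
apply: measurable_fun_pair; first exact: measurable_rV_coor.
apply: measurable_fun_rV => i.
rewrite (_ : (fun _ => _) = @rV_coor R n.+1 (lift ord0 i)).
  exact: measurable_rV_coor.
by apply/funext => x; rewrite mxE.
Qed.

Definition rV_cons_measure (R : realType) (n : nat)
    (m : {sigma_finite_measure set 'rV[R]_n -> \bar R}) :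
    set 'rV[R]_n.+1 -> \bar R :=
  pushforward (@lebesgue_measure R \x m)%E (@rV_cons R n).

Lemma rV_cons_measure0 (R : realType) (n : nat)
    (m : {sigma_finite_measure set 'rV[R]_n -> \bar R}) :
  rV_cons_measure m set0 = 0%E.
Proof. by rewrite /rV_cons_measure /pushforward preimage_set0 measure0. Qed.

Lemma rV_cons_measure_ge0 (R : realType) (n : nat)
    (m : {sigma_finite_measure set 'rV[R]_n -> \bar R}) (A : set 'rV[R]_n.+1) :
  (0 <= rV_cons_measure m A)%E.
Proof. by rewrite /rV_cons_measure /pushforward; exact: measure_ge0. Qed.

Lemma rV_cons_measure_sigma_additive (R : realType) (n : nat)
    (m : {sigma_finite_measure set 'rV[R]_n -> \bar R}) :
  semi_sigma_additive (rV_cons_measure m).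
Proof.
have mc := @measurable_rV_cons R n.
move=> F mF tF mUF; rewrite /rV_cons_measure /pushforward preimage_bigcup.
apply: measure_semi_sigma_additive.
- by move=> k; rewrite -[X in measurable X]setTI; exact: mc.
- apply/trivIsetP => /= i j _ _ ij; rewrite -preimage_setI.
  by move/trivIsetP : tF => /(_ _ _ _ _ ij) ->//; rewrite preimage_set0.
- by rewrite -preimage_bigcup -[X in measurable X]setTI; exact: mc.
Qed.

HB.instance Definition _ (R : realType) (n : nat)
    (m : {sigma_finite_measure set 'rV[R]_n -> \bar R}) :=
  isMeasure.Build _ _ _ (rV_cons_measure m) (rV_cons_measure0 m)
    (rV_cons_measure_ge0 m) (@rV_cons_measure_sigma_additive R n m).

Lemma rV_cons_measure_sigma_finite (R : realType) (n : nat)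
    (m : {sigma_finite_measure set 'rV[R]_n -> \bar R}) :
  sigma_finite setT (rV_cons_measure m).
Proof.
have /sigma_finiteP[F [TF ndF Foo]] := sigma_finiteT (@lebesgue_measure R).
have /sigma_finiteP[G [TG ndG Goo]] := sigma_finiteT m.
have {TF TG} FT : [set: R * 'rV[R]_n] = \bigcup_k (F k `*` G k).
  rewrite -setXTT TF TG predeqE => -[x y]; split.
    move=> [/= [i _ Fix] [j _ Gjy]]; exists (maxn i j) => //; split.
    - by move: x Fix; exact/subsetPset/ndF/leq_maxl.
    - by move: y Gjy; exact/subsetPset/ndG/leq_maxr.
  by move=> [k _ []/= ? ?]; split; exists k.
have Ffin k : measurable (F k `*` G k) /\
    ((@lebesgue_measure R \x m)%E (F k `*` G k) < +oo)%E.
  have [mF Fk] := Foo k; have [mG Gk] := Goo k.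
  split; first exact: measurableX.
  by rewrite product_measure1E// lte_mul_pinfty// ge0_fin_numE.
exists (fun k => @rV_uncons R n @^-1` (F k `*` G k)).
  by rewrite -preimage_bigcup -FT preimage_setT.
move=> k; have [mFk Fkoo] := Ffin k; split.
  by rewrite -[X in measurable X]setTI; exact: measurable_rV_uncons.
rewrite /rV_cons_measure /pushforward -comp_preimage.
by rewrite (_ : _ \o _ = id) ?preimage_id//; apply/funext/rV_consK.
Qed.

HB.instance Definition _ (R : realType) (n : nat)
    (m : {sigma_finite_measure set 'rV[R]_n -> \bar R}) :=
  Measure_isSigmaFinite.Build _ _ _ (rV_cons_measure m)
    (rV_cons_measure_sigma_finite m).

Fixpoint lebesgue_rV (R : realType) (n : nat) :
    {sigma_finite_measure set 'rV[R]_n -> \bar R} :=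
  match n with
  | 0 => dirac (0 : 'rV[R]_0)
  | k.+1 => rV_cons_measure (lebesgue_rV R k)
  end.

Lemma lebesgue_rV_box (R : realType) (n : nat) (a b : 'rV[R]_n) :
  (forall i, a ord0 i <= b ord0 i) ->
  lebesgue_rV R n [set x | forall i, a ord0 i <= x ord0 i <= b ord0 i] =
  (\prod_(i < n) (b ord0 i - a ord0 i))%:E.
Proof.
have mbox k (c d : 'rV[R]_k) :
    measurable [set x : 'rV[R]_k | forall i, c ord0 i <= x ord0 i <= d ord0 i].
  rewrite (_ : [set _ | _] = \bigcap_(i : 'I_k)
      (@rV_coor R k i @^-1` `[c ord0 i, d ord0 i])); last first.
    apply/seteqP; split => x /=.
      by move=> h i _; rewrite /rV_coor /= in_itv /=; exact: h.
    by move=> h i; have := h i Logic.I; rewrite /rV_coor /= in_itv.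
  apply: fin_bigcap_measurable; first exact: finite_finset.
  move=> i _; rewrite -[X in measurable X]setTI.
  by apply: measurable_rV_coor => //; exact: measurable_itv.
elim: n a b => [|n IH] a b ab /=.
  rewrite big_ord0 /dirac indicE mem_set//= => -[] //.
rewrite /rV_cons_measure /pushforward.
pose a' : 'rV[R]_n := \row_j a ord0 (lift ord0 j).
pose b' : 'rV[R]_n := \row_j b ord0 (lift ord0 j).
rewrite (_ : _ @^-1` _ = `[a ord0 ord0, b ord0 ord0]%classic `*`
   [set x : 'rV[R]_n | forall i, a' ord0 i <= x ord0 i <= b' ord0 i]); last first.
  apply/seteqP; split => -[r x] /=.
    move=> h; split; first by have := h ord0; rewrite mxE unlift_none in_itv.
    by move=> i; have := h (lift ord0 i); rewrite !mxE liftK.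
  rewrite in_itv /= => -[h0 h] i; rewrite mxE.
  by case: unliftP => [j|] -> //; have := h j; rewrite !mxE.
rewrite product_measure1E; [|exact: measurable_itv|exact: mbox].
rewrite IH; last by move=> i; rewrite !mxE.
rewrite big_ord_recl EFinM /= lebesgue_measure_itv /= lte_fin.
congr (_ * _)%E.
  case: ifPn => //; rewrite -leNgt => ba.
  by rewrite (@le_anti _ _ (a ord0 ord0) (b ord0 ord0)) ?subrr// ab ba.
by congr (_%:E); apply: eq_bigr => i _; rewrite !mxE.
Qed.

(* The library norm on 'rV[R]_N is the sup norm; |x| below is Euclidean. *)

Definition dotv (R : realType) (N : nat) (x y : 'rV[R]_N) : R :=
  \sum_(i < N) x ord0 i * y ord0 i.

Definition enorm (R : realType) (N : nat) (x : 'rV[R]_N) : R :=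
  Num.sqrt (dotv x x).

Definition partial (R : realType) (N : nat) (i : 'I_N) (u : 'rV[R]_N -> R) :
    'rV[R]_N -> R :=
  fun x => 'D_(delta_mx ord0 i) u x.

Definition grad (R : realType) (N : nat) (u : 'rV[R]_N -> R) (x : 'rV[R]_N) :
    'rV[R]_N :=
  \row_i partial i u x.

Fixpoint class_C (R : realType) (N k : nat) (u : 'rV[R]_N -> R) : Prop :=
  match k with
  | 0 => continuous u
  | j.+1 => continuous u /\
      forall i : 'I_N, (forall x, derivable u x (delta_mx ord0 i)) /\
                       class_C j (partial i u)
  end.

Definition test_function (R : realType) (N : nat) (phi : 'rV[R]_N -> R) : Prop :=
  (forall k, class_C k phi) /\ compact (closure [set x | phi x != 0]).

Definition L2 (R : realType) (N : nat) : set ('rV[R]_N -> R) :=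
  [set u | u \in Lfun (lebesgue_rV R N) 2%:E].

Definition weak_partial (R : realType) (N : nat) (i : 'I_N)
    (u g : 'rV[R]_N -> R) : Prop :=
  forall phi, test_function phi ->
    \int[lebesgue_rV R N]_x (u x * partial i phi x) =
    - \int[lebesgue_rV R N]_x (g x * phi x).

(* Elements of H^1(R^N) are represented by functions; all the notions below
   are invariant under almost everywhere equality. *)
Definition H1 (R : realType) (N : nat) : set ('rV[R]_N -> R) :=
  [set u | L2 u /\ forall i : 'I_N, exists2 g, L2 g & weak_partial i u g].

(* Weak partial derivatives are unique up to a null set: choose one. *)
Definition wpartial (R : realType) (N : nat) (i : 'I_N) (u : 'rV[R]_N -> R) :
    'rV[R]_N -> R :=
  get [set g | L2 g /\ weak_partial i u g].

Definition wgrad (R : realType) (N : nat) (u : 'rV[R]_N -> R) (x : 'rV[R]_N) :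
    'rV[R]_N :=
  \row_i wpartial i u x.

Definition H1norm (R : realType) (N : nat) (u : 'rV[R]_N -> R) : R :=
  Num.sqrt (\int[lebesgue_rV R N]_x (enorm (wgrad u x) ^+ 2 + u x ^+ 2)).

Definition primitive (R : realType) (f : R -> R) (t : R) : R :=
  if 0 <= t then \int[lebesgue_measure]_(s in `[0, t]) f s
  else - \int[lebesgue_measure]_(s in `[t, 0]) f s.

Definition energy (R : realType) (N : nat) (V : 'rV[R]_N -> R) (f : R -> R)
    (u : 'rV[R]_N -> R) : R :=
  2^-1 * \int[lebesgue_rV R N]_x (enorm (wgrad u x) ^+ 2 + V x * u x ^+ 2)
  - \int[lebesgue_rV R N]_x primitive f (u x).

Definition pohozaev (R : realType) (N : nat) (V : 'rV[R]_N -> R) (f : R -> R)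
    (u : 'rV[R]_N -> R) : R :=
  (N%:R - 2) / 2 * \int[lebesgue_rV R N]_x (enorm (wgrad u x) ^+ 2)
  + 2^-1 * \int[lebesgue_rV R N]_x
             ((N%:R * V x + dotv (grad V x) x) * u x ^+ 2)
  - N%:R * \int[lebesgue_rV R N]_x primitive f (u x).

Definition pohozaev_manifold (R : realType) (N : nat) (V : 'rV[R]_N -> R)
    (f : R -> R) : set ('rV[R]_N -> R) :=
  [set u | [/\ H1 u, ~ {ae lebesgue_rV R N, forall x, u x = 0}
             & pohozaev V f u = 0]].

Definition Lambda (R : realType) (N : nat) (Vinf : R) (f : R -> R) :
    set ('rV[R]_N -> R) :=
  [set u | H1 u /\
    \int[lebesgue_rV R N]_x (2^-1 * Vinf * u x ^+ 2 - primitive f (u x)) < 0].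

Definition dilation (R : realType) (N : nat) (t : R) (u : 'rV[R]_N -> R) :
    'rV[R]_N -> R :=
  fun x => u (t^-1 *: x).

(* J is Frechet differentiable at u on H^1(R^N), with differential L. *)
Definition H1_differential (R : realType) (N : nat) (J : ('rV[R]_N -> R) -> R)
    (u : 'rV[R]_N -> R) (L : ('rV[R]_N -> R) -> R) : Prop :=
  forall e : R, 0 < e -> exists2 d : R, 0 < d &
    forall h, H1 h -> H1norm h < d ->
      `|J (u \+ h) - J u - L h| <= e * H1norm h.

Definition critical_point (R : realType) (N : nat) (J : ('rV[R]_N -> R) -> R)
    (u : 'rV[R]_N -> R) : Prop :=
  H1 u /\ H1_differential J u (fun=> 0).

(* Weak solution of - Delta u + V u = f(u), u in H^1(R^N). *)
Definition weak_solution (R : realType) (N : nat) (V : 'rV[R]_N -> R)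
    (f : R -> R) (u : 'rV[R]_N -> R) : Prop :=
  critical_point (energy V f) u.

Definition critical_exponent (R : realType) (N : nat) : R :=
  2 * N%:R / (N%:R - 2).

(* Main.v *)
(** The growth condition on [V] says that along every fibre [t |-> u(x/t)] the
energy is bounded by
  [I(u_t) <= I(u) + (t^N - 1)/N * P(u) - (1 - theta)(N - 2)/2 * rho(t) * |grad u|^2]
with [rho(t) = (t^N - 1)/N - (t^(N-2) - 1)/(N - 2) >= 0]; the term in [theta] is
absorbed by Hardy's inequality.  Hence a point of [M] maximises the energy on its
fibre, every fibre through [Lambda] meets [M], and [M] lies in [Lambda], so both
infima coincide.

A minimising sequence on [M] is bounded in [H^1].  It is split, along an
ultrafilter and by the Brezis-Lieb lemma, into a weak limit (after a translation
if that limit vanishes) and a remainder whose fibre profile is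
[t^(N-2) e/2 + t^N b].  The remainder cannot have [b < 0], for then it would by
itself already cost the whole infimum; so the weak limit projects to a minimiser.

If the derivative at the minimiser [u] in some direction [phi] were negative, the
maximum of the energy over the fibre of [u + s phi] would drop below the infimum
for small [s > 0], since [rho] keeps the fibre maximum close to [t = 1].  Hence the
minimiser is a critical point.

Sobolev's embedding and Rellich's theorem are obtained by comparing a function
with its averages over small cubes: the [L^2] distance of [u] to its average at
scale [l] is at most [N l |grad u|]. *)

From HB Require Import structures.
From mathcomp Require Import all_boot all_order all_algebra.
From mathcomp Require Import all_classical all_reals all_analysis.
From mathcomp Require Import measurable_realfun.
From mathcomp Require Import ring lra.
Require Import Defs.

Set Implicit Arguments.
Unset Strict Implicit.
Unset Printing Implicit Defensive.

Import Order.TTheory GRing.Theory Num.Theory.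
Import numFieldNormedType.Exports.

Local Open Scope classical_set_scope.
Local Open Scope ring_scope.

(** * Integrals of real functions and the space L2 *)

Section Integrals.
Context {d : measure_display} {T : measurableType d} {R : realType}
  (mu : {measure set T -> \bar R}).
Implicit Types f g h : T -> R.

(** The set [pohozaev_manifold V f] is never treated as a manifold. A Lagrange multiplier would
    require the derivative of [pohozaev V f] to be nonzero there, and then an argument removing the
    multiplier; the gap [rho] along fibres replaces both and asks only for a [V] of class C^1 and a
    continuous [f].

    The constant (N-2)^3 theta / 4 in (b) is (N-2) theta times Hardy's (N-2)^2 / 4. Multiplied by
    t^(N-1), the factor 1 - t^-2 becomes rho'(t), so (b) integrates exactly to the fibre bound. The
    limits t -> 0 and t -> oo of that bound give the coercivity estimates [energy_lower] and
    [pohozaev_lower].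

    Nothing makes the level of the problem at infinity strictly larger, since [V] may be constant.
    Escaping mass is excluded by the geometry of fibres, not by comparing levels; writing V = Vinf -
    (Vinf - V) leaves a nonnegative deficit that vanishes at infinity.

    An ultrafilter makes all limits of bounded quantities exist at once, but dominated convergence
    wants sequences: for each j an index is chosen that meets finitely many conditions up to
    1/(j+1). *)

Definition intg f : Prop := mu.-integrable [set: T] (EFin \o f).

Lemma intg_measurable f : intg f -> measurable_fun [set: T] f.
Proof. by move=> /integrableP[/measurable_EFinP]. Qed.

Lemma intg_le f g : measurable_fun [set: T] f -> (forall x, `|f x| <= g x) ->
  intg g -> intg f.
Proof.
move=> mf fg; apply: le_integrable => //; first exact/measurable_EFinP.
by move=> x _ /=; rewrite lee_fin (le_trans (fg x)) ?ler_norm.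
Qed.

Lemma intg0 : intg (fun=> 0).
Proof. exact: integrable0. Qed.

Lemma intgD f g : intg f -> intg g -> intg (fun x => f x + g x).
Proof. by move=> fi gi; exact: (integrableD measurableT fi gi). Qed.

Lemma intgN f : intg f -> intg (fun x => - f x).
Proof. by move=> fi; exact: (integrableN fi). Qed.

Lemma intgB f g : intg f -> intg g -> intg (fun x => f x - g x).
Proof. by move=> ? ?; apply: intgD => //; exact: intgN. Qed.

Lemma intgZ c f : intg f -> intg (fun x => c * f x).
Proof. by move=> fi; exact: (integrableZl measurableT c fi). Qed.

Lemma intg_norm f : intg f -> intg (fun x => `|f x|).
Proof. by move=> ?; exact: integrable_norm. Qed.

Lemma intg_sum (I : Type) (s : seq I) (F : I -> T -> R) :
  (forall i, intg (F i)) -> intg (fun x => \sum_(i <- s) F i x).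
Proof.
move=> iF; elim: s => [|i s IH].
  by under eq_fun do rewrite big_nil; exact: intg0.
by under eq_fun do rewrite big_cons; exact: intgD.
Qed.

Lemma EFin_int f : intg f -> (\int[mu]_x f x)%:E = (\int[mu]_x (f x)%:E)%E.
Proof. by move=> fi; rewrite /Rintegral fineK//; exact: integrable_fin_num. Qed.

Lemma intD f g : intg f -> intg g ->
  \int[mu]_x (f x + g x) = \int[mu]_x f x + \int[mu]_x g x.
Proof. by move=> ? ?; rewrite RintegralD. Qed.

Lemma intB f g : intg f -> intg g ->
  \int[mu]_x (f x - g x) = \int[mu]_x f x - \int[mu]_x g x.
Proof. by move=> ? ?; rewrite RintegralB. Qed.

Lemma intZ c f : intg f -> \int[mu]_x (c * f x) = c * \int[mu]_x f x.
Proof. by move=> ?; rewrite RintegralZl. Qed.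

Lemma intN f : intg f -> \int[mu]_x (- f x) = - \int[mu]_x f x.
Proof.
by move=> fi; rewrite -mulN1r -intZ//; apply: eq_Rintegral => x _; rewrite mulN1r.
Qed.

Lemma int0 : \int[mu]_x (0 : R) = 0.
Proof. by rewrite /Rintegral integral0. Qed.

Lemma int_sum (I : Type) (s : seq I) (F : I -> T -> R) :
  (forall i, intg (F i)) ->
  \int[mu]_x (\sum_(i <- s) F i x) = \sum_(i <- s) \int[mu]_x F i x.
Proof.
move=> iF; elim: s => [|i s IH].
  by under eq_Rintegral do rewrite big_nil; rewrite int0 big_nil.
under eq_Rintegral do rewrite big_cons.
by rewrite intD//; [rewrite IH big_cons | exact: intg_sum].
Qed.

Lemma int_ge0 f : (forall x, 0 <= f x) -> 0 <= \int[mu]_x f x.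
Proof. by move=> f0; exact: Rintegral_ge0. Qed.

Lemma int_le f g : intg f -> intg g -> (forall x, f x <= g x) ->
  \int[mu]_x f x <= \int[mu]_x g x.
Proof. by move=> ? ? ?; exact: le_Rintegral. Qed.

Lemma int_norm_le f g : intg f -> intg g -> (forall x, `|f x| <= g x) ->
  `|\int[mu]_x f x| <= \int[mu]_x g x.
Proof.
move=> fi gi fg; apply: (le_trans (le_normr_Rintegral _ fi)) => //.
by apply: int_le => //; exact: intg_norm.
Qed.

Lemma eq_int f g : f =1 g -> \int[mu]_x f x = \int[mu]_x g x.
Proof. by move=> fg; apply: eq_Rintegral => x _; exact: fg. Qed.

Lemma eq_intg f g : f =1 g -> intg f -> intg g.
Proof. by move=> /funext ->. Qed.

Lemma eq_int_ae f g : measurable_fun [set: T] f -> measurable_fun [set: T] g ->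
  {ae mu, forall x, f x = g x} -> \int[mu]_x f x = \int[mu]_x g x.
Proof.
move=> mf mg fg; rewrite /Rintegral; congr fine; apply: ae_eq_integral => //.
- exact/measurable_EFinP.
- exact/measurable_EFinP.
- by apply: filterS fg => x /= -> _.
Qed.

Lemma eq_intg_ae f g : measurable_fun [set: T] g ->
  {ae mu, forall x, f x = g x} -> intg f -> intg g.
Proof.
move=> mg fg fi; have mf := intg_measurable fi.
apply/integrableP; split; first exact/measurable_EFinP.
move/integrableP : fi => [_]; apply: le_lt_trans; rewrite le_eqVlt; apply/orP; left.
apply/eqP; apply: ae_eq_integral => //.
- by apply: measurableT_comp => //; exact/measurable_EFinP.
- by apply: measurableT_comp => //; exact/measurable_EFinP.
- by apply: filterS fg => x /= -> _.
Qed.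

Lemma int_eq0_ae f : (forall x, 0 <= f x) -> intg f -> \int[mu]_x f x = 0 ->
  {ae mu, forall x, f x = 0}.
Proof.
move=> f0 fi i0.
have mf : measurable_fun [set: T] (EFin \o f) by case/integrableP : fi.
have [+ _] := ae_eq_integral_abs mu measurableT mf.
have -> : (\int[mu]_x `|(EFin \o f) x|)%E = 0%E.
  under eq_integral do rewrite /= ger0_norm//.
  by rewrite -EFin_int// i0.
move=> /(_ erefl); apply: filterS => x /= /(_ Logic.I) h.
by apply: EFin_inj.
Qed.

Lemma dct (F : nat -> T -> R) f g : (forall n, measurable_fun [set: T] (F n)) ->
  measurable_fun [set: T] f -> {ae mu, forall x, F ^~ x @ \oo --> f x} ->
  intg g -> (forall n x, `|F n x| <= g x) ->
  intg f /\ (\int[mu]_x F n x) @[n --> \oo] --> \int[mu]_x f x.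
Proof.
move=> mF mf Ff gi Fg.
have [//|||//||fi _ h] := @dominated_convergence _ _ _ mu setT measurableT
    (fun n => EFin \o F n) (EFin \o f) (EFin \o g).
- by move=> n; exact/measurable_EFinP.
- exact/measurable_EFinP.
- by apply: filterS Ff => x Fx _; apply: cvg_EFin => //; exact: nearW.
- by apply: aeW => x n _; rewrite /= lee_fin.
- split=> //; apply: fine_cvg; rewrite -[X in _ --> X]/(_) EFin_int//.
Qed.

(** Fatou's lemma in a form that delivers the integrability of the limit together with the bound, so
    that nothing about the limit has to be known beforehand. *)
Lemma fatou_bound (F : nat -> T -> R) f (C : R) : (forall n x, 0 <= F n x) ->
  (forall n, intg (F n)) -> (forall n, \int[mu]_x F n x <= C) ->
  measurable_fun [set: T] f ->
  {ae mu, forall x, F ^~ x @ \oo --> f x} -> (forall x, 0 <= f x) ->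
  intg f /\ \int[mu]_x f x <= C.
Proof.
move=> F0 iF FC mf Ff f0.
have mF n : measurable_fun [set: T] (EFin \o F n).
  exact/measurable_EFinP/intg_measurable.
have h : (\int[mu]_x (f x)%:E <= C%:E)%E.
  have := @fatou _ _ _ mu setT measurableT (fun n => EFin \o F n) mF.
  have F0' n x : [set: T] x -> (0 <= (EFin \o F n) x)%E by rewrite /= lee_fin.
  move=> /(_ F0').
  rewrite (_ : (\int[mu]_x limn_einf _)%E = (\int[mu]_x (f x)%:E)%E); last first.
    apply: ae_eq_integral => //; [|exact/measurable_EFinP|].
      rewrite /limn_einf; apply: measurableT_comp => //.
      by apply: measurable_fun_limn_esup => n; exact: measurableT_comp.
    apply: filterS Ff => x Fx _ /=.
    have cF : (F n x)%:E @[n --> \oo] --> (f x)%:E.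
      by apply: cvg_EFin => //; exact: nearW.
    by rewrite is_cvg_limn_einfE; [exact/cvg_lim|apply/cvg_ex; exists (f x)%:E].
  move=> /le_trans; apply.
  rewrite limn_einf_lim; apply: lime_le.
    exact: is_cvg_einfs.
  apply: nearW => n; rewrite /einfs.
  apply: (@le_trans _ _ (\int[mu]_x (EFin \o F n) x)%E).
    by apply: ereal_inf_lbound; exists n => //=.
  by rewrite -EFin_int// lee_fin.
have fi : intg f.
  apply/integrableP; split; first exact/measurable_EFinP.
  under eq_integral do rewrite /= ger0_norm//.
  by rewrite (le_lt_trans h)// ltry.
by split=> //; rewrite -lee_fin EFin_int.
Qed.

End Integrals.

Section L2space.
Context {d : measure_display} {T : measurableType d} {R : realType}
  (mu : {measure set T -> \bar R}).
Implicit Types f g h : T -> R.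

Definition sqint f : Prop :=
  measurable_fun [set: T] f /\ intg mu (fun x => f x ^+ 2).

Definition ip f g : R := \int[mu]_x (f x * g x).
Definition n2 f : R := \int[mu]_x (f x ^+ 2).
Definition nm f : R := Num.sqrt (n2 f).

Lemma sqintP f : sqint f <-> f \in Lfun mu 2%:E.
Proof.
split=> [[mf fi]|fL].
  rewrite inE; apply/andP; split; rewrite inE//=.
  rewrite /finite_norm unlock.
  rewrite poweR_lty//; move/integrableP : fi => [_].
  apply: le_lt_trans; apply: ge0_le_integral => //.
  - by move=> x _; exact: poweR_ge0.
  - apply/measurable_EFinP.
    apply/(@measurableT_comp _ _ _ _ _ _ (fun x : R => x `^ 2)%R) => //.
    exact/measurableT_comp.
  - by apply: measurableT_comp => //; apply/measurable_EFinP; exact: measurable_funX.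
  - by move=> t _/=; rewrite lee_fin normrX powR_mulrn.
split; last exact: Lfun2_integrable_sqr.
by move: fL; rewrite inE => /andP[]; rewrite inE.
Qed.

Lemma sqint_measurable f : sqint f -> measurable_fun [set: T] f.
Proof. by case. Qed.

Lemma sqint_sqr f : sqint f -> intg mu (fun x => f x ^+ 2).
Proof. by case. Qed.

Lemma sqint_le f g : measurable_fun [set: T] f -> (forall x, `|f x| <= `|g x|) ->
  sqint g -> sqint f.
Proof.
move=> mf fg [mg gi]; split => //; apply: intg_le gi => [|x].
  exact: measurable_funX.
by rewrite normrX -(real_normK (num_real (g x))) lerXn2r ?nnegrE.
Qed.

Lemma sqint0 : sqint (fun=> 0).
Proof.
by split=> //; under eq_fun do rewrite expr0n; exact: intg0.
Qed.

Lemma sqintM f g : sqint f -> sqint g -> intg mu (fun x => f x * g x).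
Proof.
move=> [mf fi] [mg gi]; apply: intg_le (intgD fi gi).
  exact: measurable_funM.
move=> x; rewrite ler_norml.
have h1 := sqr_ge0 (f x - g x); have h2 := sqr_ge0 (f x + g x).
have h3 := sqr_ge0 (f x); have h4 := sqr_ge0 (g x).
by apply/andP; split; nra.
Qed.

Lemma sqintD f g : sqint f -> sqint g -> sqint (fun x => f x + g x).
Proof.
move=> sf sg; have [mf fi] := sf; have [mg gi] := sg; split.
  exact: measurable_funD.
have := intgD (intgD fi (intgZ 2 (sqintM sf sg))) gi.
by apply: eq_intg => x; ring.
Qed.

Lemma sqintZ c f : sqint f -> sqint (fun x => c * f x).
Proof.
move=> [mf fi]; split; first exact: measurable_funM.
by under eq_fun do rewrite exprMn; exact: intgZ.
Qed.

Lemma sqintN f : sqint f -> sqint (fun x => - f x).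
Proof. by move=> /(sqintZ (-1)); under eq_fun do rewrite mulN1r. Qed.

Lemma sqintB f g : sqint f -> sqint g -> sqint (fun x => f x - g x).
Proof. by move=> sf sg; apply: sqintD => //; exact: sqintN. Qed.

Lemma sqint_norm f : sqint f -> sqint (fun x => `|f x|).
Proof.
move=> sf; apply: sqint_le (sf) => [|x]; last by rewrite normr_id.
by apply: measurableT_comp => //; case: sf.
Qed.

Lemma sqintMb (b : T -> R) C f : measurable_fun [set: T] b ->
  (forall x, `|b x| <= C) -> sqint f -> sqint (fun x => b x * f x).
Proof.
move=> mb bC sf; apply: (@sqint_le _ (fun x => C * f x)).
- by apply: measurable_funM => //; case: sf.
- move=> x; rewrite !normrM ler_wpM2r//.
  by rewrite (le_trans (bC x))// ler_norm.
- exact: sqintZ.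
Qed.

Lemma n2_ge0 f : 0 <= n2 f.
Proof. by apply: int_ge0 => x; exact: sqr_ge0. Qed.

Lemma nm_ge0 f : 0 <= nm f.
Proof. exact: sqrtr_ge0. Qed.

Lemma nm2 f : nm f ^+ 2 = n2 f.
Proof. by rewrite sqr_sqrtr ?n2_ge0. Qed.

Lemma n2Z c f : sqint f -> n2 (fun x => c * f x) = c ^+ 2 * n2 f.
Proof.
move=> [mf fi]; rewrite /n2 -intZ//; apply: eq_int => x.
by rewrite exprMn.
Qed.

Lemma n2N f : n2 (fun x => - f x) = n2 f.
Proof. by apply: eq_int => x; rewrite sqrrN. Qed.

Lemma n2BC f g : n2 (fun x => f x - g x) = n2 (fun x => g x - f x).
Proof. by apply: eq_int => x; rewrite -sqrrN opprB. Qed.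

Lemma ipC f g : ip f g = ip g f.
Proof. by apply: eq_int => x; rewrite mulrC. Qed.

Lemma ip_n2 f : ip f f = n2 f.
Proof. by apply: eq_int => x; rewrite expr2. Qed.

Lemma ipDl f g h : sqint f -> sqint g -> sqint h ->
  ip (fun x => f x + g x) h = ip f h + ip g h.
Proof.
move=> sf sg sh; rewrite /ip -intD; [|exact: sqintM|exact: sqintM].
by apply: eq_int => x; rewrite mulrDl.
Qed.

Lemma ipZl c f h : sqint f -> sqint h -> ip (fun x => c * f x) h = c * ip f h.
Proof.
move=> sf sh; rewrite /ip -intZ; last exact: sqintM.
by apply: eq_int => x; rewrite mulrA.
Qed.

Lemma ipNl f h : sqint f -> sqint h -> ip (fun x => - f x) h = - ip f h.
Proof.
move=> sf sh; rewrite /ip -intN; last exact: sqintM.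
by apply: eq_int => x; rewrite mulNr.
Qed.

Lemma ipBl f g h : sqint f -> sqint g -> sqint h ->
  ip (fun x => f x - g x) h = ip f h - ip g h.
Proof.
by move=> sf sg sh; rewrite ipDl// ?ipNl//; exact: sqintN.
Qed.

Lemma n2D f g : sqint f -> sqint g ->
  n2 (fun x => f x + g x) = n2 f + 2 * ip f g + n2 g.
Proof.
move=> sf sg; rewrite /n2 /ip -intZ; last exact: sqintM.
rewrite -intD; [|by case: sf|by apply: intgZ; exact: sqintM].
rewrite -intD; [|apply: intgD; [by case: sf|by apply: intgZ; exact: sqintM]|by case: sg].
by apply: eq_int => x; ring.
Qed.

Lemma n2B f g : sqint f -> sqint g ->
  n2 (fun x => f x - g x) = n2 f - 2 * ip f g + n2 g.
Proof.
move=> sf sg; rewrite (n2D sf (sqintN sg)) n2N ipC ipNl// ipC; ring.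
Qed.

Lemma n2_le f g : sqint f -> sqint g -> (forall x, `|f x| <= `|g x|) -> n2 f <= n2 g.
Proof.
move=> [_ fi] [_ gi] fg; apply: int_le => // x.
by rewrite -(real_normK (num_real (f x))) -(real_normK (num_real (g x))) lerXn2r ?nnegrE.
Qed.

Lemma nm_le f g : sqint f -> sqint g -> (forall x, `|f x| <= `|g x|) -> nm f <= nm g.
Proof. by move=> sf sg fg; rewrite ler_sqrt ?n2_ge0//; exact: n2_le. Qed.

Lemma cauchy_schwarz_sqr f g : sqint f -> sqint g -> ip f g ^+ 2 <= n2 f * n2 g.
Proof.
move=> sf sg.
have H (t : R) : 0 <= n2 f * t ^+ 2 + 2 * t * ip f g + n2 g.
  have := n2_ge0 (fun x => t * f x + g x).
  by rewrite (n2D (sqintZ t sf) sg) n2Z// ipZl// mulrA (mulrC (n2 f)).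
have [f0|f0] := eqVneq (n2 f) 0; last first.
  have fp : 0 < n2 f by rewrite lt0r f0 n2_ge0.
  have := H (- ip f g / n2 f).
  rewrite (_ : _ + _ + _ = n2 g - ip f g ^+ 2 / n2 f); last by field.
  by rewrite subr_ge0 ler_pdivrMr// mulrC.
rewrite f0 mul0r; have [->|ne] := eqVneq (ip f g) 0; first by rewrite expr0n.
have := H (- (n2 g + 1) / (2 * ip f g)).
rewrite f0 mul0r add0r (_ : _ + _ = -1); last by field.
by rewrite oppr_ge0 ler10.
Qed.

Lemma cauchy_schwarz f g : sqint f -> sqint g -> `|ip f g| <= nm f * nm g.
Proof.
move=> sf sg; rewrite -[leRHS]ger0_norm ?mulr_ge0 ?nm_ge0//.
rewrite -ler_sqr ?nnegrE// !real_normK ?num_real// exprMn !nm2.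
exact: cauchy_schwarz_sqr.
Qed.

Lemma nmD f g : sqint f -> sqint g -> nm (fun x => f x + g x) <= nm f + nm g.
Proof.
move=> sf sg; rewrite -ler_sqr ?nnegrE ?addr_ge0 ?nm_ge0// nm2 (n2D sf sg).
have := le_trans (ler_norm _) (cauchy_schwarz sf sg).
by rewrite -!nm2; nra.
Qed.

Lemma nmZ c f : sqint f -> nm (fun x => c * f x) = `|c| * nm f.
Proof.
by move=> sf; rewrite /nm (n2Z c sf) sqrtrM ?sqr_ge0// sqrtr_sqr.
Qed.

Lemma nmN f : nm (fun x => - f x) = nm f.
Proof. by rewrite /nm n2N. Qed.

Lemma nmBC f g : nm (fun x => f x - g x) = nm (fun x => g x - f x).
Proof. by rewrite /nm n2BC. Qed.

Lemma nmB f g : sqint f -> sqint g -> nm (fun x => f x - g x) <= nm f + nm g.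
Proof. by move=> sf sg; rewrite (le_trans (nmD sf (sqintN sg)))// nmN. Qed.

Lemma n2_ae0 f : sqint f -> n2 f = 0 -> {ae mu, forall x, f x = 0}.
Proof.
move=> [mf fi] /(int_eq0_ae (fun x => sqr_ge0 _) fi).
by apply: filterS => x /eqP; rewrite sqrf_eq0 => /eqP.
Qed.

Lemma ae_eq_n2 f g : measurable_fun [set: T] f -> measurable_fun [set: T] g ->
  {ae mu, forall x, f x = g x} -> n2 f = n2 g.
Proof.
move=> mf mg fg; apply: eq_int_ae; [exact: measurable_funX|exact: measurable_funX|].
by apply: filterS fg => x ->.
Qed.

Lemma ae_eq_ip f g h : measurable_fun [set: T] f -> measurable_fun [set: T] g ->
  measurable_fun [set: T] h -> {ae mu, forall x, f x = g x} -> ip f h = ip g h.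
Proof.
move=> mf mg mh fg; apply: eq_int_ae; [exact: measurable_funM|exact: measurable_funM|].
by apply: filterS fg => x ->.
Qed.

Lemma ae_eq_sqint f g : measurable_fun [set: T] g ->
  {ae mu, forall x, f x = g x} -> sqint f -> sqint g.
Proof.
move=> mg fg [mf fi]; split => //.
apply: eq_intg_ae fi; first exact: measurable_funX.
by apply: filterS fg => x ->.
Qed.

End L2space.

Section Completeness.
Context {d : measure_display} {T : measurableType d} {R : realType}
  (mu : {measure set T -> \bar R}).
Implicit Types f g h : T -> R.

(** Monotone convergence: the sum of the series has integral at most [C], hence is finite almost
    everywhere. *)
Lemma ae_summable_bounded (F : nat -> T -> R) (C : R) : (forall n x, 0 <= F n x) ->
  (forall n, intg mu (F n)) ->
  (forall n, \sum_(k < n) \int[mu]_x F k x <= C) ->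
  {ae mu, forall x, exists M : R, forall n, \sum_(k < n) F k x <= M}.
Proof.
move=> F0 iF FC.
have mF n : measurable_fun [set: T] (EFin \o F n).
  exact/measurable_EFinP/intg_measurable/iF.
have F0' n x : [set: T] x -> (0 <= (EFin \o F n) x)%E by rewrite /= lee_fin.
have := @integral_nneseries _ _ _ mu setT measurableT (fun n => EFin \o F n) mF F0'.
set S := fun x => (\sum_(0 <= n <oo) (F n x)%:E)%E.
move=> H.
have S0 x : (0 <= S x)%E by apply: nneseries_ge0 => n _ _; rewrite lee_fin.
have mS : measurable_fun [set: T] S.
  have := @ge0_emeasurable_sum _ _ _ setT (fun n => EFin \o F n) xpredT
    (fun k x Dx _ => F0' k x Dx) (fun k _ => mF k).
  by apply: eq_measurable_fun => x _; apply: eq_eseriesl => i.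
have Si : mu.-integrable [set: T] S.
  apply/integrableP; split => //.
  under eq_integral do rewrite gee0_abs//.
  rewrite H (@le_lt_trans _ _ C%:E) ?ltry//.
  apply: lime_le; first by apply: is_cvg_nneseries => n _ _; apply: integral_ge0 => x _;
    exact: F0'.
  apply: nearW => n; rewrite big_mkord.
  under eq_bigr do rewrite -EFin_int//.
  by rewrite sumEFin lee_fin.
have := integrable_ae measurableT Si.
apply: filterS => x /(_ Logic.I) fin; exists (fine (S x)) => n.
rewrite -lee_fin fineK// -sumEFin -(big_mkord xpredT (fun k => (F k x)%:E)).
by apply: nneseries_lim_ge => k _ _; rewrite lee_fin.
Qed.

(** Riesz-Fischer: a rapidly convergent subsequence converges almost everywhere, and Fatou carries
    the Cauchy estimate over to its limit. *)
Lemma L2_complete (u : nat -> T -> R) : (forall n, sqint mu (u n)) ->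
  (forall e : R, 0 < e -> exists n0, forall m n, (n0 <= m)%N -> (n0 <= n)%N ->
    n2 mu (fun x => u m x - u n x) <= e) ->
  exists2 v, sqint mu v & forall e : R, 0 < e -> exists n0, forall n, (n0 <= n)%N ->
    n2 mu (fun x => u n x - v x) <= e.
Proof.
move=> su cu.
have e0 (k : nat) : 0 < (16%:R^-1 : R) ^+ k by rewrite exprn_gt0.
have [phi0 phi0P] := choice (fun k => cu _ (e0 k)).
(* Cumulative sums make [phi] increasing while keeping [phi k] above [phi0 k]. *)
pose phi k := (\sum_(i < k.+1) (phi0 i).+1)%N.
have phiS k : phi k.+1 = (phi k + (phi0 k.+1).+1)%N by rewrite /phi big_ord_recr.
have phi_ge k : (phi0 k <= phi k)%N by rewrite /phi big_ord_recr/= addnS ltnW// ltnS leq_addl.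
have phi_mono j k : (j <= k)%N -> (phi j <= phi k)%N.
  move=> /subnK <-; elim: (k - j)%N => // i IH.
  by rewrite addSn phiS (leq_trans IH)// leq_addr.
pose w k := u (phi k).
have w_cau k m : (k <= m)%N -> n2 mu (fun x => w m x - w k x) <= 16%:R^-1 ^+ k.
  move=> km; apply: phi0P; last exact: phi_ge.
  by rewrite (leq_trans (phi_ge k))// phi_mono.
have sw k : sqint mu (w k) by exact: su.
(* Squared distances at most 16^-k leave room for the weights 4^k. A pointwise bound on the weighted
   series then forces consecutive differences below a multiple of 2^-k. *)
have ae_w : {ae mu, forall x, cvgn (w ^~ x)}.
  have := @ae_summable_bounded (fun k x => 4 ^+ k * (w k.+1 x - w k x) ^+ 2) 2.
  have Fi k : intg mu (fun x => 4 ^+ k * (w k.+1 x - w k x) ^+ 2).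
    by apply: intgZ; have [] := sqintB (sw k.+1) (sw k).
  move=> /(_ _ Fi).
  have F0 (n : nat) (x : T) : 0 <= 4 ^+ n * (w n.+1 x - w n x) ^+ 2.
    by rewrite mulr_ge0 ?sqr_ge0// exprn_ge0.
  move=> /(_ F0) H; apply: filterS (H _) => {H}; last first.
    move=> n; apply: (@le_trans _ _ (\sum_(k < n) 4^-1 ^+ k)).
      apply: ler_sum => k _; rewrite intZ; last by have [] := sqintB (sw k.+1) (sw k).
      apply: (@le_trans _ _ (4 ^+ k * 16^-1 ^+ k)).
        by rewrite ler_pM2l ?exprn_gt0//; apply: w_cau.
      by rewrite -exprMn (_ : 4 * 16^-1 = 4^-1)//; lra.
    have h m : \sum_(k < m) (4^-1 : R) ^+ k = (4 / 3) * (1 - 4^-1 ^+ m).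
      elim: m => [|m IH]; first by rewrite big_ord0 expr0 subrr mulr0.
      by rewrite big_ord_recr/= IH exprS; field.
    rewrite h; have : 0 <= (4^-1 : R) ^+ n by rewrite exprn_ge0.
    nra.
  move=> x [M HM].
  have M0 : 0 <= M by have := HM 0%N; rewrite big_ord0.
  have bd k : `|w k.+1 x - w k x| <= Num.sqrt M * 2^-1 ^+ k.
    have : 4 ^+ k * (w k.+1 x - w k x) ^+ 2 <= M.
      apply: le_trans (HM k.+1); rewrite big_ord_recr/= lerDr.
      by apply: sumr_ge0 => i _; exact: F0.
    move=> h; rewrite -ler_sqr ?nnegrE ?mulr_ge0 ?sqrtr_ge0 ?exprn_ge0//.
    rewrite real_normK ?num_real// exprMn sqr_sqrtr// exprAC (_ : 2^-1 ^+ 2 = 4^-1);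
      last by field.
    by rewrite -ler_pdivrMr ?exprn_gt0 ?invr_gt0// exprVn invrK mulrC.
  have cs : cvgn (series (fun k => w k.+1 x - w k x)).
    apply: normed_cvg; apply: (@series_le_cvg _ _ (fun k => Num.sqrt M * 2^-1 ^+ k)).
    - by move=> n /=.
    - by move=> n; rewrite mulr_ge0 ?sqrtr_ge0 ?exprn_ge0.
    - by move=> n; exact: bd.
    - rewrite -/(geometric _ _); apply: is_cvg_geometric_series.
      by rewrite ger0_norm; lra.
  have -> : (w ^~ x) = (fun n => w 0%N x + series (fun k => w k.+1 x - w k x) n).
    apply/funext => n; rewrite /series/= telescope_sumr//; ring.
  by apply: is_cvgD => //; exact: is_cvg_cst.
(* An upper limit is measurable everywhere, which avoids a case distinction on the null set where
   the subsequence diverges. *)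
pose v x := fine (limn_esup (fun k => (w k x)%:E)).
have mv : measurable_fun [set: T] v.
  apply: measurableT_comp => //; apply: measurable_fun_limn_esup => k.
  by apply/measurable_EFinP; case: (sw k).
have wv : {ae mu, forall x, w ^~ x @ \oo --> v x}.
  apply: filterS ae_w => x cw.
  rewrite /v (_ : limn_esup _ = (limn (w ^~ x))%:E)//.
  have cwE : (w k x)%:E @[k --> \oo] --> (limn (w ^~ x))%:E.
    by apply: cvg_EFin => //; exact: nearW.
  by rewrite is_cvg_limn_esupE; [exact/cvg_lim|apply/cvg_ex; eexists; exact: cwE].
have uv (e : R) : 0 < e -> exists n0, forall n, (n0 <= n)%N ->
    intg mu (fun x => (u n x - v x) ^+ 2) /\ n2 mu (fun x => u n x - v x) <= e.
  move=> /cu[n0 Hn0]; exists n0 => n nn0.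
  have [k0 k0n0] : exists k0, forall k, (n0 <= phi (k + k0))%N.
    have phi_id k : (k <= phi k)%N.
      by elim: k => // k IH; rewrite phiS addnS ltnS (leq_trans IH)// leq_addr.
    by exists n0 => k; rewrite (leq_trans _ (phi_id _))// leq_addl.
  apply: (@fatou_bound _ _ _ mu (fun k x => (u n x - w (k + k0)%N x) ^+ 2)).
  - by move=> k x; exact: sqr_ge0.
  - by move=> k; have [] := sqintB (su n) (sw (k + k0)%N).
  - by move=> k; apply: Hn0.
  - by apply: measurable_funX; apply: measurable_funB => //; case: (su n).
  - apply: filterS wv => x wx.
    have wx' : w (k + k0)%N x @[k --> \oo] --> v x.
      by have := wx; rewrite -(cvg_shiftn k0).
    under eq_fun do rewrite expr2.
    by rewrite expr2; apply: cvgM; apply: cvgB => //; exact: cvg_cst.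
  - by move=> x; exact: sqr_ge0.
exists v; last first.
  by move=> e /uv[n0 H]; exists n0 => n /H[].
have [n0 /(_ _ (leqnn n0))[i0 _]] := uv 1 ltr01.
have sd : sqint mu (fun x => u n0 x - v x).
  by split => //; apply: measurable_funB => //; case: (su n0).
by have := sqintB (su n0) sd; under eq_fun do rewrite subKr.
Qed.

End Completeness.

(** * Lebesgue measure on R^n *)

Section LebesgueRV.
Context {R : realType}.

Definition cbox n (a b : 'rV[R]_n) : set 'rV[R]_n :=
  [set x | forall i, a ord0 i <= x ord0 i <= b ord0 i].

Lemma measurable_cbox n (a b : 'rV[R]_n) : measurable (cbox a b).
Proof.
rewrite (_ : cbox a b = \bigcap_(i : 'I_n)
    (@rV_coor R n i @^-1` `[a ord0 i, b ord0 i])); last first.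
  apply/seteqP; split => x /=.
    by move=> h i _; rewrite /rV_coor /= in_itv /=; exact: h.
  by move=> h i; have := h i Logic.I; rewrite /rV_coor /= in_itv.
apply: fin_bigcap_measurable; first exact: finite_finset.
move=> i _; rewrite -[X in measurable X]setTI.
by apply: measurable_rV_coor => //; exact: measurable_itv.
Qed.

Definition cboxes n : set (set 'rV[R]_n) := [set A | exists a b, A = cbox a b].

Lemma setI_closed_cboxes n : setI_closed (@cboxes n).
Proof.
move=> _ _ [a [b ->]] [a' [b' ->]].
exists (\row_i Num.max (a ord0 i) (a' ord0 i)), (\row_i Num.min (b ord0 i) (b' ord0 i)).
apply/seteqP; split => x /=.
  move=> [h h'] i; rewrite !mxE ge_max le_min.
  by have /andP[-> ->] := h i; have /andP[-> ->] := h' i.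
move=> h; split => i; have := h i; rewrite !mxE ge_max le_min.
  by move=> /andP[/andP[-> _] /andP[-> _]].
by move=> /andP[/andP[_ ->] /andP[_ ->]].
Qed.

Definition cube n (k : R) : set 'rV[R]_n := cbox (const_mx (- k)) (const_mx k).
Arguments cube : clear implicits.

Lemma cubeE n k (x : 'rV[R]_n) : cube n k x <-> forall i, `|x ord0 i| <= k.
Proof.
split=> h i; first by have := h i; rewrite !mxE ler_norml.
by have := h i; rewrite !mxE ler_norml.
Qed.

Lemma bigcup_cube n : \bigcup_k cube n k%:R = [set: 'rV[R]_n].
Proof.
apply/seteqP; split => // x _.
exists (Num.truncn (\sum_i `|x ord0 i|)).+1 => //.
apply/cubeE => i; rewrite ltW// (le_lt_trans _ (truncnS_gt _))//.
by rewrite (bigD1 i)//= lerDl sumr_ge0.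
Qed.

(** Closed boxes are stable under intersection, so this makes them a determining class for measures
    and a base for Dynkin induction. A coordinate half-space is a countable union of boxes; in
    dimension 0 the space is a single point and is treated apart. *)
Lemma measurable_rV_cboxes n : @measurable _ 'rV[R]_n = <<s @cboxes n >>.
Proof.
apply/seteqP; split; last first.
  apply: smallest_sub; first exact: sigma_algebra_measurable.
  by move=> _ [a [b ->]]; exact: measurable_cbox.
have mcoor (i : 'I_n) : measurable_fun [set: g_sigma_algebraType (@cboxes n)]
    (@rV_coor R n i : g_sigma_algebraType (@cboxes n) -> R).
  apply: (measurability _ (RGenCInfty.measurableE R)).
  move=> _ [_ [c ->] <-]; rewrite setTI.
  rewrite (_ : _ @^-1` _ = \bigcup_k
     cbox (\row_j if j == i then c else - k%:R) (\row_j k%:R)); last first.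
    apply/seteqP; split=> x /=.
      rewrite in_itv/= andbT => cx.
      have [k _ /cubeE xk] : (\bigcup_k cube n k%:R) x by rewrite bigcup_cube.
      exists k => // j; rewrite !mxE; have := xk j; rewrite ler_norml => /andP[h1 h2].
      by rewrite h2 andbT; case: eqP => [->|].
    by move=> [k _ /(_ i)]; rewrite !mxE eqxx in_itv/= andbT => /andP[].
  apply: bigcupT_measurable => k; apply: sub_sigma_algebra.
  by exists (\row_j if j == i then c else - k%:R), (\row_j k%:R).
case: n mcoor => [|n] mcoor.
  move=> A _; have [[x Ax]|A0] := pselect (A !=set0).
    rewrite (_ : A = ~` set0).
      by rewrite -setTD; apply: sigma_algebraCD; exact: sigma_algebra0.
    by rewrite setC0; apply/seteqP; split => // y _; rewrite (_ : y = x)//; apply/rowP => -[].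
  rewrite (_ : A = set0); first exact: sigma_algebra0.
  by apply/seteqP; split => // y Ay; case: A0; exists y.
apply: smallest_sub; first exact: (sigma_algebra_measurable (g_sigma_algebraType (@cboxes n.+1))).
rewrite -bigcup_mkord_ord; apply: bigcup_sub => i Ii.
by move=> A [B mB <-]; exact: mcoor.
Qed.

Lemma cbox_empty n (a b : 'rV[R]_n) i : b ord0 i < a ord0 i -> cbox a b = set0.
Proof.
move=> ba; apply/seteqP; split => // x /(_ i) /andP[ax xb].
by have := le_lt_trans (le_trans ax xb) ba; rewrite ltxx.
Qed.

Lemma lebesgue_rV_cube n (k : R) : (lebesgue_rV R n (cube n k) < +oo)%E.
Proof.
have [k0|k0] := leP 0 k.
  rewrite lebesgue_rV_box ?ltry// => i; rewrite !mxE; lra.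
case: n => [|n]; last first.
  by rewrite /cube (@cbox_empty _ _ _ ord0) ?measure0// !mxE; lra.
by rewrite lebesgue_rV_box ?ltry// => -[].
Qed.

Lemma measurable_rV_affine n (t : R) (a : 'rV[R]_n) :
  measurable_fun [set: 'rV[R]_n] (fun x => t *: x + a).
Proof.
apply: measurable_fun_rV => i; under eq_fun do rewrite !mxE.
apply: measurable_funD => //; apply: measurable_funM => //.
exact: measurable_rV_coor.
Qed.

Lemma measurable_rV_addZ n (t : R) :
  measurable_fun [set: 'rV[R]_n * 'rV[R]_n] (fun p => p.1 + t *: p.2).
Proof.
apply: measurable_fun_rV => i; under eq_fun do rewrite !mxE.
apply: measurable_funD => //.
  by apply: (measurableT_comp (measurable_rV_coor i)).
apply: measurable_funM => //.
by apply: (measurableT_comp (measurable_rV_coor i)).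
Qed.

(** Both sides are measures in [B] that agree on closed boxes, where the volume is a product of side
    lengths; uniqueness of measures on a pi-system does the rest. *)
Lemma lebesgue_rV_affine n (t : R) (a : 'rV[R]_n) (B : set 'rV[R]_n) : 0 < t ->
  measurable B ->
  lebesgue_rV R n ((fun x => t *: x + a) @^-1` B) = ((t^-1 ^+ n)%:E * lebesgue_rV R n B)%E.
Proof.
move=> t0 mB.
have tn0 : 0 <= t^-1 ^+ n by rewrite exprn_ge0// invr_ge0 ltW.
pose m1 := pushforward (lebesgue_rV R n) (fun x => t *: x + a).
pose m1' : {measure set 'rV[R]_n -> \bar R} :=
  measure_function_pushforward__canonical__measure_function_Measure
    (lebesgue_rV R n) (measurable_rV_affine t a).
pose m2 : {measure set 'rV[R]_n -> \bar R} := mscale (NngNum tn0) (lebesgue_rV R n).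
apply: (@measure_unique _ _ _ (@cboxes n) (fun k => cube n k%:R)
   (@measurable_rV_cboxes n) (@setI_closed_cboxes n) _ _ m1' m2) => //.
- by move=> k; exists (const_mx (- k%:R)), (const_mx k%:R).
- exact: bigcup_cube.
- move=> _ [c [d ->]]; rewrite /= /mscale/= /pushforward.
  rewrite (_ : _ @^-1` _ = cbox (t^-1 *: (c - a)) (t^-1 *: (d - a))); last first.
    apply/seteqP; split=> x /= h i; have := h i; rewrite !mxE.
      by rewrite ler_pdivrMl// ler_pdivlMl// lerBlDr lerBrDr.
    by rewrite ler_pdivrMl// ler_pdivlMl// lerBlDr lerBrDr.
  have [cd|] := pselect (forall i, c ord0 i <= d ord0 i).
    rewrite !lebesgue_rV_box//; last first.
      by move=> i; rewrite !mxE ler_pM2l ?invr_gt0// lerD2r.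
    rewrite -EFinM; congr (_%:E).
    rewrite -[X in _ ^+ X]card_ord -prodr_const -big_split/=.
    by apply: eq_bigr => i _; rewrite !mxE -mulrBr opprB addrA subrK.
  move=> /existsNP[i /negP]; rewrite -ltNge => dc.
  rewrite !(@cbox_empty _ _ _ i)// ?measure0 ?mule0//.
  by rewrite !mxE ltr_pM2l ?invr_gt0// ltrD2r.
- move=> k; rewrite /= /pushforward (_ : _ @^-1` _ =
    cbox (t^-1 *: (const_mx (- k%:R) - a)) (t^-1 *: (const_mx k%:R - a))); last first.
    apply/seteqP; split=> x /= h i; have := h i; rewrite !mxE.
      by rewrite ler_pdivrMl// ler_pdivlMl// lerBlDr lerBrDr.
    by rewrite ler_pdivrMl// ler_pdivlMl// lerBlDr lerBrDr.
  rewrite lebesgue_rV_box ?ltry// => i.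
  by rewrite !mxE ler_pM2l ?invr_gt0// lerD2r; have := ler0n R k; lra.
Qed.

Lemma ge0_integral_affine n (t : R) (a : 'rV[R]_n) (f : 'rV[R]_n -> \bar R) : 0 < t ->
  measurable_fun [set: 'rV[R]_n] f -> (forall x, 0 <= f x)%E ->
  (\int[lebesgue_rV R n]_x f (t *: x + a)%R =
   (t^-1 ^+ n)%:E * \int[lebesgue_rV R n]_x f x)%E.
Proof.
move=> t0 mf f0.
have tn0 : 0 <= t^-1 ^+ n by rewrite exprn_ge0// invr_ge0 ltW.
have := ge0_integral_pushforward (measurable_rV_affine t a) (lebesgue_rV R n)
  measurableT mf (fun x _ => f0 x).
rewrite preimage_setT => <-.
rewrite (eq_measure_integral (mscale (NngNum tn0) (lebesgue_rV R n))).
- by rewrite ge0_integral_mscale.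
- exact: (measurable_rV_affine t a).
- by move=> ? A mA _; rewrite /= /pushforward; exact: lebesgue_rV_affine.
Qed.

Local Notation mu n := (lebesgue_rV R n).

Lemma measurable_affine_comp n (t : R) (a : 'rV[R]_n) (f : 'rV[R]_n -> R) :
  measurable_fun [set: 'rV[R]_n] f ->
  measurable_fun [set: 'rV[R]_n] (fun x => f (t *: x + a)).
Proof. by move=> mf; apply: measurableT_comp mf _; exact: measurable_rV_affine. Qed.

Lemma intg_affine n (t : R) (a : 'rV[R]_n) (f : 'rV[R]_n -> R) : 0 < t ->
  intg (mu n) f -> intg (mu n) (fun x => f (t *: x + a)).
Proof.
move=> t0 fi; have mf := intg_measurable fi.
apply/integrableP; split.
  by apply/measurable_EFinP; exact: measurable_affine_comp.
have := @ge0_integral_affine n t a (fun x => `|(f x)%:E|)%E t0.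
move=> /= ->; first last.
- by move=> x; rewrite lee_fin.
- by apply/measurable_EFinP; exact: measurableT_comp.
move/integrableP : fi => [_ fi]; rewrite lte_mul_pinfty// lee_fin.
by rewrite exprn_ge0// invr_ge0 ltW.
Qed.

Lemma int_affine n (t : R) (a : 'rV[R]_n) (f : 'rV[R]_n -> R) : 0 < t ->
  intg (mu n) f ->
  \int[mu n]_x f (t *: x + a) = t^-1 ^+ n * \int[mu n]_x f x.
Proof.
move=> t0 fi; have mf := intg_measurable fi.
have ge0 (h : 'rV[R]_n -> R) : (forall x, 0 <= h x) -> intg (mu n) h ->
    \int[mu n]_x h (t *: x + a) = t^-1 ^+ n * \int[mu n]_x h x.
  move=> h0 hi; apply: EFin_inj; rewrite EFin_int; last exact: intg_affine.
  rewrite (@ge0_integral_affine n t a (EFin \o h))//.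
    by rewrite EFinM EFin_int.
  by apply/measurable_EFinP; exact: intg_measurable hi.
(* The nonnegative case [ge0] suffices, because f = (|f| + f) - |f|. *)
pose p (x : 'rV[R]_n) : R := `|f x| + f x; have pi : intg (mu n) p.
  by apply: intgD => //; exact: intg_norm.
have p0 x : 0 <= p x by rewrite /p; have := ler_norm (- f x); rewrite normrN; lra.
have e1 : \int[mu n]_x f x = \int[mu n]_x p x - \int[mu n]_x `|f x|.
  rewrite -intB//; last exact: intg_norm.
  by apply: eq_int => x; rewrite /p; ring.
have e2 : \int[mu n]_x f (t *: x + a) =
    \int[mu n]_x p (t *: x + a) - \int[mu n]_x `|f (t *: x + a)|.
  rewrite -intB; [|exact: intg_affine|].
    by apply: eq_int => x; rewrite /p; ring.
  by apply: intg_norm; exact: intg_affine.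
by rewrite e1 e2 ge0// (ge0 (fun x => `|f x|))// ?mulrBr//; exact: intg_norm.
Qed.

Lemma int_translate n (a : 'rV[R]_n) (f : 'rV[R]_n -> R) : intg (mu n) f ->
  \int[mu n]_x f (x + a) = \int[mu n]_x f x.
Proof.
move=> fi; have := int_affine a ltr01 fi.
by rewrite invr1 expr1n mul1r; under eq_int do rewrite scale1r.
Qed.

Lemma intg_translate n (a : 'rV[R]_n) (f : 'rV[R]_n -> R) : intg (mu n) f ->
  intg (mu n) (fun x => f (x + a)).
Proof.
by move=> /(intg_affine a ltr01); under eq_fun do rewrite scale1r.
Qed.

Lemma int_scale n (t : R) (f : 'rV[R]_n -> R) : 0 < t -> intg (mu n) f ->
  \int[mu n]_x f (t *: x) = t^-1 ^+ n * \int[mu n]_x f x.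
Proof.
by move=> t0 fi; rewrite -(int_affine 0 t0 fi); under [RHS]eq_int do rewrite addr0.
Qed.

Lemma intg_scale n (t : R) (f : 'rV[R]_n -> R) : 0 < t -> intg (mu n) f ->
  intg (mu n) (fun x => f (t *: x)).
Proof.
by move=> t0 /(intg_affine 0 t0); under eq_fun do rewrite addr0.
Qed.

Lemma sqint_translate n (a : 'rV[R]_n) (f : 'rV[R]_n -> R) : sqint (mu n) f ->
  sqint (mu n) (fun x => f (x + a)).
Proof.
move=> [mf fi]; split; last exact: (intg_translate a fi).
by have := measurable_affine_comp 1 a mf; under eq_fun do rewrite scale1r.
Qed.

Lemma sqint_scale n (t : R) (f : 'rV[R]_n -> R) : 0 < t -> sqint (mu n) f ->
  sqint (mu n) (fun x => f (t *: x)).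
Proof.
move=> t0 [mf fi]; split; last exact: (intg_scale t0 fi).
by have := measurable_affine_comp t 0 mf; under eq_fun do rewrite addr0.
Qed.

Lemma n2_translate n (a : 'rV[R]_n) (f : 'rV[R]_n -> R) : sqint (mu n) f ->
  n2 (mu n) (fun x => f (x + a)) = n2 (mu n) f.
Proof. by move=> [mf fi]; rewrite /n2 (int_translate a fi). Qed.

Lemma nm_translate n (a : 'rV[R]_n) (f : 'rV[R]_n -> R) : sqint (mu n) f ->
  nm (mu n) (fun x => f (x + a)) = nm (mu n) f.
Proof. by move=> sf; rewrite /nm n2_translate. Qed.

Lemma n2_scale n (t : R) (f : 'rV[R]_n -> R) : 0 < t -> sqint (mu n) f ->
  n2 (mu n) (fun x => f (t *: x)) = t^-1 ^+ n * n2 (mu n) f.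
Proof. by move=> t0 [mf fi]; rewrite /n2 (int_scale t0 fi). Qed.

(** Each point of [U] lies in a closed box inside [U] with rational centre and half-width 1/(k+1),
    and such boxes are countably many. *)
Lemma open_rV_measurable n (U : set 'rV[R]_n) : open U -> measurable U.
Proof.
move=> oU.
pose F (p : 'rV[rat]_n * nat) : set 'rV[R]_n :=
  let c : 'rV[R]_n := \row_i ratr (p.1 ord0 i) in
  let B := cbox (c - const_mx p.2.+1%:R^-1) (c + const_mx p.2.+1%:R^-1) in
  if `[< B `<=` U >] then B else set0.
rewrite (_ : U = \bigcup_p F p).
  apply: countable_bigcupT_measurable => [|p]; first exact: countableP.
  by rewrite /F; case: asboolP => // _; exact: measurable_cbox.
apply/seteqP; split => x; last by case=> p _; rewrite /F; case: asboolP => // h; exact: h.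
move=> Ux.
have /nbhs_ballP[e /= e0 eU] : nbhs x U by exact: open_nbhs_nbhs.
have [k _ /(_ k (leqnn k)) ke] : \forall k \near \oo, k.+1%:R^-1 < e / 2 :> R.
  have := near_infty_natSinv_lt (PosNum (divr_gt0 e0 (ltr0n _ 2))).
  by move=> [k0 _ H]; exists k0.
have k0 : 0 < k.+1%:R^-1 :> R by rewrite invr_gt0.
have ex i : exists q : rat, x ord0 i - k.+1%:R^-1 < ratr q < x ord0 i + k.+1%:R^-1.
  have [|q] := @rat_in_itvoo R (x ord0 i - k.+1%:R^-1) (x ord0 i + k.+1%:R^-1);
    first by rewrite ltrD2l (lt_trans _ k0)// oppr_lt0.
  by rewrite in_itv; exists q.
have [q qP] := choice ex.
exists (\row_i q i, k) => //; rewrite /F /=.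
have BU : cbox (\row_i ratr ((\row_i0 q i0) ord0 i) - const_mx k.+1%:R^-1)
    (\row_i ratr ((\row_i0 q i0) ord0 i) + const_mx k.+1%:R^-1) `<=` U.
  move=> y yB; apply: eU; split => // i j; rewrite ord1 /ball/= /ball_/=.
  have := yB j; rewrite !mxE => /andP[h1 h2]; have /andP[h3 h4] := qP j.
  rewrite ltr_norml; move: h1 h2 h3 h4; move: (k.+1%:R^-1) k0 ke => r r0 re *.
  by apply/andP; split; lra.
case: asboolP => // _ i; rewrite !mxE; have /andP[] := qP i.
move: (k.+1%:R^-1) k0 ke => r r0 re *; by apply/andP; split; lra.
Qed.

Lemma continuous_rV_measurable n (f : 'rV[R]_n -> R) : continuous f ->
  measurable_fun [set: 'rV[R]_n] f.
Proof.
move=> cf; apply: (measurability _ (RGenOInfty.measurableE R)).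
move=> _ [_ [c ->] <-]; rewrite setTI; apply: open_rV_measurable.
by apply: open_comp => [x _|]; [exact: cf | exact: interval_open].
Qed.

End LebesgueRV.

(** * Test functions *)

Section Smooth1.
Context {R : realType}.
Implicit Types g h : R -> R.

Fixpoint smoothn (n : nat) g : Prop :=
  match n with
  | 0 => continuous g
  | k.+1 => (forall x, derivable g x 1) /\ smoothn k (derive1 g)
  end.

Definition smooth g : Prop := forall n, smoothn n g.

Lemma derivable_cont g : (forall x, derivable g x 1) -> continuous g.
Proof. by move=> dg x; apply: differentiable_continuous; apply/derivable1_diffP. Qed.

Lemma smoothnW n g : smoothn n.+1 g -> smoothn n g.
Proof.
elim: n g => [|n IH] g /=; first by move=> [/derivable_cont].
by move=> [dg h]; split => //; exact: IH.
Qed.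

Lemma smoothn_cst n (c : R) : smoothn n (fun=> c).
Proof.
elim: n c => [|n IH] c /=; first exact: cst_continuous.
split; first by move=> x; exact: derivable_cst.
rewrite (_ : derive1 _ = fun=> 0); first exact: IH.
by apply/funext => x; rewrite derive1_cst.
Qed.

Lemma smoothnD n g h : smoothn n g -> smoothn n h -> smoothn n (fun x => g x + h x).
Proof.
elim: n g h => [|n IH] g h /=; first by move=> cg ch x; apply: cvgD; [exact: cg|exact: ch].
move=> [dg sg] [dh sh]; split; first by move=> x; apply: derivableD.
rewrite (_ : derive1 _ = fun x => (derive1 g) x + (derive1 h) x); first exact: IH.
by apply/funext => x; rewrite !derive1E deriveD.
Qed.

Lemma smoothnM n g h : smoothn n g -> smoothn n h -> smoothn n (fun x => g x * h x).
Proof.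
elim: n g h => [|n IH] g h; first by move=> cg ch x; apply: cvgM; [exact: cg|exact: ch].
move=> sg sh; have [dg sg'] := sg; have [dh sh'] := sh.
split; first by move=> x; apply: derivableM.
rewrite (_ : derive1 _ = fun x => g x * (derive1 h) x + h x * (derive1 g) x).
  by apply: smoothnD; apply: IH => //; exact: smoothnW.
by apply/funext => x; rewrite !derive1E deriveM.
Qed.

Lemma smoothnZ n c g : smoothn n g -> smoothn n (fun x => c * g x).
Proof. by move=> sg; apply: smoothnM => //; exact: smoothn_cst. Qed.

Lemma is_derive_affine g (c e x : R) : derivable g (c * x + e) 1 ->
  is_derive x 1 (fun s => g (c * s + e)) (c * (derive1 g) (c * x + e)).
Proof.
move=> dg; rewrite derive1E mulrC.
have h : is_derive x 1 (fun s : R => c * s + e) c.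
  have := @is_deriveD _ _ _ _ _ x 1 _ _ (@is_deriveZ _ _ _ id c x 1 1 (is_derive_id _ _))
    (@is_derive_cst _ _ _ e x 1).
  by rewrite [_ *: _]mulr1 addr0.
by apply: (@is_derive1_comp _ g (fun s => c * s + e)).
Qed.

Lemma smoothn_affine n g (c e : R) : smoothn n g -> smoothn n (fun s => g (c * s + e)).
Proof.
elim: n g => [|n IH] g /=.
  move=> cg x; apply: continuous_comp; last exact: cg.
  by apply: cvgD; [apply: cvgM; [exact: cvg_cst|exact: cvg_id]|exact: cvg_cst].
move=> [dg sg]; split.
  by move=> x; have [] := is_derive_affine (dg (c * x + e)).
rewrite (_ : derive1 _ = fun x => c * (derive1 g) (c * x + e)); first by apply: smoothnZ;
  exact: IH.
by apply/funext => x; rewrite [LHS]derive1E; have [_ ->] := is_derive_affine (dg (c * x + e)).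
Qed.

(* [s^-k exp(-c/s)] for [s > 0]: the family is stable under differentiation up
   to linear combinations, which makes [flat 0] smooth. *)
Definition flat (c : R) (k : nat) (s : R) : R :=
  if 0 < s then s^-1 ^+ k * expR (- c * s^-1) else 0.

(** For an exponent k+1 put z = c y / (k+1): then exp(c y) = exp(z)^(k+1) >= z^(k+1), because exp(z)
    >= 1 + z. *)
Lemma exprn_expR_bound (c : R) k : 0 < c ->
  exists2 C, 0 <= C & forall y : R, 0 < y -> y ^+ k * expR (- c * y) <= C.
Proof.
move=> c0; case: k => [|k].
  exists 1 => // y y0; rewrite expr0 mul1r -expR0 ler_expR; nra.
have ck : 0 < c / k.+1%:R by rewrite divr_gt0.
exists ((c / k.+1%:R)^-1 ^+ k.+1); first by rewrite exprn_ge0// invr_ge0 ltW.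
move=> y y0.
have h : (c / k.+1%:R * y) ^+ k.+1 <= expR (c * y).
  have -> : c * y = k.+1%:R * (c / k.+1%:R * y).
    by rewrite mulrA [_ * (c / _)]mulrC divfK// pnatr_eq0.
  rewrite expRM_natl; apply: lerXn2r; rewrite ?nnegrE ?expR_ge0//.
    by rewrite mulr_ge0 ?ltW.
  by apply: le_trans (expR_ge1Dx _); rewrite lerDr.
rewrite mulNr expRN exprVn ler_pdivrMr ?expR_gt0// -ler_pdivrMl ?invrK.
  by rewrite -exprMn.
by rewrite invr_gt0 exprn_gt0.
Qed.

(** A quadratic bound is what makes the difference quotient at the origin tend to 0, in
    [is_derive_flat]. *)
Lemma flat_bound (c : R) k : 0 < c ->
  exists2 C, 0 <= C & forall s, `|flat c k s| <= C * s ^+ 2.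
Proof.
move=> c0; have [C C0 CP] := exprn_expR_bound k.+2 c0.
exists C => // s; rewrite /flat; case: ltP => s0; last first.
  by rewrite normr0 mulr_ge0 ?sqr_ge0.
have := CP s^-1; rewrite invr_gt0 => /(_ s0) h.
rewrite ger0_norm ?mulr_ge0 ?exprn_ge0 ?expR_ge0 ?invr_ge0 ?(ltW s0)//.
rewrite -ler_pdivrMr ?exprn_gt0//; apply: le_trans h.
by rewrite -exprVn [leLHS]mulrC mulrA -exprD add2n.
Qed.

Lemma is_derive_flat (c : R) k (x : R) : 0 < c ->
  is_derive x 1 (flat c k) (- k%:R * flat c k.+1 x + c * flat c k.+2 x).
Proof.
move=> c0; have [x0|x0|->] := ltgtP x 0.
- have -> : - k%:R * flat c k.+1 x + c * flat c k.+2 x = 0.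
    by rewrite /flat !ltNge (ltW x0) /= !mulr0 addr0.
  apply: (@near_eq_is_derive _ _ _ (cst (0 : R)) _ x 1 0 _ (is_derive_cst (0 : R) x 1)).
  near=> y; rewrite /flat ltNge (_ : y <= 0)//; near: y.
  exact: lt_le_nbhsl.
- apply: (@near_eq_is_derive _ _ _ ((fun y : R => y ^+ k * expR (- c * y)) \o (fun s : R =>
  s^-1))).
    near=> y; rewrite /flat (_ : 0 < y)//; near: y; exact: lt_nbhsr.
  have dV : is_derive x (1 : R) (fun s : R => s^-1) (- x^-1 ^+ 2).
    have := @is_deriveV _ id x 1 1 (lt0r_neq0 x0) (is_derive_id _ _).
    by rewrite [_ *: _]mulr1 exprVn.
  have dG (y : R) : is_derive y 1 (fun y : R => y ^+ k * expR (- c * y))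
      (y ^+ k * (expR (- c * y) * - c) + expR (- c * y) * (k%:R * y ^+ k.-1)).
    have d1 : is_derive y (1 : R) (fun y : R => y ^+ k) (k%:R * y ^+ k.-1).
      by have := @is_deriveX _ _ id k y 1 1 (is_derive_id _ _); rewrite exprfctE [_ *: _]mulr1.
    have d2 : is_derive y (1 : R) (fun y : R => expR (- c * y)) (expR (- c * y) * - c).
      apply: (@is_derive1_comp _ expR (fun y => - c * y)).
      have := @is_deriveZ _ _ _ id (- c) y 1 1 (is_derive_id _ _).
      by rewrite [_ *: _]mulr1.
    exact: (@is_deriveM _ _ (fun y : R => y ^+ k) (fun y : R => expR (- c * y)) y 1 _ _ d1 d2).
  have [dd ed] := is_derive1_comp (dG x^-1) dV.
  apply: DeriveDef; first exact: dd.
  rewrite [LHS]ed.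
  rewrite /flat x0; case: (k) => [|m]; first by rewrite !expr0; ring.
  by rewrite /= !exprS; ring.
- have -> : - k%:R * flat c k.+1 0 + c * flat c k.+2 0 = 0.
    by rewrite /flat ltxx !mulr0 addr0.
  have [C C0 CP] := flat_bound k c0.
  have cv : h^-1 *: (flat c k (h *: 1 + 0) - flat c k 0) @[h --> 0^'] --> (0 : R).
    apply/cvgrPdist_lt => e e0; near=> h; rewrite sub0r normrN.
    rewrite addr0 [flat c k 0]/flat ltxx subr0 [h *: 1]mulr1 normrM normfV.
    rewrite ltr_pdivrMl ?normr_gt0; last by near: h; exact: nbhs_dnbhs_neq.
    rewrite (le_lt_trans (CP _))// -real_normK ?num_real// expr2 mulrA mulrC.
    rewrite ltr_pM2l ?normr_gt0; last by near: h; exact: nbhs_dnbhs_neq.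
    rewrite (@le_lt_trans _ _ ((C + 1) * `|h|))//.
      by rewrite ler_wpM2r// lerDl.
    rewrite -ltr_pdivlMl ?ltr_wpDl//; near: h.
    apply: dnbhs0_lt; by rewrite mulr_gt0 ?invr_gt0 ?ltr_wpDl.
  apply: DeriveDef; first by apply/cvg_ex; exists 0.
  exact/cvg_lim.
Unshelve. all: by end_near. Qed.

Lemma smooth_flat (c : R) k : 0 < c -> smooth (flat c k).
Proof.
move=> c0 n; elim: n k => [|n IH] k.
  by apply: derivable_cont => x; have [] := is_derive_flat k x c0.
split; first by move=> x; have [] := is_derive_flat k x c0.
rewrite (_ : derive1 _ = fun x => - k%:R * flat c k.+1 x + c * flat c k.+2 x).
  by apply: smoothnD; apply: smoothnZ.
by apply/funext => x; rewrite derive1E; have [_ ->] := is_derive_flat k x c0.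
Qed.

Definition bump1 (c a b s : R) : R := flat c 0 (s - a) * flat c 0 (b - s).

Lemma smooth_bump1 c a b : 0 < c -> smooth (bump1 c a b).
Proof.
move=> c0 n; apply: smoothnM.
  have := smoothn_affine 1 (- a) (smooth_flat 0 c0 n).
  by under eq_fun do rewrite mul1r.
have := smoothn_affine (-1) b (smooth_flat 0 c0 n).
by under eq_fun do rewrite mulN1r addrC.
Qed.

Lemma flat0_itv c s : 0 < c -> 0 <= flat c 0 s <= 1.
Proof.
move=> c0; rewrite /flat; case: ifP => [s0|]; last by rewrite lexx ler01.
rewrite expr0 mul1r expR_ge0/= -expR0 ler_expR mulNr oppr_le0.
by rewrite mulr_ge0 ?invr_ge0 ?ltW.
Qed.

Lemma bump1_itv c a b s : 0 < c -> 0 <= bump1 c a b s <= 1.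
Proof.
move=> c0; rewrite /bump1.
have /andP[h1 h2] := flat0_itv (s - a) c0; have /andP[h3 h4] := flat0_itv (b - s) c0.
by rewrite mulr_ge0//= mulr_ile1.
Qed.

Lemma bump1_out c a b s : ~~ (a < s < b) -> bump1 c a b s = 0.
Proof.
rewrite negb_and -!leNgt => /orP[sa|bs]; rewrite /bump1 /flat.
  by rewrite ltNge subr_le0 sa mul0r.
by rewrite [X in _ * X](_ : _ = 0) ?mulr0// ltNge subr_le0 bs.
Qed.

End Smooth1.

(** * Functions of class C^k on R^n *)

Section ClassC.
Context {R : realType} {N : nat}.
Implicit Types (u w : 'rV[R]_N -> R) (i : 'I_N) (x : 'rV[R]_N).

Local Notation e_ i := (delta_mx ord0 i : 'rV[R]_N).

Lemma line_derive (v x : 'rV[R]_N) u (g : R -> R) (s : R) :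
  (forall h, u (h *: v + x) = g (h + s)) -> derivable g s 1 ->
  derivable u x v /\ 'D_v u x = (derive1 g) s.
Proof.
move=> ug dg.
have E : (fun h => h^-1 *: ((u \o shift x) (h *: v) - u x)) =
         (fun h => h^-1 *: ((g \o shift s) (h *: 1) - g s)).
  apply/funext => h /=; rewrite ug [h *: 1]mulr1.
  by have := ug 0; rewrite scale0r !add0r => ->.
by rewrite derive1E /derive /derivable E.
Qed.

Lemma derivable_line (v x : 'rV[R]_N) u : derivable u x v ->
  is_derive (0 : R) 1 (fun h => u (h *: v + x)) ('D_v u x).
Proof.
move=> du.
have E : (fun h => h^-1 *: ((u \o shift x) (h *: v) - u x)) =
  (fun h => h^-1 *: (((fun h => u (h *: v + x)) \o shift 0) (h *: 1) - u (0 *: v + x))).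
  by apply/funext => h /=; rewrite addr0 [h *: 1]mulr1 scale0r add0r.
by apply: DeriveDef; rewrite /derivable /derive -E.
Qed.

Lemma is_derive_line (v x : 'rV[R]_N) u (s : R) : derivable u (s *: v + x) v ->
  is_derive s 1 (fun h => u (h *: v + x)) ('D_v u (s *: v + x)).
Proof.
move=> du.
have E : (fun h => h^-1 *: ((u \o shift (s *: v + x)) (h *: v) - u (s *: v + x))) =
  (fun h => h^-1 *: (((fun h => u (h *: v + x)) \o shift s) (h *: 1) - u (s *: v + x))).
  by apply/funext => h /=; rewrite [h *: 1]mulr1 scalerDl addrA.
by apply: DeriveDef; rewrite /derivable /derive -E.
Qed.

Lemma class_C_cont k u : class_C k u -> continuous u.
Proof. by case: k => [//|k []]. Qed.

Lemma class_CW k u : class_C k.+1 u -> class_C k u.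
Proof.
elim: k u => [|k IH] u /=; first by case.
move=> [cu h]; split => // i; have [d c] := h i; split => //; exact: IH.
Qed.

Lemma class_C_derivable k u i x : class_C k.+1 u -> derivable u x (e_ i).
Proof. by move=> [_ /(_ i)[]]. Qed.

Lemma class_C_partial k u i : class_C k.+1 u -> class_C k (partial i u).
Proof. by move=> [_ /(_ i)[]]. Qed.

Lemma class_C_cst k (c : R) : class_C k (fun _ : 'rV[R]_N => c).
Proof.
elim: k c => [|k IH] c /=; first exact: cst_continuous.
split; first exact: cst_continuous.
move=> i; split; first by move=> x; exact: derivable_cst.
rewrite (_ : partial i _ = fun=> 0); first exact: IH.
by apply/funext => x; rewrite /partial derive_cst.
Qed.

Lemma class_CD k u w : class_C k u -> class_C k w -> class_C k (fun x => u x + w x).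
Proof.
elim: k u w => [|k IH] u w.
  by move=> cu cw x; exact: (continuousD (cu x) (cw x)).
move=> [cu du] [cw dw]; split.
  by move=> x; exact: (continuousD (cu x) (cw x)).
move=> i; have [d1 d2] := du i; have [d3 d4] := dw i; split.
  by move=> x; apply: derivableD.
rewrite (_ : partial i _ = fun x => partial i u x + partial i w x); first exact: IH.
by apply/funext => x; rewrite /partial deriveD.
Qed.

Lemma class_CM k u w : class_C k u -> class_C k w -> class_C k (fun x => u x * w x).
Proof.
elim: k u w => [|k IH] u w.
  by move=> cu cw x; exact: (continuousM (cu x) (cw x)).
move=> Cu Cw; have [cu du] := Cu; have [cw dw] := Cw; split.
  by move=> x; exact: (continuousM (cu x) (cw x)).
move=> i; have [d1 d2] := du i; have [d3 d4] := dw i; split.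
  by move=> x; apply: derivableM.
rewrite (_ : partial i _ = fun x => u x * partial i w x + w x * partial i u x).
  by apply: class_CD; apply: IH => //; exact: class_CW.
by apply/funext => x; rewrite /partial deriveM.
Qed.

Lemma class_CZ k (c : R) u : class_C k u -> class_C k (fun x => c * u x).
Proof. by move=> Cu; apply: class_CM => //; exact: class_C_cst. Qed.

Lemma partialM u w i x : derivable u x (e_ i) -> derivable w x (e_ i) ->
  partial i (fun x => u x * w x) x = u x * partial i w x + w x * partial i u x.
Proof. by move=> du dw; exact: deriveM. Qed.

Lemma partial_affine (t : R) (a : 'rV[R]_N) u i x :
  derivable u (t *: x + a) (e_ i) ->
  derivable (fun x => u (t *: x + a)) x (e_ i) /\
  partial i (fun x => u (t *: x + a)) x = t * partial i u (t *: x + a).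
Proof.
move=> du.
have [d0 e0] := derivable_line du.
have h0 : t * 0 + 0 = 0 :> R by rewrite mulr0 addr0.
have := @is_derive_affine _ (fun h => u (h *: e_ i + (t *: x + a))) t 0 0.
rewrite h0 => /(_ d0)[d1 e1].
have [|d2 e2] := @line_derive (e_ i) x (fun x => u (t *: x + a))
   (fun s => u ((t * s + 0) *: e_ i + (t *: x + a))) 0 _ d1.
  by move=> h; rewrite !addr0 scalerDr scalerA addrA.
split=> //; rewrite [LHS]e2 derive1E e1 derive1E e0.
by [].
Qed.

Lemma continuous_affine_comp (t : R) (a : 'rV[R]_N) u : continuous u ->
  continuous (fun x => u (t *: x + a)).
Proof.
move=> cu x; apply: continuous_comp; last exact: cu.
by apply: continuousD; [exact: scaler_continuous|exact: cst_continuous].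
Qed.

Lemma class_C_affine k (t : R) (a : 'rV[R]_N) u : class_C k u ->
  class_C k (fun x => u (t *: x + a)).
Proof.
elim: k u => [|k IH] u; first exact: continuous_affine_comp.
move=> [cu du]; split; first exact: continuous_affine_comp.
move=> i; have [d1 d2] := du i; split.
  by move=> x; have [] := partial_affine (d1 (t *: x + a)).
rewrite (_ : partial i _ = fun x => t * partial i u (t *: x + a)).
  by apply: class_CZ; exact: IH.
by apply/funext => x; have [] := partial_affine (d1 (t *: x + a)).
Qed.

Lemma continuous_coor i : continuous (fun x : 'rV[R]_N => x ord0 i).
Proof. exact: coord_continuous. Qed.

Lemma partial_coor (g : R -> R) i j x : derivable g (x ord0 j) 1 ->
  derivable (fun x : 'rV[R]_N => g (x ord0 j)) x (e_ i) /\
  partial i (fun x => g (x ord0 j)) x = (i == j)%:R * (derive1 g) (x ord0 j).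
Proof.
move=> dg; have [ij|ij] := eqVneq i j.
  subst i; rewrite mul1r; apply: line_derive => // h.
  by rewrite !mxE !eqxx mulr1.
have -> : false%:R * (derive1 g) (x ord0 j) = derive1 (fun _ : R => g (x ord0 j)) (0 : R).
  by rewrite mul0r derive1_cst.
apply: line_derive; last exact: derivable_cst.
by move=> h; rewrite !mxE eq_sym (negbTE ij) andbF mulr0 add0r.
Qed.

Lemma class_C_coor k (g : R -> R) j : smooth g ->
  class_C k (fun x : 'rV[R]_N => g (x ord0 j)).
Proof.
move=> sg; move: (sg k); elim: k g {sg} => [|k IH] g.
  by move=> cg x; apply: continuous_comp; [exact: continuous_coor|exact: cg].
move=> [dg sg]; split.
  move=> x; apply: continuous_comp; first exact: continuous_coor.
  exact: derivable_cont.
move=> i; split; first by move=> x; have [] := partial_coor i (dg (x ord0 j)).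
rewrite (_ : partial i _ = fun x => (i == j)%:R * (derive1 g) (x ord0 j)).
  by apply: class_CZ; exact: IH.
by apply/funext => x; have [] := partial_coor i (dg (x ord0 j)).
Qed.

Lemma class_C_prod k (I : Type) (s : seq I) (F : I -> 'rV[R]_N -> R) :
  (forall l, class_C k (F l)) -> class_C k (fun x => \prod_(l <- s) F l x).
Proof.
move=> CF; elim: s => [|l s IH].
  by under eq_fun do rewrite big_nil; exact: class_C_cst.
by under eq_fun do rewrite big_cons; exact: class_CM.
Qed.

End ClassC.

Section TestFunctions.
Context {R : realType} {N : nat}.
Implicit Types (u w phi psi : 'rV[R]_N -> R) (i : 'I_N) (x : 'rV[R]_N)
  (r s t c C M h : R).
Local Notation mu := (lebesgue_rV R N).
Local Notation e_ i := (delta_mx ord0 i : 'rV[R]_N).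
Local Notation cube := (@cube R N).

Definition supp_in (r : R) u : Prop := forall x, ~ cube r x -> u x = 0.

Lemma compact_cube r : compact (cube r).
Proof.
have := @rV_compact R N (fun=> `[- r, r]%classic) (fun=> @segment_compact R (- r) r).
rewrite (_ : mkset _ = cube r)//; apply/seteqP; split=> x /= h i.
  by have := h i; rewrite !mxE in_itv.
by have := h i; rewrite !mxE in_itv.
Qed.

Lemma closed_cube r : closed (cube r).
Proof. by apply: compact_closed; [exact: norm_hausdorff|exact: compact_cube]. Qed.

Lemma cube_le r s x : r <= s -> cube r x -> cube s x.
Proof. by move=> rs /cubeE h; apply/cubeE => i; exact: le_trans (h i) rs. Qed.

(** Closed cubes are compact and compact sets are bounded, so supports can be handled from here on
    as vanishing outside some cube. *)
Lemma test_functionP phi :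
  test_function phi <-> (forall k, class_C k phi) /\ exists2 r : R, 0 <= r & supp_in r phi.
Proof.
split=> [[Cp cp]|[Cp [r r0 sr]]]; split => //.
  have [M [Mr HM]] := compact_bounded cp.
  exists (`|M| + 1); first by rewrite addr_ge0.
  move=> x ncx; apply: contrapT => px; apply: ncx; apply/cubeE => i.
  have : `|x| <= `|M| + 1.
    apply: HM; first by rewrite (le_lt_trans (ler_norm _))// ltrDl.
    by apply: subset_closure => /=; apply/eqP.
  apply: le_trans; rewrite [leRHS]/Num.Def.normr/= mx_normrE.
  exact: (le_bigmax _ (fun ij : 'I_1 * 'I_N => `|x ij.1 ij.2|) (ord0, i)).
apply: (@subclosed_compact _ _ (cube r)); first exact: closed_closure.
- exact: compact_cube.
- rewrite [X in _ `<=` X](closure_id (cube r)).1; last exact: closed_cube.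
  apply: closure_subset => x /= /eqP px; apply: contrapT => nx; apply: px; exact: sr.
Qed.

Lemma test0 : test_function (fun _ : 'rV[R]_N => 0).
Proof.
apply/test_functionP; split; first by move=> k; exact: class_C_cst.
by exists 0.
Qed.

Lemma testD phi psi : test_function phi -> test_function psi ->
  test_function (fun x => phi x + psi x).
Proof.
move=> /test_functionP[Cp [r r0 sr]] /test_functionP[Cq [s s0 ss]].
apply/test_functionP; split; first by move=> k; exact: class_CD.
exists (r + s); first exact: addr_ge0.
move=> x nx; rewrite sr ?ss ?addr0//; apply: contra_not nx; apply: cube_le.
  by rewrite lerDr.
by rewrite lerDl.
Qed.

Lemma testM phi psi : (forall k, class_C k phi) -> test_function psi ->
  test_function (fun x => phi x * psi x).
Proof.
move=> Cp /test_functionP[Cq [s s0 ss]].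
apply/test_functionP; split; first by move=> k; exact: class_CM.
by exists s => // x nx; rewrite ss ?mulr0.
Qed.

Lemma testZ c phi : test_function phi -> test_function (fun x => c * phi x).
Proof. by apply: testM => k; exact: class_C_cst. Qed.

Lemma test_affine (t : R) (a : 'rV[R]_N) phi : t != 0 -> test_function phi ->
  test_function (fun x => phi (t *: x + a)).
Proof.
move=> t0 /test_functionP[Cp [r r0 sr]]; apply/test_functionP; split.
  by move=> k; exact: class_C_affine.
exists (`|t|^-1 * (r + \sum_i `|a ord0 i|)).
  by rewrite mulr_ge0 ?invr_ge0// addr_ge0// sumr_ge0.
move=> x nx; apply: sr; apply: contra_not nx => /cubeE h; apply/cubeE => i.
have := h i; rewrite !mxE => hi.
rewrite ler_pdivlMl ?normr_gt0// -normrM.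
have -> : t * x ord0 i = (t * x ord0 i + a ord0 i) - a ord0 i by rewrite addrK.
rewrite (le_trans (ler_normB _ _))// lerD//.
by rewrite (bigD1 i)//= lerDl sumr_ge0.
Qed.

Lemma test_translate (a : 'rV[R]_N) phi : test_function phi ->
  test_function (fun x => phi (x + a)).
Proof.
by move=> /(test_affine a (oner_neq0 R)); under eq_fun do rewrite scale1r.
Qed.

Lemma test_scale (t : R) phi : t != 0 -> test_function phi ->
  test_function (fun x => phi (t *: x)).
Proof.
by move=> t0 /(test_affine 0 t0); under eq_fun do rewrite addr0.
Qed.

Lemma smooth_id : smooth (@id R).
Proof.
case=> [|n]; first by move=> x; exact: cvg_id.
split; first by move=> x; exact: derivable_id.
rewrite (_ : derive1 _ = fun _ : R => (1 : R)); first exact: smoothn_cst.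
by apply/funext => x; rewrite derive1_id.
Qed.

Lemma test_coorM i phi : test_function phi -> test_function (fun x => x ord0 i * phi x).
Proof. by apply: testM => k; apply: (class_C_coor _ _ smooth_id). Qed.

Lemma continuous_supp_bounded r u : continuous u -> supp_in r u ->
  exists2 C : R, 0 <= C & forall x, `|u x| <= C.
Proof.
move=> cu su.
have : compact (u @` cube r).
  by apply: continuous_compact; [exact: continuous_subspaceT|exact: compact_cube].
move=> /compact_bounded[M [_ HM]]; exists (`|M| + 1); first by rewrite addr_ge0.
move=> x; have [cx|ncx] := pselect (cube r x).
  apply: HM; first by rewrite (le_lt_trans (ler_norm _))// ltrDl.
  by exists x.
by rewrite su// normr0 addr_ge0.
Qed.

Lemma intg_indic_cube r : intg mu (\1_(cube r) : 'rV[R]_N -> R).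
Proof.
apply/integrableP; split.
  by apply/measurable_EFinP; apply: measurable_indic; exact: measurable_cbox.
under eq_integral do rewrite /= ger0_norm//.
rewrite integral_indic//; last exact: measurable_cbox.
by rewrite setIT; exact: lebesgue_rV_cube.
Qed.

Lemma intg_supp r C u : measurable_fun [set: 'rV[R]_N] u -> supp_in r u ->
  (forall x, `|u x| <= C) -> intg mu u.
Proof.
move=> mu_ su uC; apply: intg_le (intgZ C (intg_indic_cube r)) => // x.
have C0 : 0 <= C by exact: le_trans (uC x).
rewrite indicE; have [cx|ncx] := boolP (x \in cube r); first by rewrite mulr1.
by rewrite su ?normr0 ?mulr0//; move: ncx; rewrite notin_setE.
Qed.

Lemma sqint_supp r C u : measurable_fun [set: 'rV[R]_N] u -> supp_in r u ->
  (forall x, `|u x| <= C) -> sqint mu u.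
Proof.
move=> mu_ su uC; split => //; apply: (@intg_supp r (C ^+ 2)).
- exact: measurable_funX.
- by move=> x nx; rewrite su// expr0n.
- move=> x; rewrite normrX lerXn2r ?nnegrE//; exact: le_trans (uC x).
Qed.

Lemma cont_supp_sqint r u : continuous u -> supp_in r u -> sqint mu u.
Proof.
move=> cu su; have [C _ uC] := continuous_supp_bounded cu su.
by apply: (sqint_supp _ su uC); exact: continuous_rV_measurable.
Qed.

Lemma cont_supp_intg r u : continuous u -> supp_in r u -> intg mu u.
Proof.
move=> cu su; have [C _ uC] := continuous_supp_bounded cu su.
by apply: (intg_supp _ su uC); exact: continuous_rV_measurable.
Qed.

Lemma test_cont phi : test_function phi -> continuous phi.
Proof. by move=> [/(_ 0%N)]. Qed.

Lemma test_sqint phi : test_function phi -> sqint mu phi.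
Proof.
move=> tp; have /test_functionP[_ [r _ sr]] := tp.
exact: cont_supp_sqint (test_cont tp) sr.
Qed.

Lemma supp_in_partial r u i : supp_in r u -> supp_in r (partial i u).
Proof.
move=> su x nx; rewrite /partial.
rewrite -(@derive_cst _ _ _ (0 : R) x (e_ i)); apply: near_eq_derive.
have oC : open (~` cube r) by apply: closed_openC; exact: closed_cube.
have : nbhs x (~` cube r) by exact: open_nbhs_nbhs.
by apply: filterS => y /su.
Qed.

Lemma test_partial i phi : test_function phi -> test_function (partial i phi).
Proof.
move=> /test_functionP[Cp [r r0 sr]]; apply/test_functionP; split.
  by move=> k; exact: class_C_partial (Cp k.+1).
by exists r => //; exact: supp_in_partial.
Qed.

Lemma line_MVT u i x (h : R) : class_C 1 u -> 0 < h ->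
  exists2 s : R, 0 < s < h & u (h *: e_ i + x) - u x = partial i u (s *: e_ i + x) * h.
Proof.
move=> Cu h0.
have D s : is_derive s 1 (fun h => u (h *: e_ i + x)) (partial i u (s *: e_ i + x)).
  by apply: is_derive_line; exact: class_C_derivable Cu.
have [|s sh E] := @MVT _ (fun h => u (h *: e_ i + x)) _ 0 h h0 (fun s _ => D s).
  apply: continuous_subspaceT => s.
  by have [ds _] := D s; apply: differentiable_continuous; apply/derivable1_diffP.
exists s; first by move: sh; rewrite in_itv.
by move: E; rewrite scale0r add0r subr0.
Qed.

Lemma supp_in_translate r (a : 'rV[R]_N) u (s : R) : (forall i, `|a ord0 i| <= s) ->
  supp_in r u -> supp_in (r + s) (fun x => u (a + x)).
Proof.
move=> as_ su x nx; apply: su; apply: contra_not nx => /cubeE h; apply/cubeE => i.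
have := h i; rewrite !mxE => hi.
have -> : x ord0 i = (a ord0 i + x ord0 i) - a ord0 i by rewrite addrC addKr.
by rewrite (le_trans (ler_normB _ _))// lerD.
Qed.

(** Every forward difference quotient has integral 0 by translation invariance. By the mean value
    theorem the quotients are bounded on a fixed cube and vanish outside it, so dominated
    convergence applies. *)
Lemma int_partial_eq0 r u i : class_C 1 u -> supp_in r u -> \int[mu]_x partial i u x = 0.
Proof.
move=> Cu su; have cu := class_C_cont Cu.
have cpu : continuous (partial i u) by exact: class_C_partial Cu.
have spu : supp_in r (partial i u) by exact: supp_in_partial.
have [C C0 uC] := continuous_supp_bounded cpu spu.
have iu := cont_supp_intg cu su.
pose h (n : nat) : R := n.+1%:R^-1.
have h0 n : 0 < h n by rewrite invr_gt0.
have h1 n : h n <= 1 by rewrite invf_le1// ler1n.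
pose F n x := (h n)^-1 * (u (x + h n *: e_ i) - u x).
have iF n : intg mu (F n) by apply: intgZ; apply: intgB => //; exact: intg_translate.
have F0 n : \int[mu]_x F n x = 0.
  rewrite intZ; last by apply: intgB => //; exact: intg_translate.
  by rewrite intB// ?int_translate// ?subrr ?mulr0//; exact: intg_translate.
have [|||||_] := @dct _ _ _ mu F (partial i u) (fun x => C * \1_(cube (r + 1)) x).
- by move=> n; exact: intg_measurable.
- exact: continuous_rV_measurable.
- apply: aeW => x; have := @class_C_derivable _ _ _ _ i x Cu.
  rewrite /derivable => /cvgr_dnbhsP /(_ h).
  have hc : h n @[n --> \oo] --> (0 : R) by exact: cvg_harmonic.
  move=> /(_ (conj (fun n => lt0r_neq0 (h0 n)) hc)) /=.
  rewrite /partial /derive/=; apply: cvg_trans; apply: near_eq_cvg; apply: nearW => n.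
  by rewrite /F /= [x + _]addrC.
- by apply: intgZ; exact: intg_indic_cube.
- move=> n x; rewrite indicE; have [cx|ncx] := boolP (x \in cube (r + 1)).
    have [s _ E] := line_MVT i x Cu (h0 n).
    rewrite /F [x + _]addrC E mulrCA mulVf ?mulr1 ?uC//; exact: lt0r_neq0.
  have nx : ~ cube (r + 1) x by move: ncx; rewrite notin_setE.
  have ha j : `|(h n *: e_ i) ord0 j| <= 1.
    rewrite !mxE eqxx/=; case: eqP => _; rewrite ?mulr1 ?mulr0 ?normr0//.
    by rewrite ger0_norm// ltW.
  have ux : u x = 0 by apply: su; apply: contra_not nx; apply: cube_le; rewrite lerDl.
  have uxh : u (h n *: e_ i + x) = 0 := supp_in_translate ha su nx.
  by rewrite mulr0 /F [x + _]addrC uxh ux subrr mulr0 normr0.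
- rewrite (_ : (fun n => _) = fun=> 0); last by apply/funext => n; rewrite F0.
  by move=> /(cvg_unique (@norm_hausdorff _ _) (cvg_cst _)) <-.
Qed.

Lemma integration_by_parts_test u phi i : class_C 1 u -> test_function phi ->
  \int[mu]_x (u x * partial i phi x) = - \int[mu]_x (partial i u x * phi x).
Proof.
move=> Cu tp; have /test_functionP[Cp [r r0 sr]] := tp.
have cpu : continuous (partial i u) by exact: class_C_partial Cu.
have cpp : continuous (partial i phi) by exact: class_C_partial (Cp 1%N).
have i1 : intg mu (fun x => u x * partial i phi x).
  apply: (@cont_supp_intg r); first exact: (@class_CM _ _ 0 u (partial i phi) (class_CW Cu) cpp).
  by move=> x nx; rewrite (supp_in_partial i sr nx) mulr0.
have i2 : intg mu (fun x => partial i u x * phi x).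
  apply: (@cont_supp_intg r); first exact: (@class_CM _ _ 0 (partial i u) phi cpu (Cp 0%N)).
  by move=> x nx; rewrite sr ?mulr0.
have := @int_partial_eq0 r (fun x => u x * phi x) i.
move=> /(_ (class_CM Cu (Cp 1%N))) H.
have {H} : \int[mu]_x partial i (fun x => u x * phi x) x = 0.
  by apply: H => x nx; rewrite sr ?mulr0.
under eq_int do rewrite (partialM (class_C_derivable Cu) (class_C_derivable (Cp 1%N))).
rewrite intD//; last by apply: eq_intg i2 => x; rewrite mulrC.
under [X in _ + X]eq_int do rewrite mulrC.
by move/eqP; rewrite addr_eq0 => /eqP.
Qed.

End TestFunctions.

(** * Density of test functions in L2 *)

Section Density.
Context {R : realType} {N : nat}.
Implicit Types (u w phi psi : 'rV[R]_N -> R) (i : 'I_N) (x a b : 'rV[R]_N)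
  (r c e : R).
Local Notation mu := (lebesgue_rV R N).
Local Notation cube := (@cube R N).

Definition bumpN (c : R) (a b : 'rV[R]_N) : 'rV[R]_N -> R :=
  fun x => \prod_i bump1 c (a ord0 i) (b ord0 i) (x ord0 i).

Lemma bumpN_class_C c a b k : 0 < c -> class_C k (bumpN c a b).
Proof.
move=> c0; apply: class_C_prod => i.
by apply: class_C_coor; exact: smooth_bump1.
Qed.

Lemma bumpN_itv c a b x : 0 < c -> 0 <= bumpN c a b x <= 1.
Proof.
move=> c0; rewrite /bumpN; elim/big_ind: _ => [|y z|i _].
- by rewrite ler01 lexx.
- by move=> /andP[h1 h2] /andP[h3 h4]; rewrite mulr_ge0//= mulr_ile1.
- exact: bump1_itv.
Qed.

Lemma bumpN_out c a b x i : ~~ (a ord0 i < x ord0 i < b ord0 i) -> bumpN c a b x = 0.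
Proof. by move=> /bump1_out h; rewrite /bumpN (bigD1 i)//= h mul0r. Qed.

Lemma bumpN_supp c r a b : (forall i, - r <= a ord0 i) -> (forall i, b ord0 i <= r) ->
  supp_in r (bumpN c a b).
Proof.
move=> ar br x nx; have [i ni] : exists i, ~~ (a ord0 i < x ord0 i < b ord0 i).
  apply: contrapT => /forallNP h; apply: nx; apply/cubeE => i.
  have /negP := h i; rewrite negbK => /andP[h1 h2].
  rewrite ler_norml; have := ar i; have := br i; move: h1 h2; lra.
exact: bumpN_out ni.
Qed.

Lemma bumpN_test c r a b : 0 < c -> (forall i, - r <= a ord0 i) ->
  (forall i, b ord0 i <= r) -> test_function (bumpN c a b).
Proof.
move=> c0 ar br; apply/test_functionP; split; first by move=> k; exact: bumpN_class_C.
exists `|r| => // x nx; apply: (bumpN_supp _ ar br); apply: contra_not nx.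
by apply: cube_le; exact: ler_norm.
Qed.

Definition margin (k : nat) : R := k.+1%:R^-1.

Lemma margin_gt0 k : 0 < margin k. Proof. by rewrite invr_gt0. Qed.

Lemma margin_le1 k : margin k <= 1. Proof. by rewrite invf_le1// ler1n. Qed.

Lemma margin_cvg : margin k @[k --> \oo] --> (0 : R). Proof. exact: cvg_harmonic. Qed.

Lemma margin_lt e : 0 < e -> \forall k \near \oo, margin k < e.
Proof. by move=> e0; exact: (near_infty_natSinv_lt (PosNum e0)). Qed.

(* A width [margin k] much larger than [margin k ^+ 2] makes
   the bumps around a closed box converge to its indicator everywhere. *)
Lemma bump1_outer_cvg (a b s : R) :
  bump1 (margin k ^+ 2) (a - margin k) (b + margin k) s @[k --> \oo] -->
  ((a <= s <= b)%R%:R : R).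
Proof.
have F (r : R) : 0 <= r -> flat (margin k ^+ 2) 0 (r + margin k) @[k --> \oo] --> (1 : R).
  move=> r0.
  have h : expR (- margin k) @[k --> \oo] --> (1 : R).
    have h : - margin k @[k --> \oo] --> (0 : R) by rewrite -oppr0; apply: cvgN;
      exact: margin_cvg.
    by have := cvg_comp _ _ h (@continuous_expR R 0); rewrite expR0.
  apply: (@squeeze_cvgr _ _ _ _ (fun k => expR (- margin k)) (fun=> 1)) => //;
    last exact: cvg_cst.
  apply: nearW => k; have m0 := margin_gt0 k.
  have /andP[_ ->] := flat0_itv (r + margin k) (exprn_gt0 2 m0).
  rewrite andbT /flat ltr_wpDl// expr0 mul1r ler_expR mulNr lerN2.
  by rewrite ler_pdivrMr ?ltr_wpDl// expr2 ler_pM2l// lerDr.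
have [/andP[as_ sb]|nasb] := boolP (a <= s <= b).
  rewrite -[X in _ --> X]mulr1; apply: cvgM.
    have := F (s - a); rewrite subr_ge0 => /(_ as_).
    by under eq_fun do rewrite -addrA -[- a + _]opprK opprD opprK.
  by have := F (b - s); rewrite subr_ge0 => /(_ sb); under eq_fun do rewrite addrAC.
have {nasb} : s < a \/ b < s.
  by move: nasb; rewrite negb_and -!ltNge => /orP.
move=> nasb.
have [e e0 he] : exists2 e : R, 0 < e & forall m : R, m < e -> ~~ (a - m < s < b + m).
  case: nasb => h.
    by exists (a - s) => [|m hm]; [rewrite subr_gt0|apply/negP => /andP[h1 h2]; lra].
  by exists (s - b) => [|m hm]; [rewrite subr_gt0|apply/negP => /andP[h1 h2]; lra].
apply: (@cvg_trans _ (cst (0 : R) @ \oo)); last exact: cvg_cst.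
apply: near_eq_cvg; apply: filterS (margin_lt e0) => k /he h.
by rewrite /= bump1_out.
Qed.

Lemma cvg_prodr (I : Type) (s : seq I) (f : I -> nat -> R) (l : I -> R) :
  (forall j, f j k @[k --> \oo] --> l j) ->
  \prod_(j <- s) f j k @[k --> \oo] --> \prod_(j <- s) l j.
Proof.
move=> fl; elim: s => [|j s IH].
  by under eq_fun do rewrite big_nil; rewrite big_nil; exact: cvg_cst.
by under eq_fun do rewrite big_cons; rewrite big_cons; apply: cvgM.
Qed.

Lemma bumpN_outer_cvg (a b x : 'rV[R]_N) :
  bumpN (margin k ^+ 2) (a - const_mx (margin k)) (b + const_mx (margin k)) x
   @[k --> \oo] --> (\1_(cbox a b) x : R).
Proof.
have -> : \1_(cbox a b) x = \prod_(i < N) ((a ord0 i <= x ord0 i <= b ord0 i)%R%:R : R).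
  rewrite indicE; have [/set_mem h|h] := boolP (x \in cbox a b).
    by rewrite big1// => i _; rewrite h.
  have [i /negbTE ni] : exists i, ~~ (a ord0 i <= x ord0 i <= b ord0 i).
    by move: h; rewrite notin_setE => /existsNP[i /negP ni]; exists i.
  by rewrite (bigD1 i)//= ni mul0r.
apply: cvg_prodr => i; have := @bump1_outer_cvg (a ord0 i) (b ord0 i) (x ord0 i).
by under [X in _ -> X @ _ --> _]eq_fun do rewrite !mxE.
Qed.

(** The support radius is recorded because the proof of Hardy's inequality multiplies the
    approximation error by |x|, which is bounded only on a fixed cube. *)
Definition test_closure (r : R) u : Prop := sqint mu u /\
  forall e : R, 0 < e -> exists phi,
    [/\ test_function phi, supp_in r phi & n2 mu (fun x => u x - phi x) <= e].

Lemma n2_parallelogram_le u w : sqint mu u -> sqint mu w ->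
  n2 mu (fun x => u x + w x) <= 2 * n2 mu u + 2 * n2 mu w.
Proof.
move=> su sw; rewrite (n2D su sw); have := n2_ge0 mu (fun x => u x - w x).
by rewrite (n2B su sw); lra.
Qed.

Lemma test_closure_lim r u (F : nat -> 'rV[R]_N -> R) : sqint mu u ->
  (forall n, test_closure r (F n)) ->
  n2 mu (fun x => u x - F n x) @[n --> \oo] --> (0 : R) -> test_closure r u.
Proof.
move=> su tF cF; split => // e e0.
have e4 : 0 < e / 4 by rewrite divr_gt0.
have [n _ /(_ n (leqnn n)) /= hn] : \forall n \near \oo, n2 mu (fun x => u x - F n x) < e / 4.
  by apply: cvgr_lt cF _ _.
have [sF /(_ _ e4)[phi [tp sp hp]]] := tF n.
exists phi; split => //.
have -> : (fun x => u x - phi x) = (fun x => (u x - F n x) + (F n x - phi x)).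
  by apply/funext => x; rewrite addrA subrK.
have := @n2_parallelogram_le (fun x => u x - F n x) (fun x => F n x - phi x)
  (sqintB su sF) (sqintB sF (test_sqint tp)).
by lra.
Qed.

Lemma test_closureD r u w : test_closure r u -> test_closure r w ->
  test_closure r (fun x => u x + w x).
Proof.
move=> [su tu] [sw tw]; split => [|e e0]; first exact: sqintD.
have e4 : 0 < e / 4 by rewrite divr_gt0.
have [phi [tp sp hp]] := tu _ e4; have [psi [tq sq hq]] := tw _ e4.
exists (fun x => phi x + psi x); split; first exact: testD.
  by move=> x nx; rewrite sp// sq// addr0.
have -> : (fun x => u x + w x - (phi x + psi x)) =
    (fun x => (u x - phi x) + (w x - psi x)) by apply/funext => x; ring.
have := @n2_parallelogram_le (fun x => u x - phi x) (fun x => w x - psi x)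
  (sqintB su (test_sqint tp)) (sqintB sw (test_sqint tq)).
by lra.
Qed.

Lemma test_closureZ r c u : test_closure r u -> test_closure r (fun x => c * u x).
Proof.
move=> [su tu]; split => [|e e0]; first exact: sqintZ.
have c1 : 0 < c ^+ 2 + 1 by rewrite ltr_wpDl ?sqr_ge0.
have [|phi [tp sp hp]] := tu (e / (c ^+ 2 + 1)); first by rewrite divr_gt0.
exists (fun x => c * phi x); split; first exact: testZ.
  by move=> x nx; rewrite sp// mulr0.
have -> : (fun x => c * u x - c * phi x) = (fun x => c * (u x - phi x)).
  by apply/funext => x; ring.
rewrite n2Z; last exact: sqintB su (test_sqint tp).
move: hp; rewrite ler_pdivlMr// => hp.
have := n2_ge0 mu (fun x => u x - phi x); nra.
Qed.

Lemma test_closure0 r : test_closure r (fun=> 0).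
Proof.
split; first exact: sqint0.
move=> e e0; exists (fun=> 0); split => //; first exact: test0.
by rewrite /n2; under eq_int do rewrite subr0 expr0n; rewrite int0 ltW.
Qed.

Lemma test_closure_sum r (I : Type) (s : seq I) (F : I -> 'rV[R]_N -> R) :
  (forall l, test_closure r (F l)) -> test_closure r (fun x => \sum_(l <- s) F l x).
Proof.
move=> tF; elim: s => [|l s IH].
  by under eq_fun do rewrite big_nil; exact: test_closure0.
by under eq_fun do rewrite big_cons; exact: test_closureD.
Qed.

Lemma sqint_indic_cube (A : set 'rV[R]_N) r : measurable A ->
  sqint mu (\1_(A `&` cube r)).
Proof.
move=> mA; apply: (@sqint_supp _ _ r 1).
- by apply: measurable_indic; apply: measurableI => //; exact: measurable_cbox.
- by move=> x nx; rewrite indicE memNset// => -[].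
- by move=> x; rewrite indicE; case: (_ \in _); rewrite ?normr1 ?normr0.
Qed.

Lemma test_closure_dct r u (F : nat -> 'rV[R]_N -> R) g : sqint mu u -> sqint mu g ->
  (forall n, test_closure r (F n)) -> (forall n x, `|u x - F n x| <= `|g x|) ->
  {ae mu, forall x, F n x @[n --> \oo] --> u x} -> test_closure r u.
Proof.
move=> su sg tF Fg Fu; apply: (test_closure_lim su tF).
have [|||||_] := @dct _ _ _ mu (fun n x => (u x - F n x) ^+ 2) (fun=> 0) (fun x => g x ^+ 2).
- move=> n; apply: measurable_funX; apply: measurable_funB; first by case: su.
  by case: (tF n) => -[].
- by [].
- apply: filterS Fu => x Fx; rewrite -[X in _ --> X](expr0n _ 2)/=.
  under eq_fun do rewrite expr2; rewrite expr2.
  have h : u x - F n x @[n --> \oo] --> (0 : R).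
    by rewrite -(subrr (u x)); apply: cvgB => //; exact: cvg_cst.
  by apply: cvgM.
- by case: sg.
- move=> n x; rewrite normrX -(real_normK (num_real (g x))) lerXn2r ?nnegrE//.
- by rewrite int0.
Qed.

Lemma test_closure_cbox r (a b : 'rV[R]_N) : 0 <= r ->
  test_closure (r + 1) (\1_(cbox a b `&` cube r)).
Proof.
move=> r0.
pose a' : 'rV[R]_N := \row_i Num.max (a ord0 i) (- r).
pose b' : 'rV[R]_N := \row_i Num.min (b ord0 i) r.
have E : cbox a b `&` cube r = cbox a' b'.
  apply/seteqP; split => x /=.
    move=> [h h'] i; rewrite !mxE ge_max le_min.
    by have /andP[-> ->] := h i; have := h' i; rewrite !mxE.
  move=> h; split => i; have := h i; rewrite !mxE ge_max le_min.
    by move=> /andP[/andP[-> _] /andP[-> _]].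
  by move=> /andP[/andP[_ ->] /andP[_ ->]].
pose B k := bumpN (margin k ^+ 2) (a' - const_mx (margin k)) (b' + const_mx (margin k)).
have c0 k : 0 < margin k ^+ 2 by rewrite exprn_gt0// margin_gt0.
have ha k i : - (r + 1) <= (a' - const_mx (margin k)) ord0 i.
  rewrite !mxE; have : - r <= Num.max (a ord0 i) (- r) by rewrite le_max lexx orbT.
  have := margin_le1 k; lra.
have hb k i : (b' + const_mx (margin k)) ord0 i <= r + 1.
  rewrite !mxE; have : Num.min (b ord0 i) r <= r by rewrite ge_min lexx orbT.
  have := margin_le1 k; lra.
have sB k : supp_in (r + 1) (B k) by apply: bumpN_supp.
have tB k : test_function (B k) by apply: (@bumpN_test _ (r + 1)).
apply: (@test_closure_dct _ _ B (fun x => 2 * \1_(cube (r + 1)) x)).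
- by apply: sqint_indic_cube; exact: measurable_cbox.
- by apply: sqintZ; have := @sqint_indic_cube setT (r + 1) measurableT; rewrite setTI.
- move=> k; split; first exact: test_sqint.
  move=> e e0; exists (B k); split => //.
  by rewrite /n2; under eq_int do rewrite subrr expr0n; rewrite int0 ltW.
- move=> k x; have /andP[h1 h2] := bumpN_itv (a' - const_mx (margin k)) (b' +
  const_mx (margin k)) x (c0 k).
  have [cx|ncx] := pselect (cube (r + 1) x); last first.
    rewrite sB// indicE memNset ?subr0 ?normr0//; last first.
      by move=> [_ cx]; apply: ncx; apply: cube_le cx; rewrite lerDl.
  rewrite [\1_(cube _) x]indicE mem_set// mulr1 [leRHS]ger0_norm//.
  rewrite (le_trans (ler_normB _ _))// -[2]/(1 + 1) lerD//.
    by rewrite indicE; case: (_ \in _); rewrite ?normr1 ?normr0.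
  by rewrite ger0_norm.
- by apply: aeW => x; rewrite E; exact: bumpN_outer_cvg.
Qed.

(** Dynkin induction: the sets with an approximable indicator contain the boxes and are stable under
    complements and countable disjoint unions. Intersecting with [cube r] keeps all indicators
    square-integrable. *)
Lemma test_closure_indic r (A : set 'rV[R]_N) : 0 <= r -> measurable A ->
  test_closure (r + 1) (\1_(A `&` cube r)).
Proof.
move=> r0 mA.
apply: (@dynkin_induction _ 'rV[R]_N (@cboxes R N)
  (fun A => test_closure (r + 1) (\1_(A `&` cube r)))) => //=.
- exact: measurable_rV_cboxes.
- exact: setI_closed_cboxes.
- have := test_closure_cbox (const_mx (- r)) (const_mx r) r0.
  by rewrite -/(cube r) setIid setTI.
- by move=> _ [a [b ->]]; exact: test_closure_cbox.
- move=> S mS tS.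
  have := test_closureD (test_closure_cbox (const_mx (- r)) (const_mx r) r0) (test_closureZ (-1)
    tS).
  rewrite -/(cube r) setIid; congr test_closure; apply/funext => x.
  rewrite !indicE !in_setI in_setC; case: (x \in S); case: (x \in cube r) => /=; ring.
- move=> F mF tF FP.
  have S n x m : F m x -> \sum_(k < n) (\1_(F k `&` cube r) x : R) = (m < n)%N%:R * \1_(cube r) x.
    move=> Fm; rewrite (eq_bigr (fun k : 'I_n => ((k == m :> nat)%:R * \1_(cube r) x))).
      rewrite -mulr_suml; congr (_ * _); have [mn|nm] := ltnP m n.
        rewrite (bigD1 (Ordinal mn))//= eqxx big1 ?addr0// => k.
        by rewrite -val_eqE/= => /negbTE ->.
      by rewrite big1// => k _; rewrite ltn_eqF// (leq_trans _ nm).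
    move=> k _; rewrite !indicE in_setI; have [->|km] := eqVneq (k : nat) m.
      by rewrite (mem_set Fm) mul1r.
    rewrite memNset ?mul0r// => Fk; move/trivIsetP : tF => /(_ k m Logic.I Logic.I km).
    by move/seteqP => [/(_ x) + _]; apply.
  apply: (@test_closure_dct _ _ (fun n x => \sum_(k < n) \1_(F k `&` cube r) x) (\1_(cube r))).
  + by apply: sqint_indic_cube; exact: bigcupT_measurable.
  + by have := @sqint_indic_cube setT r measurableT; rewrite setTI.
  + move=> n.
    have := @test_closure_sum (r + 1) 'I_n (index_enum 'I_n) (fun k => \1_(F k `&` cube r)).
    by apply => l; exact: FP.
  + move=> n x; have [[m _ Fm]|nF] := pselect ((\bigcup_k F k) x).
      rewrite (S n x m Fm) !indicE in_setI (mem_set (_ : (\bigcup_k F k) x)); last by exists m.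
      case: (x \in cube r); case: (m < n)%N; rewrite /= ?mulr1 ?mulr0 ?subr0 ?subrr ?normr0
        ?normr1//.
    rewrite indicE memNset ?sub0r ?normrN; last by move=> [].
    by rewrite big1 ?normr0// => k _; rewrite indicE memNset// => -[Fk _]; apply: nF; exists k.
  + apply: aeW => x; have [[m _ Fm]|nF] := pselect ((\bigcup_k F k) x).
      apply: (@cvg_trans _ (cst (\1_(cube r) x : R) @ \oo)).
        apply: near_eq_cvg; exists m.+1 => // n /= mn.
        by rewrite (S n x m Fm) mn mul1r.
      have -> : \1_(\bigcup_k F k `&` cube r) x = \1_(cube r) x :> R.
        by rewrite !indicE in_setI (mem_set (_ : (\bigcup_k F k) x))//; exists m.
      exact: cvg_cst.
    apply: (@cvg_trans _ (cst (0 : R) @ \oo)).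
      apply: near_eq_cvg; apply: nearW => n /=.
      by rewrite big1// => k _; rewrite indicE memNset// => -[Fk _]; apply: nF; exists k.
    by rewrite indicE memNset; [exact: cvg_cst|move=> []].
- by rewrite -measurable_rV_cboxes.
Qed.

(** A staircase approximation from below: adding the indicators of the sets where [w] exceeds the
    successive multiples of [margin n] rounds [w] down to such a multiple. *)
Lemma test_closure_ge0 r w : 0 <= r -> sqint mu w -> supp_in r w ->
  (forall x, 0 <= w x) -> test_closure (r + 1) w.
Proof.
move=> r0 sw suppw w0.
have mw : measurable_fun [set: 'rV[R]_N] w by case: sw.
pose A (n j : nat) := [set x | j.+1%:R * margin n <= w x].
(* With (n+1)^2 steps of height 1/(n+1) the staircase reaches height n+1, so that every value of [w]
   is eventually below its top. *)
pose J (n : nat) := (n.+1 ^ 2)%N.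
pose g n x := \sum_(j < J n) (margin n * \1_(A n j `&` cube r) x).
have mA n j : measurable (A n j).
  have := mw measurableT `[j.+1%:R * margin n, +oo[%classic (measurable_itv _).
  rewrite setTI; congr measurable; apply/seteqP; split => x /=.
    by rewrite in_itv/= andbT.
  by move=> h; rewrite in_itv/= andbT.
have Ac n j x : (x \in A n j `&` cube r) = (j.+1%:R * margin n <= w x).
  apply/idP/idP => [|h]; first by move=> /set_mem[].
  apply/mem_set; split => //; apply: contrapT => /suppw w00.
  by move: h; rewrite w00 leNgt mulr_gt0// margin_gt0.
have cnt (m K : nat) : \sum_(j < K) ((j < m)%N%:R : R) = (minn K m)%:R.
  elim: K => [|K IH]; first by rewrite big_ord0 min0n.
  rewrite big_ord_recr/= IH -natrD; congr (_%:R).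
  have [Km|Km] := ltnP K m.
    by rewrite addn1; symmetry; apply/minn_idPl.
  by rewrite addn0; symmetry; apply/minn_idPr; exact: leqW.
have gE n x : g n x = margin n * (minn (J n) (Num.truncn (w x / margin n)))%:R.
  rewrite /g -mulr_sumr -cnt; congr (_ * _); apply: eq_bigr => j _.
  rewrite indicE Ac truncn_ge_nat ?divr_ge0 ?(ltW (margin_gt0 _))//.
  by rewrite ler_pdivlMr ?margin_gt0.
have gw n x : 0 <= w x - g n x <= w x.
  rewrite gE subr_ge0 gerBl mulr_ge0 ?(ltW (margin_gt0 _))// andbT mulrC.
  rewrite -ler_pdivlMr ?margin_gt0// (@le_trans _ _ (Num.truncn (w x / margin n))%:R)//.
    by rewrite ler_nat geq_minr.
  by rewrite truncn_le ?divr_ge0 ?(ltW (margin_gt0 _)).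
apply: (@test_closure_dct _ _ g w) => //.
- move=> n; apply: (@test_closure_sum (r + 1) 'I_(J n) (index_enum 'I_(J n))
    (fun j x => margin n * \1_(A n j `&` cube r) x)) => j.
  by apply: test_closureZ; apply: test_closure_indic.
- by move=> n x; have /andP[h1 h2] := gw n x; rewrite !ger0_norm.
- apply: aeW => x.
  apply/cvgrPdist_le => e e0.
  have [K wK] : exists K : nat, w x < K%:R.
    by exists (Num.truncn (w x)).+1; exact: truncnS_gt.
  near=> n.
  have ne : margin n < e by near: n; exact: margin_lt.
  have nK : (K <= n)%N by near: n; exists K.
  have /andP[h1 _] := gw n x; rewrite ger0_norm// (le_trans _ (ltW ne))//.
  have hm : w x / margin n < (Num.truncn (w x / margin n)).+1%:R by exact: truncnS_gt.
  rewrite gE (minn_idPr _).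
    move: hm; rewrite ltr_pdivrMr ?margin_gt0// -natr1 mulrDl mul1r mulrC => /ltW.
    by rewrite lerBlDl addrC.
  rewrite -ltnS -(ltr_nat R) (@le_lt_trans _ _ (w x / margin n))//.
    by rewrite truncn_le ?divr_ge0 ?(ltW (margin_gt0 _)).
  rewrite ltr_pdivrMr ?margin_gt0// (lt_le_trans wK)// /margin.
  rewrite (@le_trans _ _ n.+1%:R)// ?ler_nat ?leqW//.
  by rewrite ler_pdivlMr// -natrM ler_nat /J -mulnn leqW.
Unshelve. all: by end_near. Qed.

Lemma test_dense_supp r w : 0 <= r -> sqint mu w -> supp_in r w ->
  test_closure (r + 1) w.
Proof.
move=> r0 sw suppw.
have -> : w = (fun x => Num.max (w x) 0 + (-1) * Num.max (- w x) 0).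
  apply/funext => x; rewrite mulN1r; have [h|h] := leP 0 (w x).
    by rewrite [X in _ - X]max_r ?subr0// oppr_le0.
  by rewrite max_l ?opprK ?add0r// oppr_ge0 ltW.
have H v : sqint mu v -> supp_in r v -> test_closure (r + 1) (fun x => Num.max (v x) 0).
  move=> sv suppv; apply: test_closure_ge0 => //.
  - apply: sqint_le (sv); first by apply: measurable_maxr => //; case: sv.
    by move=> x; have [h|h] := leP 0 (v x); rewrite ?normr0.
  - by move=> x nx; rewrite suppv// maxxx.
  - by move=> x; rewrite le_max lexx orbT.
apply: test_closureD; first exact: H.
apply: test_closureZ; apply: H; first exact: sqintN.
by move=> x nx; rewrite suppw// oppr0.
Qed.

Lemma cut_cvg w : sqint mu w ->
  n2 mu (fun x => w x - \1_(cube k%:R) x * w x) @[k --> \oo] --> (0 : R).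
Proof.
move=> sw.
have mi k : measurable_fun [set: 'rV[R]_N] (\1_(cube k%:R) : 'rV[R]_N -> R).
  by apply: measurable_indic; exact: measurable_cbox.
have [|||||_] := @dct _ _ _ mu (fun k x =>
  (w x - \1_(cube k%:R) x * w x) ^+ 2) (fun=> 0) (fun x => w x ^+ 2).
- move=> k; apply: measurable_funX; apply: measurable_funB; first by case: sw.
  by apply: measurable_funM => //; case: sw.
- by [].
- apply: aeW => x.
  have [k0 _ ck0] : (\bigcup_k cube k%:R) x by rewrite bigcup_cube.
  apply: (@cvg_trans _ (cst (0 : R) @ \oo)); last exact: cvg_cst.
  apply: near_eq_cvg; exists k0 => // k /= k0k.
  rewrite indicE mem_set ?mul1r ?subrr ?expr0n//.
  by apply: cube_le ck0; rewrite ler_nat.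
- by case: sw.
- move=> k x; rewrite ger0_norm ?sqr_ge0// indicE; case: (_ \in _).
    by rewrite mul1r subrr expr0n sqr_ge0.
  by rewrite mul0r subr0.
- by rewrite int0.
Qed.

Lemma test_dense w e : sqint mu w -> 0 < e ->
  exists2 phi, test_function phi & n2 mu (fun x => w x - phi x) <= e.
Proof.
move=> sw e0; have e4 : 0 < e / 4 by rewrite divr_gt0.
have [k _ /(_ k (leqnn k)) /= hk] : \forall k \near \oo,
    n2 mu (fun x => w x - \1_(cube k%:R) x * w x) < e / 4.
  by apply: cvgr_lt (cut_cvg sw) _ _.
have sc : sqint mu (fun x => \1_(cube k%:R) x * w x).
  apply: (@sqintMb _ _ _ _ _ 1) => //.
    by apply: measurable_indic; exact: measurable_cbox.
  by move=> x; rewrite indicE; case: (_ \in _); rewrite ?normr1 ?normr0.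
have [|_ /(_ _ e4)[phi [tp sp hp]]] := @test_dense_supp k%:R _ (ler0n _ _) sc.
  by move=> x nx; rewrite indicE memNset// mul0r.
exists phi => //.
have -> : (fun x => w x - phi x) = (fun x => (w x - \1_(cube k%:R) x * w x) +
    (\1_(cube k%:R) x * w x - phi x)).
  by apply/funext => x; rewrite addrA subrK.
have := n2_parallelogram_le (sqintB sw sc) (sqintB sc (test_sqint tp)).
by lra.
Qed.

(** The converse of Cauchy-Schwarz on smooth functions: a test function close to [w] itself would
    violate the bound if K were smaller than the norm. It turns estimates obtained by moving an
    operation onto test functions into norm estimates. *)
Lemma nm_dual_le w (K : R) : sqint mu w -> 0 <= K ->
  (forall phi, test_function phi -> `|ip mu w phi| <= K * nm mu phi) -> nm mu w <= K.
Proof.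
move=> sw K0 H; rewrite leNgt; apply/negP => Ka.
set a := nm mu w in Ka *.
have a0 : 0 < a by exact: le_lt_trans Ka.
have Ka0 : 0 < K + a by rewrite ltr_wpDl.
(* Chosen so that K (a + dl) + a dl = K a + a (a - K) / 2, which is less than a^2. *)
pose dl := a * (a - K) / (2 * (K + a)).
have d0 : 0 < dl by rewrite divr_gt0 ?mulr_gt0 ?subr_gt0.
have [phi tp hp] := test_dense sw (exprn_gt0 2 d0).
have sp := test_sqint tp.
have hd : nm mu (fun x => w x - phi x) <= dl.
  by rewrite -(ler_sqr (nm_ge0 _ _) (ltW d0)) nm2.
have hphi : nm mu phi <= a + dl.
  have -> : phi = (fun x => w x - (w x - phi x)) by apply/funext => x; rewrite subKr.
  by apply: le_trans (nmB sw (sqintB sw sp)) _; rewrite lerD2l.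
have h2 : a ^+ 2 = ip mu w phi + ip mu w (fun x => w x - phi x).
  have -> : ip mu w (fun x => w x - phi x) = ip mu w w - ip mu w phi.
    by rewrite ipC (ipBl sw sp sw) [ip mu phi w]ipC.
  by rewrite nm2 -ip_n2; ring.
have h3 := le_trans (ler_norm _) (H _ tp).
have h4 := le_trans (ler_norm _) (cauchy_schwarz sw (sqintB sw sp)).
have h5 : dl * (K + a) = a * (a - K) / 2 by rewrite /dl; field; rewrite gt_eqF.
have h6 : K * nm mu phi <= K * (a + dl) by rewrite ler_wpM2l.
have h7 : a * nm mu (fun x => w x - phi x) <= a * dl by rewrite ler_wpM2l// ltW.
have h8 : 0 < a * (a - K) by rewrite mulr_gt0 ?subr_gt0.
move: h2 h3 h4; rewrite -/a; nra.
Qed.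

Lemma sqint_orth_ae0 w : sqint mu w ->
  (forall phi, test_function phi -> ip mu w phi = 0) -> {ae mu, forall x, w x = 0}.
Proof.
move=> sw H; apply: n2_ae0 => //.
have : nm mu w <= 0 by apply: nm_dual_le => // phi /H ->; rewrite normr0 mul0r.
by rewrite -nm2 => h; have := nm_ge0 mu w => h';
  rewrite (@le_anti _ _ (nm mu w) 0) ?expr0n// h h'.
Qed.

End Density.

Lemma is_derive_int {d : measure_display} {T : measurableType d} {R : realType}
    (mu : {measure set T -> \bar R}) (f df : R -> T -> R) (G : T -> R) (a dl : R) : 0 < dl ->
  (forall s : R, `|s - a| < dl -> intg mu (f s)) ->
  (forall (s : R) x, `|s - a| < dl -> is_derive s 1 (f ^~ x) (df s x)) -> intg mu G ->
  (forall (s : R) x, `|s - a| < dl -> `|df s x| <= G x) ->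
  is_derive a 1 (fun s => \int[mu]_x f s x) (\int[mu]_x df a x).
Proof.
move=> dl0 fi fd Gi dG.
have Ia : `]a - dl, a + dl[%classic a by rewrite /= in_itv/=; apply/andP; split; lra.
have I_ s : `]a - dl, a + dl[%classic s -> `|s - a| < dl.
  by rewrite /= in_itv/= => /andP[h1 h2]; rewrite ltr_norml; apply/andP; split; lra.
have d1 s x : `|s - a| < dl -> partial1of2 f s x = df s x.
  by move=> sa; rewrite partial1of2E; have [_ ->] := fd s x sa.
have a0 : `|a - a| < dl by rewrite subrr normr0.
have G0 x : 0 <= G x by apply: le_trans (dG a x a0).
have Gub s x : `]a - dl, a + dl[%classic s -> [set: T] x -> `|partial1of2 f s x| <= G x.
  by move=> /I_ h _; rewrite d1//; exact: dG.
have fi' s : `]a - dl, a + dl[%classic s -> mu.-integrable [set: T] (EFin \o f s).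
  by move=> /I_/fi.
have D s x : `]a - dl, a + dl[%classic s -> [set: T] x -> derivable (f ^~ x) s 1.
  by move=> /I_ h _; case: (fd s x h).
apply: DeriveDef.
  exact: (@derivable_under_integral _ _ _ mu f setT measurableT a _ _ Ia fi' D G G0 Gi Gub).
rewrite -derive1E.
rewrite (@differentiation_under_integral _ _ _ mu f setT measurableT a _ _ Ia fi' D G G0 Gi Gub).
by apply: eq_int => x; exact: d1.
Qed.

Section Riesz.
Context {R : realType} {N : nat}.
Implicit Types (u w phi psi g : 'rV[R]_N -> R) (i : 'I_N) (x : 'rV[R]_N).
Local Notation mu := (lebesgue_rV R N).

(* The representing function is the limit of a minimising sequence of
   [n2 phi / 2 - l phi] over test functions. *)
Lemma riesz_test (l : ('rV[R]_N -> R) -> R) (M : R) : 0 <= M ->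
  (forall phi psi, test_function phi -> test_function psi ->
    l (fun x => phi x + psi x) = l phi + l psi) ->
  (forall (c : R) phi, test_function phi -> l (fun x => c * phi x) = c * l phi) ->
  (forall phi, test_function phi -> `|l phi| <= M * nm mu phi) ->
  exists g, [/\ sqint mu g, nm mu g <= M &
    forall phi, test_function phi -> l phi = ip mu g phi].
Proof.
move=> M0 lD lZ lM.
pose J phi := 2^-1 * n2 mu phi - l phi.
have J_lb phi : test_function phi -> - (2^-1 * M ^+ 2) <= J phi.
  move=> tp; have := le_trans (ler_norm _) (lM _ tp).
  rewrite /J -nm2; have := sqr_ge0 (nm mu phi - M); nra.
pose S := [set y | exists2 phi, test_function phi & y = J phi].
have Sinf : has_inf S.
  split; first by exists (J (fun=> 0)), (fun=> 0) => //; exact: test0.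
  by exists (- (2^-1 * M ^+ 2)) => _ [phi tp ->]; exact: J_lb.
pose m := inf S.
have mJ phi : test_function phi -> m <= J phi.
  by move=> tp; apply: ge_inf; [case: Sinf|exists phi].
have ex (k : nat) : exists phi, test_function phi /\ J phi < m + margin k.
  have [_ [phi tp ->] h] := inf_adherent (@margin_gt0 R k) Sinf.
  by exists phi.
have [F FP] := choice ex.
have tF k : test_function (F k) by have [] := FP k.
have JF k : J (F k) < m + margin k by have [] := FP k.
(* Parallelogram identity: the midpoint of two almost minimisers is a test function, so its value is
   at least [m]. *)
have cau j k : n2 mu (fun x => F j x - F k x) <= 4 * margin j + 4 * margin k.
  have sj := test_sqint (tF j); have sk := test_sqint (tF k).
  have th : test_function (fun x => 2^-1 * (F j x + F k x)) by apply: testZ; exact: testD.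
  have := mJ _ th; have := JF j; have := JF k.
  rewrite /J lZ; last exact: testD.
  rewrite lD// n2Z; last exact: sqintD.
  rewrite (n2D sj sk) (n2B sj sk); lra.
have [e|g sg Fg] := L2_complete (fun k => test_sqint (tF k)).
  move=> e0; have [k0 _ hk0] := margin_lt (divr_gt0 e0 (ltr0n R 8)).
  exists k0 => j k kj kk; apply: le_trans (cau j k) _.
  have := hk0 j kj; have := hk0 k kk; rewrite /=; lra.
have lg phi : test_function phi -> l phi = ip mu g phi.
  move=> tp; have sp := test_sqint tp.
  set dl := ip mu g phi - l phi.
  suff : dl = 0 by move/eqP; rewrite subr_eq0 => /eqP.
  (* First variation at the limit [g] in the direction [phi]: a quadratic in [s] without constant
     term that is nonnegative for all real [s] has zero linear coefficient. *)
  have H (s : R) : 0 <= s * dl + 2^-1 * s ^+ 2 * n2 mu phi.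
    apply/ler_addgt0Pr => e e0.
    pose K := `|s| * nm mu phi + 1.
    have K0 : 0 < K by rewrite ltr_wpDl// mulr_ge0 ?nm_ge0.
    have eK : 0 < e / 2 / K by rewrite !divr_gt0.
    have [k1 hk1] := Fg _ (exprn_gt0 2 eK).
    have [k2 _ hk2] := margin_lt (divr_gt0 e0 (ltr0n R 2)).
    pose k := maxn k1 k2.
    have sk := test_sqint (tF k).
    have := hk2 k (leq_maxr _ _); have {hk1} := hk1 k (leq_maxl _ _).
    rewrite -nm2 ler_sqr ?nnegrE ?nm_ge0 ?(ltW eK)// => h1 /= h2.
    have h3 := mJ _ (testD (tF k) (testZ s tp)).
    have h4 := JF k.
    move: h3 h4; rewrite /J lD//; last exact: testZ.
    rewrite lZ// (n2D sk (sqintZ s sp)) n2Z// ipC ipZl// ipC => h3 h4.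
    have h5 : s * ip mu (F k) phi <= s * ip mu g phi + e / 2.
      rewrite -lerBlDl -mulrBr -ipBl//.
      apply: le_trans (ler_norm _) _; rewrite normrM.
      apply: (@le_trans _ _ (`|s| * (e / 2 / K * nm mu phi))).
        rewrite ler_wpM2l//; apply: le_trans (cauchy_schwarz (sqintB sk sg) sp) _.
        by rewrite ler_wpM2r ?nm_ge0.
      have -> : `|s| * (e / 2 / K * nm mu phi) = e / 2 / K * (K - 1) by rewrite /K; ring.
      rewrite mulrBr mulr1 divfK ?gt_eqF//; move: eK; lra.
    rewrite /dl; move: h2 h3 h4 h5; lra.
  have n0 := n2_ge0 mu phi.
  have n1 : 0 < n2 mu phi + 1 by rewrite ltr_wpDl.
  have := H (- dl / (n2 mu phi + 1)).
  have -> : - dl / (n2 mu phi + 1) * dl + 2^-1 * (- dl / (n2 mu phi + 1)) ^+ 2 * n2 mu phi =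
     - (dl ^+ 2 * ((n2 mu phi + 2) / (2 * (n2 mu phi + 1) ^+ 2))).
    by field; rewrite gt_eqF.
  rewrite oppr_ge0 pmulr_lle0; last first.
    by rewrite divr_gt0 ?mulr_gt0 ?exprn_gt0// ltr_wpDl.
  move=> h; have := sqr_ge0 dl => h'; apply/eqP; rewrite -sqrf_eq0.
  by apply/eqP/le_anti; rewrite h h'.
exists g; split => //.
by apply: nm_dual_le => // phi tp; rewrite -lg// lM.
Qed.

End Riesz.

(** * The space H^1 and the Dirichlet energy *)

Section H1basics.
Context {R : realType} {N : nat}.
Implicit Types (u w phi psi g : 'rV[R]_N -> R) (i : 'I_N) (x : 'rV[R]_N).
Local Notation mu := (lebesgue_rV R N).
Local Notation e_ i := (delta_mx ord0 i : 'rV[R]_N).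

Lemma L2E u : L2 u <-> sqint mu u.
Proof. by rewrite /L2/=; split=> /sqintP. Qed.

Lemma weak_partialE i u g : weak_partial i u g <->
  forall phi, test_function phi -> ip mu u (partial i phi) = - ip mu g phi.
Proof. by []. Qed.

Lemma H1_sqint u : H1 u -> sqint mu u.
Proof. by move=> [/L2E]. Qed.

Lemma wpartialP u i : H1 u -> sqint mu (wpartial i u) /\ weak_partial i u (wpartial i u).
Proof.
move=> [_ /(_ i)[g Lg wg]].
have [] := @getPex _ [set g | L2 g /\ weak_partial i u g] (ex_intro _ g (conj Lg wg)).
by move=> /L2E.
Qed.

Lemma wpartial_sqint u i : H1 u -> sqint mu (wpartial i u).
Proof. by move=> /(wpartialP i)[]. Qed.

Lemma H1_intro u (g : 'I_N -> 'rV[R]_N -> R) : sqint mu u ->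
  (forall i, sqint mu (g i)) -> (forall i, weak_partial i u (g i)) -> H1 u.
Proof.
move=> su sg wg; split; first exact/L2E.
by move=> i; exists (g i) => //; apply/L2E.
Qed.

Lemma weak_partial_unique u i g1 g2 : sqint mu g1 -> sqint mu g2 ->
  weak_partial i u g1 -> weak_partial i u g2 -> {ae mu, forall x, g1 x = g2 x}.
Proof.
move=> s1 s2 w1 w2.
have := @sqint_orth_ae0 R N (fun x => g1 x - g2 x) (sqintB s1 s2).
move=> H; apply: filterS (H _) => [x /eqP|phi tp]; first by rewrite subr_eq0 => /eqP.
rewrite (ipBl s1 s2 (test_sqint tp)); apply/eqP; rewrite subr_eq0; apply/eqP.
by apply: oppr_inj; rewrite -(w1 _ tp) -(w2 _ tp).
Qed.

Lemma wpartial_ae u i g : H1 u -> sqint mu g -> weak_partial i u g ->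
  {ae mu, forall x, wpartial i u x = g x}.
Proof.
move=> /(wpartialP i)[s1 w1] sg wg; exact: weak_partial_unique w1 wg.
Qed.

Definition Edir u : R := \int[mu]_x (enorm (wgrad u x) ^+ 2).

Lemma enorm_sqr (x : 'rV[R]_N) : enorm x ^+ 2 = \sum_i x ord0 i ^+ 2.
Proof.
rewrite /enorm sqr_sqrtr /dotv; last by apply: sumr_ge0 => i _; rewrite -expr2 sqr_ge0.
by apply: eq_bigr => i _; rewrite expr2.
Qed.

Lemma enorm_wgrad_sqr u x : enorm (wgrad u x) ^+ 2 = \sum_i wpartial i u x ^+ 2.
Proof. by rewrite enorm_sqr; apply: eq_bigr => i _; rewrite mxE. Qed.

Lemma intg_enorm_wgrad u : H1 u -> intg mu (fun x => enorm (wgrad u x) ^+ 2).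
Proof.
move=> Hu; under eq_fun do rewrite enorm_wgrad_sqr.
by apply: intg_sum => i; have [] := wpartial_sqint i Hu.
Qed.

Lemma EdirE u : H1 u -> Edir u = \sum_i n2 mu (wpartial i u).
Proof.
move=> Hu; rewrite /Edir; under eq_int do rewrite enorm_wgrad_sqr.
by rewrite int_sum// => i; have [] := wpartial_sqint i Hu.
Qed.

Lemma Edir_ge0 u : 0 <= Edir u.
Proof. by apply: int_ge0 => x; exact: sqr_ge0. Qed.

Lemma n2_wpartial_le u i : H1 u -> n2 mu (wpartial i u) <= Edir u.
Proof.
by move=> Hu; rewrite EdirE// (bigD1 i)//= lerDl sumr_ge0// => j _; exact: n2_ge0.
Qed.

(** Since [wpartial] is a choice up to null sets, this is the tool that replaces the chosen
    derivatives by explicit ones when sums, multiples and dilations are computed. *)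
Lemma EdirP u (g : 'I_N -> 'rV[R]_N -> R) : H1 u -> (forall i, sqint mu (g i)) ->
  (forall i, weak_partial i u (g i)) -> Edir u = \sum_i n2 mu (g i).
Proof.
move=> Hu sg wg; rewrite EdirE//; apply: eq_bigr => i _; apply: ae_eq_n2.
- by have [] := wpartial_sqint i Hu.
- by have [] := sg i.
- exact: wpartial_ae.
Qed.

Lemma weak_partialD u w i g1 g2 : sqint mu u -> sqint mu w -> sqint mu g1 -> sqint mu g2 ->
  weak_partial i u g1 -> weak_partial i w g2 ->
  weak_partial i (fun x => u x + w x) (fun x => g1 x + g2 x).
Proof.
move=> su sw s1 s2 w1 w2 phi tp.
have sp := test_sqint tp; have spp := test_sqint (test_partial i tp).
have := ipDl su sw spp; rewrite /ip => ->; have := ipDl s1 s2 sp; rewrite /ip => ->.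
by rewrite w1// w2// opprD.
Qed.

Lemma weak_partialZ c u i g : sqint mu u -> sqint mu g ->
  weak_partial i u g -> weak_partial i (fun x => c * u x) (fun x => c * g x).
Proof.
move=> su sg wg phi tp.
have sp := test_sqint tp; have spp := test_sqint (test_partial i tp).
have := ipZl c su spp; rewrite /ip => ->; have := ipZl c sg sp; rewrite /ip => ->.
by rewrite wg// mulrN.
Qed.

Lemma H1D u w : H1 u -> H1 w -> H1 (fun x => u x + w x).
Proof.
move=> Hu Hw; apply: (@H1_intro _ (fun i x => wpartial i u x + wpartial i w x)).
- by apply: sqintD; exact: H1_sqint.
- by move=> i; apply: sqintD; exact: wpartial_sqint.
- move=> i; apply: weak_partialD; try exact: H1_sqint; try exact: wpartial_sqint.
  + by have [] := wpartialP i Hu.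
  + by have [] := wpartialP i Hw.
Qed.

Lemma H1Z c u : H1 u -> H1 (fun x => c * u x).
Proof.
move=> Hu; apply: (@H1_intro _ (fun i x => c * wpartial i u x)).
- by apply: sqintZ; exact: H1_sqint.
- by move=> i; apply: sqintZ; exact: wpartial_sqint.
- move=> i; apply: weak_partialZ; [exact: H1_sqint|exact: wpartial_sqint|].
  by have [] := wpartialP i Hu.
Qed.

Lemma H1B u w : H1 u -> H1 w -> H1 (fun x => u x - w x).
Proof.
move=> Hu Hw; have := H1D Hu (H1Z (-1) Hw).
by under eq_fun do rewrite mulN1r.
Qed.

(** The Dirichlet bilinear form, whose quadratic form is [Edir]. *)
Definition Dip u w : R := \sum_i ip mu (wpartial i u) (wpartial i w).

Lemma EdirD u w : H1 u -> H1 w ->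
  Edir (fun x => u x + w x) = Edir u + 2 * Dip u w + Edir w.
Proof.
move=> Hu Hw; rewrite (@EdirP _ (fun i x => wpartial i u x + wpartial i w x)).
- rewrite !EdirE// /Dip mulr_sumr -!big_split/=; apply: eq_bigr => i _.
  by rewrite n2D//; exact: wpartial_sqint.
- exact: H1D.
- by move=> i; apply: sqintD; exact: wpartial_sqint.
- move=> i; apply: weak_partialD; try exact: H1_sqint; try exact: wpartial_sqint.
  + by have [] := wpartialP i Hu.
  + by have [] := wpartialP i Hw.
Qed.

Lemma EdirZ c u : H1 u -> Edir (fun x => c * u x) = c ^+ 2 * Edir u.
Proof.
move=> Hu; rewrite (@EdirP _ (fun i x => c * wpartial i u x)).
- rewrite EdirE// mulr_sumr; apply: eq_bigr => i _.
  by rewrite n2Z//; exact: wpartial_sqint.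
- exact: H1Z.
- by move=> i; apply: sqintZ; exact: wpartial_sqint.
- move=> i; apply: weak_partialZ; [exact: H1_sqint|exact: wpartial_sqint|].
  by have [] := wpartialP i Hu.
Qed.

Lemma DipZr c u w : H1 u -> H1 w -> Dip u (fun x => c * w x) = c * Dip u w.
Proof.
move=> Hu Hw; rewrite /Dip mulr_sumr; apply: eq_bigr => i _.
rewrite ipC [ip mu (wpartial i u) (wpartial i w)]ipC.
rewrite -ipZl; [|exact: wpartial_sqint|exact: wpartial_sqint].
apply: ae_eq_ip.
- by have [] := wpartial_sqint i (H1Z c Hw).
- by have [] := sqintZ c (wpartial_sqint i Hw).
- by have [] := wpartial_sqint i Hu.
apply: wpartial_ae; [exact: H1Z|by apply: sqintZ; exact: wpartial_sqint|].
apply: weak_partialZ; [exact: H1_sqint|exact: wpartial_sqint|].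
by have [] := wpartialP i Hw.
Qed.

(** The substitution is moved onto the test function; the Jacobian t^-N appears on both sides, and
    the chain rule for the test function leaves one factor [t]. *)
Lemma weak_partial_affine (t : R) (a : 'rV[R]_N) u i g : 0 < t -> sqint mu u -> sqint mu g ->
  weak_partial i u g ->
  weak_partial i (fun x => u (t *: x + a)) (fun x => t * g (t *: x + a)).
Proof.
move=> t0 su sg wg phi tp.
have tn0 : t != 0 by rewrite gt_eqF.
have tV : t^-1 != 0 by rewrite invr_eq0.
pose psi x := phi (t^-1 *: x + (- t^-1 *: a)).
have tq : test_function psi by exact: test_affine.
have phiE x : phi x = psi (t *: x + a).
  rewrite /psi scalerDr scalerA mulVf// scale1r scaleNr addrK//.
have pE x : partial i phi x = t * partial i psi (t *: x + a).
  have dq : derivable psi (t *: x + a) (e_ i) by case: tq => /(_ 1%N)/class_C_derivable.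
  have [_ <-] := partial_affine dq.
  by congr (partial i _ x); apply/funext => y; exact: phiE.
have i1 := sqintM su (test_sqint (test_partial i tq)).
have i2 := sqintM sg (test_sqint tq).
transitivity (\int[mu]_x (t * (u (t *: x + a) * partial i psi (t *: x + a)))).
  by apply: eq_int => x; rewrite pE mulrCA.
rewrite intZ; last exact: (intg_affine a t0 i1).
rewrite (int_affine a t0 i1).
have := wg _ tq; rewrite /= => ->.
transitivity (- \int[mu]_x (t * (g (t *: x + a) * psi (t *: x + a)))); last first.
  by congr (- _); apply: eq_int => x; rewrite phiE mulrA.
rewrite intZ; last exact: (intg_affine a t0 i2).
by rewrite (int_affine a t0 i2); ring.
Qed.

Lemma sqint_affine (t : R) (a : 'rV[R]_N) u : 0 < t -> sqint mu u ->
  sqint mu (fun x => u (t *: x + a)).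
Proof.
by move=> t0 [mu_ iu]; split; [exact: measurable_affine_comp|exact: (intg_affine a t0 iu)].
Qed.

Lemma H1_affine (t : R) (a : 'rV[R]_N) u : 0 < t -> H1 u -> H1 (fun x => u (t *: x + a)).
Proof.
move=> t0 Hu; apply: (@H1_intro _ (fun i x => t * wpartial i u (t *: x + a))).
- by apply: sqint_affine => //; exact: H1_sqint.
- by move=> i; apply: sqintZ; apply: sqint_affine => //; exact: wpartial_sqint.
- move=> i; apply: weak_partial_affine => //; [exact: H1_sqint|exact: wpartial_sqint|].
  by have [] := wpartialP i Hu.
Qed.

Lemma n2_affine (t : R) (a : 'rV[R]_N) u : 0 < t -> sqint mu u ->
  n2 mu (fun x => u (t *: x + a)) = t^-1 ^+ N * n2 mu u.
Proof. by move=> t0 [_ iu]; rewrite /n2 (int_affine a t0 iu). Qed.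

Lemma Edir_affine (t : R) (a : 'rV[R]_N) u : 0 < t -> H1 u ->
  Edir (fun x => u (t *: x + a)) = t ^+ 2 * (t^-1 ^+ N * Edir u).
Proof.
move=> t0 Hu; rewrite (@EdirP _ (fun i x => t * wpartial i u (t *: x + a))).
- rewrite EdirE// !mulr_sumr; apply: eq_bigr => i _; rewrite n2Z.
    by rewrite (n2_affine a t0 (wpartial_sqint i Hu)).
  by apply: sqint_affine => //; exact: wpartial_sqint.
- exact: H1_affine.
- by move=> i; apply: sqintZ; apply: sqint_affine => //; exact: wpartial_sqint.
- move=> i; apply: weak_partial_affine => //; [exact: H1_sqint|exact: wpartial_sqint|].
  by have [] := wpartialP i Hu.
Qed.

Lemma H1_translate (a : 'rV[R]_N) u : H1 u -> H1 (fun x => u (x + a)).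
Proof. by move=> /(H1_affine a ltr01); under eq_fun do rewrite scale1r. Qed.

Lemma Edir_translate (a : 'rV[R]_N) u : H1 u -> Edir (fun x => u (x + a)) = Edir u.
Proof.
move=> Hu; have := Edir_affine a ltr01 Hu.
by rewrite invr1 !expr1n !mul1r; under eq_fun do rewrite scale1r.
Qed.

Lemma H1_test phi : test_function phi -> H1 phi.
Proof.
move=> tp; apply: (@H1_intro _ (fun i => partial i phi)); first exact: test_sqint.
- by move=> i; apply: test_sqint; exact: test_partial.
- move=> i psi tq; apply: integration_by_parts_test => //.
  by case: tp => /(_ 1%N).
Qed.

Lemma H1_ae u w : H1 u -> measurable_fun [set: 'rV[R]_N] w ->
  {ae mu, forall x, u x = w x} -> H1 w /\ Edir w = Edir u.
Proof.
move=> Hu mw uw.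
have sw : sqint mu w := ae_eq_sqint mw uw (H1_sqint Hu).
have ww i : weak_partial i w (wpartial i u).
  move=> phi tp; have [s1 w1] := wpartialP i Hu; rewrite -(w1 _ tp).
  have := @ae_eq_ip _ _ _ mu w u (partial i phi); rewrite /ip; apply => //.
  - by have [] := H1_sqint Hu.
  - by have [] := test_sqint (test_partial i tp).
  - by apply: filterS uw.
have Hw : H1 w by apply: (@H1_intro _ (fun i => wpartial i u)) => // i; exact: wpartial_sqint.
split; first exact: Hw.
by rewrite (EdirP Hw (fun i => wpartial_sqint i Hu) ww) (EdirE Hu).
Qed.

End H1basics.

(** * Differential calculus for functions of class C^1 *)

Section Calculus.
Context {R : realType} {N : nat}.
Implicit Types (u w phi psi g : 'rV[R]_N -> R) (i : 'I_N) (x v : 'rV[R]_N).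
Local Notation e_ i := (delta_mx ord0 i : 'rV[R]_N).

Lemma line_MVT_abs u i x (h : R) : class_C 1 u ->
  exists2 s : R, `|s| <= `|h| & u (h *: e_ i + x) - u x = partial i u (s *: e_ i + x) * h.
Proof.
move=> Cu; have [h0|h0|->] := ltgtP h 0; last first.
- by exists 0 => //; rewrite scale0r add0r subrr mulr0.
- have [s /andP[s0 sh] E] := line_MVT i x Cu h0.
  by exists s => //; rewrite !ger0_norm// ltW.
have nh : 0 < - h by rewrite oppr_gt0.
have [s /andP[s0 sh] E] := line_MVT i (h *: e_ i + x) Cu nh.
exists (s + h); first by rewrite !ler0_norm; lra.
have e1 : - h *: e_ i + (h *: e_ i + x) = x by rewrite addrA -scalerDl addNr scale0r add0r.
move: E; rewrite e1 addrA -scalerDl => E.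
by rewrite -[LHS]opprB E mulrN opprK.
Qed.

(** Continuous partial derivatives give a total differential: the increment is made one coordinate
    at a time, with the mean value theorem on each segment. *)
Lemma C1_expand u x (e : R) : class_C 1 u -> 0 < e ->
  exists2 dl : R, 0 < dl & forall v, (forall i, `|v ord0 i| < dl) ->
    `|u (v + x) - u x - \sum_i partial i u x * v ord0 i| <= e * \sum_i `|v ord0 i|.
Proof.
move=> Cu e0.
have [dl dl0 Hdl] : exists2 dl : R, 0 < dl & forall y : 'rV[R]_N, (forall i,
  `|y ord0 i - x ord0 i| < dl) ->
    forall i, `|partial i u y - partial i u x| <= e.
  have : \forall y \near x, forall i, `|partial i u y - partial i u x| <= e.
    have FF : Filter (nbhs x) by exact: nbhs_filter.
    apply: (filter_forall FF) => i.
    have /cvgrPdist_le /(_ _ e0) : partial i u y @[y --> x] --> partial i u x.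
      have cp : continuous (partial i u) by exact: class_C_partial Cu.
      exact: cp.
    by apply: filterS => y; rewrite distrC.
  move=> /nbhs_ballP[dl /= dl0 H]; exists dl => // y hy; apply: H; split => // j i.
  by rewrite ord1 /ball/= distrC.
exists dl => // v hv.
(* Induction on the list of coordinates already moved. By [uniq] the new coordinate is still at its
   original value, so each intermediate point stays within [dl] of [x] in every coordinate. *)
have H (s : seq 'I_N) : uniq s ->
    `|u (\sum_(i <- s) v ord0 i *: e_ i + x) - u x - \sum_(i <- s) partial i u x * v ord0 i|
    <= e * \sum_(i <- s) `|v ord0 i|.
  elim: s => [|i s IH].
    by rewrite !big_nil add0r subrr subr0 normr0 mulr0.
  rewrite !big_cons /= => /andP[nis us].
  set w := \sum_(j <- s) v ord0 j *: e_ j.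
  have [sg sgh E] := line_MVT_abs i (w + x) (v ord0 i) Cu.
  have h1 : `|partial i u (sg *: e_ i + (w + x)) - partial i u x| <= e.
    apply: Hdl => j; rewrite !mxE addrA addrK.
    have wj : w ord0 j = if j \in s then v ord0 j else 0.
      rewrite /w summxE; case: ifPn => js.
        rewrite (bigD1_seq j)//= !mxE !eqxx mulr1 big1_seq ?addr0// => k /andP[kj _].
        by rewrite !mxE eqxx/= eq_sym (negbTE kj) mulr0.
      rewrite big1_seq// => k /andP[_ ks]; rewrite !mxE eqxx/=.
      by case: eqP => [jk|]; rewrite ?mulr0//; move: js; rewrite jk ks.
    rewrite eqxx/=; have [ji|ji] := eqVneq j i.
      by rewrite wj ji (negbTE nis) addr0 mulr1 (le_lt_trans sgh).
    by rewrite mulr0 add0r wj; case: ifP => _; rewrite ?normr0.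
  have -> : u (v ord0 i *: e_ i + w + x) - u x -
      (partial i u x * v ord0 i + \sum_(j <- s) partial j u x * v ord0 j) =
      (partial i u (sg *: e_ i + (w + x)) - partial i u x) * v ord0 i +
      (u (w + x) - u x - \sum_(j <- s) partial j u x * v ord0 j).
    rewrite -[_ + w + x]addrA mulrBl -E; ring.
  apply: le_trans (ler_normD _ _) _; rewrite mulrDr lerD ?IH// normrM.
  by rewrite ler_wpM2r.
have := H (index_enum 'I_N) (index_enum_uniq _).
by rewrite -row_sum_delta.
Qed.

Lemma C1_chain u x (t : R) : class_C 1 u ->
  is_derive t 1 (fun t : R => u (t *: x)) (\sum_i x ord0 i * partial i u (t *: x)).
Proof.
move=> Cu.
set L := \sum_i _.
have cv : h^-1 *: (u ((h *: 1 + t) *: x) - u (t *: x)) @[h --> (0 : R)^'] --> L.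
  apply/cvgrPdist_le => e e0.
  pose S := \sum_i `|x ord0 i|.
  have S0 : 0 <= S by exact: sumr_ge0.
  have S1 : 0 < S + 1 by rewrite ltr_wpDl.
  have [dl dl0 H] := @C1_expand u (t *: x) _ Cu (divr_gt0 e0 S1).
  have dS : 0 < dl / (S + 1) by rewrite divr_gt0.
  near=> h.
  have h0 : h != 0 by near: h; exact: nbhs_dnbhs_neq.
  have hd : `|h| < dl / (S + 1) by near: h; exact: dnbhs0_lt.
  have hv i : `|(h *: x) ord0 i| < dl.
    rewrite mxE normrM; apply: (@le_lt_trans _ _ (`|h| * S)).
      by rewrite ler_wpM2l// /S (bigD1 i)//= lerDl sumr_ge0.
    by move: hd; rewrite ltr_pdivlMr// mulrDr mulr1; have := normr_ge0 h; lra.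
  have := H _ hv; rewrite scalerDl [h *: 1]mulr1.
  have -> : \sum_i partial i u (t *: x) * (h *: x) ord0 i = h * L.
    by rewrite /L mulr_sumr; apply: eq_bigr => i _; rewrite mxE; ring.
  have -> : \sum_i `|(h *: x) ord0 i| = `|h| * S.
    by rewrite /S mulr_sumr; apply: eq_bigr => i _; rewrite mxE normrM.
  move=> {}H; rewrite distrC.
  have -> : h^-1 *: (u (h *: x + t *: x) - u (t *: x)) - L =
     h^-1 * (u (h *: x + t *: x) - u (t *: x) - h * L).
    by rewrite mulrBr mulKf.
  rewrite normrM normfV ler_pdivrMl ?normr_gt0//.
  apply: le_trans H _; rewrite mulrCA ler_wpM2l//.
  rewrite mulrAC ler_pdivrMr// ler_wpM2l// ?ltW//; lra.
apply: DeriveDef; first by apply/cvg_ex; exists L.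
exact/cvg_lim.
Unshelve. all: by end_near. Qed.

End Calculus.

(** * Translation estimates in H^1 *)

Section Translation.
Context {R : realType} {N : nat}.
Implicit Types (u w phi psi g : 'rV[R]_N -> R) (i : 'I_N) (x v z : 'rV[R]_N).
Local Notation mu := (lebesgue_rV R N).
Local Notation e_ i := (delta_mx ord0 i : 'rV[R]_N).
Local Notation cube := (@cube R N).

Lemma intg_sqint_cube u r (C : R) : sqint mu u -> intg mu (fun x => `|u x| * (C * \1_(cube r) x)).
Proof.
move=> su; apply: sqintM; first exact: sqint_norm.
apply: sqintZ; have := @sqint_indic_cube R N setT r measurableT.
by rewrite setTI.
Qed.

Lemma is_derive_shift u phi i (h : R) : sqint mu u -> test_function phi ->
  is_derive h 1 (fun h => \int[mu]_x (u x * phi (h *: e_ i + x)))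
    (\int[mu]_x (u x * partial i phi (h *: e_ i + x))).
Proof.
move=> su tp; have tpp := test_partial i tp.
have /test_functionP[Cpp [r r0 sr]] := tpp.
have [C C0 HC] := continuous_supp_bounded (test_cont tpp) sr.
apply: (@is_derive_int _ _ _ mu (fun h x => u x * phi (h *: e_ i + x))
   (fun h x => u x * partial i phi (h *: e_ i + x))
   (fun x => `|u x| * (C * \1_(cube (r + (`|h| + 1))) x)) h 1) => //.
- move=> s _; apply: sqintM => //; apply: test_sqint.
  by under eq_fun do rewrite addrC; exact: test_translate.
- move=> s x _.
  have := @is_derive_line _ _ (e_ i) x phi s; case: tp => /(_ 1%N) Cp _.
  move=> /(_ (class_C_derivable Cp)) H.
  exact: (@is_deriveZ _ _ _ _ (u x) s 1 _ H).
- exact: intg_sqint_cube.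
- move=> s x sh; rewrite normrM ler_wpM2l// indicE.
  have [cx|ncx] := boolP (x \in _); first by rewrite mulr1.
  rewrite mulr0; have := @supp_in_translate _ _ r (s *: e_ i) (partial i phi) (`|h| + 1) _ sr x.
  move=> ->; rewrite ?normr0//.
    move=> j; rewrite !mxE eqxx/=; case: eqP => _; rewrite ?mulr1 ?mulr0 ?normr0 ?addr_ge0//.
    have -> : s = (s - h) + h by rewrite subrK.
    by rewrite (le_trans (ler_normD _ _))// addrC lerD2l ltW.
  by move: ncx; rewrite notin_setE.
Qed.

(** The shift is carried by the test function, where it can be differentiated; the weak derivative
    then brings in [g], and the mean value theorem is applied to a real function of the shift. *)
Lemma translate_dual u i g phi (h : R) : 0 < h -> sqint mu u -> sqint mu g ->
  weak_partial i u g -> test_function phi ->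
  `|ip mu (fun x => u (x + h *: e_ i) - u x) phi| <= h * nm mu g * nm mu phi.
Proof.
move=> h0 su sg wg tp; have sp := test_sqint tp.
have tps s : test_function (fun x => phi (s *: e_ i + x)).
  by under eq_fun do rewrite addrC; exact: test_translate.
pose D s := \int[mu]_x (u x * phi (s *: e_ i + x)).
have E : ip mu (fun x => u (x + h *: e_ i) - u x) phi = D (- h) - D 0.
  rewrite ipBl//; last exact: sqint_translate.
  congr (_ - _); last by apply: eq_int => x; rewrite scale0r add0r.
  have := @int_translate R N (h *: e_ i) _ (sqintM su (test_sqint (tps (- h)))).
  rewrite /D => <-; apply: eq_int => x.
  by rewrite scaleNr addrCA addNr addr0.
have dD (s : R) : is_derive s 1 D (- ip mu g (fun x => phi (s *: e_ i + x))).
  have := is_derive_shift i s su tp.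
  have -> : \int[mu]_x (u x * partial i phi (s *: e_ i + x)) =
     - ip mu g (fun x => phi (s *: e_ i + x)).
    rewrite -(wg _ (tps s)); apply: eq_int => x; congr (_ * _).
    have dp : derivable phi (1 *: x + s *: e_ i) (e_ i).
      by case: tp => /(_ 1%N)/class_C_derivable.
    have [_] := partial_affine dp; rewrite mul1r scale1r addrC => <-.
    by congr (partial i _ x); apply/funext => y; rewrite scale1r addrC.
  by [].
have cD : {within `[- h, 0], continuous D}.
  apply: continuous_subspaceT => s; have [ds _] := dD s.
  by apply: differentiable_continuous; apply/derivable1_diffP.
have [|c _ Ec] := @MVT _ D _ (- h) 0 _ (fun s _ => dD s) cD; first by rewrite oppr_lt0.
have {}Ec : D (- h) - D 0 = ip mu g (fun x => phi (c *: e_ i + x)) * h.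
  by rewrite -[LHS]opprB Ec sub0r opprK mulNr opprK.
rewrite E Ec normrM [`|h|]ger0_norm ?(ltW h0)// mulrC -mulrA ler_pM2l//.
apply: le_trans (cauchy_schwarz sg (test_sqint (tps c))) _.
have -> : nm mu (fun x => phi (c *: e_ i + x)) = nm mu phi; last by [].
by rewrite -(nm_translate (c *: e_ i) sp); congr nm; apply/funext => x; rewrite addrC.
Qed.

Lemma translate_nm u i g (h : R) : sqint mu u -> sqint mu g -> weak_partial i u g ->
  nm mu (fun x => u (x + h *: e_ i) - u x) <= `|h| * nm mu g.
Proof.
move=> su sg wg.
have H (k : R) : 0 < k -> nm mu (fun x => u (x + k *: e_ i) - u x) <= k * nm mu g.
  move=> k0; apply: nm_dual_le.
  - by apply: sqintB => //; exact: sqint_translate.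
  - by rewrite mulr_ge0 ?nm_ge0// ltW.
  - by move=> phi tp; exact: translate_dual.
have [h0|h0|->] := ltgtP h 0.
- have nh : 0 < - h by rewrite oppr_gt0.
  have := H _ nh; rewrite ltr0_norm//; apply: le_trans.
  have sd : sqint mu (fun x => u (x + - h *: e_ i) - u x).
    by apply: sqintB => //; exact: sqint_translate.
  rewrite -(nm_translate (h *: e_ i) sd) [leRHS]nmBC le_eqVlt; apply/orP; left.
  by apply/eqP; congr nm; apply/funext => x; rewrite scaleNr addrK.
- by rewrite gtr0_norm//; exact: H.
- rewrite normr0 mul0r /nm /n2.
  by under eq_int do rewrite scale0r addr0 subrr expr0n; rewrite int0 sqrtr0.
Qed.

(** The displacement is decomposed into steps along the axes, and translation invariance removes the
    base point of each step. *)
Lemma translate_est u z : H1 u ->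
  nm mu (fun x => u (x + z) - u x) <= (\sum_i `|z ord0 i|) * Num.sqrt (Edir u).
Proof.
move=> Hu; have su := H1_sqint Hu.
have H (s : seq 'I_N) : nm mu (fun x => u (x + \sum_(i <- s) z ord0 i *: e_ i) - u x)
    <= (\sum_(i <- s) `|z ord0 i|) * Num.sqrt (Edir u).
  elim: s => [|i s IH].
    rewrite !big_nil mul0r /nm /n2.
    by under eq_int do rewrite addr0 subrr expr0n; rewrite int0 sqrtr0.
  rewrite !big_cons mulrDl; set w := \sum_(j <- s) _.
  have -> : (fun x => u (x + (z ord0 i *: e_ i + w)) - u x) =
    (fun x => (u (x + w + z ord0 i *: e_ i) - u (x + w)) + (u (x + w) - u x)).
    apply/funext => x; rewrite [_ *: _ + w]addrC [x + (_ + _)]addrA; ring.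
  have s1 : sqint mu (fun x => u (x + z ord0 i *: e_ i) - u x).
    by apply: sqintB => //; exact: sqint_translate.
  have s2 : sqint mu (fun x => u (x + w) - u x).
    by apply: sqintB => //; exact: sqint_translate.
  apply: le_trans (nmD (sqint_translate w s1) s2) _; rewrite lerD//.
  rewrite (nm_translate w s1).
  have [sg wg] := wpartialP i Hu.
  apply: le_trans (translate_nm (z ord0 i) su sg wg) _.
  by rewrite ler_wpM2l// ler_sqrt ?Edir_ge0// n2_wpartial_le.
by have := H (index_enum 'I_N); rewrite -row_sum_delta.
Qed.

End Translation.

(** * Hardy's inequality *)

Section Hardy.
Context {R : realType} {N : nat}.
Implicit Types (u w phi psi g : 'rV[R]_N -> R) (i : 'I_N) (x v z : 'rV[R]_N) (eps r : R).
Local Notation mu := (lebesgue_rV R N).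
Local Notation e_ i := (delta_mx ord0 i : 'rV[R]_N).
Local Notation cube := (@cube R N).

Lemma cauchy_schwarz_sum (a b : 'I_N -> R) :
  \sum_i a i * b i <= Num.sqrt (\sum_i a i ^+ 2) * Num.sqrt (\sum_i b i ^+ 2).
Proof.
set A := \sum_i a i ^+ 2; set B := \sum_i b i ^+ 2; set P := \sum_i a i * b i.
have A0 : 0 <= A by apply: sumr_ge0 => i _; exact: sqr_ge0.
have B0 : 0 <= B by apply: sumr_ge0 => i _; exact: sqr_ge0.
have H (t : R) : 0 <= A * t ^+ 2 + 2 * t * P + B.
  have : 0 <= \sum_i (t * a i + b i) ^+ 2 by apply: sumr_ge0 => i _; exact: sqr_ge0.
  congr (_ <= _); rewrite /A /B /P mulr_suml mulr_sumr -!big_split/=.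
  by apply: eq_bigr => i _; ring.
have P2 : P ^+ 2 <= A * B.
  have [a0|a0] := eqVneq A 0; last first.
    have fp : 0 < A by rewrite lt0r a0 A0.
    have := H (- P / A).
    rewrite (_ : _ + _ + _ = B - P ^+ 2 / A); last by field.
    by rewrite subr_ge0 ler_pdivrMr// mulrC.
  rewrite a0 mul0r; have [->|ne] := eqVneq P 0; first by rewrite expr0n.
  have := H (- (B + 1) / (2 * P)).
  rewrite a0 mul0r add0r (_ : _ + _ = -1); last by field.
  by rewrite oppr_ge0 ler10.
rewrite -sqrtrM// (le_trans (ler_norm _))// -sqrtr_sqr ler_sqrt//.
exact: mulr_ge0.
Qed.

Lemma sum_ip_le (a b : 'I_N -> 'rV[R]_N -> R) : (forall i, sqint mu (a i)) ->
  (forall i, sqint mu (b i)) ->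
  `|\sum_i ip mu (a i) (b i)| <=
  Num.sqrt (\sum_i n2 mu (a i)) * Num.sqrt (\sum_i n2 mu (b i)).
Proof.
move=> sa sb; apply: le_trans (ler_norm_sum _ _ _) _.
apply: (@le_trans _ _ (\sum_i nm mu (a i) * nm mu (b i))).
  by apply: ler_sum => i _; exact: cauchy_schwarz.
have := cauchy_schwarz_sum (fun i => nm mu (a i)) (fun i => nm mu (b i)).
by rewrite (eq_bigr _ (fun i _ => nm2 mu (a i))) (eq_bigr _ (fun i _ => nm2 mu (b i))).
Qed.

Lemma is_derive_dilate u phi (s : R) : 0 < s -> sqint mu u -> test_function phi ->
  is_derive s 1 (fun s => \int[mu]_x (u x * phi (s *: x)))
    (\int[mu]_x (u x * \sum_i x ord0 i * partial i phi (s *: x))).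
Proof.
move=> s0 su tp; have /test_functionP[Cp [r r0 sr]] := tp.
have HC i : exists C : R, 0 <= C /\ forall x, `|partial i phi x| <= C.
  have cpp := test_cont (test_partial i tp).
  by have [C C0 H] := continuous_supp_bounded cpp (supp_in_partial i sr); exists C.
have [C CP] := choice HC.
have s2 : 0 < s / 2 by rewrite divr_gt0.
pose rr := r / (s / 2).
have rr0 : 0 <= rr by rewrite divr_ge0// ltW.
have near_s (t : R) : `|t - s| < s / 2 -> s / 2 < t.
  by rewrite ltr_norml => /andP[h1 h2]; lra.
apply: (@is_derive_int _ _ _ mu (fun t x => u x * phi (t *: x))
   (fun t x => u x * \sum_i x ord0 i * partial i phi (t *: x))
   (fun x => `|u x| * ((\sum_i rr * C i) * \1_(cube rr) x)) s (s / 2)) => //.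
- move=> t /near_s t0; apply: sqintM => //; apply: test_sqint; apply: test_scale => //.
  by rewrite gt_eqF// (lt_trans s2).
- move=> t x _; exact: (@is_deriveZ _ _ _ _ (u x) t 1 _ (C1_chain x t (Cp 1%N))).
- exact: intg_sqint_cube.
- move=> t x /near_s t0; rewrite normrM ler_wpM2l// indicE.
  have [/set_mem/cubeE cx|ncx] := boolP (x \in cube rr).
    rewrite mulr1; apply: le_trans (ler_norm_sum _ _ _) _; apply: ler_sum => i _.
    by rewrite normrM ler_pM//; have [] := CP i.
  rewrite mulr0 big1 ?normr0// => i _; rewrite (supp_in_partial i sr) ?mulr0//.
  move: ncx; rewrite notin_setE; apply: contra_not => /cubeE h; apply/cubeE => j.
  have := h j; rewrite mxE normrM (ger0_norm (ltW (lt_trans s2 t0))) => hj.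
  rewrite ler_pdivlMr//; apply: le_trans hj; rewrite mulrC ler_wpM2r// ltW//.
Qed.

Lemma sum_n2_coor phi : test_function phi ->
  \sum_i n2 mu (fun x => x ord0 i * phi x) = n2 mu (fun x => enorm x * phi x).
Proof.
move=> tp; rewrite /n2 -int_sum; last by move=> i; have [] := test_sqint (test_coorM i tp).
by apply: eq_int => x; rewrite exprMn enorm_sqr mulr_suml; apply: eq_bigr => i _; rewrite exprMn.
Qed.

(** The analogue of [translate_dual] for dilations. With D(t) = t^N times the pairing of [u] with
    phi(t x), one has D'(t) = - t^(N-1) X(t): summing the weak derivatives of [u] against x_i phi(t
    x) over [i] produces both the factor N and the radial derivative of [phi]. *)
Lemma dilate_dual u phi (s : R) : (0 < N)%N -> 0 < s < 1 -> H1 u -> test_function phi ->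
  `|ip mu (fun x => u (s^-1 *: x) - u x) phi| <=
  (1 - s) * s ^- 2 * Num.sqrt (Edir u) * nm mu (fun x => enorm x * phi x).
Proof.
move=> N0 /andP[s0 s1] Hu tp; have su := H1_sqint Hu; have sp := test_sqint tp.
have sV0 : 0 < s^-1 by rewrite invr_gt0.
pose M t := \int[mu]_x (u x * phi (t *: x)).
pose D t := t ^+ N * M t.
have tps t : 0 < t -> test_function (fun x => phi (t *: x)).
  by move=> t0; apply: test_scale => //; rewrite gt_eqF.
have E : ip mu (fun x => u (s^-1 *: x) - u x) phi = D s - D 1.
  rewrite ipBl//; last exact: sqint_scale.
  congr (_ - _); last first.
    by rewrite /D /M expr1n mul1r; apply: eq_int => x; rewrite scale1r.
  have := int_scale sV0 (sqintM su (test_sqint (tps _ s0))).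
  rewrite invrK -/(M s) -/(D s) => <-; apply: eq_int => x.
  by rewrite scalerA mulfV ?gt_eqF// scale1r.
pose X t := \sum_i ip mu (wpartial i u) (fun x => x ord0 i * phi (t *: x)).
have dD (t : R) : 0 < t -> is_derive t 1 D (- (t ^+ N.-1 * X t)).
  move=> t0.
  have dM := is_derive_dilate t0 su tp.
  have dX : is_derive t 1 (fun t : R => t ^+ N) (N%:R * t ^+ N.-1).
    by have := @is_deriveX _ _ id N t 1 1 (is_derive_id _ _); rewrite exprfctE [_ *: _]mulr1.
  have [ed1 ed2] := @is_deriveM _ _ (fun t : R => t ^+ N) M t 1 _ _ dX dM.
  apply: DeriveDef; first exact: ed1.
  have ed3 : 'D_1 ((fun t : R => t ^+ N) * M) t =
    t ^+ N * \int[mu]_x (u x * \sum_i x ord0 i * partial i phi (t *: x)) +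
    M t * (N%:R * t ^+ N.-1) := ed2.
  rewrite [LHS]ed3.
  have tpi i : test_function (fun x => x ord0 i * phi (t *: x)) by apply: test_coorM; exact: tps.
  have Xi i : ip mu (wpartial i u) (fun x => x ord0 i * phi (t *: x)) =
      - (M t + t * \int[mu]_x (u x * (x ord0 i * partial i phi (t *: x)))).
    have [sg wg] := wpartialP i Hu.
    have := wg _ (tpi i); rewrite /= => wgi.
    apply: oppr_inj; rewrite opprK -[LHS]wgi.
    have i1 : intg mu (fun x => u x * phi (t *: x)) := sqintM su (test_sqint (tps _ t0)).
    have i2 : intg mu (fun x => u x * (x ord0 i * partial i phi (t *: x))).
      apply: sqintM => //; apply: test_sqint; apply: test_coorM.
      by apply: test_scale; [rewrite gt_eqF|exact: test_partial].
    rewrite -intZ// -intD//; last exact: intgZ.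
    apply: eq_int => x.
    have dp : derivable phi (t *: x + 0) (e_ i) by case: tp => /(_ 1%N)/class_C_derivable.
    have [dpt ept] := partial_affine dp.
    have dpt' : derivable (fun x => phi (t *: x)) x (e_ i).
      by move: dpt; under eq_fun do rewrite addr0.
    have ept' : partial i (fun x => phi (t *: x)) x = t * partial i phi (t *: x).
      by move: ept; rewrite addr0 => <-; congr (partial i _ x); apply/funext => y; rewrite addr0.
    have [dc ec] := @partial_coor R N id i i x (@derivable_id _ _ _ _).
    rewrite (partialM dc dpt') ept' ec eqxx mul1r derive1_id; ring.
  have sumE : \int[mu]_x (u x * \sum_i x ord0 i * partial i phi (t *: x)) =
     \sum_i \int[mu]_x (u x * (x ord0 i * partial i phi (t *: x))).
    rewrite -int_sum; first by apply: eq_int => x; rewrite mulr_sumr.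
    move=> i; apply: sqintM => //; apply: test_sqint; apply: test_coorM.
    by apply: test_scale; [rewrite gt_eqF|exact: test_partial].
  have XE : X t = - (N%:R * M t + t * \int[mu]_x (u x * \sum_i x ord0 i * partial i phi (t *:
    x))).
    rewrite /X (eq_bigr _ (fun i _ => Xi i)) sumrN big_split/= -mulr_sumr -sumE.
    by congr (- (_ + _)); rewrite sumr_const card_ord mulr_natl.
  rewrite XE mulrN opprK mulrDr mulrA [t ^+ N.-1 * (t * _)]mulrA.
  rewrite -exprSr prednK//; ring.
have cD : {within `[s, 1], continuous D}.
  apply: derivable_within_continuous => t; rewrite in_itv/= => /andP[h _].
  by have [] := dD t (lt_le_trans s0 h).
have dD' (t : R) : t \in `]s, 1[ -> is_derive t 1 D (- (t ^+ N.-1 * X t)).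
  by rewrite in_itv/= => /andP[h _]; exact: dD (lt_trans s0 h).
have [c cs Ec] := @MVT _ D (fun t => - (t ^+ N.-1 * X t)) s 1 s1 dD' cD.
move: cs; rewrite in_itv/= => /andP[sc c1].
have c0 : 0 < c by exact: lt_trans sc.
have EX : D s - D 1 = c ^+ N.-1 * X c * (1 - s) by rewrite -[LHS]opprB Ec mulNr opprK.
have hX : `|X c| <= Num.sqrt (Edir u) * Num.sqrt (\sum_i n2 mu (fun x =>
  x ord0 i * phi (c *: x))).
  rewrite (EdirE Hu); apply: sum_ip_le => i; first exact: wpartial_sqint.
  by apply: test_sqint; apply: test_coorM; exact: tps.
have hS : \sum_i n2 mu (fun x => x ord0 i * phi (c *: x)) =
    c^-1 ^+ N.+2 * n2 mu (fun x => enorm x * phi x).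
  rewrite -sum_n2_coor// mulr_sumr; apply: eq_bigr => i _.
  have si := test_sqint (test_coorM i tp).
  have -> : (fun x => x ord0 i * phi (c *: x)) =
     (fun x => c^-1 * ((fun y : 'rV[R]_N => y ord0 i * phi y) (c *: x))).
    by apply/funext => x; rewrite mxE !mulrA mulVf ?mul1r// gt_eqF.
  rewrite n2Z; last exact: (sqint_scale c0 si).
  by rewrite (n2_scale c0 si) mulrA -exprD.
(* Rescaling costs c^-(N+2), halved in the exponent by the square root. Against c^(N-1) this leaves
   at most s^-2, because s < c < 1. *)
have key : c ^+ N.-1 * Num.sqrt (\sum_i n2 mu (fun x => x ord0 i * phi (c *: x))) <=
    s ^- 2 * nm mu (fun x => enorm x * phi x).
  rewrite hS sqrtrM ?exprn_ge0 ?invr_ge0 ?(ltW c0)// mulrA -/(nm mu _).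
  rewrite ler_wpM2r ?nm_ge0//.
  rewrite -ler_sqr ?nnegrE ?mulr_ge0 ?sqrtr_ge0 ?exprn_ge0 ?invr_ge0 ?exprn_ge0 ?(ltW c0) ?(ltW
    s0)//.
  rewrite exprMn sqr_sqrtr ?exprn_ge0 ?invr_ge0 ?(ltW c0)//.
  have -> : N.+2 = (N.-1 + 3)%N by rewrite -[in LHS](prednK N0) addnC.
  rewrite exprD mulrA expr2 -[_ * _ * c^-1 ^+ N.-1]mulrA -exprMn mulfV ?gt_eqF// expr1n mulr1.
  have sV1 : 1 <= s^-1 by rewrite invf_ge1// ltW.
  have cV : 0 <= c^-1 <= s^-1 by rewrite invr_ge0 (ltW c0)/= lef_pV2 ?posrE// ltW.
  have /andP[cV0 cVs] := cV.
  have -> : s ^- 2 ^+ 2 = s^-1 ^+ 4 by rewrite -exprVn -exprM.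
  apply: (@le_trans _ _ (1 * s^-1 ^+ 3)).
    apply: ler_pM; rewrite ?exprn_ge0 ?(ltW c0)//.
      by rewrite exprn_ile1// ltW.
    by apply: lerXn2r => //; rewrite nnegrE ltW.
  by rewrite mul1r [in leRHS]exprSr ler_peMr// exprn_ge0 ?invr_ge0 ?ltW.
rewrite E EX normrM [`|1 - s|]ger0_norm ?subr_ge0 ?(ltW s1)// mulrC.
rewrite -!mulrA ler_wpM2l ?subr_ge0 ?(ltW s1)//.
rewrite normrM [`|c ^+ _|]ger0_norm ?exprn_ge0 ?(ltW c0)//.
apply: (@le_trans _ _ (c ^+ N.-1 * (Num.sqrt (Edir u) *
    Num.sqrt (\sum_i n2 mu (fun x => x ord0 i * phi (c *: x)))))).
  by rewrite ler_wpM2l ?exprn_ge0 ?(ltW c0).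
rewrite mulrCA [leRHS]mulrCA ler_wpM2l ?sqrtr_ge0//.
Qed.

Lemma measurable_enorm : measurable_fun [set: 'rV[R]_N] (@enorm R N).
Proof.
apply: (@measurableT_comp _ _ _ _ _ _ (@Num.sqrt R)).
  by apply: continuous_measurable_fun; exact: sqrt_continuous.
apply: measurable_sum => i; apply: measurable_funM; exact: measurable_rV_coor.
Qed.

Lemma enorm_ge0 x : 0 <= enorm x. Proof. exact: sqrtr_ge0. Qed.

Lemma enormZ (t : R) x : 0 <= t -> enorm (t *: x) = t * enorm x.
Proof.
move=> t0; rewrite /enorm (_ : dotv _ _ = t ^+ 2 * dotv x x).
  by rewrite sqrtrM ?sqr_ge0// sqrtr_sqr ger0_norm.
by rewrite /dotv mulr_sumr; apply: eq_bigr => i _; rewrite !mxE; ring.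
Qed.

Lemma sum_sqr_le (I : eqType) (s : seq I) (f : I -> R) :
  \sum_(i <- s) f i ^+ 2 <= (\sum_(i <- s) `|f i|) ^+ 2.
Proof.
elim: s => [|i s IH]; first by rewrite !big_nil expr0n.
rewrite !big_cons sqrrD real_normK ?num_real// -addrA lerD2l (le_trans IH)// lerDr.
by rewrite mulrn_wge0// mulr_ge0// sumr_ge0.
Qed.

Lemma enorm_le_sum x : enorm x <= \sum_i `|x ord0 i|.
Proof.
rewrite -ler_sqr ?nnegrE ?enorm_ge0 ?sumr_ge0// enorm_sqr.
exact: sum_sqr_le.
Qed.

(** The Hardy weight cut off near the origin. Being bounded, it keeps the weighted function in L2
    before Hardy's inequality is available. *)
Definition omg (eps : R) x : R := if eps < enorm x then (enorm x)^-1 else 0.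

Lemma omg_ge0 eps x : 0 <= omg eps x.
Proof. by rewrite /omg; case: ifP; rewrite ?invr_ge0 ?enorm_ge0. Qed.

Lemma omg_le eps x : 0 < eps -> `|omg eps x| <= eps^-1.
Proof.
move=> e0; rewrite ger0_norm ?omg_ge0// /omg; case: ifPn => [h|_]; last by rewrite invr_ge0 ltW.
by rewrite lef_pV2 ?posrE ?(lt_trans e0 h)//; exact: ltW.
Qed.

Lemma omg_enorm eps x : 0 <= eps -> enorm x * omg eps x ^+ 2 = omg eps x.
Proof.
move=> e0; rewrite /omg; case: ifPn => [h|_]; last by rewrite expr0n mulr0.
by rewrite expr2 mulrA mulfV ?mul1r// gt_eqF// (le_lt_trans e0).
Qed.

Lemma measurable_omg eps : measurable_fun [set: 'rV[R]_N] (omg eps).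
Proof.
rewrite (_ : omg eps = fun x => if eps < enorm x then enorm x `^ (-1) else 0); last first.
  by apply/funext => x; rewrite /omg; case: ifP => // _; rewrite powR_inv1// enorm_ge0.
apply: measurable_fun_ifT => //.
  by apply: measurable_fun_ltr => //; exact: measurable_enorm.
by apply: (@measurableT_comp _ _ _ _ _ _ (@powR R ^~ (-1)));
  [exact: measurable_powR|exact: measurable_enorm].
Qed.

Lemma omg_sqint eps u : 0 < eps -> sqint mu u -> sqint mu (fun x => omg eps x * u x).
Proof.
move=> e0; apply: (sqintMb (C := eps^-1)); first exact: measurable_omg.
by move=> x; exact: omg_le.
Qed.

Lemma indic_le1 (A : set 'rV[R]_N) x : `|\1_A x : R| <= 1.
Proof. by rewrite indicE; case: (_ \in _); rewrite ?normr1 ?normr0. Qed.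

Lemma measurable_indic_cube r : measurable_fun [set: 'rV[R]_N] (\1_(cube r) : 'rV[R]_N -> R).
Proof. by apply: measurable_indic; exact: measurable_cbox. Qed.

(** Duality with the test object psi = omg^2 D on a cube, D being the dilation increment: the factor
    |x| in [dilate_dual] cancels one [omg], so both sides involve the same weighted norm. As psi is
    not smooth, it is approximated by test functions supported in a fixed cube, where |x| is
    bounded. *)
Lemma hardy_dilate eps u (s : R) : (0 < N)%N -> 0 < s < 1 -> 0 < eps -> H1 u ->
  nm mu (fun x => omg eps x * (u (s^-1 *: x) - u x)) <= (1 - s) * s ^- 2 * Num.sqrt (Edir u).
Proof.
move=> N0 s01 e0 Hu; have /andP[s0 s1] := s01; have su := H1_sqint Hu.
pose kp : R := (1 - s) * s ^- 2 * Num.sqrt (Edir u); rewrite -/kp.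
have kp0 : 0 <= kp by rewrite !mulr_ge0 ?sqrtr_ge0 ?subr_ge0 ?invr_ge0 ?exprn_ge0 ?ltW.
pose D x := u (s^-1 *: x) - u x.
have sD : sqint mu D by apply: sqintB => //; apply: sqint_scale => //; rewrite invr_gt0.
have soD := omg_sqint e0 sD.
have H (k : nat) : nm mu (fun x => \1_(cube k%:R) x * (omg eps x * D x)) <= kp.
  rewrite leNgt; apply/negP; set a := nm mu _ => ka.
  have a0 : 0 < a by exact: le_lt_trans ka.
  have s1o : sqint mu (fun x => \1_(cube k%:R) x * (omg eps x * D x)).
    apply: (sqintMb (C := 1)) => //; [exact: measurable_indic_cube|by move=> x; exact: indic_le1].
  pose psi x := omg eps x * (\1_(cube k%:R) x * (omg eps x * D x)).
  have sps : sqint mu psi by exact: omg_sqint.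
  have psis : supp_in k%:R psi by move=> x nx; rewrite /psi indicE memNset// mul0r mulr0.
  have epsi x : enorm x * psi x = \1_(cube k%:R) x * (omg eps x * D x).
    by rewrite /psi -[in RHS](omg_enorm x (ltW e0)); ring.
  pose C : R := N%:R * (k%:R + 1).
  have C0 : 0 <= C by rewrite mulr_ge0// addr_ge0.
  (* With dl = a (a - kp) / q the approximation errors, at most dl (kp C + nm mu D), stay below a (a
     - kp) / 2, which is incompatible with kp < a. *)
  pose q : R := 2 * (kp * C + nm mu D + 1).
  have q0 : 0 < q by have := nm_ge0 mu D; have := mulr_ge0 kp0 C0; rewrite /q; lra.
  pose dl := a * (a - kp) / q.
  have ak : 0 < a - kp by rewrite subr_gt0.
  have dl0 : 0 < dl := divr_gt0 (mulr_gt0 a0 ak) q0.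
  have [_ /(_ _ (exprn_gt0 2 dl0))[phi [tp sp hp]]] := test_dense_supp (ler0n R k) sps psis.
  have sphi := test_sqint tp.
  have hd : nm mu (fun x => psi x - phi x) <= dl.
    by rewrite -(ler_sqr (nm_ge0 _ _) (ltW dl0)) nm2.
  pose b x := \1_(cube (k%:R + 1)) x * enorm x.
  have mb : measurable_fun [set: 'rV[R]_N] b.
    by apply: measurable_funM; [exact: measurable_indic_cube|exact: measurable_enorm].
  have bC x : `|b x| <= C.
    rewrite /b indicE; have [/set_mem/cubeE h|_] := boolP (x \in _); last by rewrite mul0r normr0.
    rewrite mul1r ger0_norm ?enorm_ge0// (le_trans (enorm_le_sum x))//.
    rewrite /C -[X in X%:R](card_ord N) mulr_natl -sumr_const; exact: ler_sum.
  have bd : nm mu (fun x => b x * (psi x - phi x)) <= C * nm mu (fun x => psi x - phi x).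
    rewrite -[X in X * _](ger0_norm C0) -nmZ; last exact: sqintB.
    apply: nm_le; [apply: (sqintMb mb bC); exact: sqintB|by apply: sqintZ; exact: sqintB|].
    by move=> x; rewrite normrM [leRHS]normrM ler_wpM2r// (le_trans (bC x))// ler_norm.
  have hphi : nm mu (fun x => enorm x * phi x) <= a + C * dl.
    have -> : (fun x => enorm x * phi x) = (fun x =>
      \1_(cube k%:R) x * (omg eps x * D x) - b x * (psi x - phi x)).
      apply/funext => x; rewrite -epsi /b indicE; have [_|h] := boolP (x \in _).
        by rewrite mul1r; ring.
      move: h; rewrite notin_setE => h; rewrite sp// psis ?mulr0 ?subrr ?mul0r ?subr0 ?mulr0//.
      by apply: contra_not h; apply: cube_le; rewrite lerDl.
    apply: le_trans (nmB s1o (sqintMb mb bC (sqintB sps sphi))) _.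
    by rewrite lerD2l (le_trans bd)// ler_wpM2l.
  have h2 : a ^+ 2 = ip mu D phi + ip mu D (fun x => psi x - phi x).
    have -> : ip mu D (fun x => psi x - phi x) = ip mu D psi - ip mu D phi.
      by rewrite ipC (ipBl sps sphi sD) ipC [ip mu phi D]ipC.
    rewrite addrC subrK nm2 /n2 /ip; apply: eq_int => x; rewrite /psi indicE.
    case: (_ \in _); rewrite ?mul1r ?mul0r ?mulr0 ?expr0n//; ring.
  have h3 : ip mu D phi <= kp * (a + C * dl).
    apply: le_trans (ler_norm _) _; apply: le_trans (dilate_dual N0 s01 Hu tp) _.
    by rewrite ler_wpM2l.
  have h4 : ip mu D (fun x => psi x - phi x) <= nm mu D * dl.
    apply: le_trans (ler_norm _) _; apply: le_trans (cauchy_schwarz sD (sqintB sps sphi)) _.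
    by rewrite ler_wpM2l ?nm_ge0.
  have h5 : dl * q = a * (a - kp) by rewrite /dl divfK// gt_eqF.
  have h8 : 0 < a * (a - kp) := mulr_gt0 a0 ak.
  move: h5; rewrite /q; move: dl0; move: h2 h3 h4 h8; nra.
(* The restriction to a cube is removed: truncations to growing cubes converge in norm. *)
rewrite leNgt; apply/negP => hk.
have d0 : 0 < (nm mu (fun x => omg eps x * D x) - kp) ^+ 2 by rewrite exprn_gt0// subr_gt0.
have [k _ /(_ k (leqnn k)) /= hh] : \forall k \near \oo,
    n2 mu (fun x => omg eps x * D x - \1_(cube k%:R) x * (omg eps x * D x)) <
    (nm mu (fun x => omg eps x * D x) - kp) ^+ 2.
  by apply: cvgr_lt (cut_cvg soD) _ _.
have s1o : sqint mu (fun x => \1_(cube k%:R) x * (omg eps x * D x)).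
  apply: (sqintMb (C := 1)) => //; [exact: measurable_indic_cube|by move=> x; exact: indic_le1].
have h1 : nm mu (fun x => omg eps x * D x) <= nm mu (fun x =>
  \1_(cube k%:R) x * (omg eps x * D x)) +
   nm mu (fun x => omg eps x * D x - \1_(cube k%:R) x * (omg eps x * D x)).
  apply: le_trans _ (nmD s1o (sqintB soD s1o)); rewrite le_eqVlt; apply/orP; left; apply/eqP.
  by congr nm; apply/funext => x; rewrite addrC subrK.
move: hh; rewrite -nm2 ltr_sqr ?nnegrE ?nm_ge0 ?subr_ge0 ?(ltW hk)// => hh.
have := H k; move: h1 hh hk; rewrite /D; lra.
Qed.

(** By scaling, the weighted norm of u(x/s) is at most s^((N-2)/2) times that of [u], so the
    dilation increment has norm at least 1 - s^((N-2)/2) times it. Comparing with [hardy_dilate] and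
    dividing by the rate at which both vanish as s -> 1 leaves Hardy's constant. *)
Lemma hardy_omg eps u : (2 < N)%N -> 0 < eps -> H1 u ->
  (N%:R - 2) * nm mu (fun x => omg eps x * u x) <= 2 * Num.sqrt (Edir u).
Proof.
move=> N2 e0 Hu; have su := H1_sqint Hu; have sou := omg_sqint e0 su.
have N0 : (0 < N)%N by exact: ltn_trans N2.
pose m := N.-2.
have Nm : N = m.+2 by rewrite /m prednK// -?subn1 ?subn_gt0 ?prednK//; case: (N) N2 => [|[|]].
have -> : N%:R - 2 = m%:R :> R by rewrite Nm -addn2 natrD addrK.
set A := nm mu _; set E := Num.sqrt (Edir u).
have A0 : 0 <= A by exact: nm_ge0.
have E0 : 0 <= E by exact: sqrtr_ge0.
have H (q : R) : 0 < q < 1 -> m%:R * q ^+ (m + 4) * A <= 2 * E.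
  move=> /andP[q0 q1].
  (* A square, so that s^((N-2)/2) is the natural power q^m. *)
  pose s := q ^+ 2.
  have s0 : 0 < s by rewrite exprn_gt0.
  have s1 : s < 1 by rewrite /s expr2; nra.
  have sV0 : 0 < s^-1 by rewrite invr_gt0.
  have h1 : nm mu (fun x => omg eps x * u (s^-1 *: x)) <= q ^+ m * A.
    have sF : sqint mu (fun y => omg eps (s *: y) * u y).
      apply: (sqintMb (C := eps^-1)) => //; last by move=> x; exact: omg_le.
      have := measurable_affine_comp s 0 (measurable_omg eps).
      by under eq_fun do rewrite addr0.
    have -> : (fun x => omg eps x * u (s^-1 *: x)) =
       (fun x => (fun y => omg eps (s *: y) * u y) (s^-1 *: x)).
      by apply/funext => x; rewrite scalerA mulfV ?scale1r// gt_eqF.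
    have oF : nm mu (fun y => omg eps (s *: y) * u y) <= s^-1 * A.
      rewrite -[X in X * _](ger0_norm (ltW sV0)) -nmZ//; apply: nm_le => //; first exact: sqintZ.
      move=> x; rewrite mulrA !normrM ler_wpM2r// [leLHS]ger0_norm ?omg_ge0//.
      rewrite [`|s^-1|]ger0_norm ?(ltW sV0)// [`|omg eps x|]ger0_norm ?omg_ge0//.
      rewrite /omg enormZ ?(ltW s0)//; case: ifPn => h.
        have h' : eps < enorm x.
          by apply: lt_le_trans h _; rewrite ler_piMl ?enorm_ge0// ltW.
        by rewrite h' invfM.
      by case: ifP; rewrite ?mulr0 ?mulr_ge0 ?invr_ge0 ?enorm_ge0 ?(ltW s0).
    rewrite /nm (n2_scale sV0 sF) invrK sqrtrM; last exact: exprn_ge0 (ltW s0).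
    have qN : 0 <= q ^+ N by rewrite exprn_ge0// ltW.
    rewrite (_ : s ^+ N = (q ^+ N) ^+ 2); last by rewrite /s -!exprM mulnC.
    rewrite sqrtr_sqr ger0_norm//; apply: le_trans (ler_wpM2l qN oF) _.
    rewrite mulrA (_ : q ^+ N * s^-1 = q ^+ m)//.
    by rewrite Nm /s -addn2 exprD mulfK// gt_eqF// exprn_gt0.
  have h2 := @hardy_dilate eps u s N0 (introT andP (conj s0 s1)) e0 Hu.
  have h3 : A <= nm mu (fun x => omg eps x * u (s^-1 *: x)) +
      nm mu (fun x => omg eps x * (u (s^-1 *: x) - u x)).
    have so2 : sqint mu (fun x => omg eps x * u (s^-1 *: x)).
      by apply: omg_sqint => //; exact: sqint_scale.
    have so3 : sqint mu (fun x => omg eps x * (u (s^-1 *: x) - u x)).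
      by apply: omg_sqint => //; apply: sqintB => //; exact: sqint_scale.
    apply: le_trans _ (nmB so2 so3); rewrite le_eqVlt; apply/orP; left; apply/eqP.
    by congr nm; apply/funext => x; ring.
  have geo (n : nat) : n%:R * q ^+ n * (1 - q) <= 1 - q ^+ n.
    elim: n => [|n IH]; first by rewrite mul0r mul0r expr0 subrr.
    rewrite exprS -natr1; have qn : 0 <= q ^+ n by rewrite exprn_ge0 ?(ltW q0).
    have X0 : 0 <= n%:R * q ^+ n * (1 - q) by rewrite !mulr_ge0// subr_ge0 ltW.
    have Y0 : 0 <= q ^+ n * (1 - q) by rewrite mulr_ge0// subr_ge0 ltW.
    have h1' : q * (n%:R * q ^+ n * (1 - q)) <= n%:R * q ^+ n * (1 - q) by rewrite ler_piMl// ltW.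
    have h2' : q * (q ^+ n * (1 - q)) <= q ^+ n * (1 - q) by rewrite ler_piMl// ltW.
    move: IH h1' h2'; lra.
  have h4 : (1 - q ^+ m) * A <= (1 - s) * s ^- 2 * E by move: h1 h2 h3; rewrite -/E; lra.
  have h5 : m%:R * q ^+ m * (1 - q) * A <= (1 - s) * s ^- 2 * E.
    by apply: le_trans h4; rewrite ler_wpM2r.
  have q4 : 0 < q ^+ 4 by rewrite exprn_gt0.
  have h6 : (1 - s) * s ^- 2 * E = (1 - q) * ((1 + q) * E / q ^+ 4).
    have -> : 1 - s = (1 - q) * (1 + q) by rewrite /s; ring.
    have -> : s ^- 2 = (q ^+ 4)^-1 by rewrite /s -exprM.
    by ring.
  move: h5; rewrite h6 (_ : _ * A = (1 - q) * (m%:R * q ^+ m * A)); last by ring.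
  rewrite ler_pM2l ?subr_gt0//.
  rewrite ler_pdivlMr// => h7; rewrite exprD.
  have : (1 + q) * E <= 2 * E by rewrite ler_wpM2r//; lra.
  by apply: le_trans; apply: le_trans h7; rewrite le_eqVlt; apply/orP; left; apply/eqP; ring.
(* Now q = 1 - dl tends to 1; Bernoulli's inequality controls the loss in q^(m+4). *)
apply/ler_addgt0Pr => e ee.
have bern (n : nat) (q : R) : 0 <= q <= 1 -> 1 - n%:R * (1 - q) <= q ^+ n.
  move=> /andP[q0 q1]; elim: n => [|n IH]; first by rewrite mul0r subr0 expr0.
  rewrite exprS -natr1.
  have : q ^+ n <= 1 by rewrite exprn_ile1.
  have : 0 <= n%:R :> R by []. 
  nra.
pose K := m%:R * (m + 4)%:R * A + 1.
have K0 : 0 < K by rewrite ltr_wpDl// !mulr_ge0.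
pose dl := Num.min (2^-1) (e / K).
have dl0 : 0 < dl by rewrite lt_min divr_gt0// invr_gt0 ltr0n.
have dl1 : dl <= 2^-1 by rewrite ge_min lexx.
have dle : dl * K <= e by rewrite -ler_pdivlMr// ge_min lexx orbT.
have q01 : 0 < 1 - dl < 1 by apply/andP; split; lra.
have h1 := H _ q01.
have q01' : 0 <= 1 - dl <= 1 by apply/andP; split; lra.
have h2 := bern (m + 4)%N _ q01'.
have m0 : 0 <= m%:R * A by rewrite mulr_ge0.
have h3 : m%:R * A * (1 - (m + 4)%:R * (1 - (1 - dl))) <= m%:R * A * (1 - dl) ^+ (m + 4).
  by rewrite ler_wpM2l.
move: h1 h3 dle; rewrite /K; nra.
Qed.

Lemma hardy u : (2 < N)%N -> H1 u ->
  intg mu (fun x => u x ^+ 2 / enorm x ^+ 2) /\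
  (N%:R - 2) ^+ 2 * \int[mu]_x (u x ^+ 2 / enorm x ^+ 2) <= 4 * Edir u.
Proof.
move=> N2 Hu; have su := H1_sqint Hu.
have N20 : 0 < N%:R - 2 :> R by rewrite subr_gt0 ltr_nat.
have [||||||i1 i2] := @fatou_bound _ _ _ mu (fun k x => (omg (margin k) x * u x) ^+ 2)
   (fun x => u x ^+ 2 / enorm x ^+ 2) (4 * Edir u / (N%:R - 2) ^+ 2).
- by move=> k x; exact: sqr_ge0.
- by move=> k; have [] := omg_sqint (@margin_gt0 R k) su.
- move=> k; rewrite -/(n2 mu _) -nm2 ler_pdivlMr ?exprn_gt0// -exprMn.
  have := hardy_omg N2 (@margin_gt0 R k) Hu; rewrite mulrC => h.
  have -> : 4 * Edir u = (2 * Num.sqrt (Edir u)) ^+ 2.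
    by rewrite exprMn sqr_sqrtr ?Edir_ge0// expr2; ring.
  by rewrite ler_sqr ?nnegrE ?mulr_ge0 ?nm_ge0 ?sqrtr_ge0 ?(ltW N20).
- rewrite (_ : (fun x => _) = fun x => u x ^+ 2 * (enorm x `^ (-1)) ^+ 2); last first.
    by apply/funext => x; rewrite powR_inv1 ?enorm_ge0// exprVn.
  apply: measurable_funM; first by apply: measurable_funX; case: su.
  apply: measurable_funX; apply: (@measurableT_comp _ _ _ _ _ _ (@powR R ^~ (-1)));
    first exact: measurable_powR.
  exact: measurable_enorm.
- apply: aeW => x.
  (* At the origin the truncated weight is 0 and so is the limit, division by zero being 0. *)
  have [e0|e0] := eqVneq (enorm x) 0.
    apply: (@cvg_trans _ (cst (0 : R) @ \oo)); last first.
      by rewrite e0 expr0n/= invr0 mulr0; exact: cvg_cst.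
    apply: near_eq_cvg; apply: nearW => k /=.
    by rewrite /omg e0 ltNge (ltW (margin_gt0 k)) /= mul0r expr0n.
  have e1 : 0 < enorm x by rewrite lt0r e0 enorm_ge0.
  apply: (@cvg_trans _ (cst (u x ^+ 2 / enorm x ^+ 2) @ \oo)); last exact: cvg_cst.
  apply: near_eq_cvg; apply: filterS (margin_lt e1) => k h.
  by rewrite /omg h exprMn exprVn mulrC.
- by move=> x; rewrite divr_ge0 ?sqr_ge0.
split=> //; move: i2; rewrite ler_pdivlMr ?exprn_gt0//; by rewrite mulrC.
Qed.

End Hardy.

(** * Averages over small cubes *)

Section Averages.
Context {R : realType} {N : nat}.
Implicit Types (u w phi g h : 'rV[R]_N -> R) (i : 'I_N) (x y z : 'rV[R]_N) (l : R).
Local Notation mu := (lebesgue_rV R N).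

Definition ucube : set 'rV[R]_N := cbox (const_mx 0) (const_mx 1).

Definition chi z : R := \1_ucube z.

Definition avg l u x : R := \int[mu]_z (chi z * u (x + l *: z)).

Lemma measurable_chi : measurable_fun [set: 'rV[R]_N] chi.
Proof. by apply: measurable_indic; exact: measurable_cbox. Qed.

Lemma chi_sqr z : chi z ^+ 2 = chi z.
Proof. by rewrite /chi indicE; case: (_ \in _); rewrite ?expr1n ?expr0n. Qed.

Lemma chi_ge0 z : 0 <= chi z.
Proof. by rewrite /chi indicE; case: (_ \in _). Qed.

Lemma chi_le1 z : `|chi z| <= 1.
Proof. by rewrite /chi indicE; case: (_ \in _); rewrite ?normr1 ?normr0. Qed.

Lemma chiM_ucube z (a b : R) : (ucube z -> a <= b) -> chi z * a <= chi z * b.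
Proof.
rewrite /chi indicE => ab; have [/set_mem/ab|_] := boolP (z \in _); last by rewrite !mul0r.
by rewrite !mul1r.
Qed.

Lemma chi_int : intg mu chi /\ \int[mu]_z chi z = 1.
Proof.
have mC := measurable_cbox (const_mx 0 : 'rV[R]_N) (const_mx 1).
have E : (\int[mu]_z (chi z)%:E = 1)%E.
  rewrite integral_indic// setIT.
  have := @lebesgue_rV_box R N (const_mx 0) (const_mx 1).
  rewrite big1; last by move=> i _; rewrite !mxE subr0.
  by apply => i; rewrite !mxE ler01.
split; last by rewrite /Rintegral E.
apply/integrableP; split; first by apply/measurable_EFinP; exact: measurable_chi.
under eq_integral => z _ do rewrite /= ger0_norm ?chi_ge0//.
by rewrite E ltry.
Qed.

Lemma chi_sqint : sqint mu chi /\ n2 mu chi = 1.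
Proof.
have [i1 i2] := chi_int; split.
  split; first exact: measurable_chi.
  by apply: eq_intg i1 => z; rewrite chi_sqr.
by rewrite /n2 -i2; apply: eq_int => z; rewrite chi_sqr.
Qed.

Lemma sqint_ray x l u : 0 < l -> sqint mu u -> sqint mu (fun z => u (x + l *: z)).
Proof. by move=> l0 su; under eq_fun do rewrite addrC; exact: sqint_affine. Qed.

Lemma avg_sqr_le l u x : 0 < l -> sqint mu u -> avg l u x ^+ 2 <= l^-1 ^+ N * n2 mu u.
Proof.
move=> l0 su; have [sc nc] := chi_sqint.
apply: le_trans (cauchy_schwarz_sqr sc (sqint_ray x l0 su)) _.
rewrite nc mul1r -(n2_affine x l0 su) le_eqVlt; apply/orP; left; apply/eqP.
by congr n2; apply/funext => z; rewrite addrC.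
Qed.

Lemma avg_intg_le l g x : 0 < l -> sqint mu g -> intg mu g ->
  `|avg l g x| <= l^-1 ^+ N * \int[mu]_y `|g y|.
Proof.
move=> l0 sg ig; have [sc nc] := chi_sqint.
have h : intg mu (fun z => `|g (x + l *: z)|).
  have := intg_affine x l0 (intg_norm ig).
  by under eq_fun do rewrite addrC.
rewrite -(int_affine x l0 (intg_norm ig)).
have -> : \int[mu]_z `|g (l *: z + x)| = \int[mu]_z `|g (x + l *: z)|.
  by apply: eq_int => z; rewrite addrC.
apply: int_norm_le => //; first by apply: sqintM => //; exact: sqint_ray.
by move=> z; rewrite normrM ler_piMl// chi_le1.
Qed.

Lemma avgB l u w x : 0 < l -> sqint mu u -> sqint mu w ->
  avg l (fun y => u y - w y) x = avg l u x - avg l w x.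
Proof.
move=> l0 su sw; have [sc _] := chi_sqint.
rewrite /avg -intB; [|by apply: sqintM => //; exact: sqint_ray..].
by apply: eq_int => z; rewrite mulrBr.
Qed.

Lemma avg_translate l u x y : avg l u (x + y) = avg l (fun z => u (z + y)) x.
Proof. by apply: eq_int => z; rewrite addrAC. Qed.

(* [avg] at a point is an inner product against a fixed square-integrable
   function, so it converges under weak convergence. *)
Lemma avg_ip l u x : 0 < l -> sqint mu u ->
  avg l u x = l^-1 ^+ N * ip mu u (fun y => chi (l^-1 *: (y - x))).
Proof.
move=> l0 su; have [sc _] := chi_sqint.
have sV : 0 < l^-1 by rewrite invr_gt0.
have sk : sqint mu (fun y => chi (l^-1 *: (y - x))).
  have := sqint_affine (- (l^-1 *: x)) sV sc.
  by under eq_fun do rewrite -scalerBr.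
rewrite -(int_affine x l0 (sqintM su sk)); apply: eq_int => z.
by rewrite addrK scalerA mulVf ?gt_eqF// scale1r mulrC [_ + x]addrC.
Qed.

Lemma sqint_avg_kernel l x : 0 < l -> sqint mu (fun y => chi (l^-1 *: (y - x))).
Proof.
move=> l0; have [sc _] := chi_sqint.
have sV : 0 < l^-1 by rewrite invr_gt0.
have := sqint_affine (- (l^-1 *: x)) sV sc.
by under eq_fun do rewrite -scalerBr.
Qed.

(** A squared L2 modulus of continuity at scale [l], averaged over the offsets. It stands in for the
    Dirichlet energy of truncated functions: it makes sense on all of L2 and decreases under
    contractions, so no chain rule for weak derivatives enters. *)
Definition Qa l g : R := \int[mu]_z (chi z * n2 mu (fun x => g (x + l *: z) - g x)).

Lemma measurable_Qa_joint l g : measurable_fun [set: 'rV[R]_N] g ->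
  measurable_fun [set: 'rV[R]_N * 'rV[R]_N]
    (fun p => (chi p.2 * (g (p.1 + l *: p.2) - g p.1) ^+ 2)%:E).
Proof.
move=> mg; apply/measurable_EFinP; apply: measurable_funM.
  exact: measurableT_comp measurable_chi (@measurable_snd _ _ _ _).
apply: measurable_funX; apply: measurable_funB.
  exact: measurableT_comp mg (@measurable_rV_addZ _ _ _).
exact: measurableT_comp mg (@measurable_fst _ _ _ _).
Qed.

Lemma sqint_diff l g z : sqint mu g -> sqint mu (fun x => g (x + l *: z) - g x).
Proof. by move=> sg; apply: sqintB => //; exact: sqint_translate. Qed.

Lemma Qa_inner l g z : sqint mu g ->
  (\int[mu]_x (chi z * (g (x + l *: z) - g x) ^+ 2)%:E =
   (chi z * n2 mu (fun x => g (x + l *: z) - g x))%:E)%E.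
Proof.
move=> sg; have [ms is_] := sqint_diff l z sg.
by rewrite -EFin_int; [rewrite intZ|exact: intgZ].
Qed.

Lemma Qa_intg l g : sqint mu g ->
  intg mu (fun z => chi z * n2 mu (fun x => g (x + l *: z) - g x)).
Proof.
move=> sg; have [ic _] := chi_int.
apply: (@intg_le _ _ _ _ _ (fun z => 4 * n2 mu g * chi z)); last exact: intgZ.
  have mf := measurable_Qa_joint l (sqint_measurable sg).
  have f0 (p : 'rV[R]_N * 'rV[R]_N) : (0 <= (chi p.2 * (g (p.1 + l *: p.2) - g p.1) ^+ 2)%:E)%E.
    by rewrite lee_fin mulr_ge0 ?chi_ge0 ?sqr_ge0.
  have /= := @measurable_fun_fubini_tonelli_G _ _ _ _ R mu _ mf f0.
  rewrite /fubini_G /=; under eq_fun do rewrite Qa_inner//.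
  by move/measurable_EFinP.
move=> z; rewrite ger0_norm; last by rewrite mulr_ge0 ?chi_ge0 ?n2_ge0.
rewrite mulrC ler_wpM2r ?chi_ge0//.
have st := @sqint_translate R N (l *: z) g sg.
have := n2_parallelogram_le st (sqintN sg); rewrite n2N n2_translate//.
by have := n2_ge0 mu g; lra.
Qed.

Lemma Qa_ge0 l g : 0 <= Qa l g.
Proof. by apply: int_ge0 => z; rewrite mulr_ge0 ?chi_ge0 ?n2_ge0. Qed.

Lemma avg_jensen l g x : 0 < l -> sqint mu g ->
  (((g x - avg l g x) ^+ 2)%:E <= \int[mu]_z (chi z * (g (x + l *: z) - g x) ^+ 2)%:E)%E.
Proof.
move=> l0 sg; have [sc nc] := chi_sqint; have [ic jc] := chi_int.
have sr := sqint_ray x l0 sg.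
have s1 : sqint mu (fun z => chi z * (g (x + l *: z) - g x)).
  have -> : (fun z => chi z * (g (x + l *: z) - g x)) =
      (fun z => chi z * g (x + l *: z) - g x * chi z).
    by apply/funext => z; ring.
  apply: sqintB; last exact: sqintZ.
  by apply: (sqintMb (C := 1)) => //; [exact: measurable_chi|exact: chi_le1].
have E : g x - avg l g x = - ip mu chi (fun z => chi z * (g (x + l *: z) - g x)).
  rewrite /avg -[in LHS](mulr1 (g x)) -jc -intZ// -intB; [|exact: intgZ|exact: sqintM].
  rewrite -intN; last exact: sqintM.
  by apply: eq_int => z; rewrite mulrA -expr2 chi_sqr; ring.
have i2 : intg mu (fun z => chi z * (g (x + l *: z) - g x) ^+ 2).
  by apply: eq_intg (sqint_sqr s1) => z; rewrite exprMn chi_sqr.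
rewrite -EFin_int// lee_fin E sqrrN; apply: le_trans (cauchy_schwarz_sqr sc s1) _.
rewrite nc mul1r /n2 le_eqVlt; apply/orP; left; apply/eqP.
by apply: eq_int => z; rewrite exprMn chi_sqr.
Qed.

(** Jensen pointwise, then Tonelli. The minorant [h] stands for the squared deviation from the
    average, so that measurability is only asked of explicit functions and not of [avg]. *)
Lemma avg_le_Qa l g h : 0 < l -> sqint mu g -> measurable_fun [set: 'rV[R]_N] h ->
  (forall x, 0 <= h x) -> (forall x, h x <= (g x - avg l g x) ^+ 2) ->
  intg mu h /\ \int[mu]_x h x <= Qa l g.
Proof.
move=> l0 sg mh h0 hle.
have mf := measurable_Qa_joint l (sqint_measurable sg).
have f0 (p : 'rV[R]_N * 'rV[R]_N) : (0 <= (chi p.2 * (g (p.1 + l *: p.2) - g p.1) ^+ 2)%:E)%E.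
  by rewrite lee_fin mulr_ge0 ?chi_ge0 ?sqr_ge0.
have le1 : (\int[mu]_x (h x)%:E <= (Qa l g)%:E)%E.
  rewrite /Qa EFin_int; last exact: Qa_intg.
  under [leRHS]eq_integral => z _ do rewrite -Qa_inner//.
  have := @fubini_tonelli _ _ _ _ R mu mu _ mf f0; rewrite /= => <-.
  apply: ge0_le_integral => //.
  - by move=> x _; rewrite lee_fin.
  - by apply/measurable_EFinP.
  - exact: (@measurable_fun_fubini_tonelli_F _ _ _ _ R mu _ mf f0).
  - by move=> x _; apply: le_trans (avg_jensen x l0 sg); rewrite lee_fin.
have ih : intg mu h.
  apply/integrableP; split; first by apply/measurable_EFinP.
  under eq_integral => x _ do rewrite /= ger0_norm//.
  exact: le_lt_trans le1 (ltry _).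
by split => //; rewrite -lee_fin EFin_int.
Qed.

Lemma Qa_le l u : 0 < l -> H1 u -> Qa l u <= (N%:R * l) ^+ 2 * Edir u.
Proof.
move=> l0 Hu; have [ic jc] := chi_int; have su := H1_sqint Hu.
rewrite -[leRHS]mulr1 -[X in _ <= _ * X]jc -intZ//; apply: int_le; [exact: Qa_intg|exact: intgZ|].
move=> z; rewrite [leRHS]mulrC; apply: chiM_ucube => cz.
have := translate_est (l *: z) Hu.
have le2 : \sum_i `|(l *: z) ord0 i| <= N%:R * l.
  rewrite -[X in X%:R](card_ord N) mulr_natl -sumr_const; apply: ler_sum => i _.
  rewrite mxE normrM (ger0_norm (ltW l0)) ler_piMr ?(ltW l0)//.
  by have := cz i; rewrite !mxE => /andP[h1 h2]; rewrite ger0_norm.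
move=> h; rewrite -nm2 -[Edir u]sqr_sqrtr ?Edir_ge0// -exprMn.
rewrite ler_sqr ?nnegrE ?nm_ge0 ?mulr_ge0 ?sqrtr_ge0 ?(ltW l0)//.
by apply: le_trans h _; rewrite ler_wpM2r ?sqrtr_ge0.
Qed.

(** A translation by m l z is made of [m] translations by l z. This passes from a fine scale common
    to all levels to the scale suited to one level. *)
Lemma Qa_mul (m : nat) l g : sqint mu g -> Qa (m%:R * l) g <= m%:R ^+ 2 * Qa l g.
Proof.
move=> sg; rewrite /Qa -intZ; last exact: Qa_intg.
apply: int_le; [exact: Qa_intg|by apply: intgZ; exact: Qa_intg|].
move=> z; rewrite mulrCA ler_wpM2l ?chi_ge0//.
suff H (k : nat) : nm mu (fun x => g (x + (k%:R * l) *: z) - g x) <= k%:R * nm mu (fun x =>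
  g (x + l *: z) - g x).
  rewrite -!nm2 -exprMn ler_sqr ?nnegrE ?nm_ge0 ?mulr_ge0 ?nm_ge0//.
elim: k => [|k IH].
  rewrite mul0r; have -> : (fun x => g (x + 0 *: z) - g x) = (fun=> 0 * 0).
    by apply/funext => x; rewrite scale0r addr0 subrr mul0r.
  by rewrite nmZ ?normr0 ?mul0r//; exact: sqint0.
have sd := sqint_diff l z sg.
have -> : (fun x => g (x + (k.+1%:R * l) *: z) - g x) =
   (fun x => ((fun y => g (y + l *: z) - g y) (x + (k%:R * l) *: z)) + (g (x +
     (k%:R * l) *: z) - g x)).
  apply/funext => x /=; rewrite -natr1 mulrDl mul1r scalerDl addrA; ring.
apply: le_trans (nmD _ (sqint_diff _ z sg)) _; first exact: (sqint_translate _ sd).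
rewrite (nm_translate _ sd) -natr1 mulrDl mul1r addrC; exact: lerD.
Qed.

Lemma Qa_sum_le l u (n : nat) (G : nat -> 'rV[R]_N -> R) : sqint mu u ->
  (forall k, sqint mu (G k)) ->
  (forall x y, \sum_(k < n) (G k x - G k y) ^+ 2 <= (u x - u y) ^+ 2) ->
  \sum_(k < n) Qa l (G k) <= Qa l u.
Proof.
move=> su sG H; rewrite /Qa -int_sum; last by move=> k; exact: Qa_intg.
apply: int_le; [by apply: intg_sum => k; exact: Qa_intg|exact: Qa_intg|].
move=> z; rewrite -mulr_sumr ler_wpM2l ?chi_ge0// /n2 -int_sum; last first.
  by move=> k; have [] := sqint_diff l z (sG k).
apply: int_le => //; last by have [] := sqint_diff l z su.
by apply: intg_sum => k; have [] := sqint_diff l z (sG k).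
Qed.

End Averages.

(** * The Sobolev inequality *)

(* The level sets decouple: [b k] is [s_k^p * mu {|u| > s_k}] and [eps k] is the
   share of the Dirichlet energy carried by the level [s_k < |u| < 2 s_k]. *)
Lemma level_recursion (R : realType) (b eps : nat -> R) (K S al : R) (n : nat) :
  0 < al < 1 -> 0 <= K -> (forall k, 0 <= b k) -> (forall k, 0 <= eps k) ->
  \sum_(k < n) eps k <= S ->
  (forall k, (k < n)%N -> b k.+1 <= K * b k `^ al * eps k) ->
  \sum_(k < n) b k <= 2 * Num.max (b 0%N) ((K * S) `^ ((1 - al)^-1)).
Proof.
move=> /andP[al0 al1] K0 b0 e0 eS H.
(* [M] dominates the fixed point of x = K S x^al, so a step of the recursion with [eps k <= S] never
   leaves the interval from 0 to [M]. *)
set M := Num.max _ _.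
have S0 : 0 <= S by apply: le_trans eS; apply: sumr_ge0.
have KS0 : 0 <= K * S by rewrite mulr_ge0.
have M0 : 0 <= M by rewrite le_max b0.
have al1' : 0 < 1 - al by rewrite subr_gt0.
have KSM : K * S <= M `^ (1 - al).
  have KSE : ((K * S) `^ (1 - al)^-1) `^ (1 - al) = K * S.
    by rewrite -powRrM mulVf ?powRr1// lt0r_neq0.
  rewrite -[leLHS]KSE.
  by apply: ge0_ler_powR; rewrite ?nnegrE ?powR_ge0 ?(ltW al1')// le_max lexx orbT.
have MM : M `^ al * (K * S) <= M.
  apply: (@le_trans _ _ (M `^ al * M `^ (1 - al))); first by rewrite ler_wpM2l ?powR_ge0.
  by rewrite -powRD addrC subrK ?powRr1// oner_eq0.
have eS1 k : (k < n)%N -> eps k <= S.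
  move=> kn; apply: le_trans eS; rewrite (bigD1 (Ordinal kn))//= lerDl.
  exact: sumr_ge0.
have bM k : (k <= n)%N -> b k <= M.
  elim: k => [_|k IH kn]; first by rewrite le_max lexx.
  apply: le_trans (H k kn) _; apply: le_trans _ MM.
  rewrite mulrAC mulrC ler_pM ?mulr_ge0 ?powR_ge0//.
    by apply: ge0_ler_powR; rewrite ?nnegrE ?(ltW al0)// IH// ltnW.
  by rewrite ler_wpM2l// eS1.
have : \sum_(k < n) b k <= b 0%N + \sum_(k < n) b k.+1.
  have -> : b 0%N + \sum_(k < n) b k.+1 = \sum_(k < n.+1) b k by rewrite big_ord_recl.
  by rewrite big_ord_recr/= lerDl.
move=> /le_trans; apply; rewrite [2 * M]mulr_natl mulr2n lerD//; first exact: bM.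
apply: le_trans _ MM; apply: (@le_trans _ _ (\sum_(k < n) M `^ al * K * eps k)).
  apply: ler_sum => k _; apply: le_trans (H k (ltn_ord k)) _.
  rewrite ler_wpM2r// mulrC ler_wpM2r//.
  by apply: ge0_ler_powR; rewrite ?nnegrE ?(ltW al0)// bM// ltnW.
by rewrite -mulr_sumr -mulrA ler_wpM2l ?powR_ge0// ler_wpM2l.
Qed.

Lemma powR_sqrM (R : realType) (s q : R) : 0 <= s -> 2 < q ->
  s `^ q = s `^ (q - 2) * s ^+ 2.
Proof.
move=> s0 q2; rewrite -powR_mulrn// -powRD ?subrK//.
by apply/implyP => /eqP; lra.
Qed.

Section Sobolev.
Context {R : realType} {N : nat}.
Implicit Types (u w g h : 'rV[R]_N -> R) (x y z : 'rV[R]_N) (l s lam : R).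
Local Notation mu := (lebesgue_rV R N).

Definition lev u s x : R := (s < `|u x|)%R%:R.

(** Isolates one dyadic level of |u|: zero below height [s], constant equal to [s] above height 2
    s. *)
Definition slab u s x : R := Num.min `|u x| (2 * s) - Num.min `|u x| s.

Lemma lev_ge0 u s x : 0 <= lev u s x. Proof. exact: ler0n. Qed.

Lemma measurable_lev u s : measurable_fun [set: 'rV[R]_N] u ->
  measurable_fun [set: 'rV[R]_N] (lev u s).
Proof.
move=> mu_; rewrite (_ : lev u s = fun x => if s < `|u x| then 1 else 0); last first.
  by apply/funext => x; rewrite /lev; case: ifP.
apply: measurable_fun_ifT => //; apply: measurable_fun_ltr => //.
exact: measurableT_comp.
Qed.

Lemma lev_int u s : 0 < s -> sqint mu u ->
  intg mu (lev u s) /\ s ^+ 2 * \int[mu]_x lev u s x <= n2 mu u.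
Proof.
move=> s0 [mu_ iu].
have H x : s ^+ 2 * lev u s x <= u x ^+ 2.
  rewrite /lev; case: ltP => h; rewrite ?mulr1 ?mulr0 ?sqr_ge0//.
  by rewrite -[u x ^+ 2]real_normK ?num_real// ler_sqr ?nnegrE ?(ltW s0)// ltW.
have ih : intg mu (lev u s).
  apply: (@intg_le _ _ _ _ _ (fun x => s ^- 2 * u x ^+ 2));
    [exact: measurable_lev| |exact: intgZ].
  by move=> x; rewrite ger0_norm ?lev_ge0// mulrC ler_pdivlMr ?exprn_gt0// mulrC.
by split=> //; rewrite -intZ//; apply: int_le => //; exact: intgZ.
Qed.

Lemma slab_ge0 u s x : 0 < s -> 0 <= slab u s x.
Proof. by move=> s0; rewrite /slab /Num.min; do 2 case: ltP => ?; lra. Qed.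

Lemma slab_le u s x : 0 < s -> slab u s x <= s * lev u s x.
Proof.
by move=> s0; rewrite /slab /lev /Num.min; do 3 case: ltP => ?; rewrite /= ?mulr1 ?mulr0; lra.
Qed.

Lemma slab_top u s x : 0 < s -> 2 * s < `|u x| -> slab u s x = s.
Proof. by move=> s0 ?; rewrite /slab /Num.min; do 2 case: ltP => ?; lra. Qed.

Lemma slab_le_norm u s x : 0 < s -> `|slab u s x| <= `|u x|.
Proof.
move=> s0; rewrite ger0_norm ?slab_ge0//; have n0 := normr_ge0 (u x).
by rewrite /slab /Num.min; do 2 case: ltP => ?; lra.
Qed.

Lemma slab_sqint u s : 0 < s -> sqint mu u -> sqint mu (slab u s).
Proof.
move=> s0 su; have [mu_ _] := su; apply: sqint_le su; last by move=> x; exact: slab_le_norm.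
have m1 : measurable_fun [set: 'rV[R]_N] (fun x => `|u x|) by exact: measurableT_comp.
by apply: measurable_funB; apply: measurable_minr.
Qed.

Lemma slab_intg u s : 0 < s -> sqint mu u -> intg mu (slab u s).
Proof.
move=> s0 su; have [il _] := lev_int s0 su; have [ms _] := slab_sqint s0 su.
apply: (@intg_le _ _ _ _ _ (fun x => s * lev u s x)) => //; last exact: intgZ.
by move=> x; rewrite ger0_norm ?slab_ge0//; exact: slab_le.
Qed.

(** Cubes of side [l] have at least twice the volume of the set where |u| > s, so the slab has
    averages at most s/2. Where |u| > 2 s the slab equals [s] and differs from its average by at
    least s/2; Chebyshev's inequality concludes. *)
Lemma level_step u s l : 0 < s -> 0 < l -> sqint mu u ->
  2 * \int[mu]_x lev u s x <= l ^+ N ->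
  s ^+ 2 * \int[mu]_x lev u (2 * s) x <= 4 * Qa l (slab u s).
Proof.
move=> s0 l0 su hl; have [mu_ _] := su.
have s20 : 0 < 2 * s by rewrite mulr_gt0.
have sg := slab_sqint s0 su; have ig := slab_intg s0 su.
have [il _] := lev_int s0 su; have [il2 _] := lev_int s20 su.
have lN : 0 < l ^+ N by rewrite exprn_gt0.
have av x : avg l (slab u s) x <= s / 2.
  apply: le_trans (ler_norm _) _; apply: le_trans (avg_intg_le x l0 sg ig) _.
  have h1 : \int[mu]_y `|slab u s y| <= s * \int[mu]_x lev u s x.
    rewrite -intZ//; apply: int_le; [exact: intg_norm|exact: intgZ|].
    by move=> y; rewrite ger0_norm ?slab_ge0//; exact: slab_le.
  rewrite exprVn mulrC ler_pdivrMr//; apply: le_trans h1 _.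
  by have := ler_wpM2l (ltW s0) hl; lra.
pose h x := s ^+ 2 / 4 * lev u (2 * s) x.
have [|||_] := @avg_le_Qa _ _ l (slab u s) h l0 sg.
- by apply: measurable_funM => //; exact: measurable_lev.
- by move=> x; rewrite mulr_ge0 ?lev_ge0// divr_ge0 ?sqr_ge0.
- move=> x; rewrite /h /lev; case: ltP => hx; last by rewrite mulr0 sqr_ge0.
  rewrite mulr1 (slab_top s0 hx); have := av x => hav.
  have : (s / 2) ^+ 2 <= (s - avg l (slab u s) x) ^+ 2.
    by rewrite ler_sqr ?nnegrE ?divr_ge0 ?(ltW s0)//; lra.
  by apply: le_trans; rewrite le_eqVlt; apply/orP; left; apply/eqP; field.
by rewrite /h intZ// -mulrA => h1; lra.
Qed.

Lemma clip_mono (a b s s' : R) : b <= a -> s <= s' ->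
  0 <= (Num.min a s' - Num.min a s) - (Num.min b s' - Num.min b s) <= a - b.
Proof.
by move=> ba ss; rewrite /Num.min; do 4 case: ltP => ?; apply/andP; split; lra.
Qed.

(** Between two points all slabs vary in the same direction and their variations telescope to that
    of a truncation of |u|; a sum of squares of nonnegative numbers is at most the square of the
    sum. *)
Lemma slab_sum_le u lam n x y : 0 < lam ->
  \sum_(k < n) (slab u (lam * 2 ^+ k) x - slab u (lam * 2 ^+ k) y) ^+ 2 <= (u x - u y) ^+ 2.
Proof.
move=> lam0.
wlog xy : x y / `|u y| <= `|u x|.
  move=> W; have [/W//|/ltW/W] := leP `|u y| `|u x|.
  rewrite -[(u y - u x) ^+ 2]sqrrN opprB => h; apply: le_trans h.
  by rewrite le_eqVlt; apply/orP; left; apply/eqP; apply: eq_bigr => k _; ring.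
have s0 (k : nat) : 0 < lam * 2 ^+ k by rewrite mulr_gt0// exprn_gt0.
pose T k z := Num.min `|u z| (lam * 2 ^+ k).
have slabE k z : slab u (lam * 2 ^+ k) z = T k.+1 z - T k z.
  by rewrite /slab /T exprS mulrCA.
have d0 k : 0 <= slab u (lam * 2 ^+ k) x - slab u (lam * 2 ^+ k) y.
  have sk : lam * 2 ^+ k <= 2 * (lam * 2 ^+ k) by have := s0 k; lra.
  by have /andP[] := clip_mono xy sk.
apply: le_trans (sum_sqr_le _ _) _.
have -> : \sum_(k < n) `|slab u (lam * 2 ^+ k) x - slab u (lam * 2 ^+ k) y| =
    (T n x - T 0%N x) - (T n y - T 0%N y).
  rewrite (eq_bigr (fun k : 'I_n => (T k.+1 x - T k x) - (T k.+1 y - T k y))); last first.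
    by move=> k _; rewrite ger0_norm// !slabE.
  rewrite sumrB; congr (_ - _).
    by rewrite -(big_mkord xpredT (fun k => T k.+1 x - T k x)) telescope_sumr.
  by rewrite -(big_mkord xpredT (fun k => T k.+1 y - T k y)) telescope_sumr.
have h : lam * 2 ^+ 0 <= lam * 2 ^+ n.
  by rewrite expr0 mulr1 ler_peMr ?(ltW lam0)// exprn_ege1// ler1n.
have /andP[h1 h2] := clip_mono xy h.
rewrite -[leRHS]real_normK ?num_real//; apply: lerXn2r; rewrite ?nnegrE//.
exact: le_trans h2 (lerB_dist _ _).
Qed.

(** Level [k] calls for cubes of side L k = (2 D k)^(1/N), but slab energies add up only at a common
    scale. So a scale [eta] below all relevant L k is fixed, and [Qa_mul] brings each level to its
    own scale. The factor 16 is 4 from [level_step] times 4 from rounding L k / eta up. *)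
Lemma level_split u lam n : (0 < N)%N -> 0 < lam -> H1 u ->
  exists eps : nat -> R, [/\ forall k, 0 <= eps k,
    \sum_(k < n) eps k <= N%:R ^+ 2 * Edir u &
    forall k, (k < n)%N -> (lam * 2 ^+ k) ^+ 2 * \int[mu]_x lev u (lam * 2 ^+ k.+1) x <=
      16 * (2 * \int[mu]_x lev u (lam * 2 ^+ k) x) `^ (2 / N%:R) * eps k].
Proof.
move=> N0 lam0 Hu; have su := H1_sqint Hu.
have s0 (k : nat) : 0 < lam * 2 ^+ k by rewrite mulr_gt0// exprn_gt0.
pose D k := \int[mu]_x lev u (lam * 2 ^+ k) x.
have D0 k : 0 <= D k by apply: int_ge0 => x; exact: lev_ge0.
pose L k := (2 * D k) `^ N%:R^-1.
have N0' : N%:R != 0 :> R by rewrite pnatr_eq0 -lt0n.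
have LN k : L k ^+ N = 2 * D k.
  rewrite -powR_mulrn ?powR_ge0// -powRrM mulVf// powRr1// mulr_ge0//.
have L2 k : L k ^+ 2 = (2 * D k) `^ (2 / N%:R).
  by rewrite -powR_mulrn ?powR_ge0// -powRrM; congr (_ `^ _); rewrite mulrC.
have [eta eta0 Heta] : exists2 eta : R, 0 < eta & forall k, (k < n)%N -> 0 < D k -> eta <= L k.
  elim: (n) => [|m [e e0 IH]]; first by exists 1.
  have [Dm|Dm] := ltP 0 (D m); last first.
    exists e => // k; rewrite ltnS leq_eqVlt => /predU1P[->|]; last exact: IH.
    by rewrite ltNge Dm.
  exists (Num.min e (L m)); first by rewrite lt_min e0 powR_gt0// mulr_gt0.
  move=> k; rewrite ltnS leq_eqVlt => /predU1P[->|km] Dk; first by rewrite ge_min lexx orbT.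
  by rewrite ge_min IH.
exists (fun k => Qa eta (slab u (lam * 2 ^+ k)) / eta ^+ 2); split.
- by move=> k; rewrite divr_ge0 ?Qa_ge0 ?sqr_ge0.
- rewrite -mulr_suml ler_pdivrMr ?exprn_gt0//.
  apply: le_trans (Qa_sum_le eta su (fun k => slab_sqint (s0 k) su) (fun x y =>
    slab_sum_le u n x y lam0)) _.
  apply: le_trans (Qa_le eta0 Hu) _.
  by rewrite le_eqVlt; apply/orP; left; apply/eqP; ring.
move=> k kn; rewrite -/(D k) -/(D k.+1) -L2.
(* A null level has scale 0, but then the next level, a subset of it, is null too and the left side
   vanishes. *)
have [Dk|Dk] := ltP 0 (D k); last first.
  have -> : D k.+1 = 0.
    apply/eqP; rewrite eq_le D0 andbT; apply: le_trans Dk.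
    have [i1 _] := lev_int (s0 k) su; have [i2 _] := lev_int (s0 k.+1) su.
    apply: int_le => // x; rewrite /lev ler_nat.
    have [h|//] := ltP (lam * 2 ^+ k.+1) `|u x|.
    have -> // : lam * 2 ^+ k < `|u x|.
    apply: le_lt_trans h; rewrite exprS mulrCA ler_peMl ?(ltW (s0 k))// ler1n//.
  by rewrite mulr0; apply: mulr_ge0; [rewrite mulr_ge0// sqr_ge0|rewrite divr_ge0 ?Qa_ge0
    ?sqr_ge0].
have He := Heta k kn Dk.
have L0 : 0 < L k by exact: lt_le_trans He.
(* Since L k / eta is at least 1, rounding it up loses at most a factor 2. *)
pose m := `|Num.ceil (L k / eta)|%N.
have c0 : 0 <= L k / eta by rewrite divr_ge0 ?ltW.
have mE : m%:R = (Num.ceil (L k / eta))%:~R :> R.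
  by rewrite /m natr_absz ger0_norm// -(@ler_int R) (le_trans c0)// ceil_ge.
have mle : m%:R * eta <= 2 * L k.
  have : m%:R - 1 < L k / eta.
    by rewrite mE; have := ceil_itv (L k / eta); rewrite intrB => /andP[].
  by rewrite ltr_pdivlMr//; lra.
have mge : L k <= m%:R * eta by rewrite -ler_pdivrMr// mE ceil_ge.
have m0 : 0 < m%:R * eta by exact: lt_le_trans mge.
have := @level_step u (lam * 2 ^+ k) (m%:R * eta) (s0 k) m0 su.
rewrite -/(D k) -LN => /(_ _)/le_trans => st.
have -> : D k.+1 = \int[mu]_x lev u (2 * (lam * 2 ^+ k)) x by rewrite /D exprS mulrCA.
apply: st; first by apply: lerXn2r; rewrite ?nnegrE ?(ltW m0) ?(ltW L0).
apply: (@le_trans _ _ (4 * (m%:R ^+ 2 * Qa eta (slab u (lam * 2 ^+ k))))).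
  by rewrite ler_wpM2l// Qa_mul//; exact: slab_sqint.
have hm : m%:R ^+ 2 * eta ^+ 2 <= 4 * L k ^+ 2.
  rewrite -exprMn (_ : 4 * L k ^+ 2 = (2 * L k) ^+ 2); last by ring.
  by apply: lerXn2r; rewrite ?nnegrE ?(ltW m0)// mulr_ge0// ltW.
rewrite [leRHS]mulrA ler_pdivlMr ?exprn_gt0//.
have := ler_wpM2r (Qa_ge0 eta (slab u (lam * 2 ^+ k))) hm; lra.
Qed.

Context (N2 : (2 < N)%N).
Local Notation p := (critical_exponent R N).

Let N0 : (0 < N)%N. Proof. exact: ltn_trans N2. Qed.

Let Npos : 0 < N%:R :> R. Proof. by rewrite ltr0n. Qed.

Let N2pos : 0 < N%:R - 2 :> R. Proof. by rewrite subr_gt0 ltr_nat. Qed.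

Lemma critical_exponent_gt2 : 2 < p.
Proof. by rewrite /critical_exponent ltr_pdivlMr//; lra. Qed.

Lemma critical_exponent_half : p / 2 = N%:R / (N%:R - 2).
Proof. by rewrite /critical_exponent; field; rewrite lt0r_neq0. Qed.

Definition sobolev_const : R :=
  2 `^ p * 2 * (16 * 2 `^ p * 2 `^ (2 / N%:R) * N%:R ^+ 2) `^ (p / 2).

(** [level_recursion] with exponent 2/N. The identity p (2/N) = p - 2 makes the powers of s_k match,
    and 1/(1 - 2/N) = p/2 becomes the power of the Dirichlet energy; here the critical exponent is
    singled out. *)
Lemma sobolev_level_sum u lam n : 0 < lam -> H1 u ->
  2 `^ p * \sum_(k < n) (lam * 2 ^+ k) `^ p * \int[mu]_x lev u (lam * 2 ^+ k) x <=
  sobolev_const * Edir u `^ (p / 2) + 2 `^ p * 2 * (lam `^ (p - 2) * n2 mu u).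
Proof.
move=> lam0 Hu; have su := H1_sqint Hu.
have [eps [e0 eS He]] := level_split n N0 lam0 Hu.
have s0 (k : nat) : 0 < lam * 2 ^+ k by rewrite mulr_gt0// exprn_gt0.
pose D k := \int[mu]_x lev u (lam * 2 ^+ k) x.
have D0 k : 0 <= D k by apply: int_ge0 => x; exact: lev_ge0.
have p2 := critical_exponent_gt2.
pose K : R := 16 * 2 `^ p * 2 `^ (2 / N%:R).
have K0 : 0 <= K by rewrite !mulr_ge0 ?powR_ge0.
pose b k := (lam * 2 ^+ k) `^ p * D k.
have b0 k : 0 <= b k by rewrite mulr_ge0 ?powR_ge0.
have Na0 : 0 < 2 / N%:R :> R by rewrite divr_gt0.
have Na1 : 2 / N%:R < 1 :> R by rewrite ltr_pdivrMr// mul1r; move: N2pos; lra.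
have al01 := introT andP (conj Na0 Na1).
have alE : p * (2 / N%:R) = p - 2 by rewrite /critical_exponent; field; rewrite !lt0r_neq0.
have al1E : (1 - 2 / N%:R)^-1 = p / 2 by rewrite critical_exponent_half; field;
  rewrite !lt0r_neq0.
have Hb k : (k < n)%N -> b k.+1 <= K * b k `^ (2 / N%:R) * eps k.
  move=> kn; have := He k kn; rewrite -/(D k) -/(D k.+1).
  have bE : b k `^ (2 / N%:R) = (lam * 2 ^+ k) `^ (p - 2) * D k `^ (2 / N%:R).
    by rewrite /b powRM ?powR_ge0// -powRrM alE.
  rewrite bE (powRM (x := 2))// /b.
  rewrite [lam * 2 ^+ k.+1](_ : _ = 2 * (lam * 2 ^+ k)); last by rewrite exprS mulrCA.
  rewrite [(2 * (lam * _)) `^ p]powRM ?(ltW (s0 k))//.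
  move: (s0 k); set s := lam * 2 ^+ k => sk.
  rewrite (powR_sqrM (ltW sk) p2) => h.
  have := ler_wpM2l (mulr_ge0 (powR_ge0 2 p) (powR_ge0 s (p - 2))) h.
  by rewrite /K; lra.
have := level_recursion al01 K0 b0 e0 eS Hb; rewrite al1E.
set M := Num.max _ _ => hM.
have MS : M <= lam `^ (p - 2) * n2 mu u + (K * (N%:R ^+ 2 * Edir u)) `^ (p / 2).
  have hb : b 0%N <= lam `^ (p - 2) * n2 mu u.
    rewrite /b /D expr0 mulr1.
    have [_ h] := lev_int lam0 su.
    by rewrite (powR_sqrM (ltW lam0) p2) -mulrA ler_wpM2l ?powR_ge0.
  have x0 : 0 <= lam `^ (p - 2) * n2 mu u by rewrite mulr_ge0 ?powR_ge0 ?n2_ge0.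
  have y0 := powR_ge0 (K * (N%:R ^+ 2 * Edir u)) (p / 2).
  by rewrite /M ge_max; apply/andP; split; move: hb x0 y0; lra.
have E1 : (K * (N%:R ^+ 2 * Edir u)) `^ (p / 2) =
    (K * N%:R ^+ 2) `^ (p / 2) * Edir u `^ (p / 2).
  by rewrite mulrA powRM ?Edir_ge0 ?mulr_ge0 ?sqr_ge0.
rewrite /sobolev_const -/K; move: MS hM; rewrite E1 => MS hM.
have h1 : \sum_(k < n) b k <= 2 * (lam `^ (p - 2) * n2 mu u +
  (K * N%:R ^+ 2) `^ (p / 2) * Edir u `^ (p / 2)).
  by apply: le_trans hM _; rewrite ler_wpM2l.
have := ler_wpM2l (powR_ge0 2 p) h1; rewrite /b /D; lra.
Qed.

Lemma measurable_powR_norm u q : measurable_fun [set: 'rV[R]_N] u ->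
  measurable_fun [set: 'rV[R]_N] (fun x => `|u x| `^ q).
Proof.
move=> m_u; apply: (@measurableT_comp _ _ _ _ _ _ (@powR R ^~ q)); first exact: measurable_powR.
exact: measurableT_comp.
Qed.

(** Between two consecutive heights |u|^p is at most 2^p times the p-th power of the lower one, so
    finitely many levels bound the part of |u|^p below height lam 2^n; Fatou removes the cap. *)
Lemma sobolev_lev u lam : 0 < lam -> H1 u ->
  intg mu (fun x => lev u lam x * `|u x| `^ p) /\
  \int[mu]_x (lev u lam x * `|u x| `^ p) <=
  sobolev_const * Edir u `^ (p / 2) + 2 `^ p * 2 * (lam `^ (p - 2) * n2 mu u).
Proof.
move=> lam0 Hu; have su := H1_sqint Hu; have [m_u _] := su.
have s0 (k : nat) : 0 < lam * 2 ^+ k by rewrite mulr_gt0// exprn_gt0.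
have p0 : 0 <= p by have := critical_exponent_gt2; lra.
pose G n x := 2 `^ p * \sum_(k < n) (lam * 2 ^+ k) `^ p * lev u (lam * 2 ^+ k) x.
have iG n : intg mu (G n).
  apply: intgZ; apply: intg_sum => k; apply: intgZ.
  by have [] := lev_int (s0 k) su.
have GE n : \int[mu]_x G n x = 2 `^ p * \sum_(k < n) (lam * 2 ^+ k) `^ p * \int[mu]_x lev u (lam
  * 2 ^+ k) x.
  rewrite /G intZ; last by apply: intg_sum => k; apply: intgZ; have [] := lev_int (s0 k) su.
  congr (_ * _); rewrite int_sum; last by move=> k; apply: intgZ; have [] := lev_int (s0 k) su.
  by apply: eq_bigr => k _; rewrite intZ//; have [] := lev_int (s0 k) su.
pose F n x := (1 - lev u (lam * 2 ^+ n) x) * (lev u lam x * `|u x| `^ p).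
have F0 n x : 0 <= F n x.
  by rewrite !mulr_ge0 ?powR_ge0 ?lev_ge0// /lev; case: (_ < _); rewrite ?subrr ?subr0.
have FG n x : F n x <= G n x.
  rewrite /F /G; elim: n => [|n IH].
    rewrite expr0 mulr1 big_ord0 mulr0 /lev; case: (_ < _); rewrite ?subrr ?mul0r ?mulr0//.
  rewrite big_ord_recr/= mulrDr.
  have Y0 : 0 <= 2 `^ p * ((lam * 2 ^+ n) `^ p * lev u (lam * 2 ^+ n) x).
    by rewrite !mulr_ge0 ?powR_ge0 ?lev_ge0.
  have [h|h] := ltP (lam * 2 ^+ n) `|u x|; last first.
    apply: le_trans (le_trans IH _); last by rewrite lerDl.
    rewrite ler_wpM2r ?mulr_ge0 ?lev_ge0 ?powR_ge0// {2}/lev ltNge h/= subr0.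
    by rewrite gerBl lev_ge0.
  have S0 : 0 <= 2 `^ p * \sum_(k < n) (lam * 2 ^+ k) `^ p * lev u (lam * 2 ^+ k) x.
    by rewrite mulr_ge0 ?powR_ge0// sumr_ge0// => k _; rewrite mulr_ge0 ?powR_ge0 ?lev_ge0.
  apply: le_trans (_ : _ <= 2 `^ p * ((lam * 2 ^+ n) `^ p * lev u (lam * 2 ^+ n) x)) _;
    last by rewrite lerDr.
  have -> : lev u (lam * 2 ^+ n) x = 1 by rewrite /lev h.
  have hl : lev u lam x <= 1 by rewrite /lev; case: (_ < _).
  rewrite mulr1 {1}/lev; case: ltP => h'; first by rewrite subrr mul0r mulr_ge0 ?powR_ge0.
  rewrite subr0 mul1r; apply: le_trans (ler_piMl (powR_ge0 _ _) hl) _.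
  rewrite -powRM ?(ltW (s0 n))//; apply: ge0_ler_powR;
    [exact: p0|by rewrite nnegrE|by rewrite nnegrE mulr_ge0// ltW|].
  by apply: le_trans h' _; rewrite exprS mulrCA.
have mF n : measurable_fun [set: 'rV[R]_N] (F n).
  apply: measurable_funM; first by apply: measurable_funB => //; exact: measurable_lev.
  apply: measurable_funM; first exact: measurable_lev.
  exact: measurable_powR_norm.
have iF n : intg mu (F n) by apply: intg_le (iG n) => // x; rewrite ger0_norm.
have [||||||i1 i2] := @fatou_bound _ _ _ mu F (fun x => lev u lam x * `|u x| `^ p)
   (sobolev_const * Edir u `^ (p / 2) + 2 `^ p * 2 * (lam `^ (p - 2) * n2 mu u)) => //.
- move=> n; apply: le_trans (int_le (iF n) (iG n) (FG n)) _.
  by rewrite GE; exact: sobolev_level_sum.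
- by apply: measurable_funM; [exact: measurable_lev|exact: measurable_powR_norm].
- apply: aeW => x.
  have [n hn] : exists n : nat, `|u x| <= lam * 2 ^+ n.
    have [n hn] : exists n : nat, `|u x| / lam <= n%:R.
      by exists (Num.truncn (`|u x| / lam)).+1; rewrite ltW// truncnS_gt.
    exists n; move: hn; rewrite ler_pdivrMr// mulrC => /le_trans; apply.
    rewrite ler_wpM2l ?(ltW lam0)// -natrX ler_nat; exact/ltnW/ltn_expl.
  apply: (@cvg_trans _ (cst (lev u lam x * `|u x| `^ p) @ \oo)); last exact: cvg_cst.
  apply: near_eq_cvg; exists n => // m /= nm_; rewrite /F.
  have -> : lev u (lam * 2 ^+ m) x = 0.
    rewrite /lev ltNge (le_trans hn)// ler_wpM2l ?(ltW lam0)//.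
    by rewrite ler_weXn2l// ler1n.
  by rewrite subr0 mul1r.
- by move=> x; rewrite mulr_ge0 ?lev_ge0 ?powR_ge0.
Qed.

(** Where |u| is at most [lam], |u|^p is at most lam^(p-2) u^2. This part and the base level
    together carry the factor lam^(p-2), which vanishes with [lam]. *)
Lemma sobolev u : H1 u ->
  intg mu (fun x => `|u x| `^ p) /\
  \int[mu]_x `|u x| `^ p <= sobolev_const * Edir u `^ (p / 2).
Proof.
move=> Hu; have su := H1_sqint Hu; have [m_u iu] := su.
have p2 := critical_exponent_gt2.
have key lam : 0 < lam -> intg mu (fun x => `|u x| `^ p) /\
  \int[mu]_x `|u x| `^ p <= sobolev_const * Edir u `^ (p / 2) +
    lam `^ (p - 2) * ((2 `^ p * 2 + 1) * n2 mu u).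
  move=> lam0; have [i1 i2] := sobolev_lev lam0 Hu.
  have le1 x : `|u x| `^ p <= lev u lam x * `|u x| `^ p + lam `^ (p - 2) * u x ^+ 2.
    rewrite /lev; case: ltP => h.
      by rewrite mul1r lerDl mulr_ge0 ?powR_ge0 ?sqr_ge0.
    rewrite mul0r add0r -[u x ^+ 2]real_normK ?num_real//.
    rewrite (powR_sqrM (normr_ge0 _) p2) ler_wpM2r ?sqr_ge0//; apply: ge0_ler_powR;
      rewrite ?nnegrE ?(ltW lam0)//; lra.
  have i3 : intg mu (fun x => lev u lam x * `|u x| `^ p + lam `^ (p - 2) * u x ^+ 2).
    by apply: intgD => //; exact: intgZ.
  have i4 : intg mu (fun x => `|u x| `^ p).
    apply: intg_le i3; first exact: measurable_powR_norm.
    by move=> x; rewrite ger0_norm ?powR_ge0.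
  split=> //; have := int_le i4 i3 le1.
  rewrite intD//; last exact: intgZ.
  by rewrite intZ// -/(n2 mu u); move: i2; lra.
split; first by have [] := key 1 ltr01.
apply/ler_addgt0Pr => e e0.
pose A := (2 `^ p * 2 + 1) * n2 mu u + 1.
have A0 : 0 < A by rewrite ltr_wpDl// mulr_ge0 ?n2_ge0// addr_ge0// mulr_ge0 ?powR_ge0.
pose lam := (e / A) `^ (p - 2)^-1.
have eA : 0 < e / A by rewrite divr_gt0.
have [_ h] := key lam (powR_gt0 _ eA).
apply: le_trans h _; rewrite lerD2l /lam -powRrM mulVf; last by rewrite gt_eqF// subr_gt0.
rewrite powRr1 ?(ltW eA)// mulrAC ler_pdivrMr// ler_wpM2l ?(ltW e0)//.
by rewrite /A lerDl.
Qed.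

End Sobolev.

(** * Weak compactness along an ultrafilter *)

Section UltraLimits.
Context {R : realType} {U : set_system nat} {UU : UltraFilter U}.
Let FU : Filter U. Proof. exact: filter_filter. Qed.

Lemma ultra_bounded_cvg (x : nat -> R) (M : R) : (forall n, `|x n| <= M) ->
  exists l : R, x n @[n --> U] --> l.
Proof.
move=> xM; have cK := @segment_compact R (- M) M.
have PF : ProperFilter (x n @[n --> U]) by exact: fmap_proper_filter.
have [] := cK _ PF.
  by apply: (@filterE _ U) => n /=; rewrite in_itv/= -ler_norml.
move=> l [_ cl]; exists l => B nB.
have [//|nUB] := in_ultra_setVsetC (x @^-1` B) UU.
have [y []] := cl (~` B) B nUB nB.
by move=> ? ?; exfalso.
Qed.

Lemma ultra_cvg_sum (I : Type) (s : seq I) (a : I -> nat -> R) (l : I -> R) :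
  (forall j, a j n @[n --> U] --> l j) ->
  \sum_(j <- s) a j n @[n --> U] --> \sum_(j <- s) l j.
Proof.
move=> al; elim: s => [|j s IH].
  by under eq_fun do rewrite big_nil; rewrite big_nil; exact: cvg_cst.
by under eq_fun do rewrite big_cons; rewrite big_cons; apply: cvgD.
Qed.

Context {N : nat}.
Implicit Types (f : nat -> 'rV[R]_N -> R) (g w phi : 'rV[R]_N -> R).
Local Notation mu := (lebesgue_rV R N).
Local Notation cube := (@cube R N).

(** Along an ultrafilter the pairings with all functions converge simultaneously, without diagonal
    extraction. The limit functional is bounded, [riesz_test] represents it on test functions, and
    density extends the convergence to L2. *)
Lemma weak_compact_L2 f (K : R) : 0 <= K -> (forall n, sqint mu (f n)) ->
  (forall n, nm mu (f n) <= K) ->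
  exists2 w, sqint mu w & forall g, sqint mu g ->
    ip mu (f n) g @[n --> U] --> ip mu w g.
Proof.
move=> K0 sf fK.
have bd g n : sqint mu g -> `|ip mu (f n) g| <= K * nm mu g.
  by move=> sg; apply: le_trans (cauchy_schwarz (sf n) sg) _; rewrite ler_wpM2r ?nm_ge0.
pose L g : R := lim (ip mu (f n) g @[n --> U]).
have LP g : sqint mu g -> ip mu (f n) g @[n --> U] --> L g.
  move=> sg; have [l lP] := ultra_bounded_cvg (fun n => bd g n sg).
  by rewrite /L (cvg_lim (@Rhausdorff R) lP).
have LE g (l : R) : ip mu (f n) g @[n --> U] --> l -> L g = l.
  by move=> h; exact: (cvg_lim (@Rhausdorff R) h).
have [||||w [sw wK wP]] := @riesz_test R N L K.
- by [].
- move=> phi psi tp tq; have sp := test_sqint tp; have sq := test_sqint tq.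
  apply: LE; under eq_fun do rewrite ipC ipDl// ![ip mu _ (f _)]ipC.
  by apply: cvgD; exact: LP.
- move=> c phi tp; have sp := test_sqint tp.
  apply: LE; under eq_fun do rewrite ipC ipZl// [ip mu _ (f _)]ipC.
  by apply: cvgMr; exact: LP.
- move=> phi tp; have sp := test_sqint tp.
  have h := cvg_norm (LP _ sp).
  by apply: (cvgr_to_le (h FU)); apply: nearW => n; exact: bd.
exists w => // g sg; apply/cvgrPdist_le => e e0.
pose q := 2 * K + 1.
have q0 : 0 < q by rewrite /q; lra.
pose dl := e / 2 / q.
have dl0 : 0 < dl by rewrite !divr_gt0.
have [phi tp hp] := test_dense sg (exprn_gt0 2 dl0).
have sp := test_sqint tp.
have hd : nm mu (fun x => g x - phi x) <= dl.
  by rewrite -(ler_sqr (nm_ge0 _ _) (ltW dl0)) nm2.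
have e2 : 0 < e / 2 by rewrite divr_gt0.
have := LP _ sp; rewrite wP// => /cvgrPdist_le/(_ _ e2).
apply: filterS => n hn.
have E h : sqint mu h -> ip mu h g = ip mu h phi + ip mu h (fun x => g x - phi x).
  by move=> sh; rewrite [RHS]addrC ![ip mu h _]ipC ipBl// subrK.
rewrite (E w)// (E (f n))//.
have h1 := bd _ n (sqintB sg sp).
have h2 := cauchy_schwarz sw (sqintB sg sp).
have h3 : nm mu w * nm mu (fun x => g x - phi x) <= K * nm mu (fun x => g x - phi x).
  by rewrite ler_wpM2r ?nm_ge0.
have h4 : K * nm mu (fun x => g x - phi x) <= K * dl by rewrite ler_wpM2l.
have h5 : dl * q = e / 2 by rewrite /dl divfK// gt_eqF.
rewrite (_ : _ - _ = (ip mu w phi - ip mu (f n) phi) +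
   (ip mu w (fun x => g x - phi x) - ip mu (f n) (fun x => g x - phi x))); last by ring.
apply: le_trans (ler_normD _ _) _.
have := ler_normB (ip mu w (fun x => g x - phi x)) (ip mu (f n) (fun x => g x - phi x)).
by move: hn h1 h2 h3 h4 h5; rewrite /q; lra.
Qed.

Lemma weak_compact_H1 f (M : R) : (forall n, H1 (f n)) ->
  (forall n, n2 mu (f n) <= M) -> (forall n, Edir (f n) <= M) ->
  exists w, [/\ H1 w, forall g, sqint mu g -> ip mu (f n) g @[n --> U] --> ip mu w g &
    forall v, H1 v -> Dip (f n) v @[n --> U] --> Dip w v].
Proof.
move=> Hf fM EM; have sf n := H1_sqint (Hf n).
have nK g : n2 mu g <= M -> nm mu g <= Num.sqrt M.
  move=> h; rewrite /nm ler_sqrt//; exact: le_trans (n2_ge0 mu _) h.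
have [w sw wP] := weak_compact_L2 (sqrtr_ge0 M) sf (fun n => nK _ (fM n)).
have Hg i : exists h, sqint mu h /\
    forall g, sqint mu g -> ip mu (wpartial i (f n)) g @[n --> U] --> ip mu h g.
  have [|g sg gP] := @weak_compact_L2 (fun n =>
    wpartial i (f n)) (Num.sqrt M) (sqrtr_ge0 M) (fun n => wpartial_sqint i (Hf n)).
    by move=> n; apply: nK; apply: le_trans (n2_wpartial_le i (Hf n)) (EM n).
  by exists g.
have [gg ggP] := choice Hg.
have wg i : weak_partial i w (gg i).
  apply/weak_partialE => phi tp; have sp := test_sqint tp.
  have h1 := wP _ (test_sqint (test_partial i tp)).
  have h2 := cvgN ((ggP i).2 _ sp).
  apply: (cvg_unique _ h1); first exact: Rhausdorff.
  apply: cvg_trans (h2 FU); apply: near_eq_cvg; apply: nearW => n /=.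
  have [_ /weak_partialE ->//] := wpartialP i (Hf n).
have Hw : H1 w by apply: (H1_intro sw (fun i => (ggP i).1) wg).
exists w; split => // v Hv.
have -> : Dip w v = \sum_i ip mu (gg i) (wpartial i v).
  apply: eq_bigr => i _; apply: ae_eq_ip.
  - by have [] := wpartial_sqint i Hw.
  - by have [[]] := ggP i.
  - by have [] := wpartial_sqint i Hv.
  - exact: wpartial_ae (ggP i).1 (wg i).
rewrite /Dip; apply: ultra_cvg_sum => i; by apply: (ggP i).2; exact: wpartial_sqint.
Qed.

(* Local averages of a weakly null sequence are equicontinuous and tend to zero
   pointwise, hence uniformly on compact sets. *)
Lemma avg_unif_cvg0 f (M l r kp : R) : 0 < l -> 0 < kp -> (forall n, H1 (f n)) ->
  (forall n, Edir (f n) <= M) ->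
  (forall g, sqint mu g -> ip mu (f n) g @[n --> U] --> (0 : R)) ->
  \forall n \near U, cube r `<=` [set x | `|avg l (f n) x| <= kp].
Proof.
move=> l0 kp0 Hf EM f0; have sf n := H1_sqint (Hf n).
have M0 : 0 <= M by exact: le_trans (Edir_ge0 _) (EM 0%N).
have /compact_near_coveringP cov := @compact_cube R N r.
apply: (cov nat U (fun n x => `|avg l (f n) x| <= kp) FU) => x _.
pose A := Num.sqrt (l^-1 ^+ N) * (N%:R * Num.sqrt M) + 1.
have A0 : 0 < A by rewrite ltr_wpDl// !mulr_ge0 ?sqrtr_ge0.
pose dl := kp / 2 / A.
have dl0 : 0 < dl by rewrite !divr_gt0.
have kp2 : 0 < kp / 2 by rewrite divr_gt0.
have ax : avg l (f n) x @[n --> U] --> (0 : R).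
  rewrite (_ : (fun n => _) = (fun n => l^-1 ^+ N * ip mu (f n) (fun y =>
    chi (l^-1 *: (y - x))))); last first.
    by apply/funext => n; rewrite avg_ip.
  by rewrite -(mulr0 (l^-1 ^+ N)); apply: cvgMr; apply: f0; exact: sqint_avg_kernel.
exists (ball x dl, [set n | `|avg l (f n) x| <= kp / 2]).
  split; first exact: nbhsx_ballx.
  exact: (cvgr0_norm_le _ ax _ kp2).
move=> [y n]/= [[_ xy] hn].
have E : avg l (f n) y = avg l (f n) x + avg l (fun z => f n (z + (y - x)) - f n z) x.
  rewrite avgB//; last exact: sqint_translate.
  by rewrite -avg_translate [x + (y - x)]addrC subrK addrC subrK.
rewrite E; apply: le_trans (ler_normD _ _) _.
suff : `|avg l (fun z => f n (z + (y - x)) - f n z) x| <= kp / 2 by move: hn; lra.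
have sd := sqintB (@sqint_translate R N (y - x) (f n) (sf n)) (sf n).
have := avg_sqr_le x l0 sd => h.
apply: (@le_trans _ _ (Num.sqrt (l^-1 ^+ N) * nm mu (fun z => f n (z + (y - x)) - f n z))).
  rewrite -ler_sqr ?nnegrE ?mulr_ge0 ?sqrtr_ge0 ?nm_ge0// real_normK ?num_real//.
  by rewrite exprMn nm2 sqr_sqrtr// exprn_ge0// invr_ge0 ltW.
have h2 : nm mu (fun z => f n (z + (y - x)) - f n z) <= N%:R * dl * Num.sqrt M.
  apply: le_trans (translate_est _ (Hf n)) _; apply: ler_pM; rewrite ?sumr_ge0 ?sqrtr_ge0//.
    rewrite -[X in X%:R](card_ord N) mulr_natl -sumr_const; apply: ler_sum => i _.
    by rewrite !mxE distrC; apply/ltW/xy.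
  by rewrite ler_sqrt.
apply: le_trans (ler_wpM2l (sqrtr_ge0 _) h2) _.
have h3 : dl * A = kp / 2 by rewrite /dl divfK// gt_eqF.
move: h3; rewrite /A; move: dl0; set S := Num.sqrt _; set T := Num.sqrt _ => dl0 h3.
by rewrite -h3; lra.
Qed.

(** From f^2 <= 2 (f - avg)^2 + 2 avg^2: the first part is at most a multiple of l^2 by [Qa_le], and
    at a fixed scale [l] the averages become uniformly small on the cube by [avg_unif_cvg0]. *)
Lemma rellich f (M r e : R) : 0 < e -> (forall n, H1 (f n)) ->
  (forall n, Edir (f n) <= M) ->
  (forall g, sqint mu g -> ip mu (f n) g @[n --> U] --> (0 : R)) ->
  \forall n \near U, \int[mu]_x (\1_(cube r) x * f n x ^+ 2) <= e.
Proof.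
move=> e0 Hf EM f0; have sf n := H1_sqint (Hf n).
have M0 : 0 <= M by exact: le_trans (Edir_ge0 _) (EM 0%N).
have ic := intg_indic_cube (N := N) r.
pose A := 4 * (N%:R ^+ 2 * M) + 1.
have A0 : 0 < A by rewrite ltr_wpDl// !mulr_ge0.
pose l := Num.min 1 (e / A).
have l0 : 0 < l by rewrite lt_min ltr01 divr_gt0.
have lA : l * A <= e by rewrite -ler_pdivlMr// ge_min lexx orbT.
have l1 : l <= 1 by rewrite ge_min lexx.
pose c := \int[mu]_x \1_(cube r) x : R.
have c0 : 0 <= c by apply: int_ge0 => x; rewrite indicE.
pose kp := Num.min 1 (e / (4 * c + 1)).
have cp : 0 < 4 * c + 1 by lra.
have kp0 : 0 < kp by rewrite lt_min ltr01 divr_gt0.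
have kp1 : kp <= 1 by rewrite ge_min lexx.
have kpc : kp * (4 * c + 1) <= e by rewrite -ler_pdivlMr// ge_min lexx orbT.
apply: filterS (avg_unif_cvg0 r l0 kp0 Hf EM f0) => n hn.
have [mf iff] := sf n.
(* Where |avg| <= kp, the quantity f^2 / 2 - kp^2 lies below (f - avg)^2; its positive part on the
   cube is a measurable minorant suited to [avg_le_Qa]. *)
pose h x := \1_(cube r) x * Num.max 0 (f n x ^+ 2 / 2 - kp ^+ 2).
have [|||ih hQ] := @avg_le_Qa _ _ l (f n) h l0 (sf n).
- apply: measurable_funM; first exact: measurable_indic_cube.
  apply: measurable_maxr => //; apply: measurable_funB => //; apply: measurable_funM => //.
  exact: measurable_funX.
- by move=> x; rewrite mulr_ge0 ?indicE// le_max lexx.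
- move=> x; rewrite /h indicE; have [/set_mem cx|_] := boolP (x \in _);
  last by rewrite mul0r sqr_ge0.
  rewrite mul1r ge_max sqr_ge0/=.
  have ha := hn x cx.
  have ha2 : avg l (f n) x ^+ 2 <= kp ^+ 2.
    by rewrite -[leLHS]real_normK ?num_real//; apply: lerXn2r; rewrite ?nnegrE ?(ltW kp0).
  have := sqr_ge0 (f n x - 2 * avg l (f n) x); move: ha2; lra.
have i1 : intg mu (fun x => \1_(cube r) x * f n x ^+ 2).
  apply: intg_le iff; first by apply: measurable_funM;
    [exact: measurable_indic_cube|exact: measurable_funX].
  by move=> x; rewrite normrM [`|f n x ^+ 2|]ger0_norm ?sqr_ge0// ler_piMl ?sqr_ge0// indic_le1.
have i2 : intg mu (fun x => 2 * h x + 2 * kp ^+ 2 * \1_(cube r) x) by apply: intgD; exact: intgZ.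
apply: le_trans (int_le i1 i2 _) _.
  move=> x; rewrite /h; set I := \1_(cube r) x.
  have I0 : 0 <= I by rewrite /I indicE.
  have : f n x ^+ 2 / 2 - kp ^+ 2 <= Num.max 0 (f n x ^+ 2 / 2 - kp ^+ 2) by rewrite le_max lexx
    orbT.
  by move=> /(ler_wpM2l I0); lra.
rewrite intD ?intZ//; [|exact: intgZ|exact: intgZ].
rewrite -/c.
have hE := le_trans hQ (Qa_le l0 (Hf n)).
have h5 : (N%:R * l) ^+ 2 * Edir (f n) <= N%:R ^+ 2 * M * l.
  rewrite (_ : _ * Edir _ = N%:R ^+ 2 * (Edir (f n) * l ^+ 2)); last by ring.
  rewrite -mulrA; apply: ler_wpM2l; first exact: sqr_ge0.
  apply: ler_pM; rewrite ?Edir_ge0 ?sqr_ge0//.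
  by rewrite expr2 ler_piMl// ltW.
have h6 : kp ^+ 2 * c <= kp * c by rewrite ler_wpM2r// expr2 ler_piMl// ltW.
by move: hE h5 h6 lA kpc; rewrite /A; lra.
Qed.

(** The way back from the ultrafilter to a sequence. Index [j] is picked where the mass on the j-th
    cube is at most 2^-j, and summability gives convergence almost everywhere; [S j] carries
    whatever else has to hold at that index. *)
Lemma extract_ae f (S : nat -> set nat) : (forall n, sqint mu (f n)) ->
  (forall r e : R, 0 < e -> \forall n \near U, \int[mu]_x (\1_(cube r) x * f n x ^+ 2) <= e) ->
  (forall j, U (S j)) ->
  exists sg : nat -> nat, (forall j, S j (sg j)) /\
    {ae mu, forall x, f (sg j) x @[j --> \oo] --> (0 : R)}.
Proof.
move=> sf fl US.
have e0 j : 0 < 2^-1 ^+ j :> R by rewrite exprn_gt0// invr_gt0.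
have Hs j : exists n, S j n /\ \int[mu]_x (\1_(cube j%:R) x * f n x ^+ 2) <= 2^-1 ^+ j.
  have UF : ProperFilter U by exact: ultra_proper.
  exact: filter_ex (filterI (US j) (fl j%:R _ (e0 j))).
have [sg sgP] := choice Hs.
exists sg; split; first by move=> j; have [] := sgP j.
have iF j : intg mu (fun x => \1_(cube j%:R) x * f (sg j) x ^+ 2).
  have [mf iff] := sf (sg j).
  apply: intg_le iff; first by apply: measurable_funM;
    [exact: measurable_indic_cube|exact: measurable_funX].
  by move=> x; rewrite normrM [`|f _ x ^+ 2|]ger0_norm ?sqr_ge0// ler_piMl ?sqr_ge0// indic_le1.
have geo n : \sum_(k < n) 2^-1 ^+ k <= 2 :> R.
  suff -> : \sum_(k < n) 2^-1 ^+ k = 2 - 2 * 2^-1 ^+ n :> R by rewrite gerBl mulr_ge0// ltW.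
  elim: n => [|n IH]; first by rewrite big_ord0 expr0 mulr1 subrr.
  by rewrite big_ord_recr/= IH exprS; field.
have h := @ae_summable_bounded _ _ _ mu (fun j x => \1_(cube j%:R) x * f (sg j) x ^+ 2) 2.
have {}h : {ae mu, forall x, exists B : R, forall n,
    \sum_(k < n) \1_(cube k%:R) x * f (sg k) x ^+ 2 <= B}.
  apply: h => //; first by move=> j x; rewrite mulr_ge0 ?sqr_ge0// indicE.
  by move=> n; apply: le_trans (geo n); apply: ler_sum => k _; have [] := sgP k.
apply: filterS h => x [B hB].
pose a j := \1_(cube j%:R) x * f (sg j) x ^+ 2.
have a0 j : 0 <= a j by rewrite mulr_ge0 ?sqr_ge0// indicE.
have ac : a j @[j --> \oo] --> (0 : R).
  apply: cvg_series_cvg_0; apply: nondecreasing_is_cvgn.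
    by apply: nondecreasing_series => n _ _; exact: a0.
  exists B => _ [n _ <-]; rewrite /series/= big_mkord; exact: hB.
have [k _ kx] : (\bigcup_k cube k%:R) x by rewrite bigcup_cube.
apply/cvgr0Pnorm_lt => e e1.
apply: filterS2 (nbhs_infty_ge k) (cvgr0_norm_lt _ ac _ (exprn_gt0 2 e1)) => j kj.
rewrite ger0_norm// /a indicE mem_set; last first.
  by apply: (cube_le _ kx); rewrite ler_nat.
by rewrite mul1r -[f _ _ ^+ 2]real_normK ?num_real// ltr_sqr ?nnegrE ?(ltW e1).
Qed.

End UltraLimits.

(** * Nonlinearities of subcritical growth *)

Section Primitive.
Context {R : realType} (f : R -> R) (f_cont : continuous f).
Implicit Types a b s t : R.

Let f_intg a b : (@lebesgue_measure R).-integrable `[a, b] (EFin \o f).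
Proof.
apply: continuous_compact_integrable; first exact: segment_compact.
exact: continuous_subspaceT.
Qed.

(** A fixed lower endpoint removes the sign test on [t] in [primitive], so that the fundamental
    theorem of calculus applies across 0. *)
Let primitiveE (A t : R) : 0 < A -> - A < t < A ->
  primitive f t = \int[lebesgue_measure]_(s in `[- A, t]) f s -
                  \int[lebesgue_measure]_(s in `[- A, 0]) f s.
Proof.
move=> A0 /andP[At tA]; rewrite /primitive; case: ifPn => t0.
  rewrite Rintegral_itvB ?bnd_simp ?(ltW A0)//; last by rewrite lerNl oppr0 ltW.
  by rewrite Rintegral_itv_obnd_cbnd//; apply: integrableS (f_intg 0 t) => //;
    exact: subset_itv_oc_cc.
move: t0; rewrite -ltNge => t0.
rewrite -[RHS]opprB Rintegral_itvB ?bnd_simp ?(ltW At) ?(ltW t0)//.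
by rewrite Rintegral_itv_obnd_cbnd//; apply: integrableS (f_intg t 0) => //;
  exact: subset_itv_oc_cc.
Qed.

Lemma is_derive_primitive t : is_derive t 1 (primitive f) (f t).
Proof.
pose A := `|t| + 1.
have A0 : 0 < A by rewrite ltr_wpDl.
have tA : - A < t < A by rewrite -ltr_norml /A ltrDl.
have /andP[At At'] := tA.
have [d e] := @continuous_FTC1_closed _ f (- A) t A At' (f_intg _ _) At (@f_cont t).
have h : is_derive t 1 (fun t => \int[lebesgue_measure]_(s in `[- A, t]) f s) (f t).
  by apply: DeriveDef => //; rewrite -e derive1E.
have h2 : is_derive t 1 (fun t => \int[lebesgue_measure]_(s in `[- A, t]) f s -
    \int[lebesgue_measure]_(s in `[- A, 0]) f s) (f t).
  have [d2 e2] := @is_deriveB _ _ _ _ (cst (\int[lebesgue_measure]_(s in `[- A,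
    0]) f s)) t 1 _ _ h (is_derive_cst _ _ _).
  by apply: DeriveDef; [exact: d2|rewrite [LHS]e2 subr0].
apply: near_eq_is_derive h2.
have tI : t \in `](- A), A[ by rewrite in_itv.
by apply: filterS (near_in_itvoo tI) => s; rewrite in_itv/= => sI; rewrite (primitiveE A0 sI).
Qed.

Lemma primitive0 : primitive f 0 = 0.
Proof. by rewrite (@primitiveE 1) ?subrr// ltr01 andbT oppr_lt0 ltr01. Qed.

Lemma continuous_primitive : continuous (primitive f).
Proof.
move=> t; have [d _] := is_derive_primitive t.
by apply: differentiable_continuous; exact/derivable1_diffP.
Qed.

Lemma primitive_mvt a b :
  exists2 th : R, 0 <= th <= 1 & primitive f (a + b) - primitive f a = f (a + th * b) * b.
Proof.
pose g s := primitive f (a + s * b).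
have dg (s : R) : is_derive s 1 g (f (a + s * b) * b).
  have h1 : is_derive s 1 (fun s : R => a + s * b) b.
    have [d2 e2] := @is_deriveD _ _ _ (cst a) (fun s : R => s * b) s 1 _ _ (is_derive_cst _ _ _)
      (@is_deriveM _ _ id (cst b) s 1 _ _ (is_derive_id _ _) (is_derive_cst _ _ _)).
    by apply: DeriveDef; [exact: d2|rewrite [LHS]e2 scaler0 !add0r [_ *: _]mulr1].
  exact: is_derive1_comp (is_derive_primitive _) h1.
have cg : {within `[0, 1], continuous g}.
  by apply: derivable_within_continuous => s _; have [] := dg s.
have [c cI E] := @MVT _ g (fun s => f (a + s * b) * b) 0 1 ltr01 (fun s _ => dg s) cg.
exists c; first by move: cI; rewrite in_itv/= => /andP[/ltW-> /ltW->].
by move: E; rewrite /g mul1r mul0r addr0 subr0 mulr1.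
Qed.

End Primitive.

Lemma powR_addr_le (R : realType) (a b q : R) : 0 <= a -> 0 <= b -> 0 <= q ->
  (a + b) `^ q <= 2 `^ q * (a `^ q + b `^ q).
Proof.
move=> a0 b0 q0; wlog ab : a b a0 b0 / a <= b.
  by move=> W; have [/W|/ltW/W] := leP a b; [exact|rewrite addrC [b `^ q + _]addrC; exact].
apply: (@le_trans _ _ (2 `^ q * b `^ q)).
  rewrite -powRM//; apply: ge0_ler_powR; rewrite ?nnegrE ?addr_ge0 ?mulr_ge0//; lra.
by rewrite ler_wpM2l ?powR_ge0// lerDr powR_ge0.
Qed.

(** The growth hypotheses on [f] in quantitative form, with q = p - 1 in all later uses. The absence
    of a constant term in the global bound encodes the smallness of [f] at 0. *)
Definition admissible (R : realType) (q : R) (f : R -> R) : Prop :=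
  [/\ 1 < q, continuous f,
    exists2 C : R, 0 < C & forall t : R, `|f t| <= C * (`|t| + `|t| `^ q),
    forall e : R, 0 < e -> exists2 d : R, 0 < d & forall t : R, `|t| <= d -> `|f t| <= e * `|t| &
    forall e : R, 0 < e -> exists2 M : R, 0 < M & forall t : R, M <= `|t| -> `|f t| <=
      e * `|t| `^ q].

Section Growth.
Context {R : realType} (q : R) (f : R -> R) (af : admissible q f).
Implicit Types (a b t e : R).
Local Notation F := (primitive f).
Local Notation p := (q + 1).

Let q1 : 1 < q. Proof. by case: af. Qed.
Let q0 : 0 <= q. Proof. by rewrite ltW// (lt_trans _ q1). Qed.
Let fc : continuous f. Proof. by case: af. Qed.

Let powp t : 0 <= t -> t `^ p = t * t `^ q.
Proof. by move=> t0; rewrite -(@mulr_powRB1 _ t p)// ?addrK// ltr_wpDl. Qed.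

Let monoq a b : 0 <= a -> a <= b -> a `^ q <= b `^ q.
Proof. by move=> a0 ab; apply: ge0_ler_powR; rewrite ?nnegrE// (le_trans a0). Qed.

Lemma primitive_growth : exists2 C : R, 0 < C & forall t, `|F t| <= C * (t ^+ 2 + `|t| `^ p).
Proof.
have [_ _ [C C0 fC] _ _] := af; exists C => // t.
have [th /andP[th0 th1] E] := primitive_mvt fc 0 t.
move: E; rewrite !add0r primitive0// subr0 => ->; rewrite normrM.
have ht : `|th * t| <= `|t| by rewrite normrM (ger0_norm th0) ler_piMl.
have h : `|f (th * t)| <= C * (`|t| + `|t| `^ q).
  by apply: le_trans (fC _) _; rewrite ler_pM2l// lerD// monoq.
apply: le_trans (ler_wpM2r (normr_ge0 t) h) _.
rewrite powp// -[t ^+ 2]real_normK ?num_real// le_eqVlt; apply/orP; left; apply/eqP; ring.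
Qed.

Lemma primitive_small e : 0 < e -> exists2 C : R, 0 < C &
  forall t, `|F t| <= e * t ^+ 2 + C * `|t| `^ p.
Proof.
move=> e0; have [_ _ _ /(_ e e0)[d d0 fd] _] := af.
have [C C0 FC] := primitive_growth.
have dq : 0 < d `^ (q - 1) by rewrite powR_gt0.
exists (C * ((d `^ (q - 1))^-1 + 1)) => [|t].
  by rewrite mulr_gt0// ltr_wpDl// invr_ge0 ltW.
have [td|td] := leP `|t| d.
  apply: le_trans (_ : _ <= e * t ^+ 2) _; last first.
    by rewrite lerDl !mulr_ge0 ?powR_ge0 ?addr_ge0 ?invr_ge0 ?(ltW dq) ?(ltW C0).
  have [th /andP[th0 th1] E] := primitive_mvt fc 0 t.
  move: E; rewrite !add0r primitive0// subr0 => ->; rewrite normrM.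
  have ht : `|th * t| <= `|t| by rewrite normrM (ger0_norm th0) ler_piMl.
  have h : `|f (th * t)| <= e * `|t|.
    by apply: le_trans (fd _ (le_trans ht td)) _; rewrite ler_pM2l.
  apply: le_trans (ler_wpM2r (normr_ge0 t) h) _.
  by rewrite -mulrA -expr2 real_normK ?num_real.
apply: le_trans (FC t) _.
have t0 : 0 <= `|t| by [].
have q12 : 0 <= q - 1 by rewrite subr_ge0 ltW.
have h1 : t ^+ 2 <= (d `^ (q - 1))^-1 * `|t| `^ p.
  rewrite (powR_sqrM t0); last by move: q1; lra.
  rewrite mulrA real_normK ?num_real// ler_peMl ?sqr_ge0// mulrC ler_pdivlMr// mul1r.
  rewrite (_ : q + 1 - 2 = q - 1); last by ring.
  by apply: ge0_ler_powR; rewrite ?nnegrE ?(ltW d0) ?(ltW td).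
have h2 : 0 <= e * t ^+ 2 by rewrite mulr_ge0 ?sqr_ge0 ?(ltW e0).
have := ler_wpM2l (ltW C0) h1; lra.
Qed.

(** Beyond [M] the value at [t] is compared with the value at the point [s] of modulus [M] on the
    same ray; the increment only involves [f] at arguments of modulus between [M] and |t|, where it
    is a small multiple of the power. *)
Lemma primitive_big e : 0 < e -> exists2 C : R, 0 < C &
  forall t, `|F t| <= C * t ^+ 2 + e * `|t| `^ p.
Proof.
move=> e0; have [_ _ _ _ /(_ e e0)[M M0 fM]] := af.
have [C C0 FC] := primitive_growth.
pose K := C * (1 + M `^ (q - 1)).
have q12 : 0 <= q - 1 by rewrite subr_ge0 ltW.
have K0 : 0 < K by rewrite mulr_gt0// ltr_wpDr ?powR_ge0.
have small t : `|t| <= M -> `|F t| <= K * t ^+ 2.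
  move=> tM; apply: le_trans (FC t) _; rewrite /K -mulrA ler_pM2l// mulrDl mul1r lerD2l.
  rewrite (powR_sqrM (normr_ge0 t)); last by move: q1; lra.
  rewrite real_normK ?num_real// ler_wpM2r ?sqr_ge0//.
  rewrite (_ : q + 1 - 2 = q - 1); last by ring.
  by apply: ge0_ler_powR; rewrite ?nnegrE ?(ltW M0).
exists K => // t; have [tM|tM] := leP `|t| M.
  by apply: le_trans (small t tM) _; rewrite lerDl mulr_ge0 ?powR_ge0 ?ltW.
pose s := M / `|t| * t.
have t0 : 0 < `|t| by exact: lt_trans M0 tM.
have ns : `|s| = M by rewrite /s !normrM normfV !normr_id divfK ?gt_eqF// ger0_norm ?ltW.
have [th /andP[th0 th1] E] := primitive_mvt fc s (t - s).
move: E; rewrite [s + (t - s)]addrC subrK => E.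
have -> : F t = F s + f (s + th * (t - s)) * (t - s) by rewrite -E addrC subrK.
apply: le_trans (ler_normD _ _) _; apply: lerD.
  apply: le_trans (small s _) _; first by rewrite ns.
  rewrite ler_pM2l// -[s ^+ 2]real_normK ?num_real// -[t ^+ 2]real_normK ?num_real//.
  by rewrite ler_sqr ?nnegrE// ns ltW.
pose c := M / `|t|.
have c0 : 0 <= c by rewrite divr_ge0 ?ltW.
have c1 : c <= 1 by rewrite ler_pdivrMr// mul1r ltW.
have E1 : s + th * (t - s) = (c + th * (1 - c)) * t by rewrite /s -/c; ring.
have th1c : 0 <= th * (1 - c) by rewrite mulr_ge0// subr_ge0.
have k0 : 0 <= c + th * (1 - c) by rewrite addr_ge0.
have k1 : c + th * (1 - c) <= 1.
  have : th * (1 - c) <= 1 * (1 - c) by rewrite ler_wpM2r// subr_ge0.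
  lra.
have nE : `|s + th * (t - s)| = (c + th * (1 - c)) * `|t| by rewrite E1 normrM ger0_norm.
have hM : M <= `|s + th * (t - s)|.
  rewrite nE mulrDl /c divfK ?gt_eqF// lerDl mulr_ge0//.
have hle : `|s + th * (t - s)| <= `|t| by rewrite nE ler_piMl.
have h : `|f (s + th * (t - s))| <= e * `|t| `^ q.
  by apply: le_trans (fM _ hM) _; rewrite ler_pM2l// monoq.
have ht : `|t - s| <= `|t|.
  have -> : t - s = (1 - c) * t by rewrite /s -/c; ring.
  by rewrite normrM ger0_norm ?subr_ge0// ler_piMl// gerBl.
rewrite normrM powp// mulrCA mulrC; exact: ler_pM.
Qed.

(* If |a| <= h |b| the mean value theorem gives a small multiple of b^2 + |b|^p;
   otherwise |b| is controlled by |a|. *)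
Lemma primitive_split e : 0 < e -> exists2 C : R, 0 < C & forall a b,
  `|F (a + b) - F a - F b| <= e * (b ^+ 2 + `|b| `^ p) + C * (a ^+ 2 + `|a| `^ p).
Proof.
move=> e0; have [_ _ [C C0 fC] _ _] := af; have [D D0 FD] := primitive_growth.
pose B := C * (2 + 2 `^ q).
have B0 : 0 < B by rewrite mulr_gt0// ltr_wpDr ?powR_ge0.
pose h := Num.min 1 (e / B).
have h0 : 0 < h by rewrite lt_min ltr01 divr_gt0.
have h1 : h <= 1 by rewrite ge_min lexx.
have hB : h * B <= e by rewrite -ler_pdivlMr// ge_min lexx orbT.
have G0 t : 0 <= t ^+ 2 + `|t| `^ p by rewrite addr_ge0 ?sqr_ge0 ?powR_ge0.
pose L := 1 + h^-1.
have L1 : 1 <= L by rewrite lerDl invr_ge0 ltW.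
pose K := D * (L ^+ 2 + L `^ p + 1 + (L ^+ 2 + L `^ p)).
have L20 : 0 <= L ^+ 2 + L `^ p by rewrite addr_ge0 ?sqr_ge0 ?powR_ge0.
have K0 : 0 <= K by rewrite mulr_ge0 ?(ltW D0)// !addr_ge0 ?sqr_ge0 ?powR_ge0.
exists (K + D) => [|a b]; first by rewrite ltr_wpDl.
have scal (t : R) : `|t| <= L * `|a| -> t ^+ 2 + `|t| `^ p <= (L ^+ 2 + L `^ p) * (a ^+ 2 +
  `|a| `^ p).
  move=> ta.
  have La : 0 <= L * `|a| by rewrite mulr_ge0// (le_trans _ L1).
  have x1 : t ^+ 2 <= L ^+ 2 * a ^+ 2.
    rewrite -[t ^+ 2]real_normK ?num_real// -[a ^+ 2]real_normK ?num_real// -exprMn.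
    by apply: lerXn2r; rewrite ?nnegrE.
  have x2 : `|t| `^ p <= L `^ p * `|a| `^ p.
    rewrite -powRM ?(le_trans _ L1)//; apply: ge0_ler_powR; rewrite ?nnegrE ?addr_ge0//.
  have y1 : 0 <= L ^+ 2 * `|a| `^ p by rewrite mulr_ge0 ?sqr_ge0 ?powR_ge0.
  have y2 : 0 <= L `^ p * a ^+ 2 by rewrite mulr_ge0 ?sqr_ge0 ?powR_ge0.
  move: x1 x2 y1 y2; lra.
have [ab|ab] := leP `|a| (h * `|b|).
  have [th /andP[th0 th1] E] := primitive_mvt fc b a.
  have ab1 : `|a| <= `|b| by apply: le_trans ab _; rewrite ler_piMl.
  have hn : `|b + th * a| <= 2 * `|b|.
    apply: le_trans (ler_normD _ _) _; rewrite normrM (ger0_norm th0).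
    have : th * `|a| <= `|a| by rewrite ler_piMl.
    by move: ab1; lra.
  have hf : `|f (b + th * a)| <= C * (2 * `|b| + 2 `^ q * `|b| `^ q).
    apply: le_trans (fC _) _; rewrite ler_pM2l// lerD//.
    by rewrite -powRM//; apply: monoq.
  have hfa : `|f (b + th * a) * a| <= C * (2 * `|b| + 2 `^ q * `|b| `^ q) * (h * `|b|).
    by rewrite normrM; apply: ler_pM.
  have b2E : `|b| * `|b| = b ^+ 2 by rewrite -expr2 real_normK ?num_real.
  have hb : C * (2 * `|b| + 2 `^ q * `|b| `^ q) * (h * `|b|) <= h * B * (b ^+ 2 + `|b| `^ p).
    rewrite powp// -b2E /B.
    have z1 : 0 <= `|b| * `|b| by rewrite mulr_ge0.
    have z2 : 0 <= `|b| * `|b| `^ q by rewrite mulr_ge0 ?powR_ge0.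
    have z3 : 0 <= 2 `^ q * (`|b| * `|b|) by rewrite mulr_ge0 ?powR_ge0.
    have z4 : 0 <= C * h by rewrite mulr_ge0 ?ltW.
    have := mulr_ge0 z4 z2; have := mulr_ge0 z4 z3; lra.
  have -> : F (a + b) - F a - F b = f (b + th * a) * a - F a by rewrite -E [b + a]addrC; ring.
  apply: le_trans (ler_normB _ _) _.
  have := FD a; have := ler_wpM2r (G0 b) hB; have := mulr_ge0 K0 (G0 a).
  move: hfa hb; lra.
have bL : `|b| <= L * `|a|.
  have : `|b| <= h^-1 * `|a| by rewrite mulrC ler_pdivlMr// mulrC ltW.
  by rewrite /L mulrDl mul1r; have := normr_ge0 a; lra.
have abL : `|a + b| <= L * `|a|.
  apply: le_trans (ler_normD _ _) _; rewrite /L mulrDl mul1r lerD2l.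
  by rewrite mulrC ler_pdivlMr// mulrC ltW.
have F1 := le_trans (FD (a + b)) (ler_wpM2l (ltW D0) (scal _ abL)).
have F2 := le_trans (FD b) (ler_wpM2l (ltW D0) (scal _ bL)).
have F3 := FD a.
apply: le_trans (ler_normB _ _) _; have := ler_normB (F (a + b)) (F a).
have := mulr_ge0 (ltW e0) (G0 b); have := mulr_ge0 (ltW D0) (G0 a).
move: F1 F2 F3; rewrite /K; lra.
Qed.

Lemma uniform_continuity_segment (M e : R) : 0 < e -> exists2 r : R, 0 < r &
  forall a b, `|a| <= M -> `|b| <= r -> `|f (a + b) - f a| <= e.
Proof.
move=> e0; have /compact_near_coveringP cov := @segment_compact R (- M) M.
have H : \forall r \near (0:R)^'+, `[- M, M]%classic `<=` [set a | forall b, `|b| <= r ->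
  `|f (a + b) - f a| <= e].
  apply: cov => a _.
  have e2 : 0 < e / 2 by rewrite divr_gt0.
  have /cvgrPdist_le/(_ _ e2)/nbhs_ballP[d /= d0 hd] := @fc a.
  have d2 : 0 < d / 2 by rewrite divr_gt0.
  exists (ball a (d / 2), [set r | r < d / 2]).
    by split; [exact: nbhsx_ballx|exact: nbhs_right_lt].
  move=> [a' r]/= [aa rd] b br.
  have h1 : `|f a - f a'| <= e / 2.
    by apply: hd; rewrite /ball/=; move: aa; rewrite /ball/=; lra.
  have h2 : `|f a - f (a' + b)| <= e / 2.
    apply: hd; rewrite /ball/=; move: aa; rewrite /ball/= => aa.
    rewrite opprD addrA; apply: le_lt_trans (ler_normB _ _) _; lra.
  have -> : f (a' + b) - f a' = (f a - f a') - (f a - f (a' + b)) by ring.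
  by apply: le_trans (ler_normB _ _) _; lra.
have [r [r0 hr]] := filter_ex (filterI (nbhs_right_gt 0) H).
exists r => // a b aM br; apply: hr => //=.
by rewrite in_itv/= -ler_norml.
Qed.

(** Four regimes. If |b| is not small, its power absorbs all constants. If |a| is large, [f] is a
    small multiple of the q-th power at both points. If |a| is small, [f] is a small multiple of its
    argument. In between, uniform continuity gives an error measured against |a| > d/2. *)
Lemma diff_growth e : 0 < e -> exists2 C : R, 0 < C & forall a b,
  `|f (a + b) - f a| <= e * (`|a| + `|a| `^ q + `|b|) + C * `|b| `^ q.
Proof.
move=> e0; pose k : R := 3 + 2 `^ q.
have k0 : 0 < k by rewrite ltr_wpDr ?powR_ge0.
have k3 : 3 <= k by rewrite lerDl powR_ge0.
have kq : 2 `^ q + 1 <= k by rewrite /k; lra.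
pose n := e / k; have n0 : 0 < n by rewrite divr_gt0.
have nk : n * k = e by rewrite /n divfK// gt_eqF.
have [_ _ [C C0 fC] /(_ n n0)[d d0 fd] /(_ n n0)[M M0 fM]] := af.
pose K := C * (M + M `^ q).
have K0 : 0 <= K by rewrite mulr_ge0 ?(ltW C0)// addr_ge0 ?powR_ge0 ?ltW.
have gen t : `|f t| <= n * (`|t| + `|t| `^ q) + K.
  have x0 : 0 <= n * `|t| by rewrite mulr_ge0 ?(ltW n0).
  have y0 : 0 <= n * `|t| `^ q by rewrite mulr_ge0 ?powR_ge0 ?(ltW n0).
  have [/fM|tM] := leP M `|t|; first by move: K0; lra.
  have : C * (`|t| + `|t| `^ q) <= K by rewrite ler_pM2l// lerD ?(ltW tM)// monoq// ltW.
  by have := fC t; lra.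
have [r0 r00 hr0] := @uniform_continuity_segment (2 * M) (n * (d / 2)) (mulr_gt0 n0 (divr_gt0 d0
  (ltr0n _ 2))).
pose r := Num.min r0 (Num.min (d / 2) M).
have rp : 0 < r by rewrite !lt_min r00 divr_gt0.
have [rr0 rd rM] : [/\ r <= r0, r <= d / 2 & r <= M].
  by split; rewrite /r ?ge_min ?lexx ?orbT.
have rq : 0 < r `^ q by rewrite powR_gt0.
exists (n * 2 `^ q + 2 * K / r `^ q) => [|a b].
  apply: ltr_pwDl; first by rewrite mulr_gt0 ?powR_gt0.
  exact: divr_ge0 (mulr_ge0 (ler0n _ 2) K0) (ltW rq).
have A0 := normr_ge0 a; have B0 := normr_ge0 b.
have Aq := powR_ge0 `|a| q; have Bq := powR_ge0 `|b| q.
have nA := mulr_ge0 (ltW n0) A0; have nB := mulr_ge0 (ltW n0) B0.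
have nAq := mulr_ge0 (ltW n0) Aq; have nBq := mulr_ge0 (ltW n0) Bq.
have n2q := mulr_ge0 (ltW n0) (powR_ge0 2 q).
have n2Bq := mulr_ge0 n2q Bq; have n2Aq := mulr_ge0 n2q Aq.
have n2A := mulr_ge0 n2q A0; have n2B := mulr_ge0 n2q B0.
have KB := mulr_ge0 (divr_ge0 (mulr_ge0 (ler0n R 2) K0) (ltW rq)) Bq.
have tri := ler_normB (f (a + b)) (f a).
have nab := ler_normD a b.
have pab : `|a + b| `^ q <= 2 `^ q * (`|a| `^ q + `|b| `^ q).
  apply: le_trans (powR_addr_le A0 B0 q0); exact: monoq.
rewrite -nk /k; have [br|br] := ltP r `|b|.
  have hK : 2 * K <= 2 * K / r `^ q * `|b| `^ q.
    rewrite mulrAC ler_pdivlMr//.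
    exact: (ler_wpM2l (mulr_ge0 (ler0n R 2) K0) (monoq (ltW rp) (ltW br))).
  have g1 := gen (a + b); have g2 := gen a.
  have h1 := ler_wpM2l (ltW n0) pab; have h2 := ler_wpM2l (ltW n0) nab.
  by move: tri g1 g2 h1 h2 hK; lra.
have [aM|aM] := leP (2 * M) `|a|.
  have hM : M <= `|a + b|.
    have := lerB_normD a b; move: aM br rM; lra.
  have hM2 : M <= `|a| by move: aM M0; lra.
  have ba : `|b| <= `|a| by move: aM br rM M0; lra.
  have g1 := fM _ hM; have g2 := fM _ hM2.
  have h1 : `|a + b| `^ q <= 2 `^ q * `|a| `^ q.
    by rewrite -powRM//; apply: monoq => //; move: nab ba; lra.
  have h2 := ler_wpM2l (ltW n0) h1.
  by move: tri g1 g2 h2; lra.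
have [ad|ad] := leP `|a| (d / 2).
  have g1 := fd (a + b); have g2 := fd a.
  have h1 : `|a + b| <= d by move: nab ad br rd; lra.
  have h2 : `|a| <= d by move: ad d0; lra.
  have h3 := ler_wpM2l (ltW n0) nab.
  by move: (g1 h1) (g2 h2) tri h3; lra.
have h := hr0 a b (ltW aM) (le_trans br rr0).
have h3 : n * (d / 2) <= n * `|a| by rewrite ler_pM2l// ltW.
by move: h h3; lra.
Qed.

Lemma primitive_expand e : 0 < e -> exists2 C : R, 0 < C & forall a b,
  `|F (a + b) - F a - f a * b| <=
  e * (`|a| * `|b| + `|a| `^ q * `|b| + b ^+ 2) + C * `|b| `^ p.
Proof.
move=> e0; have [C C0 H] := diff_growth e0; exists C => // a b.
have [th /andP[th0 th1] ->] := primitive_mvt fc a b.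
rewrite -mulrBl normrM.
have hb : `|th * b| <= `|b| by rewrite normrM (ger0_norm th0) ler_piMl.
have h : `|f (a + th * b) - f a| <= e * (`|a| + `|a| `^ q + `|b|) + C * `|b| `^ q.
  apply: le_trans (H _ _) _; rewrite lerD// ?ler_pM2l// ?lerD2l//.
  by apply: monoq.
apply: le_trans (ler_wpM2r (normr_ge0 b) h) _.
rewrite powp// -[b ^+ 2]real_normK ?num_real// le_eqVlt; apply/orP; left; apply/eqP; ring.
Qed.

End Growth.

(** * Integral functionals of the nonlinearity on H^1 *)

Section NonlinearIntegrals.
Context {R : realType} {N : nat} (N2 : (2 < N)%N) (f : R -> R).
Local Notation p := (critical_exponent R N).
Context (af : admissible (p - 1) f).
Implicit Types (u w h : 'rV[R]_N -> R) (x : 'rV[R]_N) (e s t l : R).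
Local Notation mu := (lebesgue_rV R N).
Local Notation F := (primitive f).
Local Notation S := (@sobolev_const R N).

Let p2 : 2 < p. Proof. exact: critical_exponent_gt2. Qed.
Let pE : p - 1 + 1 = p. Proof. by rewrite subrK. Qed.
Let fc : continuous f. Proof. by case: af. Qed.
Let p10 : 0 <= p - 1. Proof. by move: p2; lra. Qed.

Lemma sobolev_const_ge0 : 0 <= S.
Proof. by rewrite !mulr_ge0 ?powR_ge0. Qed.

Definition np u : R := \int[mu]_x `|u x| `^ p.

Lemma np_ge0 u : 0 <= np u.
Proof. by apply: int_ge0 => x; exact: powR_ge0. Qed.

Lemma np_le u (M : R) : H1 u -> Edir u <= M -> np u <= S * M `^ (p / 2).
Proof.
move=> Hu EM; have [_ h] := sobolev N2 Hu; apply: le_trans h _.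
rewrite ler_wpM2l ?sobolev_const_ge0//; apply: ge0_ler_powR; rewrite ?nnegrE ?Edir_ge0//.
  by move: p2; lra.
exact: le_trans (Edir_ge0 u) EM.
Qed.

Lemma np_intg u : H1 u -> intg mu (fun x => `|u x| `^ p).
Proof. by move=> /(sobolev N2)[]. Qed.

Lemma measurable_comp_cont (g : R -> R) u : continuous g -> measurable_fun [set: 'rV[R]_N] u ->
  measurable_fun [set: 'rV[R]_N] (fun x => g (u x)).
Proof. by move=> cg mu_; apply: measurableT_comp => //; exact: continuous_measurable_fun. Qed.

Lemma intg_primitive u : H1 u -> intg mu (fun x => F (u x)).
Proof.
move=> Hu; have [m_u iu] := H1_sqint Hu.
have [C C0] := primitive_growth af; rewrite pE => FC.
apply: (@intg_le _ _ _ _ _ (fun x => C * (u x ^+ 2 + `|u x| `^ p))) => //.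
  by apply: measurable_comp_cont => //; exact: continuous_primitive.
by apply: intgZ; apply: intgD => //; exact: np_intg.
Qed.

(** A crude Young inequality obtained by comparing [a] with b / s. The free scale [s] is what makes
    the mixed term in [primitive_frechet] linear in the size of the increment. *)
Let young (a b s : R) : 0 <= a -> 0 <= b -> 0 < s ->
  a `^ (p - 1) * b <= s * (a `^ p + s^-1 `^ p * b `^ p).
Proof.
move=> a0 b0 s0; have sV : 0 <= s^-1 by rewrite invr_ge0 ltW.
rewrite -powRM//; set c := s^-1 * b.
have c0 : 0 <= c by rewrite mulr_ge0.
have -> : b = s * c by rewrite /c mulrA mulfV ?mul1r// gt_eqF.
rewrite mulrCA ler_pM2l//.
have pp (d : R) : 0 <= d -> d `^ p = d `^ (p - 1) * d.
  by move=> d0; rewrite mulrC mulr_powRB1//; move: p2; lra.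
have [ca|ac] := leP c a.
  apply: (@le_trans _ _ (a `^ p)); last by rewrite lerDl powR_ge0.
  by rewrite [leRHS]pp// ler_wpM2l ?powR_ge0.
apply: (@le_trans _ _ (c `^ p)); last by rewrite lerDr powR_ge0.
rewrite [leRHS]pp// ler_wpM2r//; apply: ge0_ler_powR; rewrite ?nnegrE//; exact: ltW.
Qed.

Lemma intg_powRM u h : H1 u -> H1 h -> intg mu (fun x => `|u x| `^ (p - 1) * `|h x|).
Proof.
move=> Hu Hh; have [m_u _] := H1_sqint Hu; have [mh _] := H1_sqint Hh.
apply: (@intg_le _ _ _ _ _ (fun x => 1 * (`|u x| `^ p + 1^-1 `^ p * `|h x| `^ p))).
- apply: measurable_funM; [exact: measurable_powR_norm|exact: measurableT_comp].
- by move=> x; rewrite ger0_norm ?mulr_ge0 ?powR_ge0//; exact: young.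
- by apply: intgZ; apply: intgD; [|apply: intgZ]; exact: np_intg.
Qed.

Lemma intg_fM u h : H1 u -> H1 h -> intg mu (fun x => f (u x) * h x).
Proof.
move=> Hu Hh; have su := H1_sqint Hu; have sh := H1_sqint Hh.
have [m_u _] := su; have [mh _] := sh.
have [_ _ [C C0 fC] _ _] := af.
apply: (@intg_le _ _ _ _ _ (fun x => C * (`|u x| * `|h x| + `|u x| `^ (p - 1) * `|h x|))).
- by apply: measurable_funM => //; exact: measurable_comp_cont.
- move=> x; rewrite normrM.
  by apply: le_trans (ler_wpM2r (normr_ge0 (h x)) (fC (u x))) _; rewrite -mulrA mulrDl.
- apply: intgZ; apply: intgD; first by apply: sqintM; exact: sqint_norm.
  exact: intg_powRM.
Qed.

(** The size of [h] is measured by a strictly positive upper bound [s] of its H^1 norm, so that [s]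
    can serve as the scale in [young]. *)
Lemma primitive_frechet u e : H1 u -> 0 < e -> exists2 d : R, 0 < d &
  forall h s, H1 h -> 0 < s < d -> Edir h + n2 mu h <= s ^+ 2 ->
  `|\int[mu]_x F (u x + h x) - \int[mu]_x F (u x) - \int[mu]_x (f (u x) * h x)| <= e * s.
Proof.
move=> Hu e0; have su := H1_sqint Hu.
have S0 := sobolev_const_ge0.
pose B := nm mu u + np u + S + 1.
have B0 : 0 < B by have := nm_ge0 mu u; have := np_ge0 u; rewrite /B; lra.
pose e1 := e / (2 * B).
have e10 : 0 < e1 by rewrite divr_gt0// mulr_gt0.
have e1B : e1 * B = e / 2 by rewrite /e1 invfM mulrA -[e / 2 / B * B]mulrA mulVf ?mulr1// gt_eqF.
have [C C0] := primitive_expand af e10; rewrite pE => HC.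
have CS : 0 < 2 * (C * S + 1) by rewrite mulr_gt0// ltr_wpDl// mulr_ge0// ltW.
exists (Num.min 1 (e / (2 * (C * S + 1)))); first by rewrite lt_min ltr01 divr_gt0.
move=> h s Hh /andP[s0]; rewrite lt_min => /andP[s1 sd] hs.
have sh := H1_sqint Hh; have Huh := H1D Hu Hh.
have E0 := Edir_ge0 h; have n0 := n2_ge0 mu h.
have nh : nm mu h <= s.
  by rewrite -(ler_sqr (nm_ge0 _ _) (ltW s0)) nm2; move: hs; lra.
have sp0 : 0 < s `^ p by rewrite powR_gt0.
have npS : np h <= S * s `^ p.
  have Es : Edir h <= s ^+ 2 by move: hs; lra.
  have := np_le Hh Es; rewrite -powR_mulrn ?(ltW s0)// -powRrM.
  by rewrite (_ : 2%:R * (p / 2) = p)//; field.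
have s2 : s ^+ 2 <= s by rewrite expr2 ler_piMl// ltW.
have sps : s `^ p <= s ^+ 2.
  rewrite (powR_sqrM (ltW s0) p2) ler_piMl ?sqr_ge0//.
  apply: (@le_trans _ _ (1 `^ (p - 2))); last by rewrite powR1.
  apply: ge0_ler_powR; rewrite ?nnegrE ?(ltW s0) ?(ltW s1)//.
  by move: p2; lra.
have i1 := intg_primitive Huh; have i2 := intg_primitive Hu; have i3 := intg_fM Hu Hh.
rewrite -intB// -intB//; last exact: intgB.
have ia : intg mu (fun x => `|u x| * `|h x|) by apply: sqintM; exact: sqint_norm.
have ib := intg_powRM Hu Hh; have ic := sqint_sqr sh; have idd := np_intg Hh.
have iab : intg mu (fun x => `|u x| * `|h x| + `|u x| `^ (p - 1) * `|h x|) by exact: intgD.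
have iabc : intg mu (fun x => `|u x| * `|h x| + `|u x| `^ (p - 1) * `|h x| +
  h x ^+ 2) by exact: intgD.
have le1 := int_norm_le (intgB (intgB i1 i2) i3)
  (intgD (intgZ e1 iabc) (intgZ C idd)) (fun x => HC (u x) (h x)).
apply: le_trans le1 _.
rewrite intD; [|exact: intgZ|exact: intgZ].
rewrite intZ// intZ// intD// intD// -/(np h) -/(n2 mu h).
have ha : \int[mu]_x (`|u x| * `|h x|) <= nm mu u * s.
  apply: le_trans (ler_norm _) _.
  apply: le_trans (cauchy_schwarz (sqint_norm su) (sqint_norm sh)) _.
  have nn w : nm mu (fun x => `|w x|) = nm mu w.
    by rewrite /nm /n2; congr Num.sqrt; apply: eq_int => x; rewrite real_normK ?num_real.
  by rewrite !nn ler_wpM2l ?nm_ge0.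
have hb : \int[mu]_x (`|u x| `^ (p - 1) * `|h x|) <= s * (np u + S).
  have ij : intg mu (fun x => `|u x| `^ p + s^-1 `^ p * `|h x| `^ p).
    by apply: intgD; [|apply: intgZ]; exact: np_intg.
  apply: le_trans (int_le ib (intgZ s ij) _) _.
    by move=> x; exact: young.
  rewrite intZ// ler_pM2l// intD; [|exact: np_intg|by apply: intgZ; exact: np_intg].
  rewrite intZ; last exact: np_intg.
  rewrite -/(np u) -/(np h) lerD2l.
  have sVp : s^-1 `^ p * s `^ p = 1.
    by rewrite -powRM ?invr_ge0 ?(ltW s0)// mulVf ?gt_eqF// powR1.
  have := ler_wpM2l (powR_ge0 s^-1 p) npS.
  by rewrite mulrCA sVp mulr1.
have hd : C * np h <= C * S * s ^+ 2.
  rewrite -mulrA ler_pM2l//; apply: le_trans npS _; exact: ler_wpM2l.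
have hcs : (C * S + 1) * s <= e / 2.
  move: sd; rewrite ltr_pdivlMr// => /ltW; lra.
have n2s : n2 mu h <= s by move: hs s2; lra.
have X : e1 * (\int[mu]_x (`|u x| * `|h x|) + \int[mu]_x (`|u x| `^ (p - 1) * `|h x|) +
  n2 mu h) <= e1 * (B * s).
  by rewrite ler_pM2l// /B; move: ha hb n2s; lra.
have Y : C * S * s ^+ 2 <= e / 2 * s.
  rewrite expr2 mulrA ler_wpM2r ?(ltW s0)//; move: hcs s0; lra.
by move: X Y hd; rewrite mulrA e1B; lra.
Qed.

Lemma primitive_int_small e : 0 < e -> exists2 C : R, 0 < C & forall u, H1 u ->
  `|\int[mu]_x F (u x)| <= e * n2 mu u + C * Edir u `^ (p / 2).
Proof.
move=> e0; have [C C0] := primitive_small af e0; rewrite pE => HC.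
have S0 := sobolev_const_ge0.
exists (C * (S + 1)); first by rewrite mulr_gt0// ltr_wpDl.
move=> u Hu; have [_ iu] := H1_sqint Hu; have ip_ := np_intg Hu.
apply: le_trans (int_norm_le (intg_primitive Hu) (intgD (intgZ e iu) (intgZ C ip_)) (fun x =>
  HC (u x))) _.
rewrite intD ?intZ//; [|exact: intgZ|exact: intgZ].
rewrite -/(n2 mu u) -/(np u) lerD2l -mulrA ler_pM2l// mulrDl mul1r.
by apply: le_trans (np_le Hu (lexx _)) _; rewrite lerDl powR_ge0.
Qed.

(** Plays the role of the vanishing lemma of concentration-compactness. Where |u| > kp, an average
    of size at most kp/2 forces |u - avg| >= |u|/2, so the mass of u^2 there is controlled by the
    Dirichlet energy at scale [l]. *)
Lemma primitive_vanish e : 0 < e -> exists kp C : R, [/\ 0 < kp, 0 < C & forall u l,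
  H1 u -> 0 < l -> (forall x, `|avg l u x| <= kp / 2) ->
  `|\int[mu]_x F (u x)| <= e * (n2 mu u + np u) + C * (l ^+ 2 * Edir u)].
Proof.
move=> e0; have e2 : 0 < e / 2 by rewrite divr_gt0.
have [C1 C10] := primitive_small af e2; rewrite pE => H1_.
have [C2 C20] := primitive_big af e0; rewrite pE => H2_.
(* Solves C1 kp^(p-2) = e/2: below this threshold the critical power is dominated by (e/2) u^2. *)
pose kp := (e / 2 / C1) `^ (p - 2)^-1.
have c0 : 0 < e / 2 / C1 by rewrite divr_gt0.
have kp0 : 0 < kp by rewrite powR_gt0.
have p20 : 0 < p - 2 by rewrite subr_gt0.
have kpE : C1 * kp `^ (p - 2) = e / 2.
  rewrite /kp -powRrM mulVf ?gt_eqF// powRr1 ?(ltW c0)//.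
  by rewrite mulrC divfK// gt_eqF.
have N0 : 0 < N%:R :> R by rewrite ltr0n; exact: leq_ltn_trans N2.
exists kp, (C2 * (4 * N%:R ^+ 2)); split => //; first by rewrite !mulr_gt0.
move=> u l Hu l0 hav; have su := H1_sqint Hu; have [m_u iu] := su; have ip_ := np_intg Hu.
pose k x := lev u kp x * u x ^+ 2.
have k0 x : 0 <= k x := mulr_ge0 (lev_ge0 u kp x) (sqr_ge0 (u x)).
have mk : measurable_fun [set: 'rV[R]_N] k.
  by apply: measurable_funM; [exact: measurable_lev|exact: measurable_funX].
have [|||ih hQ] := @avg_le_Qa _ _ l u (fun x => 4^-1 * k x) l0 su.
- exact: measurable_funM.
- by move=> x; rewrite mulr_ge0// k0.
- move=> x; rewrite /k /lev; case: ltP => hx; last by rewrite mul0r mulr0 sqr_ge0.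
  rewrite mul1r.
  have h1 : `|u x| / 2 <= `|u x - avg l u x|.
    by have := lerB_dist (u x) (avg l u x); have := hav x; move: hx; lra.
  have -> : 4^-1 * u x ^+ 2 = (`|u x| / 2) ^+ 2.
    by rewrite exprMn real_normK ?num_real// exprVn mulrC; congr (_ * _^-1); rewrite expr2; ring.
  by rewrite -[leRHS]real_normK ?num_real//; apply: lerXn2r; rewrite ?nnegrE ?divr_ge0.
have ik : intg mu k.
  apply: intg_le iu => // x; rewrite ger0_norm//.
  by rewrite ler_piMl ?sqr_ge0// /lev; case: (_ < _).
have hk : \int[mu]_x k x <= 4 * N%:R ^+ 2 * (l ^+ 2 * Edir u).
  have := le_trans hQ (Qa_le l0 Hu); rewrite intZ//.
  by rewrite exprMn -mulrA; lra.
have pt x : `|F (u x)| <= e * (u x ^+ 2 + `|u x| `^ p) + C2 * k x.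
  rewrite /k /lev; case: ltP => hx.
    rewrite mul1r; have := H2_ (u x); have := mulr_ge0 (ltW e0) (sqr_ge0 (u x)); lra.
  rewrite mul0r mulr0 addr0; apply: le_trans (H1_ (u x)) _.
  have h1 : C1 * `|u x| `^ p <= e / 2 * u x ^+ 2.
    rewrite (powR_sqrM (normr_ge0 _) p2) real_normK ?num_real// mulrA -kpE.
    rewrite ler_wpM2r ?sqr_ge0// ler_pM2l//; apply: ge0_ler_powR;
      rewrite ?nnegrE ?(ltW p20) ?(ltW kp0)//.
  have h2 : 0 <= e * `|u x| `^ p by rewrite mulr_ge0 ?powR_ge0 ?ltW.
  by move: h1 h2; lra.
have i2 : intg mu (fun x => u x ^+ 2 + `|u x| `^ p) by exact: intgD.
apply: le_trans (int_norm_le (intg_primitive Hu) (intgD (intgZ e i2) (intgZ C2 ik)) pt) _.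
rewrite intD ?intZ ?intD//; [|exact: intgZ|exact: intgZ].
rewrite -/(n2 mu u) -/(np u) lerD2l -mulrA; apply: ler_wpM2l; first exact: ltW.
by move: hk; lra.
Qed.

(** By [primitive_split] the part of the defect exceeding a small multiple of v^2 + |v|^p is
    dominated by a fixed integrable function of [w], and tends to 0 by dominated convergence; the
    small multiple is bounded uniformly in [j]. *)
Lemma brezis_lieb w (v : nat -> 'rV[R]_N -> R) (M : R) : H1 w -> (forall j, H1 (v j)) ->
  (forall j, n2 mu (v j) <= M) -> (forall j, np (v j) <= M) ->
  {ae mu, forall x, v j x @[j --> \oo] --> (0 : R)} ->
  (\int[mu]_x F (w x + v j x) - \int[mu]_x F (w x) - \int[mu]_x F (v j x)) @[j --> \oo]
    --> (0 : R).
Proof.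
move=> Hw Hv n2M npM v0; apply/cvgr0Pnorm_le => e e0.
have M0 : 0 <= M by exact: le_trans (n2_ge0 mu _) (n2M 0%N).
have M20 : 0 < 4 * M + 1 by lra.
pose e1 := e / (4 * M + 1).
have e10 : 0 < e1 by rewrite divr_gt0.
have e1M : e1 * (4 * M + 1) = e by rewrite /e1 divfK// gt_eqF.
have [C C0] := primitive_split af e10; rewrite pE => HC.
have [mw iw] := H1_sqint Hw.
pose D j x := F (w x + v j x) - F (w x) - F (v j x).
pose T j x := Num.max 0 (`|D j x| - e1 * (v j x ^+ 2 + `|v j x| `^ p)).
have mv j : measurable_fun [set: 'rV[R]_N] (v j) by have [] := H1_sqint (Hv j).
have cF : continuous F by exact: continuous_primitive.
have mD j : measurable_fun [set: 'rV[R]_N] (D j).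
  apply: measurable_funB; [apply: measurable_funB|]; apply: measurable_comp_cont => //.
  exact: measurable_funD.
have mT j : measurable_fun [set: 'rV[R]_N] (T j).
  apply: measurable_maxr => //; apply: measurable_funB; first exact: measurableT_comp.
  apply: measurable_funM => //; apply: measurable_funD; first exact: measurable_funX.
  exact: measurable_powR_norm.
have iD j : intg mu (D j).
  by apply: intgB; [apply: intgB|]; apply: intg_primitive => //; exact: H1D.
have iV j : intg mu (fun x => v j x ^+ 2 + `|v j x| `^ p).
  by apply: intgD; [have [] := H1_sqint (Hv j)|exact: np_intg].
have Tle j x : `|T j x| <= C * (w x ^+ 2 + `|w x| `^ p).
  rewrite ger0_norm ?le_max ?lexx// ge_max.
  rewrite mulr_ge0 ?(ltW C0) ?addr_ge0 ?sqr_ge0 ?powR_ge0//=.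
  by have := HC (w x) (v j x); rewrite /D; lra.
have ig : intg mu (fun x => C * (w x ^+ 2 + `|w x| `^ p)).
  by apply: intgZ; apply: intgD => //; exact: np_intg.
have Tcvg : {ae mu, forall x, T ^~ x @ \oo --> (0 : R)}.
  apply: filterS v0 => x vx.
  have Dx : D j x @[j --> \oo] --> (0 : R).
    have -> : (0 : R) = F (w x + 0) - F (w x) - F 0 by rewrite addr0 subrr primitive0 ?subr0.
    have wv : (w x + v j x) @[j --> \oo] --> w x + 0 by apply: cvgD => //; exact: cvg_cst.
    have F1 : F (w x + v j x) @[j --> \oo] --> F (w x + 0) by apply: (cvg_comp _ _ wv); exact: cF.
    have F2 : F (v j x) @[j --> \oo] --> F 0 by apply: (cvg_comp _ _ vx); exact: cF.
    by apply: cvgB => //; apply: cvgB => //; exact: cvg_cst.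
  apply/cvgr0Pnorm_le => d d0; apply: filterS (cvgr0_norm_le _ Dx _ d0) => j hj.
  rewrite ger0_norm ?le_max ?lexx// ge_max (ltW d0)/=.
  have : 0 <= e1 * (v j x ^+ 2 + `|v j x| `^ p).
    by rewrite mulr_ge0 ?(ltW e10)// addr_ge0 ?sqr_ge0 ?powR_ge0.
  by move: hj; lra.
have [|||||_] := @dct _ _ _ mu T (fun=> 0) (fun x => C * (w x ^+ 2 + `|w x| `^ p)) => //.
rewrite int0 => Tc.
have e40 : 0 < e1 * (2 * M + 1) by rewrite mulr_gt0//; lra.
apply: filterS (cvgr0_norm_le _ Tc _ e40) => j hj.
have iT : intg mu (T j) by exact: intg_le (mT j) (Tle j) ig.
have j1 := intg_primitive (H1D Hw (Hv j)); have j2 := intg_primitive Hw;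
  have j3 := intg_primitive (Hv j).
rewrite -intB// -intB//; last exact: intgB.
apply: le_trans (int_norm_le (iD j) (intgD iT (intgZ e1 (iV j))) _) _.
  move=> x; have : `|D j x| - e1 * (v j x ^+ 2 + `|v j x| `^ p) <=
    T j x by rewrite le_max lexx orbT.
  by lra.
rewrite intD; [|exact: iT|exact: intgZ].
rewrite intZ// (intD (sqint_sqr (H1_sqint (Hv j))) (np_intg (Hv j))) -/(n2 mu (v j)) -/(np (v j)).
have h1 : e1 * (n2 mu (v j) + np (v j)) <= e1 * (2 * M).
  by rewrite ler_pM2l//; have := n2M j; have := npM j; lra.
have := ler_norm (\int[mu]_x T j x); move: hj h1; rewrite -e1M; lra.
Qed.

End NonlinearIntegrals.

(** * The fibering maps *)

Lemma monotone_about1 (R : realType) (g dg : R -> R) :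
  (forall t : R, 0 < t -> is_derive t 1 g (dg t)) ->
  (forall t : R, 1 <= t -> 0 <= dg t) -> (forall t : R, 0 < t < 1 -> dg t <= 0) ->
  (forall s t : R, 1 <= s <= t -> g s <= g t) /\ (forall s t : R, 0 < t -> t <= s <= 1 -> g s <=
    g t).
Proof.
move=> dgP dg1 dg0.
have cg (a b : R) : 0 < a -> {within `[a, b], continuous g}.
  move=> a0; apply: derivable_within_continuous => t; rewrite in_itv/= => /andP[h _].
  by have [] := dgP t (lt_le_trans a0 h).
split=> [s t /andP[s1 st]|s t t0 /andP[ts s1]].
  have s0 : 0 < s by exact: lt_le_trans s1.
  have [|c] := @MVT_segment _ g dg s t st _ (cg s t s0).
    by move=> x; rewrite in_itv/= => /andP[h _]; exact: dgP (lt_trans s0 h).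
  rewrite in_itv/= => /andP[sc _] E.
  by rewrite -subr_ge0 E mulr_ge0 ?subr_ge0// dg1// (le_trans s1).
have [<-//|ne] := eqVneq t s; have lts : t < s by rewrite lt_neqAle ne.
have [|c] := @MVT _ g dg t s lts _ (cg t s t0).
  by move=> x; rewrite in_itv/= => /andP[h _]; exact: dgP (lt_trans t0 h).
rewrite in_itv/= => /andP[tc cs] E.
rewrite -subr_le0 E mulr_le0_ge0 ?subr_ge0// dg0//.
by rewrite (lt_trans t0 tc) (lt_le_trans cs s1).
Qed.

Section Rho.
Context {R : realType} (N : nat) (N2 : (2 < N)%N).
Implicit Types s t : R.

(** The integral from 1 to [t] of s^(N-1) (1 - s^-2), the weight with which hypothesis (b) is
    integrated along a ray. *)
Definition rho t : R := (t ^+ N - 1) / N%:R - (t ^+ N.-2 - 1) / (N%:R - 2).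

Let Nm : N = N.-2.+2. Proof. by case: N N2 => [|[|]]. Qed.
Let mE : N%:R - 2 = N.-2%:R :> R. Proof. by rewrite [in LHS]Nm -addn2 natrD addrK. Qed.
Let m0 : 0 < N.-2%:R :> R. Proof. by rewrite ltr0n; case: N N2 => [|[|[]]]. Qed.
Let N0 : 0 < N%:R :> R. Proof. by rewrite ltr0n (leq_trans _ N2). Qed.

Lemma is_derive_pow (n : nat) t : is_derive t 1 (fun t : R => t ^+ n) (n%:R * t ^+ n.-1).
Proof.
by have := @is_deriveX _ _ id n t 1 1 (is_derive_id _ _); rewrite exprfctE [_ *: _]mulr1.
Qed.

Lemma is_derive_affine_comb (a b c t da db : R) (g h : R -> R) :
  is_derive t 1 g da -> is_derive t 1 h db ->
  is_derive t 1 (fun t => a * g t + b * h t + c) (a * da + b * db).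
Proof.
move=> dg dh.
have h1 : is_derive t 1 (fun t => a * g t) (a * da) by exact: (@is_deriveZ _ _ _ g a t 1 _ dg).
have h2 : is_derive t 1 (fun t => b * h t) (b * db) by exact: (@is_deriveZ _ _ _ h b t 1 _ dh).
have [d3 e3] := @is_deriveD _ _ _ (fun t => a * g t + b * h t) (cst c) t 1 _ _
  (@is_deriveD _ _ _ (fun t => a * g t) (fun t => b * h t) t 1 _ _ h1 h2) (is_derive_cst _ _ _).
by apply: DeriveDef; [exact: d3|rewrite [LHS]e3 addr0].
Qed.

Lemma is_derive_rho t : 0 < t -> is_derive t 1 rho (t ^+ N.-1 * (1 - t ^- 2)).
Proof.
move=> t0.
have := is_derive_affine_comb N%:R^-1 (- N.-2%:R^-1) (- N%:R^-1 + N.-2%:R^-1)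
  (is_derive_pow N t) (is_derive_pow N.-2 t).
have -> : (fun t : R => N%:R^-1 * t ^+ N + - N.-2%:R^-1 * t ^+ N.-2 + (- N%:R^-1 + N.-2%:R^-1)) =
  rho.
  by apply/funext => s; rewrite /rho mE; ring.
have -> // : N%:R^-1 * (N%:R * t ^+ N.-1) + - N.-2%:R^-1 * (N.-2%:R * t ^+ N.-2.-1) =
  t ^+ N.-1 * (1 - t ^- 2).
have mS : N.-2 = N.-2.-1.+1 by rewrite prednK// -(ltr0n R).
have -> : t ^+ N.-1 = t ^+ N.-2.-1 * t ^+ 2.
  by rewrite -exprD; congr (_ ^+ _); rewrite [in LHS]Nm/= mS addn2.
by field; rewrite !gt_eqF.
Qed.

Lemma rho1 : rho 1 = 0. Proof. by rewrite /rho !expr1n subrr !mul0r subrr. Qed.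

Let drho1 t : 1 <= t -> 0 <= t ^+ N.-1 * (1 - t ^- 2).
Proof.
move=> t1; have t0 : 0 < t by exact: lt_le_trans t1.
by rewrite mulr_ge0 ?exprn_ge0 ?(ltW t0)// subr_ge0 invf_le1 ?exprn_gt0// exprn_ege1.
Qed.

Let drho0 t : 0 < t < 1 -> t ^+ N.-1 * (1 - t ^- 2) <= 0.
Proof.
move=> /andP[t0 t1]; rewrite mulr_ge0_le0 ?exprn_ge0 ?(ltW t0)// subr_le0.
by rewrite invf_ge1 ?exprn_gt0// exprn_ile1 ?ltW.
Qed.

Lemma rho_mono : (forall s t, 1 <= s <= t -> rho s <= rho t) /\
  (forall s t, 0 < t -> t <= s <= 1 -> rho s <= rho t).
Proof. exact: monotone_about1 is_derive_rho drho1 drho0. Qed.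

Lemma rho_ge0 t : 0 < t -> 0 <= rho t.
Proof.
move=> t0; have [h1 h2] := rho_mono; rewrite -rho1; have [t1|/ltW t1] := leP 1 t.
  by apply: h1; rewrite lexx.
by apply: h2; rewrite // lexx andbT.
Qed.

Lemma rho_gt0 t : 0 < t -> t != 1 -> 0 < rho t.
Proof.
move=> t0 t1; have cg (a b : R) : 0 < a -> {within `[a, b], continuous rho}.
  move=> a0; apply: derivable_within_continuous => s; rewrite in_itv/= => /andP[h _].
  by have [] := is_derive_rho (lt_le_trans a0 h).
rewrite -[ltRHS]subr0 -[X in _ < _ - X]rho1; have [lt1|gt1|] := ltgtP t 1; last by move/eqP;
  rewrite (negPf t1).
  have [|c] := @MVT _ rho (fun s => s ^+ N.-1 * (1 - s ^- 2)) t 1 lt1 _ (cg t 1 t0).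
    by move=> s; rewrite in_itv/= => /andP[h _]; exact: is_derive_rho (lt_trans t0 h).
  rewrite in_itv/= => /andP[tc c1] E.
  have c0 : 0 < c by exact: lt_trans tc.
  rewrite -opprB oppr_gt0 E pmulr_llt0 ?subr_gt0// pmulr_rlt0 ?exprn_gt0// subr_lt0.
  by rewrite invf_gt1 ?exprn_gt0// exprn_ilt1 ?ltW.
have [|c] := @MVT _ rho (fun s => s ^+ N.-1 * (1 - s ^- 2)) 1 t gt1 _ (cg 1 t ltr01).
  by move=> s; rewrite in_itv/= => /andP[h _]; exact: is_derive_rho (lt_trans ltr01 h).
rewrite in_itv/= => /andP[c1 ct] E.
have c0 : 0 < c by exact: lt_trans c1.
by rewrite E !mulr_gt0 ?subr_gt0 ?exprn_gt0// invf_lt1 ?exprn_gt0// exprn_egt1.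
Qed.

(** Allows the gap [rho] to absorb errors of order s (1 + t^N) uniformly along a whole fibre, in
    [fiber_perturbation]. *)
Lemma rho_coercive : exists2 A : R, 0 < A & forall t, 0 < t -> t ^+ N <= A + 2 * N%:R * rho t.
Proof.
pose T := 2 * N%:R : R.
have T1 : 1 <= T by rewrite /T -natrM ler1n muln_gt0 (leq_trans _ N2).
have T0 : 0 < T by exact: lt_le_trans T1.
exists (T ^+ N) => [|t t0]; first by rewrite exprn_gt0.
have r0 := rho_ge0 t0.
have [tT|/ltW tT] := leP t T.
  apply: (@le_trans _ _ (T ^+ N)); first by apply: lerXn2r; rewrite ?nnegrE// ltW.
  by rewrite lerDl mulr_ge0// mulr_ge0.
have tE : t ^+ N = t ^+ N.-2 * t ^+ 2 by rewrite -exprD addn2 -Nm.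
have tn0 : 0 <= t ^+ N.-2 by rewrite exprn_ge0 ?ltW.
have h1 : t ^+ N.-2 * T <= t ^+ N.
  rewrite tE ler_wpM2l// expr2 -[leLHS]mul1r; apply: ler_pM => //; first by rewrite ltW.
  exact: le_trans tT.
have m1 : 1 <= N.-2%:R :> R by rewrite ler1n -(ltr0n R).
have TN : 2 <= T ^+ N.
  apply: (@le_trans _ _ T); last by rewrite ler_eXnr// (leq_trans _ N2).
  by rewrite /T ler_peMr// ler1n (leq_trans _ N2).
have h2 : (t ^+ N.-2 - 1) / N.-2%:R <= t ^+ N.-2.
  rewrite ler_pdivrMr//; have := ler_wpM2l tn0 m1; lra.
have N1 : 1 <= N%:R :> R by rewrite ler1n (leq_trans _ N2).
have h3 : N%:R * rho t = t ^+ N - 1 - N%:R * ((t ^+ N.-2 - 1) / N.-2%:R).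
  by rewrite /rho mE mulrBr mulrCA mulfV ?gt_eqF// mulr1.
have := ler_wpM2l (ltW N0) h2; move: h1 h3 TN; rewrite /T; lra.
Qed.

End Rho.

(** The density of the quadratic term of [pohozaev]. It is the radial derivative in disguise: d/ds
    (s^N V(s x)) = s^(N-1) kV(s x). *)
Definition kV (R : realType) (N : nat) (V : 'rV[R]_N -> R) x : R :=
  N%:R * V x + dotv (grad V x) x.

(** Hypotheses (a) and (b) for a fixed [theta], with (b) written through [kV] and with t^-2 (t^2 -
    1) = 1 - t^-2, the factor that occurs in rho'. *)
Definition potential (R : realType) (N : nat) (V : 'rV[R]_N -> R) (Vinf th : R) : Prop :=
  [/\ class_C 1 V, forall x, 0 <= V x <= Vinf,
    forall e : R, 0 < e -> exists r : R, forall y, r < enorm y -> `|V y - Vinf| < e,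
    0 < Vinf /\ 0 <= th < 1 &
    forall (x : 'rV[R]_N) (t : R), x != 0 ->
      let Q := kV V x - kV V (t *: x) +
        (N%:R - 2) ^+ 3 * th / 4 / enorm x ^+ 2 * (1 - t ^- 2) in
      (1 <= t -> 0 <= Q) /\ (0 < t < 1 -> Q <= 0)].

(** * The potential along rays *)

Section Potential.
Context {R : realType} {N : nat} (N2 : (2 < N)%N) (V : 'rV[R]_N -> R) (Vinf th : R).
Context (pV : potential V Vinf th).
Implicit Types (u w h : 'rV[R]_N -> R) (x y : 'rV[R]_N) (s t : R).
Local Notation mu := (lebesgue_rV R N).
Local Notation k := (kV V).
Local Notation cube := (@cube R N).
Local Notation cc := ((N%:R - 2) ^+ 3 * th / 4).
Local Notation rho := (@rho R N).

Let Nm : N = N.-2.+2. Proof. by case: N N2 => [|[|]]. Qed.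
Let N0 : 0 < N%:R :> R. Proof. by rewrite ltr0n (leq_trans _ N2). Qed.
Let N20 : 0 < N%:R - 2 :> R. Proof. by rewrite subr_gt0 ltr_nat. Qed.
Let th01 : 0 <= th < 1. Proof. by case: pV => _ _ _ []. Qed.
Let V0 x : 0 <= V x. Proof. by case: pV => _ /(_ x)/andP[]. Qed.
Let VV x : V x <= Vinf. Proof. by case: pV => _ /(_ x)/andP[]. Qed.

Lemma cc_ge0 : 0 <= cc.
Proof.
have /andP[t0 _] := th01.
exact: divr_ge0 (mulr_ge0 (exprn_ge0 3 (ltW N20)) t0) (ler0n _ 4).
Qed.

Lemma continuous_V : continuous V.
Proof. by case: pV => /class_C_cont. Qed.

Lemma continuous_kV : continuous k.
Proof.
have [CV _ _ _ _] := pV; apply: (class_CD (k := 0));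
  first exact: (class_CZ (k := 0) _ continuous_V).
rewrite /dotv; elim: (index_enum _) => [|i r IH].
  by under eq_fun do rewrite big_nil; exact: (class_C_cst 0).
under eq_fun do rewrite big_cons; apply: (class_CD (k := 0)) => //.
under eq_fun do rewrite mxE; apply: (class_CM (k := 0)); first exact: (class_C_partial i CV).
exact: (class_C_coor 0 i smooth_id).
Qed.

(** Right side minus left side vanishes at t = 1 and has derivative t^(N-1) Q(t), where Q is the
    quantity in (b). By (b) it decreases before 1 and increases after, so it is nonnegative. *)
Lemma potential_fiber x t : 0 < t ->
  t ^+ N * V (t *: x) <= V x + k x * ((t ^+ N - 1) / N%:R) + cc / enorm x ^+ 2 * rho t.
Proof.
move=> t0; have [CV _ _ _ hQ] := pV.
(* At the origin the singular weight is 0, division by zero being 0, and the claim is an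
   identity. *)
have [->|x0] := eqVneq x 0.
  rewrite scaler0 /kV (_ : dotv _ 0 = 0); last by rewrite /dotv big1// => i _;
    rewrite [X in _ * X]mxE mulr0.
  rewrite (_ : enorm 0 = 0); last by rewrite /enorm /dotv big1 ?sqrtr0// => i _;
    rewrite mxE mulr0.
  rewrite expr0n/= invr0 mulr0 mul0r !addr0 le_eqVlt; apply/orP; left; apply/eqP.
  by field; rewrite gt_eqF.
pose c := cc / enorm x ^+ 2.
pose j s := s ^+ N * V (s *: x).
have dj (s : R) : 0 < s -> is_derive s 1 j (s ^+ N.-1 * k (s *: x)).
  move=> s0; have [d e] := @is_deriveM _ _ (fun s : R => s ^+ N) (fun s : R => V (s *: x)) s 1 _ _
    (is_derive_pow N s) (C1_chain x s CV).
  apply: DeriveDef; first exact: d.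
  have e' : 'D_1 ((fun s : R => s ^+ N) * (fun s : R => V (s *: x))) s =
    s ^+ N * (\sum_i x ord0 i * partial i V (s *: x)) + V (s *: x) * (N%:R * s ^+ N.-1) := e.
  rewrite [LHS]e' /kV.
  have -> : dotv (grad V (s *: x)) (s *: x) = s * \sum_i x ord0 i * partial i V (s *: x).
    by rewrite /dotv mulr_sumr; apply: eq_bigr => i _; rewrite !mxE; ring.
  have -> : s ^+ N = s ^+ N.-1 * s by rewrite -exprSr prednK// (leq_trans _ N2).
  by ring.
pose g s := c * rho s + k x * ((s ^+ N - 1) / N%:R) + V x - j s.
have dg (s : R) : 0 < s -> is_derive s 1 g (s ^+ N.-1 * (k x - k (s *: x) + c * (1 - s ^- 2))).
  move=> s0.
  have h1 := is_derive_affine_comb c (-1) 0 (is_derive_rho N2 s0) (dj s s0).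
  have h2 := is_derive_affine_comb (k x / N%:R) 1 (V x - k x / N%:R) (is_derive_pow N s) h1.
  have -> : g = (fun s => k x / N%:R * s ^+ N + 1 * (c * rho s + -1 * j s + 0) +
    (V x - k x / N%:R)).
    by apply/funext => r; rewrite /g; ring.
  have -> // : s ^+ N.-1 * (k x - k (s *: x) + c * (1 - s ^- 2)) =
    k x / N%:R * (N%:R * s ^+ N.-1) + 1 * (c * (s ^+ N.-1 * (1 - s ^- 2)) +
      -1 * (s ^+ N.-1 * k (s *: x))).
  by field; rewrite !gt_eqF.
have [||h1 h2] := monotone_about1 dg.
- move=> s s1; have [q1 _] := hQ x s x0; rewrite mulr_ge0 ?exprn_ge0 ?(le_trans _ s1)//.
  exact: q1.
- move=> s s1; have [_ q1] := hQ x s x0; rewrite mulr_ge0_le0 ?exprn_ge0//.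
    by have /andP[/ltW] := s1.
  exact: q1.
have g1 : g 1 = 0 by rewrite /g /j (rho1 N) scale1r !expr1n subrr; ring.
have : 0 <= g t.
  rewrite -g1; have [t1|/ltW t1] := leP 1 t; first by apply: h1; rewrite lexx.
  by apply: h2; rewrite // lexx andbT.
by rewrite /g /j -/c; lra.
Qed.

(** Divide [potential_fiber] by t^N / N and let t tend to infinity: V(t x) tends to [Vinf], and
    rho(t) is at most (t^N - 1)/N. *)
Lemma kV_lower x : x != 0 -> N%:R * Vinf <= k x + cc / enorm x ^+ 2.
Proof.
move=> x0; have [CV _ Vlim [Vi0 _] _] := pV.
have ex : 0 < enorm x.
  rewrite lt0r enorm_ge0 andbT; apply: contra x0 => /eqP e0; apply/eqP/rowP => i; rewrite mxE.
  have := enorm_sqr x; rewrite e0 expr0n/= => /esym/eqP; rewrite psumr_eq0; last by move=> j _;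
    exact: sqr_ge0.
  by move=> /allP/(_ i); rewrite mem_index_enum sqrf_eq0 => /(_ isT)/eqP.
set A := k x + _; rewrite leNgt; apply/negP => hA.
pose e := (N%:R * Vinf - A) / (4 * N%:R).
have e0 : 0 < e by rewrite divr_gt0 ?subr_gt0// mulr_gt0.
have [r hr] := Vlim e e0.
pose t := Num.max 2 ((`|r| + 1) / enorm x).
have t2 : 2 <= t by rewrite le_max lexx.
have t0 : 0 < t by exact: lt_le_trans t2.
have tr : r < enorm (t *: x).
  rewrite enormZ ?(ltW t0)//; apply: (@lt_le_trans _ _ (`|r| + 1)).
    by have := ler_norm r; lra.
  by rewrite -ler_pdivrMr// le_max lexx orbT.
have := hr _ tr; rewrite ltr_norml => /andP[hV _].
have h := potential_fiber x t0.
have rle : rho t <= (t ^+ N - 1) / N%:R.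
  by rewrite /rho gerBl divr_ge0 ?(ltW N20)// subr_ge0 exprn_ege1//; move: t2; lra.
have c0 : 0 <= cc / enorm x ^+ 2 by rewrite divr_ge0 ?cc_ge0 ?sqr_ge0.
have h2 := ler_wpM2l c0 rle.
have T2 : 2 <= t ^+ N.
  apply: (le_trans t2); rewrite -[leLHS]expr1; apply: ler_weXn2l;
    last by rewrite (leq_trans _ N2).
  by move: t2; lra.
have h3 : t ^+ N * V (t *: x) <= Vinf + A * ((t ^+ N - 1) / N%:R).
  by rewrite /A mulrDl; have := VV x; move: h h2; lra.
have h4 : t ^+ N * (Vinf - e) <= t ^+ N * V (t *: x).
  by rewrite ler_wpM2l ?exprn_ge0 ?(ltW t0)//; lra.
have eE : A = N%:R * (Vinf - 4 * e).
  by rewrite /e; field; rewrite gt_eqF.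
have h5 : A * ((t ^+ N - 1) / N%:R) = (Vinf - 4 * e) * (t ^+ N - 1).
  by rewrite eE; field; rewrite gt_eqF.
have := mulr_ge0 (ltW e0) (ltW (lt_le_trans (ltr0Sn R 1) T2)).
have : 2 * e <= t ^+ N * e by rewrite ler_wpM2r// ltW.
by move: h3 h4; rewrite h5; lra.
Qed.

(** Compactness settles the unit cube. Outside it [kV_lower] bounds from below, and
    [potential_fiber] at t = 1/2, whose left side is nonnegative, bounds from above. *)
Lemma kV_bounded : exists2 K : R, 0 <= K & forall x, `|k x| <= K.
Proof.
have [C C0 kC] : exists2 C : R, 0 <= C & forall x, cube 1 x -> `|k x| <= C.
  have cn : {within cube 1, continuous (fun x => `|k x|)}.
    apply: continuous_subspaceT => x; apply: continuous_comp; last exact: norm_continuous.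
    exact: continuous_kV.
  have [M [_ MP]] := compact_bounded (continuous_compact cn (@compact_cube R N 1)).
  exists (`|M| + 1); first by rewrite addr_ge0.
  have MM : M < `|M| + 1 by rewrite (le_lt_trans (ler_norm M))// ltrDl.
  move=> x cx; have /= := MP _ MM `|k x|; rewrite normr_id; apply.
  by exists x.
have [_ _ _ [Vi0 _] _] := pV.
have h0 : 0 < 2^-1 :> R by rewrite invr_gt0.
pose D : R := cc * rho 2^-1.
have D0 : 0 <= D by rewrite mulr_ge0 ?cc_ge0 ?rho_ge0.
pose K := C + 2 * N%:R * (Vinf + D) + cc + N%:R * Vinf.
have NV := mulr_ge0 (ltW N0) (ltW Vi0).
have ND := mulr_ge0 (ltW N0) D0.
have cc0 := cc_ge0.
exists K => [|x]; first by rewrite /K; lra.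
have [/kC|ncx] := pselect (cube 1 x); first by rewrite /K; lra.
have e1 : 1 <= enorm x ^+ 2.
  have [i hi] : exists i, 1 < `|x ord0 i|.
    apply/not_existsP => h; apply: ncx; apply/cubeE => i; rewrite leNgt; exact/negP/h.
  rewrite enorm_sqr (bigD1 i)//= ler_wpDr ?sumr_ge0// => [j _|]; first exact: sqr_ge0.
  by rewrite -real_normK ?num_real// exprn_ege1// ltW.
have ei : (enorm x ^+ 2)^-1 <= 1 by rewrite invf_le1// (lt_le_trans _ e1).
have ce : cc / enorm x ^+ 2 <= cc by rewrite ler_piMr.
have x0 : x != 0.
  apply: contra_notN ncx => /eqP->; apply/cubeE => i; rewrite mxE normr0 ler01 //.
have lo := kV_lower x0.
have up := potential_fiber x h0.
have hh : 2^-1 ^+ N <= 2^-1 :> R.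
  rewrite -[leRHS]expr1; apply: ler_wiXn2l; rewrite ?(ltW h0)//; last by rewrite (leq_trans _ N2).
  by rewrite invf_le1// ler1n.
have hn : 0 <= 2^-1 ^+ N :> R by rewrite exprn_ge0 ?ltW.
have hV : 0 <= 2^-1 ^+ N * V (2^-1 *: x) by rewrite mulr_ge0.
have hc : cc / enorm x ^+ 2 * rho 2^-1 <= D by rewrite ler_wpM2r ?rho_ge0.
have up2 : k x * (1 - 2^-1 ^+ N) <= N%:R * (Vinf + D).
  have : k x * (1 - 2^-1 ^+ N) / N%:R <= Vinf + D.
    by have := VV x; move: up hV hc; rewrite -mulrA; lra.
  by rewrite ler_pdivrMr// [_ * N%:R]mulrC.
rewrite ler_norml; apply/andP; split; first by rewrite /K; move: lo ce NV ND; lra.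
have [k0|k0] := leP (k x) 0; first by rewrite /K; lra.
have : k x * 2^-1 <= k x * (1 - 2^-1 ^+ N) by rewrite ler_wpM2l ?(ltW k0)//; lra.
by move: up2; rewrite /K; lra.
Qed.

End Potential.

Lemma int_le_ae {d : measure_display} {T : measurableType d} {R : realType}
    (mu : {measure set T -> \bar R}) (g h : T -> R) : intg mu g -> intg mu h ->
  {ae mu, forall x, g x <= h x} -> \int[mu]_x g x <= \int[mu]_x h x.
Proof.
move=> ig ih gh; have mg := intg_measurable ig; have mh := intg_measurable ih.
have mm : measurable_fun [set: T] (fun x => Num.min (g x) (h x)) by exact: measurable_minr.
have e : {ae mu, forall x, g x = Num.min (g x) (h x)}.
  by apply: filterS gh => x /min_idPl.
rewrite (eq_int_ae mg mm e); apply: int_le => //; first exact: eq_intg_ae e ig.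
by move=> x; rewrite ge_min lexx orbT.
Qed.

(** * The energy and the Pohozaev functional on fibres *)

Section Fibering.
Context {R : realType} {N : nat} (N2 : (2 < N)%N) (f : R -> R).
Local Notation p := (critical_exponent R N).
Context (af : admissible (p - 1) f).
Context (V : 'rV[R]_N -> R) (Vinf th : R) (pV : potential V Vinf th).
Implicit Types (u w h : 'rV[R]_N -> R) (x y : 'rV[R]_N) (s t : R).
Local Notation mu := (lebesgue_rV R N).
Local Notation F := (primitive f).
Local Notation k := (kV V).
Local Notation cc := ((N%:R - 2) ^+ 3 * th / 4).
Local Notation rho := (@rho R N).

Let Nm : N = N.-2.+2. Proof. by case: N N2 => [|[|]]. Qed.
Let Ngt0 : (0 < N)%N. Proof. exact: leq_trans N2. Qed.
Let N0 : 0 < N%:R :> R. Proof. by rewrite ltr0n. Qed.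
Let N20 : 0 < N%:R - 2 :> R. Proof. by rewrite subr_gt0 ltr_nat. Qed.
Let th0 : 0 <= th. Proof. by case: pV => _ _ _ [_ /andP[]]. Qed.
Let th1 : 0 < 1 - th. Proof. by rewrite subr_gt0; case: pV => _ _ _ [_ /andP[]]. Qed.
Let V0 x : 0 <= V x. Proof. by case: pV => _ /(_ x)/andP[]. Qed.
Let VV x : V x <= Vinf. Proof. by case: pV => _ /(_ x)/andP[]. Qed.
Let Vn x : `|V x| <= Vinf. Proof. by rewrite ger0_norm. Qed.
Let tN2 t : t ^+ N = t ^+ N.-2 * t ^+ 2. Proof. by rewrite -exprD addn2 -Nm. Qed.

Lemma ae_neq0 : {ae mu, forall x, x != 0}.
Proof.
exists (cbox 0 0); split; first exact: measurable_cbox.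
  rewrite [LHS](@lebesgue_rV_box R N 0 0 (fun i => lexx _)).
  by rewrite (bigD1 (Ordinal Ngt0))//= subrr mul0r.
by move=> x /negP; rewrite negbK => /eqP-> i; rewrite mxE lexx.
Qed.

Lemma intg_bsq (b : 'rV[R]_N -> R) (C : R) u w : measurable_fun [set: 'rV[R]_N] b ->
  (forall x, `|b x| <= C) -> sqint mu u -> sqint mu w -> intg mu (fun x => b x * (u x * w x)).
Proof.
by move=> mb bC su sw; apply: eq_intg (sqintM (sqintMb mb bC su) sw) => x; rewrite mulrA.
Qed.

Lemma measurable_V : measurable_fun [set: 'rV[R]_N] V.
Proof. exact: continuous_rV_measurable (continuous_V pV). Qed.

Lemma measurable_scale (b : 'rV[R]_N -> R) t : continuous b ->
  measurable_fun [set: 'rV[R]_N] (fun x => b (t *: x)).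
Proof.
move=> cb; have := measurable_affine_comp t 0 (continuous_rV_measurable cb).
by under eq_fun do rewrite addr0.
Qed.

(** The dilation is carried by the continuous factor [b], which is why functionals on a fibre are
    written with V(t x) against a fixed u^2. *)
Lemma continuous_int_scale (b g : 'rV[R]_N -> R) (C : R) : continuous b ->
  (forall x, `|b x| <= C) -> intg mu g -> continuous (fun t : R => \int[mu]_x (b (t *: x) * g x)).
Proof.
move=> cb bC ig t.
have igt s : intg mu (fun x => b (s *: x) * g x).
  apply: (@intg_le _ _ _ _ _ (fun x => C * `|g x|)).
  - by apply: measurable_funM; [exact: measurable_scale|exact: intg_measurable ig].
  - by move=> x; rewrite normrM ler_wpM2r.
  - by apply: intgZ; exact: intg_norm.
have cbs x : continuous (fun s : R => b (s *: x) * g x).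
  move=> s; apply: cvgM; last exact: cvg_cst.
  apply: continuous_comp; last exact: cb.
  by apply: cvgZl; exact: cvg_id.
apply: (@continuity_under_integral R _ _ mu (fun s x =>
  b (s *: x) * g x) setT measurableT (t - 1) (t + 1) _ _ (fun x => C * `|g x|)).
- by move=> s _; exact: igt.
- by apply: aeW => x _ s _; exact: cbs.
- by apply: intgZ; exact: intg_norm.
- by move=> s _; apply: aeW => x _; rewrite normrM ler_wpM2r.
- by apply: mem_set; rewrite /= in_itv/=; apply/andP; split; lra.
Qed.

Lemma dilationE t u : dilation t u = (fun x => u (t^-1 *: x + 0)).
Proof. by apply/funext => x; rewrite addr0. Qed.

Lemma dilation_comp s t u : dilation s (dilation t u) = dilation (s * t) u.
Proof. by apply/funext => x; rewrite /dilation scalerA invfM mulrC. Qed.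

Lemma dilation1 u : dilation 1 u = u.
Proof. by apply/funext => x; rewrite /dilation invr1 scale1r. Qed.

Lemma H1_dilation t u : 0 < t -> H1 u -> H1 (dilation t u).
Proof. by move=> t0 Hu; rewrite dilationE; apply: H1_affine => //; rewrite invr_gt0. Qed.

Lemma Edir_dilation t u : 0 < t -> H1 u -> Edir (dilation t u) = t ^+ N.-2 * Edir u.
Proof.
move=> t0 Hu; rewrite dilationE Edir_affine ?invr_gt0// invrK tN2 mulrA; congr (_ * _).
by rewrite mulrCA -exprMn mulVf ?gt_eqF// expr1n mulr1.
Qed.

Lemma int_dilation t (b g : 'rV[R]_N -> R) : 0 < t -> intg mu (fun x => b (t *: x) * g x) ->
  \int[mu]_x (b x * g (t^-1 *: x)) = t ^+ N * \int[mu]_x (b (t *: x) * g x).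
Proof.
move=> t0 ig; have tV : 0 < t^-1 by rewrite invr_gt0.
have := int_scale tV ig; rewrite invrK => <-; apply: eq_int => x.
by rewrite scalerA mulfV ?gt_eqF// scale1r.
Qed.

Lemma int_primitive_dilation t u : 0 < t -> H1 u ->
  \int[mu]_x F (dilation t u x) = t ^+ N * \int[mu]_x F (u x).
Proof.
move=> t0 Hu; have iF := intg_primitive N2 af Hu; have tV : 0 < t^-1 by rewrite invr_gt0.
by have := int_scale tV iF; rewrite invrK.
Qed.

Lemma intg_bscale (b : 'rV[R]_N -> R) (C : R) t u w : continuous b -> (forall x, `|b x| <= C) ->
  sqint mu u -> sqint mu w -> intg mu (fun x => b (t *: x) * (u x * w x)).
Proof. by move=> cb bC; apply: intg_bsq => //; exact: measurable_scale. Qed.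

Lemma energyE u : H1 u -> energy V f u =
  2^-1 * (Edir u + \int[mu]_x (V x * (u x * u x))) - \int[mu]_x F (u x).
Proof.
move=> Hu; have su := H1_sqint Hu; rewrite /energy; congr (_ * _ - _).
rewrite intD; first by congr (_ + _); apply: eq_int => x; rewrite expr2.
  exact: intg_enorm_wgrad.
by apply: eq_intg (intg_bsq measurable_V Vn su su) => x; rewrite expr2.
Qed.

Lemma energy_dilation t u : 0 < t -> H1 u -> energy V f (dilation t u) =
  2^-1 * (t ^+ N.-2 * Edir u + t ^+ N * \int[mu]_x (V (t *: x) * (u x * u x))) -
  t ^+ N * \int[mu]_x F (u x).
Proof.
move=> t0 Hu; have su := H1_sqint Hu.
rewrite energyE ?Edir_dilation ?int_primitive_dilation//; last exact: H1_dilation.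
congr (_ * (_ + _) - _).
rewrite (@int_dilation t V (fun x => u x * u x))//.
exact: (intg_bscale t (continuous_V pV) Vn su su).
Qed.

Lemma pohozaevE u : H1 u -> pohozaev V f u =
  (N%:R - 2) / 2 * Edir u + 2^-1 * \int[mu]_x (k x * (u x * u x)) - N%:R * \int[mu]_x F (u x).
Proof. by move=> Hu; congr (_ + _ * _ - _); apply: eq_int => x; rewrite expr2. Qed.

Lemma pohozaev_dilation t u : 0 < t -> H1 u -> pohozaev V f (dilation t u) =
  (N%:R - 2) / 2 * (t ^+ N.-2 * Edir u) +
  2^-1 * (t ^+ N * \int[mu]_x (k (t *: x) * (u x * u x))) - N%:R * (t ^+ N * \int[mu]_x F (u x)).
Proof.
move=> t0 Hu; have su := H1_sqint Hu; have [K K0 kK] := kV_bounded N2 pV.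
rewrite pohozaevE ?Edir_dilation ?int_primitive_dilation//; last exact: H1_dilation.
congr (_ + _ * _ - _).
rewrite (@int_dilation t k (fun x => u x * u x))//.
exact: (intg_bscale t (continuous_kV pV) kK su su).
Qed.

(** The zero-order part of the energy of the problem at infinity. It scales by t^N under dilation,
    so that energy has the fibre profile t^(N-2) Edir u / 2 + t^N Bf u. *)
Definition Bf u : R := 2^-1 * Vinf * n2 mu u - \int[mu]_x F (u x).

Lemma BfE u : H1 u -> Bf u = \int[mu]_x (2^-1 * Vinf * u x ^+ 2 - F (u x)).
Proof.
move=> Hu; have [_ iu] := H1_sqint Hu.
by rewrite intB ?intZ//; [exact: intgZ|exact: intg_primitive].
Qed.

Lemma hardy_cc u : H1 u -> cc * \int[mu]_x (u x ^+ 2 / enorm x ^+ 2) <= (N%:R - 2) * th * Edir u.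
Proof.
move=> Hu; have [_ h] := hardy N2 Hu.
have c0 : 0 <= (N%:R - 2) * th / 4 by rewrite divr_ge0// mulr_ge0// ltW.
have := ler_wpM2l c0 h.
rewrite (_ : _ * (_ ^+ 2 * _) = cc * \int[mu]_x (u x ^+ 2 / enorm x ^+ 2)); last by ring.
move/le_trans; apply; rewrite le_eqVlt; apply/orP; left; apply/eqP; by field.
Qed.

Lemma fiber_inequality u t : H1 u -> 0 < t ->
  energy V f (dilation t u) <= energy V f u + (t ^+ N - 1) / N%:R * pohozaev V f u -
    2^-1 * (1 - th) * (N%:R - 2) * rho t * Edir u.
Proof.
move=> Hu t0; have su := H1_sqint Hu; have [K K0 kK] := kV_bounded N2 pV.
have [ih hh] := hardy N2 Hu.
have iV := intg_bsq measurable_V Vn su su.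
have ik : intg mu (fun x => k x * (u x * u x)).
  exact: (intg_bsq (continuous_rV_measurable (continuous_kV pV)) kK su su).
have iVt := intg_bscale t (continuous_V pV) Vn su su.
set a := (t ^+ N - 1) / N%:R.
have pt x : t ^+ N * (V (t *: x) * (u x * u x)) <=
    (V x * (u x * u x) + a * (k x * (u x * u x))) + cc * rho t * (u x ^+ 2 / enorm x ^+ 2).
  have u0 : 0 <= u x * u x by rewrite -expr2 sqr_ge0.
  have := ler_wpM2r u0 (potential_fiber N2 pV x t0); rewrite -/a.
  by rewrite expr2; lra.
have := int_le (intgZ (t ^+ N) iVt) (intgD (intgD iV (intgZ a ik)) (intgZ (cc * rho t) ih)) pt.
rewrite intZ// intD; [|by apply: intgD => //; exact: intgZ|exact: intgZ].
rewrite intD ?intZ//; last exact: intgZ.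
have rh := ler_wpM2l (rho_ge0 N2 t0) (hardy_cc Hu).
rewrite energy_dilation// energyE// pohozaevE//.
(* Both powers of [t] are expressed through [a] and [rho t]; the claim is then a linear inequality
   between products of these with the integrals. *)
have tE : t ^+ N.-2 = 1 + (N%:R - 2) * a - (N%:R - 2) * rho t.
  by rewrite /rho /a; field; rewrite !gt_eqF.
have tNE : t ^+ N = 1 + N%:R * a by rewrite /a; field; rewrite gt_eqF.
have e1 : t ^+ N.-2 * Edir u = (1 + (N%:R - 2) * a - (N%:R - 2) * rho t) * Edir u by rewrite tE.
have e2 : t ^+ N * \int[mu]_x F (u x) = (1 + N%:R * a) * \int[mu]_x F (u x) by rewrite -tNE.
move: rh e1 e2; clearbody a; lra.
Qed.

(** [kV_lower] integrated against u^2, with Hardy's inequality for the singular term; the excluded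
    origin is a null set. The point is that P(u) = 0 makes [Bf u] negative. *)
Lemma pohozaev_lower u : H1 u ->
  2^-1 * (1 - th) * (N%:R - 2) * Edir u + N%:R * Bf u <= pohozaev V f u.
Proof.
move=> Hu; have su := H1_sqint Hu; have [_ iu] := su; have [K K0 kK] := kV_bounded N2 pV.
have [ih _] := hardy N2 Hu.
have ik := intg_bsq (continuous_rV_measurable (continuous_kV pV)) kK su su.
have := int_le_ae (intgZ (N%:R * Vinf) iu) (intgD ik (intgZ cc ih)) _.
rewrite intD ?intZ//; last exact: intgZ.
have hc := hardy_cc Hu; rewrite pohozaevE// /Bf -/(n2 mu u).
suff : {ae mu, forall x, N%:R * Vinf * u x ^+ 2 <= k x * (u x * u x) +
  cc * (u x ^+ 2 / enorm x ^+ 2)}.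
  move=> hae /(_ hae); move: hc; lra.
apply: filterS ae_neq0 => x x0.
by have := ler_wpM2r (sqr_ge0 (u x)) (kV_lower N2 pV x0); rewrite expr2; lra.
Qed.

(** Let t -> 0 in [fiber_inequality]: the left side is bounded below by a multiple of t^N, and since
    rho(t) tends to 2 / (N (N-2)) the gap term tends to (1 - theta)/N times the Dirichlet energy. *)
Lemma energy_lower u : H1 u ->
  (1 - th) / N%:R * Edir u + pohozaev V f u / N%:R <= energy V f u.
Proof.
move=> Hu; have su := H1_sqint Hu.
pose IF := \int[mu]_x F (u x).
pose X := energy V f u - pohozaev V f u / N%:R - (1 - th) / N%:R * Edir u.
pose Y := `|pohozaev V f u / N%:R + IF| + 2^-1 * (1 - th) * Edir u.
have E0 := Edir_ge0 u.
have Y0 : 0 <= Y by rewrite addr_ge0// !mulr_ge0// ltW.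
have H t : 0 < t < 1 -> 0 <= X + t * Y.
  move=> /andP[t0 t1].
  have := fiber_inequality Hu t0; rewrite energy_dilation// -/IF.
  have h1 : 0 <= 2^-1 * (t ^+ N.-2 * Edir u + t ^+ N * \int[mu]_x (V (t *: x) * (u x * u x))).
    rewrite mulr_ge0// addr_ge0// mulr_ge0 ?exprn_ge0 ?(ltW t0)//.
    by apply: int_ge0 => x; rewrite mulr_ge0// -expr2 sqr_ge0.
  have tle (n : nat) : (0 < n)%N -> t ^+ n <= t.
    by move=> n0; rewrite -[leRHS]expr1; apply: ler_wiXn2l => //; exact: ltW.
  have tN : t ^+ N <= t by exact: tle.
  have tN' : t ^+ N.-2 <= t by apply: tle; case: (N) N2 => [|[|[]]].
  have tN0 : 0 <= t ^+ N by rewrite exprn_ge0 ?ltW.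
  have z0 : 0 <= 2^-1 * (1 - th) * Edir u by rewrite !mulr_ge0// ltW.
  have z1 : 0 <= 2^-1 * (1 - th) * (N%:R - 2) / N%:R * Edir u * t ^+ N.
    by rewrite !mulr_ge0 ?invr_ge0 ?exprn_ge0 ?(ltW t0) ?(ltW th1) ?(ltW N20).
  have h2 := ler_wpM2r z0 tN'.
  have h3 : t ^+ N * (pohozaev V f u / N%:R + IF) <= t * `|pohozaev V f u / N%:R + IF|.
    apply: le_trans (ler_norm _) _; rewrite normrM ger0_norm//; exact: ler_wpM2r.
  have rE : 2^-1 * (1 - th) * (N%:R - 2) * rho t * Edir u =
    2^-1 * (1 - th) * (N%:R - 2) / N%:R * Edir u * t ^+ N -
    2^-1 * (1 - th) * Edir u * t ^+ N.-2 + (1 - th) / N%:R * Edir u.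
    by rewrite /rho; field; rewrite !gt_eqF.
  rewrite rE /X /Y; move: h1 h2 h3 z1; lra.
suff : 0 <= X by rewrite /X; lra.
rewrite leNgt; apply/negP => X0.
pose t := Num.min 2^-1 (- X / (2 * (Y + 1))).
have Y1 : 0 < 2 * (Y + 1) by rewrite mulr_gt0// ltr_wpDl.
have t0 : 0 < t by rewrite lt_min invr_gt0 ltr0n/= divr_gt0// oppr_gt0.
have t2 : t <= 2^-1 by rewrite ge_min lexx.
have tX : t * (2 * (Y + 1)) <= - X by rewrite -ler_pdivlMr// ge_min lexx orbT.
have t01 : 0 < t < 1 by rewrite t0 (le_lt_trans t2)// invf_lt1// ltr1n.
have := H t t01; have := mulr_ge0 (ltW t0) Y0; move: X0 tX t0; lra.
Qed.

Lemma Edir_gt0 u : H1 u -> ~ {ae mu, forall x, u x = 0} -> 0 < Edir u.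
Proof.
move=> Hu nu; rewrite lt0r Edir_ge0 andbT; apply/eqP => E0; apply: nu.
have [i1 i2] := sobolev N2 Hu.
have p0 : p / 2 != 0.
  by rewrite gt_eqF// divr_gt0// (lt_trans _ (critical_exponent_gt2 (R := R) N2)).
rewrite E0 powR0// mulr0 in i2.
have := int_eq0_ae (fun x => powR_ge0 `|u x| p) i1.
case=> [|A [mA A0 sA]]; first by apply/eqP; rewrite eq_le i2 int_ge0// => x; exact: powR_ge0.
exists A; split => //; apply: subset_trans sA; apply: subsetC => x /powR_eq0_eq0/eqP.
by rewrite normr_eq0 => /eqP.
Qed.

Lemma Lambda_Bf u : Lambda Vinf f u <-> H1 u /\ Bf u < 0.
Proof. by split=> -[Hu]; rewrite -?BfE// => h; split; rewrite -?BfE// BfE. Qed.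

Lemma Bf_neq0 u : H1 u -> Bf u < 0 -> ~ {ae mu, forall x, u x = 0}.
Proof.
move=> Hu Bu u0; have [m_u _] := H1_sqint Hu.
have m0 : measurable_fun [set: 'rV[R]_N] (fun _ : 'rV[R]_N => 0 : R) by [].
have n0 : n2 mu u = 0.
  by rewrite (ae_eq_n2 m_u m0 u0) /n2; under eq_fun do rewrite expr0n; exact: int0.
have F0 : \int[mu]_x F (u x) = 0.
  have mF : measurable_fun [set: 'rV[R]_N] (fun x => F (u x)).
    by apply: measurable_comp_cont => //; apply: continuous_primitive; case: af.
  rewrite (eq_int_ae mF m0) ?int0//; apply: filterS u0 => x ->; apply: primitive0; by case: af.
by move: Bu; rewrite /Bf n0 F0 mulr0 subr0 ltxx.
Qed.

Lemma manifold_Lambda u : pohozaev_manifold V f u -> Lambda Vinf f u.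
Proof.
move=> [Hu nu Pu]; apply/Lambda_Bf; split=> //.
have := pohozaev_lower Hu; rewrite Pu; have E0 := Edir_gt0 Hu nu => h.
have c0 : 0 < 2^-1 * (1 - th) * (N%:R - 2) * Edir u by rewrite !mulr_gt0// invr_gt0.
rewrite -(pmulr_rlt0 _ N0); lra.
Qed.

Lemma manifold_max u t : pohozaev_manifold V f u -> 0 < t ->
  energy V f (dilation t u) <= energy V f u - 2^-1 * (1 - th) * (N%:R - 2) * rho t * Edir u.
Proof. by move=> [Hu nu Pu] t0; have := fiber_inequality Hu t0; rewrite Pu mulr0 addr0. Qed.

Lemma manifold_max_le u t : pohozaev_manifold V f u -> 0 < t ->
  energy V f (dilation t u) <= energy V f u.
Proof.
move=> Mu t0; apply: le_trans (manifold_max Mu t0) _; rewrite gerBl.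
by rewrite !mulr_ge0 ?Edir_ge0 ?(rho_ge0 N2 t0)// ltW// invr_gt0.
Qed.

Lemma energy_dilation_le t u : 0 < t -> H1 u ->
  energy V f (dilation t u) <= 2^-1 * (t ^+ N.-2 * Edir u) + t ^+ N * Bf u.
Proof.
move=> t0 Hu; have su := H1_sqint Hu; have [_ iu] := su; rewrite energy_dilation// /Bf.
have : \int[mu]_x (V (t *: x) * (u x * u x)) <= Vinf * n2 mu u.
  rewrite -intZ//; apply: int_le; [exact: (intg_bscale t (continuous_V pV) Vn su su)|exact:
    intgZ|].
  by move=> x; rewrite -expr2 ler_wpM2r ?sqr_ge0.
have tN0 : 0 <= t ^+ N by rewrite exprn_ge0 ?ltW.
by move=> /(ler_wpM2l tN0); lra.
Qed.

(** If P(u_s) were positive for a large s, [fiber_inequality] applied from u_s back to [u] would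
    give I(u) <= I(u_s), whereas I(u_s) tends to -oo because [Bf u] is negative. *)
Lemma pohozaev_dilation_le0 u : H1 u -> Bf u < 0 ->
  exists2 s : R, 1 < s & pohozaev V f (dilation s u) <= 0.
Proof.
move=> Hu Bu; have b0 : 0 < - Bf u by rewrite oppr_gt0.
(* With this [s], [energy_dilation_le] puts I(u_s) at or below -|I(u)| - 1. *)
have [s s1 sb] : exists2 s : R, 1 < s & 2^-1 * Edir u + `|energy V f u| + 1 <= s ^+ 2 * - Bf u.
  pose A := 2^-1 * Edir u + `|energy V f u| + 1.
  have A0 : 0 < A by rewrite ltr_wpDl// addr_ge0// mulr_ge0// Edir_ge0.
  exists (1 + A / - Bf u); first by rewrite ltrDl divr_gt0.
  apply: (@le_trans _ _ ((1 + A / - Bf u) * - Bf u)).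
    by rewrite mulrDl mul1r divfK ?gt_eqF// lerDr ltW.
  by rewrite ler_pM2r// expr2 ler_peMl// ?lerDl ?addr_ge0 ?divr_ge0// ltW.
exists s => //; have s0 : 0 < s by exact: lt_trans s1.
rewrite leNgt; apply/negP => Ps.
have Hs := H1_dilation s0 Hu; have sV0 : 0 < s^-1 by rewrite invr_gt0.
have h := fiber_inequality Hs sV0; rewrite dilation_comp mulVf ?gt_eqF// dilation1 in h.
have r0 : 0 <= 2^-1 * (1 - th) * (N%:R - 2) * rho s^-1 * Edir (dilation s u).
  by rewrite !mulr_ge0 ?Edir_ge0 ?(rho_ge0 N2)// ltW// invr_gt0.
have a0 : (s^-1 ^+ N - 1) / N%:R * pohozaev V f (dilation s u) <= 0.
  apply: mulr_le0_ge0; last exact: ltW.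
  rewrite pmulr_lle0 ?invr_gt0// subr_le0 exprn_ile1 ?(ltW sV0)//.
  by rewrite invf_le1// ltW.
have h1 : energy V f u <= energy V f (dilation s u).
  by apply: (le_trans h); rewrite -addrA gerDl subr_le0 (le_trans a0 r0).
have h2 := energy_dilation_le s0 Hu; rewrite tN2 in h2.
have sN1 : 1 <= s ^+ N.-2 by rewrite exprn_ege1// ltW.
have h3 : `|energy V f u| + 1 <= s ^+ N.-2 * (s ^+ 2 * - Bf u - 2^-1 * Edir u).
  apply: (@le_trans _ _ (s ^+ N.-2 * (`|energy V f u| + 1))).
    by rewrite ler_peMl// addr_ge0.
  apply: ler_wpM2l; first exact: exprn_ge0 (ltW s0).
  rewrite lerBrDl addrA; exact: sb.
have h4 := ler_norm (- energy V f u); rewrite normrN in h4.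
clear h r0 a0 sb Ps Bu b0; move: h1 h2 h3 h4.
move: (energy V f (dilation s u)) (energy V f u) (Edir u) (Bf u) => a b c d; lra.
Qed.

(** Intermediate value theorem for P along the fibre: near 0 the gradient term of order t^(N-2)
    dominates those of order t^N, and [pohozaev_dilation_le0] supplies the opposite sign. *)
Lemma fiber_max u : H1 u -> Bf u < 0 ->
  exists2 t0 : R, 0 < t0 & pohozaev_manifold V f (dilation t0 u).
Proof.
move=> Hu Bu; have su := H1_sqint Hu; have [_ iu] := su; have nu := Bf_neq0 Hu Bu.
have E0 := Edir_gt0 Hu nu; have [K K0 kK] := kV_bounded N2 pV.
pose IF := \int[mu]_x F (u x).
pose P t := (N%:R - 2) / 2 * (t ^+ N.-2 * Edir u) +
  2^-1 * (t ^+ N * \int[mu]_x (k (t *: x) * (u x * u x))) - N%:R * (t ^+ N * IF).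
have PE t : 0 < t -> pohozaev V f (dilation t u) = P t by move=> t0; rewrite pohozaev_dilation.
have cP : continuous P.
  have cX (n : nat) : continuous (fun t : R => t ^+ n) by exact: exprn_continuous.
  have ci : intg mu (fun x => u x * u x) by apply: sqintM.
  have ck := continuous_int_scale (continuous_kV pV) kK ci.
  move=> t; apply: cvgB; first apply: cvgD.
  - by apply: cvgM; [exact: cvg_cst|apply: cvgM; [exact: cX|exact: cvg_cst]].
  - by apply: cvgM; [exact: cvg_cst|apply: cvgM; [exact: cX|exact: ck]].
  - by apply: cvgM; [exact: cvg_cst|apply: cvgM; [exact: cX|exact: cvg_cst]].
pose Z := 2^-1 * (K * n2 mu u) + N%:R * `|IF|.
have Z0 : 0 <= Z by rewrite addr_ge0// !mulr_ge0 ?n2_ge0 ?(ltW N0).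
pose q := (N%:R - 2) / 2 * Edir u.
have q0 : 0 < q by rewrite !mulr_gt0// invr_gt0.
(* Small enough that t1^2 [Z], which bounds the terms of order t^N after division by t1^(N-2), stays
   below the gradient coefficient [q]. *)
pose t1 := Num.min 1 (q / (Z + 1)).
have t10 : 0 < t1 by rewrite lt_min ltr01 divr_gt0// ltr_wpDl.
have t11 : t1 <= 1 by rewrite ge_min lexx.
have t1Z : t1 * (Z + 1) <= q by rewrite -ler_pdivlMr ?ltr_wpDl// ge_min lexx orbT.
have P1 : 0 <= P t1.
  have kb : - (K * n2 mu u) <= \int[mu]_x (k (t1 *: x) * (u x * u x)).
    have ik := intg_bscale t1 (continuous_kV pV) kK su su.
    have : `|\int[mu]_x (k (t1 *: x) * (u x * u x))| <= K * n2 mu u.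
      rewrite -intZ//; apply: int_norm_le => //; first exact: intgZ.
      by move=> x; rewrite -expr2 normrM [`|u x ^+ 2|]ger0_norm ?sqr_ge0// ler_wpM2r ?sqr_ge0.
    by rewrite ler_norml => /andP[].
  have -> : P t1 = t1 ^+ N.-2 * (q + t1 ^+ 2 * (2^-1 * \int[mu]_x (k (t1 *: x) * (u x * u x)) -
    N%:R * IF)).
    by rewrite /P /q tN2; ring.
  rewrite mulr_ge0 ?exprn_ge0 ?(ltW t10)//.
  have hZ : - Z <= 2^-1 * \int[mu]_x (k (t1 *: x) * (u x * u x)) - N%:R * IF.
    have := ler_wpM2l (ltW N0) (ler_norm IF); rewrite /Z; move: kb; lra.
  have := ler_wpM2l (sqr_ge0 t1) hZ.
  have : t1 ^+ 2 * Z <= t1 * Z by rewrite ler_wpM2r// expr2 ler_piMl// ltW.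
  by move: t1Z t10; lra.
have [s s1 P2'] := pohozaev_dilation_le0 Hu Bu.
have s0 : 0 < s by exact: lt_trans s1.
have P2 : P s <= 0 by rewrite -PE.
have t1s : t1 <= s by rewrite (le_trans t11)// ltW.
have [|c] := @IVT _ P t1 s 0 t1s (continuous_subspaceT cP).
  by rewrite ge_min P2 orbT le_max P1.
rewrite in_itv/= => /andP[t1c _] Pc.
have c0 : 0 < c by exact: lt_le_trans t1c.
exists c => //; split; [exact: H1_dilation| |by rewrite PE].
move=> uc; have := Edir_dilation c0 Hu.
have HcE := H1_dilation c0 Hu.
have [mc _] := H1_sqint HcE.
have m0 : measurable_fun [set: 'rV[R]_N] (fun _ : 'rV[R]_N => 0 : R) by [].
have [_ <-] := H1_ae HcE m0 uc.
have -> : Edir (fun _ : 'rV[R]_N => 0 : R) = 0.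
  have h := EdirZ 0 Hu; rewrite expr0n/= mul0r in h; rewrite -[RHS]h.
  by congr Edir; apply/funext => x; rewrite mul0r.
by move=> /esym/eqP; rewrite mulf_eq0 expf_eq0 (gt_eqF c0) andbF (gt_eqF E0).
Qed.

End Fibering.

(** * Existence of a minimiser *)

Lemma margin_squeeze (R : realType) (a : nat -> R) (l : R) :
  (forall j, `|a j - l| <= margin j) -> a j @[j --> \oo] --> l.
Proof.
move=> al; apply/cvgrPdist_lt => e e0; apply: filterS (margin_lt e0) => j je.
by rewrite distrC; exact: le_lt_trans (al j) je.
Qed.

Lemma local_cvg0 (R : realType) (N : nat) (v : nat -> 'rV[R]_N -> R) :
  (forall j, sqint (lebesgue_rV R N) (v j)) ->
  (forall j, \int[lebesgue_rV R N]_x (\1_(@cube R N j%:R) x * v j x ^+ 2) <= margin j) ->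
  forall r : R, \int[lebesgue_rV R N]_x (\1_(@cube R N r) x * v j x ^+ 2) @[j --> \oo] --> (0 :
    R).
Proof.
move=> sv hv r; apply/cvgr0Pnorm_lt => d d0.
have [k hk] : exists k : nat, r <= k%:R.
  by exists (Num.truncn r).+1; rewrite ltW// truncnS_gt.
apply: filterS2 (nbhs_infty_ge k) (margin_lt d0) => j kj jd.
apply: le_lt_trans jd; rewrite ger0_norm; last by apply: int_ge0 => x;
  rewrite mulr_ge0 ?sqr_ge0// indicE.
apply: le_trans (hv j).
have iv q : intg (lebesgue_rV R N) (fun x => \1_(@cube R N q) x * v j x ^+ 2).
  have [mv iv] := sv j; apply: intg_le iv.
    by apply: measurable_funM; [exact: measurable_indic_cube|exact: measurable_funX].
  by move=> x; rewrite normrM [`|_ ^+ 2|]ger0_norm ?sqr_ge0// ler_piMl ?sqr_ge0// indic_le1.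
apply: int_le => // x; rewrite ler_wpM2r ?sqr_ge0// !indicE.
have [/set_mem cx|_] := boolP (x \in @cube R N r); last by [].
by rewrite mem_set//; apply: (cube_le _ cx); rewrite (le_trans hk)// ler_nat.
Qed.

(** Eventually B j < b/2, which makes the profile nonpositive beyond [T]; the good scales are
    therefore bounded. Their limit along an ultrafilter inherits the lower bound [c], and it is not
    0 because the limit profile vanishes there. *)
Lemma limit_profile (R : realType) (m : nat) (E B : nat -> R) (e b c : R) : (0 < m)%N ->
  0 <= e -> b < 0 -> 0 < c -> E j @[j --> \oo] --> e -> B j @[j --> \oo] --> b ->
  (forall j, B j < 0 -> exists2 t : R, 0 < t & c <= 2^-1 * (t ^+ m * E j) + t ^+ m.+2 * B j) ->
  exists2 t : R, 0 < t & c <= 2^-1 * (t ^+ m * e) + t ^+ m.+2 * b.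
Proof.
move=> m0 e0 b0 c0 Ee Bb H.
have [U [UU UF]] := @ultraFilterLemma nat \oo _.
have b2 : b / 2 < 0 by move: b0; lra.
have bb2 : b < b / 2 by move: b0; lra.
have ee1 : e < e + 1 by rewrite ltrDl.
pose T := 1 + (e + 1) / - b.
have T1 : 1 <= T by rewrite lerDl divr_ge0//; move: b0 e0; lra.
have T0 : 0 <= T by exact: le_trans T1.
pose good j (t : R) := c <= 2^-1 * (t ^+ m * E j) + t ^+ m.+2 * B j.
have Hj : \forall j \near \oo, exists t : R, 0 <= t <= T /\ good j t.
  have hB : \forall j \near \oo, B j < b / 2 by apply: cvgr_lt Bb _ _.
  have hE : \forall j \near \oo, E j < e + 1 by apply: cvgr_lt Ee _ _.
  apply: filterS2 hB hE => j Bj Ej.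
  have [t t0 h] := H j (lt_trans Bj b2).
  exists t; split => //; rewrite (ltW t0)/= leNgt; apply/negP => Tt.
  have tn : 0 < t ^+ m by rewrite exprn_gt0.
  have t1 : 1 <= t by apply: le_trans T1 (ltW Tt).
  have bb : T * - b <= t ^+ 2 * - b.
    by rewrite ler_wpM2r ?oppr_ge0 ?(ltW b0)// (le_trans (ltW Tt))// expr2 ler_peMl// ltW.
  have Tb : T * - b = - b + (e + 1).
    by rewrite /T mulrDl mul1r divfK// oppr_eq0 lt_eqF.
  have neg : 2^-1 * E j + t ^+ 2 * B j <= 0.
    by have := ler_wpM2l (sqr_ge0 t) (ltW Bj); move: bb Tb Ej b0; lra.
  have : c <= 0.
    have EQ : 2^-1 * (t ^+ m * E j) + t ^+ m.+2 * B j = t ^+ m * (2^-1 * E j + t ^+ 2 * B j).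
      have -> : t ^+ m.+2 = t ^+ m * t ^+ 2 by rewrite -exprD addn2.
      by move: (t ^+ m) (t ^+ 2) (E j) (B j) => x1 x2 x3 x4; ring.
    by apply: (le_trans h); rewrite EQ pmulr_rle0.
  by rewrite leNgt c0.
(* The default scale 0 serves the indices without a good scale, so that a bounded sequence is
   defined everywhere. *)
have HT j : exists t : R, 0 <= t <= T /\ ((exists t : R, 0 <= t <= T /\ good j t) -> good j t).
  have [[t [tT ht]]|n] := pselect (exists t : R, 0 <= t <= T /\ good j t); first by exists t.
  by exists 0; rewrite lexx.
have [ts tsP] := choice HT.
have tsb j : `|ts j| <= T by have [/andP[h1 h2] _] := tsP j; rewrite ger0_norm.
have [tau ctau] := @ultra_bounded_cvg R U UU ts T tsb.
have FU : ProperFilter U by exact: ultra_proper.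
have Bb' : B j @[j --> U] --> b by move=> A /Bb; exact: UF.
have Ee' : E j @[j --> U] --> e by move=> A /Ee; exact: UF.
have tp (n : nat) : ts j ^+ n @[j --> U] --> tau ^+ n.
  exact: (cvg_comp ts (fun t : R => t ^+ n) ctau (@exprn_continuous R n tau)).
have lim : (2^-1 * (ts j ^+ m * E j) + ts j ^+ m.+2 * B j) @[j --> U] -->
   2^-1 * (tau ^+ m * e) + tau ^+ m.+2 * b.
  apply: cvgD; last by apply: cvgM; [exact: tp|exact: Bb'].
  by apply: cvgM; [exact: cvg_cst|apply: cvgM; [exact: tp|exact: Ee']].
have ctau' : c <= 2^-1 * (tau ^+ m * e) + tau ^+ m.+2 * b.
  apply: (cvgr_to_ge lim); apply: UF; apply: filterS Hj => j hj.
  by have [_] := tsP j; exact.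
exists tau => //; rewrite lt0r; apply/andP; split.
  apply/eqP => t0; move: ctau'; rewrite t0 !expr0n (gtn_eqF m0)/=.
  by rewrite !mul0r mulr0 addr0 leNgt c0.
by apply: (cvgr_to_ge ctau); apply: nearW => j; have [/andP[]] := tsP j.
Qed.

Section Minimiser.
Context {R : realType} {N : nat} (N2 : (2 < N)%N) (f : R -> R).
Local Notation p := (critical_exponent R N).
Context (af : admissible (p - 1) f).
Context (V : 'rV[R]_N -> R) (Vinf th : R) (pV : potential V Vinf th).
Implicit Types (u w h : 'rV[R]_N -> R) (x y : 'rV[R]_N) (s t : R).
Local Notation mu := (lebesgue_rV R N).
Local Notation F := (primitive f).
Local Notation rho := (@rho R N).
Local Notation BB := (@Bf R N f Vinf).
Local Notation MM := (pohozaev_manifold V f).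
Local Notation cube := (@cube R N).

Let Nm : N = N.-2.+2. Proof. by case: N N2 => [|[|]]. Qed.
Let Npred : (0 < N.-2)%N. Proof. by case: N N2 => [|[|[]]]. Qed.
Let N0 : 0 < N%:R :> R. Proof. by rewrite ltr0n (leq_trans _ N2). Qed.
Let N20 : 0 < N%:R - 2 :> R. Proof. by rewrite subr_gt0 ltr_nat. Qed.
Let th1 : 0 < 1 - th. Proof. by rewrite subr_gt0; case: pV => _ _ _ [_ /andP[]]. Qed.
Let Vi0 : 0 < Vinf. Proof. by case: pV => _ _ _ []. Qed.
Let a0 : 0 < 2^-1 * (1 - th) * (N%:R - 2). Proof. by rewrite !mulr_gt0// invr_gt0. Qed.
Let tN2 t : t ^+ N = t ^+ N.-2 * t ^+ 2. Proof. by rewrite -exprD addn2 -Nm. Qed.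
Let fc : continuous f. Proof. by case: af. Qed.
Let p2 : 2 < p. Proof. exact: critical_exponent_gt2. Qed.

(** On M, [pohozaev_lower] and [primitive_int_small] with coefficient Vinf/4 give a E + N (Vinf/4)
    n2 <= N C E^(p/2), E being the Dirichlet energy. As p/2 > 1, E is bounded away from 0; the other
    term controls the L2 norm. *)
Lemma manifold_bounds : exists be C : R, [/\ 0 < be, 0 < C & forall u, MM u ->
  be <= Edir u /\ n2 mu u <= C * Edir u `^ (p / 2)].
Proof.
have Vi4 : 0 < Vinf / 4 by rewrite divr_gt0.
have [C C0 HC] := primitive_int_small N2 af Vi4.
have NC0 : 0 < N%:R * C by rewrite mulr_gt0.
have [a aE a1] : exists2 a : R, a = 2^-1 * (1 - th) * (N%:R - 2) & 0 < a by exists (2^-1 * (1 -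
  th) * (N%:R - 2)).
pose q := p / 2 - 1.
have q0 : 0 < q by rewrite /q; move: p2; lra.
pose be := (a / (N%:R * C)) `^ q^-1.
exists be, (C * (4 / Vinf)); split; first by rewrite powR_gt0 ?divr_gt0.
  by rewrite mulr_gt0 ?divr_gt0.
move=> u Mu; have [Hu nu Pu] := Mu.
have E0 := Edir_gt0 N2 Hu nu.
have h := pohozaev_lower N2 f pV Hu; rewrite Pu /Bf -aE in h.
have hF := le_trans (ler_norm _) (HC u Hu).
have n0 := n2_ge0 mu u.
have key : a * Edir u + N%:R * (Vinf / 4 * n2 mu u) <= N%:R * (C * Edir u `^ (p / 2)).
  have := ler_wpM2l (ltW N0) hF; move: h; lra.
have Nn0 : 0 <= N%:R * (Vinf / 4 * n2 mu u) by exact: mulr_ge0 (ltW N0) (mulr_ge0 (ltW Vi4) n0).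
split.
  have EE : Edir u `^ (p / 2) = Edir u `^ q * Edir u.
    by rewrite [RHS]mulrC /q mulr_powRB1 ?(ltW E0)// divr_gt0// (lt_trans _ p2).
  have h1 : a <= N%:R * C * Edir u `^ q.
    rewrite -(ler_pM2r E0); move: key Nn0; rewrite EE; lra.
  have h2 : a / (N%:R * C) <= Edir u `^ q by rewrite ler_pdivrMr// mulrC.
  have qq : q * q^-1 = 1 by rewrite mulfV// gt_eqF.
  have qV : 0 <= q^-1 by rewrite invr_ge0 ltW.
  have aN : 0 <= a / (N%:R * C) by rewrite divr_ge0 ?ltW.
  have := ge0_ler_powR qV; move=> /(_ (a / (N%:R * C)) (Edir u `^ q)).
  by rewrite !nnegrE => /(_ aN (powR_ge0 _ _) h2); rewrite -powRrM qq powRr1// ltW.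
have aE0 := mulr_ge0 (ltW a1) (ltW E0).
have h3 : N%:R * (Vinf / 4 * n2 mu u) <= N%:R * (C * Edir u `^ (p / 2)) by move: key aE0; lra.
move: h3; rewrite ler_pM2l// mulrC -ler_pdivlMr// => h3; apply: le_trans h3 _.
by rewrite le_eqVlt; apply/orP; left; apply/eqP; field; rewrite gt_eqF.
Qed.

(** Take [s0] times smooth approximations of the indicator of the unit cube: that cube has volume 1,
    so the integrals tend to Vinf s0^2 / 2 - F(s0), which is negative. *)
Lemma Lambda_nonempty (s0 : R) : 0 < s0 -> 2^-1 * Vinf * s0 ^+ 2 < F s0 ->
  exists2 u, H1 u & BB u < 0.
Proof.
move=> s00 hs0.
have [C C0] := primitive_growth af; rewrite subrK => FC.
pose G (s : R) := 2^-1 * Vinf * s ^+ 2 - F s.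
have cG : continuous G.
  move=> s; apply: cvgB; last exact: continuous_primitive.
  by apply: cvgM; [exact: cvg_cst|exact: exprn_continuous].
pose one : 'rV[R]_N := const_mx 1; pose zero : 'rV[R]_N := const_mx 0.
pose bj j := bumpN (margin j ^+ 2) (zero - const_mx (margin j)) (one + const_mx (margin j)).
have m20 j : 0 < (margin j : R) ^+ 2 by rewrite exprn_gt0// margin_gt0.
have lo j i : - 2 <= (zero - const_mx (margin j)) ord0 i.
  by rewrite !mxE; have := margin_le1 j (R := R); lra.
have hi j i : (one + const_mx (margin j)) ord0 i <= 2.
  by rewrite !mxE; have := margin_le1 j (R := R); lra.
have tb j : test_function (bj j) by exact: bumpN_test (m20 j) (lo j) (hi j).
have sb j : supp_in 2 (bj j) by exact: bumpN_supp (lo j) (hi j).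
pose uj j x := s0 * bj j x.
have Hj j : H1 (uj j) by apply: H1_test; exact: testZ.
pose D := 2^-1 * Vinf * s0 ^+ 2 + C * (s0 ^+ 2 + s0 `^ p).
have u01 j x : 0 <= uj j x <= s0.
  have /andP[h1 h2] := bumpN_itv (zero - const_mx (margin j)) (one +
    const_mx (margin j)) x (m20 j).
  by rewrite mulr_ge0 ?(ltW s00)//= ler_piMr// ltW.
have GD j x : `|G (uj j x)| <= D * \1_(cube 2) x.
  rewrite indicE; have [_|ncx] := boolP (x \in cube 2); last first.
    rewrite mulr0 /uj sb; last by move: ncx; rewrite notin_setE.
    by rewrite mulr0 /G expr0n/= mulr0 primitive0// subrr normr0.
  rewrite mulr1; have /andP[h1 h2] := u01 j x.
  apply: le_trans (ler_normB _ _) _; apply: lerD.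
    have V20 : 0 <= 2^-1 * Vinf by rewrite mulr_ge0// ltW.
    rewrite (ger0_norm (mulr_ge0 V20 (sqr_ge0 _))); apply: ler_wpM2l => //.
    by apply: lerXn2r; rewrite ?nnegrE// ltW.
  apply: le_trans (FC _) _; rewrite ler_pM2l//; apply: lerD.
    by apply: lerXn2r; rewrite ?nnegrE// ltW.
  rewrite ger0_norm//; apply: ge0_ler_powR; rewrite ?nnegrE ?(ltW s00)//.
  by rewrite ltW// (lt_trans _ p2).
have mc : measurable_fun [set: 'rV[R]_N] (fun x => G s0 * @chi R N x).
  by apply: measurable_funM => //; exact: measurable_chi.
have [|||||_] := @dct _ _ _ mu (fun j x => G (uj j x)) (fun x => G s0 * chi x) (fun x =>
  D * \1_(cube 2) x) => //.
- move=> j; apply: measurable_comp_cont => //; by have [] := H1_sqint (Hj j).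
- apply: aeW => x.
  have hx : uj j x @[j --> \oo] --> s0 * chi x.
    by apply: cvgMr; exact: bumpN_outer_cvg.
  have -> : G s0 * chi x = G (s0 * chi x).
    rewrite /chi indicE; case: (_ \in _); rewrite ?mulr1// !mulr0.
    by rewrite /G expr0n/= mulr0 primitive0// subrr.
  by apply: (cvg_comp _ _ hx); exact: cG.
- by apply: intgZ; exact: intg_indic_cube.
have [ic jc] := @chi_int R N; rewrite intZ// jc mulr1 => hc.
have G0 : G s0 < 0 by rewrite subr_lt0.
have [j _ /(_ j (leqnn j))/= hj] : \forall j \near \oo, \int[mu]_x G (uj j x) < 0.
  by apply: cvgr_lt hc _ _.
by exists (uj j) => //; rewrite (BfE N2 af).
Qed.

Lemma Bf_dilation t u : 0 < t -> H1 u -> BB (dilation t u) = t ^+ N * BB u.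
Proof.
move=> t0 Hu; have su := H1_sqint Hu; have tV : 0 < t^-1 by rewrite invr_gt0.
rewrite /Bf (int_primitive_dilation N2 af)// -[n2 mu (dilation t u)]/(n2 mu (fun x =>
  u (t^-1 *: x))).
by rewrite (n2_scale tV su) invrK; ring.
Qed.

(* The part of the minimising sequence that escapes has a nonnegative energy,
   so the profile [w] carries a minimiser on its fibre. *)
Lemma minimiser_of_limit w (v : nat -> 'rV[R]_N -> R) (e b c : R) :
  H1 w -> ~ {ae mu, forall x, w x = 0} -> (forall j, H1 (v j)) ->
  Edir (v j) @[j --> \oo] --> e -> BB (v j) @[j --> \oo] --> b ->
  (forall t, 0 < t -> energy V f (dilation t w) + 2^-1 * (t ^+ N.-2 * e) + t ^+ N * b <= c) ->
  2^-1 * (1 - th) * (N%:R - 2) * (Edir w + e) + N%:R * (BB w + b) <= 0 ->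
  0 < c -> (forall u, MM u -> c <= energy V f u) ->
  exists2 u, MM u & energy V f u <= c.
Proof.
move=> Hw nw Hv ve vb H Hb c0 cM.
(* Linear facts on plain reals, stated first to keep the integrals out of the arithmetic below. *)
have k1 (A X : R) : 0 < A -> A + X <= 0 -> X < 0 by lra.
have k2 (X y : R) : X + y < 0 -> 0 <= y -> X < 0 by lra.
have k3 (I x y : R) : I + x + y <= c -> c <= x + y -> I <= 0 by lra.
have k4 (I x y : R) : I + x + y <= c -> c <= I -> x + y <= 0 by lra.
have k5 (I J x y : R) : I <= J + x - y -> 0 <= y -> x <= 0 -> J <= 0 -> c <= I ->
  False by move: c0; lra.
have E0 := Edir_gt0 N2 Hw nw.
have e0 : 0 <= e by apply: (cvgr_to_ge ve); apply: nearW => j; exact: Edir_ge0.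
have Bwb : BB w + b < 0.
  rewrite -(pmulr_rlt0 _ N0); apply: k1 Hb.
  by rewrite mulr_gt0// ltr_wpDr.
(* If b >= 0, then [w] lies in Lambda, and at its fibre maximum the remainder contributes a
   nonnegative amount to a total of at most [c]. *)
have [b0|b0] := leP 0 b.
  have Bw : BB w < 0 := k2 _ _ Bwb b0.
  have [t t0 Mt] := fiber_max N2 af pV Hw Bw.
  exists (dilation t w) => //; apply: le_trans (H t t0).
  by rewrite -addrA lerDl addr_ge0// !mulr_ge0// exprn_ge0// ltW.
exfalso.
(* If b < 0, the v j eventually lie in Lambda and their fibre maxima are at least [c]; in the limit
   the remainder alone reaches [c] at some scale [tau], so w_tau has energy at most 0. *)
have [tau tau0 ptau] : exists2 tau : R, 0 < tau & c <= 2^-1 * (tau ^+ N.-2 * e) + tau ^+ N * b.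
  have [|tau tau0 h] := @limit_profile _ N.-2 (fun j => Edir (v j)) (fun j =>
    BB (v j)) e b c Npred e0 b0 c0 ve vb.
    move=> j Bj; have [t t0 Mt] := fiber_max N2 af pV (Hv j) Bj; exists t => //.
    by rewrite -Nm; exact: le_trans (cM _ Mt) (energy_dilation_le N2 af pV t0 (Hv j)).
  by exists tau => //; move: h; rewrite -Nm.
have Hwt := H1_dilation tau0 Hw.
have Ewt : 0 < Edir (dilation tau w) by rewrite (Edir_dilation N2)// mulr_gt0// exprn_gt0.
have Iw : energy V f (dilation tau w) <= 0 := k3 _ _ _ (H tau tau0) ptau.
(* Nonpositive energy forces P < 0 by [energy_lower], and this puts [w] in Lambda by
   [pohozaev_lower]. *)
have Pw : pohozaev V f (dilation tau w) < 0.
  rewrite -(pmulr_llt0 (x := N%:R^-1)) ?invr_gt0//.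
  apply: k1 (le_trans (energy_lower N2 af pV Hwt) Iw).
  by rewrite mulr_gt0// divr_gt0.
have Bw : BB w < 0.
  rewrite -(pmulr_rlt0 _ (exprn_gt0 N tau0)) -Bf_dilation// -(pmulr_rlt0 _ N0).
  exact: k1 (mulr_gt0 a0 Ewt) (le_trans (pohozaev_lower N2 f pV Hwt) (ltW Pw)).
have [t t0 Mt] := fiber_max N2 af pV Hw Bw.
have cIt := cM _ Mt.
have pt : 2^-1 * (t ^+ N.-2 * e) + t ^+ N * b <= 0 := k4 _ _ _ (H t t0) cIt.
(* Divided by t^(N-2) the profile of the remainder decreases in [t], so a scale where it is positive
   precedes one where it is nonpositive. *)
have taut : tau < t.
  rewrite ltNge; apply/negP => tt.
  have h1 : 0 < 2^-1 * e + tau ^+ 2 * b.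
    rewrite -(pmulr_rgt0 _ (exprn_gt0 N.-2 tau0)).
    apply: (lt_le_trans c0); apply: (le_trans ptau); rewrite tN2 le_eqVlt; apply/orP; left.
    by apply/eqP; ring.
  have h2 : t ^+ N.-2 * (2^-1 * e + t ^+ 2 * b) <= 0.
    by move: pt; rewrite tN2 => /(le_trans _); apply; rewrite le_eqVlt; apply/orP; left;
      apply/eqP; ring.
  rewrite pmulr_rle0 ?exprn_gt0// in h2.
  have h3 : t ^+ 2 <= tau ^+ 2 by apply: lerXn2r; rewrite ?nnegrE// ltW.
  have h4 := ler_wnM2r (ltW b0) h3; rewrite leNgt (lt_le_trans h1)// in h2.
  by rewrite lerD2l.
pose s := t / tau.
have s0 : 0 < s by rewrite divr_gt0.
have s1 : 1 <= s by rewrite ler_pdivlMr// mul1r ltW.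
(* Going outward from w_tau, where P is negative, cannot raise the energy: I(w_t) <= I(w_tau) <= 0,
   against I(w_t) >= c > 0. *)
have := fiber_inequality N2 af pV Hwt s0.
rewrite dilation_comp /s divfK ?gt_eqF// -/s => h.
have r0 : 0 <= 2^-1 * (1 - th) * (N%:R - 2) * rho s * Edir (dilation tau w).
  by rewrite mulr_ge0 ?Edir_ge0// mulr_ge0 ?(ltW a0) ?(rho_ge0 N2).
have q0 : (s ^+ N - 1) / N%:R * pohozaev V f (dilation tau w) <= 0.
  apply: mulr_ge0_le0; last exact: ltW.
  by rewrite divr_ge0 ?(ltW N0)// subr_ge0 exprn_ege1.
exact: k5 h r0 q0 Iw cIt.
Qed.

(** * Splitting off a weak limit *)

Section Splitting.
Context {U : set_system nat} {UU : UltraFilter U} (UF : \oo `<=` U).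

(** All limits exist along [U]; one index per [j] is then chosen at which each of them holds up to
    [margin j], together with the caller's condition [S j]. Quadratic cross terms vanish by weak
    convergence, the nonlinear one by [brezis_lieb] along the chosen sequence. *)
Lemma splitting (g : nat -> 'rV[R]_N -> R) (M : R) w (S : nat -> set nat) :
  (forall n, H1 (g n)) -> (forall n, n2 mu (g n) <= M) -> (forall n, Edir (g n) <= M) -> H1 w ->
  (forall h, sqint mu h -> ip mu (g n) h @[n --> U] --> ip mu w h) ->
  (forall h, H1 h -> Dip (g n) h @[n --> U] --> Dip w h) ->
  (forall j, U (S j)) ->
  exists (sg : nat -> nat) (e b : R), let v j x := g (sg j) x - w x in
    [/\ forall j, S j (sg j),
      (Edir (v j) @[j --> \oo] --> e) /\ (BB (v j) @[j --> \oo] --> b),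
      Edir (g (sg j)) @[j --> \oo] --> Edir w + e,
      BB (g (sg j)) @[j --> \oo] --> BB w + b &
      forall r : R, \int[mu]_x (\1_(cube r) x * v j x ^+ 2) @[j --> \oo] --> (0 : R)].
Proof.
move=> Hg n2M EM Hw gw Dw US; have sg n := H1_sqint (Hg n); have sw := H1_sqint Hw.
pose v n x := g n x - w x.
have Hv n : H1 (v n) by exact: H1B.
have sv n := H1_sqint (Hv n).
have gE n : g n = (fun x => w x + v n x) by apply/funext => x; rewrite /v addrC subrK.
have v0 h : sqint mu h -> ip mu (v n) h @[n --> U] --> (0 : R).
  move=> sh; under eq_fun do rewrite ipBl//.
  by rewrite -(subrr (ip mu w h)); apply: cvgB; [exact: gw|exact: cvg_cst].
have Dv0 : Dip w (v n) @[n --> U] --> (0 : R).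
  have DE n : Dip w (v n) = Dip (g n) w - Dip w w.
    rewrite /Dip -sumrB; apply: eq_bigr => i _.
    have gi : {ae mu, forall x, wpartial i (v n) x = wpartial i (g n) x - wpartial i w x}.
      apply: wpartial_ae => //; first by apply: sqintB; exact: wpartial_sqint.
      have [_ wg] := wpartialP i (Hg n); have [_ ww] := wpartialP i Hw.
      have h := weak_partialD (sg n) (sqintZ (-1) sw) (wpartial_sqint i (Hg n)) (sqintZ (-1)
        (wpartial_sqint i Hw)) wg
        (weak_partialZ (-1) sw (wpartial_sqint i Hw) ww).
      move: h; under eq_fun do rewrite mulN1r.
      by under [X in weak_partial _ _ X]eq_fun do rewrite mulN1r.
    rewrite ipC (ae_eq_ip _ _ _ gi); last 3 first.
    - exact: sqint_measurable (wpartial_sqint i (Hv n)).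
    - exact: sqint_measurable (sqintB (wpartial_sqint i (Hg n)) (wpartial_sqint i Hw)).
    - exact: sqint_measurable (wpartial_sqint i Hw).
    by rewrite ipBl//; exact: wpartial_sqint.
  under eq_fun do rewrite DE; rewrite -(subrr (Dip w w)).
  by apply: cvgB; [exact: Dw|exact: cvg_cst].
have Ev n : Edir (v n) <= 2 * M + 2 * Edir w.
  have := EdirD (Hg n) (H1Z (-1) Hw); rewrite EdirZ//.
  have -> : (fun x => g n x + -1 * w x) = v n by apply/funext => x; rewrite mulN1r.
  have := EdirD (Hg n) Hw; have := Edir_ge0 (fun x => g n x + w x).
  rewrite (DipZr (-1) (Hg n) Hw); have := EM n.
  move: (Edir (g n)) (Edir w) (Edir (v n)) (Dip (g n) w) (Edir (fun x => g n x + w x)) =>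
    a1 a2 a3 a4 a5.
  by rewrite sqrrN expr1n; lra.
have nv n : n2 mu (v n) <= 2 * M + 2 * n2 mu w.
  have := n2_parallelogram_le (sg n) (sqintN sw); rewrite n2N; have := n2M n.
  by move: (n2 mu (v n)) (n2 mu (g n)) (n2 mu w) => a1 a2 a3; lra.
pose M1 := 2 * M + 2 * Edir w; pose M2 := 2 * M + 2 * n2 mu w.
have M10 : 0 <= M1 by exact: le_trans (Edir_ge0 _) (Ev 0%N).
have [e eP] : exists e : R, Edir (v n) @[n --> U] --> e.
  by apply: (@ultra_bounded_cvg R U UU _ M1) => n; rewrite ger0_norm ?Edir_ge0//; exact: Ev.
have Vi2 : 0 < Vinf / 2 by rewrite divr_gt0.
have [C C0 FC] := primitive_int_small N2 af Vi2.
have [b bP] : exists b : R, BB (v n) @[n --> U] --> b.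
  apply: (@ultra_bounded_cvg R U UU _ (Vinf * M2 + C * M1 `^ (p / 2))) => n.
  apply: le_trans (ler_normB _ _) _.
  have h1 := FC _ (Hv n); have h2 : Edir (v n) `^ (p / 2) <= M1 `^ (p / 2).
    apply: ge0_ler_powR; [|by rewrite nnegrE Edir_ge0|by rewrite nnegrE|exact: Ev].
    by rewrite divr_ge0// ltW// (lt_trans _ p2).
  have h3 := ler_wpM2l (ltW C0) h2.
  have h4 : Vinf * n2 mu (v n) <= Vinf * M2 by rewrite ler_pM2l//; exact: nv.
  have h5 : `|2^-1 * Vinf * n2 mu (v n)| = 2^-1 * (Vinf * n2 mu (v n)).
    by rewrite mulrA ger0_norm// mulr_ge0 ?n2_ge0// mulr_ge0// ltW.
  rewrite h5; move: h1 h3 h4; rewrite -mulrA.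
  move: (n2 mu (v n)) (Edir (v n) `^ (p / 2)) (`|_|) (M1 `^ (p / 2)) => a1 a2 a3 a4; lra.
have near_lim (a : nat -> R) (l : R) : a n @[n --> U] --> l -> forall j, U [set n | `|a n - l| <=
  margin j].
  move=> al j; have /cvgrPdist_le/(_ _ (margin_gt0 j)) := al.
  by apply: filterS => n; rewrite distrC.
pose S' j := S j `&` ([set n | `|Edir (v n) - e| <= margin j] `&` ([set n | `|BB (v n) - b| <=
  margin j] `&`
  ([set n | `|Dip w (v n) - 0| <= margin j] `&` ([set n | `|ip mu (v n) w - 0| <= margin j] `&`
   [set n | \int[mu]_x (\1_(cube j%:R) x * v n x ^+ 2) <= margin j])))).
have rel (r d : R) : 0 < d -> \forall n \near U, \int[mu]_x (\1_(cube r) x * v n x ^+ 2) <= d.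
  by move=> d0; apply: (rellich r d0 Hv Ev v0).
have US' j : U (S' j).
  do !apply: filterI.
  - exact: US.
  - exact: near_lim eP j.
  - exact: near_lim bP j.
  - exact: near_lim Dv0 j.
  - exact: near_lim (v0 w sw) j.
  - exact: rel (margin_gt0 j).
have [sg_ [sgP aeP]] := extract_ae sv rel US'.
exists sg_, e, b => v'.
have ve : Edir (v' j) @[j --> \oo] --> e by apply: margin_squeeze => j; have [_ []] := sgP j.
have vb : BB (v' j) @[j --> \oo] --> b by apply: margin_squeeze => j; have [_ [_ []]] := sgP j.
have vD : Dip w (v' j) @[j --> \oo] --> (0 : R) by apply: margin_squeeze => j;
  have [_ [_ [_ []]]] := sgP j.
have vi : ip mu (v' j) w @[j --> \oo] --> (0 : R) by apply: margin_squeeze => j;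
  have [_ [_ [_ [_ []]]]] := sgP j.
split=> //.
- by move=> j; have [] := sgP j.
- have -> : Edir w + e = Edir w + 2 * 0 + e by rewrite mulr0 addr0.
  have EE j : Edir (g (sg_ j)) = Edir w + 2 * Dip w (v' j) + Edir (v' j).
    by rewrite gE EdirD//; exact: Hv.
  under eq_fun do rewrite EE.
  by apply: cvgD => //; apply: cvgD; [exact: cvg_cst|apply: cvgM => //; exact: cvg_cst].
- have npM j : np (v' j) <= @sobolev_const R N * M1 `^ (p / 2) by exact: np_le (Hv _) (Ev _).
  pose M3 := Num.max M2 (@sobolev_const R N * M1 `^ (p / 2)).
  have BL := @brezis_lieb R N N2 f af w v' M3 Hw (fun j => Hv _).
  have {}BL : (\int[mu]_x F (w x + v' j x) - \int[mu]_x F (w x) - \int[mu]_x F (v' j x)) @[j -->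
    \oo] --> (0 : R).
    by apply: BL aeP => j; rewrite le_max ?npM ?orbT// nv.
  have BE j : BB (g (sg_ j)) = BB w + BB (v' j) + Vinf * ip mu (v' j) w -
     (\int[mu]_x F (w x + v' j x) - \int[mu]_x F (w x) - \int[mu]_x F (v' j x)).
    rewrite gE /Bf -/(v' j) (n2D sw (sv _)) -/(v' j) [ip mu w _]ipC.
    have -> : v (sg_ j) = v' j by [].
    move: (n2 mu w) (ip mu (v' j) w) (n2 mu (v' j)) (\int[mu]_x F (w x +
      v' j x)) (\int[mu]_x F (w x)) (\int[mu]_x F (v' j x)) => x1 x2 x3 x4 x5 x6.
    by field.
  under eq_fun do rewrite BE.
  have -> : BB w + b = BB w + b + Vinf * 0 - 0 by rewrite mulr0 addr0 subr0.
  apply: cvgB => //; apply: cvgD; last by apply: cvgM => //; exact: cvg_cst.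
  by apply: cvgD => //; exact: cvg_cst.
- by apply: local_cvg0 => [j|j]; [exact: sv|have [_ [_ [_ [_ [_]]]]] := sgP j].
Qed.

End Splitting.

End Minimiser.

(** * From a minimising sequence to a minimiser *)

Section MinimiserExistence.
Context {R : realType} {N : nat} (N2 : (2 < N)%N) (f : R -> R).
Local Notation p := (critical_exponent R N).
Context (af : admissible (p - 1) f).
Context (V : 'rV[R]_N -> R) (Vinf th : R) (pV : potential V Vinf th).
Implicit Types (u w h : 'rV[R]_N -> R) (x y : 'rV[R]_N) (s t : R).
Local Notation mu := (lebesgue_rV R N).
Local Notation F := (primitive f).
Local Notation BB := (@Bf R N f Vinf).
Local Notation MM := (pohozaev_manifold V f).
Local Notation cube := (@cube R N).

Let N0 : 0 < N%:R :> R. Proof. by rewrite ltr0n (leq_trans _ N2). Qed.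
Let N20 : 0 < N%:R - 2 :> R. Proof. by rewrite subr_gt0 ltr_nat. Qed.
Let th1 : 0 < 1 - th. Proof. by rewrite subr_gt0; case: pV => _ _ _ [_ /andP[]]. Qed.
Let Vi0 : 0 < Vinf. Proof. by case: pV => _ _ _ []. Qed.
Let V0 x : 0 <= V x. Proof. by case: pV => _ /(_ x)/andP[]. Qed.
Let VV x : V x <= Vinf. Proof. by case: pV => _ /(_ x)/andP[]. Qed.
Let a0 : 0 < 2^-1 * (1 - th) * (N%:R - 2). Proof. by rewrite !mulr_gt0// invr_gt0. Qed.
Let p2 : 2 < p. Proof. exact: critical_exponent_gt2. Qed.

Definition vanishing_weight (W : 'rV[R]_N -> R) (C : R) : Prop :=
  [/\ measurable_fun [set: 'rV[R]_N] W, forall x, 0 <= W x <= C &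
    forall e : R, 0 < e -> exists r : R, forall x, ~ cube r x -> W x <= e].

Lemma weight_bound (W : 'rV[R]_N -> R) C x : vanishing_weight W C -> `|W x| <= C.
Proof. by case=> _ /(_ x)/andP[h1 h2] _; rewrite ger0_norm. Qed.

(** On a large cube the local convergence applies; outside it the weight is small and the L2 norms
    are bounded. *)
Lemma weight_vanish (W : 'rV[R]_N -> R) (C K : R) (v : nat -> 'rV[R]_N -> R) :
  vanishing_weight W C -> (forall j, sqint mu (v j)) -> (forall j, n2 mu (v j) <= K) ->
  (forall r : R, \int[mu]_x (\1_(cube r) x * v j x ^+ 2) @[j --> \oo] --> (0 : R)) ->
  \int[mu]_x (W x * (v j x * v j x)) @[j --> \oo] --> (0 : R).
Proof.
move=> Wv sv vK loc; have [mW W01 W0] := Wv.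
have C0 : 0 <= C by have /andP[h1 h2] := W01 0; exact: le_trans h2.
have K0 : 0 <= K by exact: le_trans (n2_ge0 _ _) (vK 0%N).
apply/cvgr0Pnorm_le => e e0.
pose d := e / (2 * (K + 1)).
have K1 : 0 < 2 * (K + 1) by rewrite mulr_gt0// ltr_wpDl.
have d0 : 0 < d by rewrite divr_gt0.
have dK : d * K <= e / 2.
  have -> : e / 2 = d * (K + 1) by rewrite /d; field; rewrite gt_eqF// ltr_wpDl.
  by rewrite ler_pM2l// lerDl.
have [r Wr] := W0 d d0.
have C1 : 0 < e / 2 / (C + 1) by rewrite !divr_gt0// ltr_wpDl.
apply: filterS (cvgr0_norm_le _ (loc r) _ C1) => j hj.
have [mv iv] := sv j.
have i1 : intg mu (fun x => \1_(cube r) x * v j x ^+ 2).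
  apply: intg_le iv.
    by apply: measurable_funM; [exact: measurable_indic_cube|exact: measurable_funX].
  by move=> x; rewrite normrM [`|_ ^+ 2|]ger0_norm ?sqr_ge0// ler_piMl ?sqr_ge0// indic_le1.
have i2 : intg mu (fun x => W x * (v j x * v j x)).
  by apply: (intg_bsq mW (C := C)) => // x; exact: weight_bound.
rewrite ger0_norm; last first.
  by apply: int_ge0 => x; rewrite -expr2; have /andP[h _] := W01 x; exact: mulr_ge0 h (sqr_ge0 _).
have h1 : \int[mu]_x (W x * (v j x * v j x)) <= \int[mu]_x (C * (\1_(cube r) x * v j x ^+ 2) +
  d * v j x ^+ 2).
  apply: int_le => //; first by apply: intgD; [exact: intgZ|exact: intgZ].
  move=> x; rewrite -expr2 indicE; have /andP[h h'] := W01 x; have q0 := sqr_ge0 (v j x).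
  have [_|/negP ncx] := boolP (x \in cube r).
    rewrite mul1r; apply: (le_trans (ler_wpM2r q0 h')).
    by rewrite lerDl; exact: mulr_ge0 (ltW d0) q0.
  rewrite mul0r mulr0 add0r; apply: ler_wpM2r => //; apply: Wr => cx; apply: ncx.
  exact: mem_set.
apply: (le_trans h1); rewrite intD; [|exact: intgZ|exact: intgZ].
rewrite !intZ// -/(n2 mu (v j)).
move: (le_trans (ler_norm _) hj); rewrite ler_pdivlMr ?ltr_wpDl// => h2.
have h3 : d * n2 mu (v j) <= d * K by rewrite ler_pM2l.
have h4 : 0 <= \int[mu]_x (\1_(cube r) x * v j x ^+ 2).
  by apply: int_ge0 => x; rewrite indicE; exact: mulr_ge0 (ler0n _ _) (sqr_ge0 _).
move: (\int[mu]_x (\1_(cube r) x * v j x ^+ 2)) (n2 mu (v j)) h2 h3 h4 dK => y1 y2.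
by clearbody d; lra.
Qed.

Lemma weight_split (W : 'rV[R]_N -> R) (C K : R) w (v : nat -> 'rV[R]_N -> R) :
  vanishing_weight W C -> sqint mu w -> (forall j, sqint mu (v j)) -> (forall j, n2 mu (v j) <=
    K) ->
  (forall r : R, \int[mu]_x (\1_(cube r) x * v j x ^+ 2) @[j --> \oo] --> (0 : R)) ->
  \int[mu]_x (W x * ((w x + v j x) * (w x +
    v j x))) @[j --> \oo] --> \int[mu]_x (W x * (w x * w x)).
Proof.
move=> Wv sw sv vK loc; have [mW W01 W0] := Wv.
have hv := weight_vanish Wv sv vK loc.
pose A := \int[mu]_x (W x * (w x * w x)).
have A0 : 0 <= A.
  by apply: int_ge0 => x; rewrite -expr2; have /andP[h _] := W01 x; exact: mulr_ge0 h (sqr_ge0 _).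
have iw u h : sqint mu u -> sqint mu h -> intg mu (fun x => W x * (u x * h x)).
  by move=> su sh; apply: (intg_bsq mW (C := C)) => // x; exact: weight_bound.
apply/cvgrPdist_le => e e0.
pose d := e / (2 * (A + 1)).
have A1 : 0 < A + 1 by rewrite ltr_wpDl.
have d0 : 0 < d by rewrite divr_gt0// mulr_gt0.
have dA : d * A <= e / 2.
  have -> : e / 2 = d * (A + 1) by rewrite /d; move: A1; move: (A) => y hy; field; rewrite gt_eqF.
  by rewrite ler_pM2l// lerDl.
have D0 : 0 < 1 + d^-1 by rewrite ltr_wpDr// invr_ge0 ltW.
have C1 : 0 < e / 2 / (1 + d^-1) by rewrite !divr_gt0.
apply: filterS (cvgr0_norm_le _ hv _ C1) => j hj.
rewrite distrC -intB; [|by apply: iw => //; exact: sqintD|exact: iw].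
apply: le_trans (_ : \int[mu]_x (d * (W x * (w x * w x)) + (1 +
  d^-1) * (W x * (v j x * v j x))) <= e).
  apply: int_norm_le.
  - by apply: intgB; [apply: iw => //; exact: sqintD|exact: iw].
  - by apply: intgD; apply: intgZ; exact: iw.
  move=> x; have /andP[h _] := W01 x.
  have -> : W x * ((w x + v j x) * (w x + v j x)) - W x * (w x * w x) =
    W x * (2 * (w x * v j x) + v j x * v j x).
    by move: (W x) (w x) (v j x) => y1 y2 y3; ring.
  have -> : d * (W x * (w x * w x)) + (1 + d^-1) * (W x * (v j x * v j x)) =
    W x * (d * (w x * w x) + (1 + d^-1) * (v j x * v j x)).
    by move: (W x) (w x) (v j x) (d^-1) => y1 y2 y3 y4; ring.
  rewrite normrM (ger0_norm h); apply: ler_wpM2l => //.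
  (* Weighted Young inequality: the small factor [d] goes to the fixed [w], the large one to the
     part that tends to 0. *)
  have q (y z : R) : y * z <= 2^-1 * (d * (y * y) + d^-1 * (z * z)) /\ - (y * z) <=
    2^-1 * (d * (y * y) + d^-1 * (z * z)).
    have h1 := mulr_ge0 (ltW d0) (sqr_ge0 (y - d^-1 * z)).
    have h2 := mulr_ge0 (ltW d0) (sqr_ge0 (y + d^-1 * z)).
    have e1 : d * (y - d^-1 * z) ^+ 2 = d * (y * y) + d^-1 * (z * z) - 2 * (y * z).
      by field; rewrite gt_eqF.
    have e2 : d * (y + d^-1 * z) ^+ 2 = d * (y * y) + d^-1 * (z * z) + 2 * (y * z).
      by field; rewrite gt_eqF.
    move: h1 h2; rewrite e1 e2; move: (d * (y * y)) (d^-1 * (z * z)) (y * z) => y1 y2 y3; lra.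
  have [q1 q2] := q (w x) (v j x); have := sqr_ge0 (v j x); rewrite expr2 => q3.
  have q4 := mulr_ge0 (ltW d0) (sqr_ge0 (w x)); rewrite expr2 in q4.
  have q5 : 0 <= d^-1 * (v j x * v j x) by apply: mulr_ge0 => //; rewrite invr_ge0 ltW.
  rewrite mulrDl mul1r ler_norml; move: q1 q2 q3 q4 q5.
  move: (d * (w x * w x)) (d^-1 * (v j x * v j x)) (w x * v j x) (v j x * v j x) => y1 y2 y3 y4 *.
  by apply/andP; split; lra.
rewrite intD; [|by apply: intgZ; exact: iw|by apply: intgZ; exact: iw].
rewrite !intZ; [|exact: iw|exact: iw]; rewrite -/A.
have h2 := le_trans (ler_norm _) hj; rewrite ler_pdivlMr// mulrC in h2.
move: dA h2; move: (d * A) ((1 + d^-1) * \int[mu]_x (W x * (v j x * v j x))) => y1 y2; lra.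
Qed.

Lemma deficit_weight t : 0 < t -> vanishing_weight (fun x => Vinf - V (t *: x)) Vinf.
Proof.
move=> t0; split.
- by apply: measurable_funB => //; apply: measurable_scale; exact: continuous_V pV.
- by move=> x; rewrite subr_ge0 VV/= gerBl.
- move=> e e0; have [_ _ lim _ _] := pV; have [r hr] := lim e e0.
  exists (r / t) => x ncx.
  have [i hi] : exists i, r / t < `|x ord0 i|.
    apply: contrapT => /forallNP h; apply: ncx; apply/cubeE => i.
    by rewrite leNgt; apply/negP; exact: h.
  have hx : `|x ord0 i| <= enorm x.
    rewrite -(sqrtr_sqr (x ord0 i)) /enorm ler_wsqrtr// /dotv (bigD1 i)//= -expr2 lerDl.
    by apply: sumr_ge0 => k _; rewrite -expr2 sqr_ge0.
  have : r < enorm (t *: x).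
    by rewrite enormZ ?(ltW t0)// mulrC -ltr_pdivrMr//; exact: lt_le_trans hi hx.
  move/hr; rewrite distrC => /ltW; apply: le_trans; exact: ler_norm.
Qed.

(** Separates the problem at infinity, whose terms are translation invariant, from a deficit that is
    continuous under local L2 convergence. This lets the translated and the untranslated case share
    one argument. *)
Lemma energy_dilation_deficit t u : 0 < t -> H1 u ->
  energy V f (dilation t u) = 2^-1 * (t ^+ N.-2 * Edir u) + t ^+ N * BB u
    - 2^-1 * (t ^+ N * \int[mu]_x ((Vinf - V (t *: x)) * (u x * u x))).
Proof.
move=> t0 Hu; have su := H1_sqint Hu; rewrite (energy_dilation N2 af pV)//.
have iV : intg mu (fun x => V (t *: x) * (u x * u x)).
  apply: (@intg_bscale _ _ V Vinf) => //; first exact: continuous_V pV.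
  by move=> x; rewrite ger0_norm.
have -> : \int[mu]_x ((Vinf - V (t *: x)) * (u x * u x)) =
  Vinf * n2 mu u - \int[mu]_x (V (t *: x) * (u x * u x)).
  have -> : n2 mu u = \int[mu]_x (u x * u x) by apply: eq_int => x; rewrite expr2.
  under eq_int do rewrite mulrBl.
  have iu : intg mu (fun x => u x * u x) := sqintM su su.
  by rewrite (intB (intgZ Vinf iu) iV) (intZ Vinf iu).
rewrite /Bf; move: (t ^+ N.-2) (t ^+ N) (Edir u) (n2 mu u) (\int[mu]_x F (u x)) (\int[mu]_x (V (t
  *: x) * (u x * u x))) => y1 y2 y3 y4 y5 y6.
by field.
Qed.

(** If all averages were small, [primitive_vanish] would bring N times the integral of F below a be
    / 2, whereas P(u) = 0 and the lower bound [be] on the Dirichlet energy require at least a be. *)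
Lemma nonvanishing (M : R) : exists l d : R, [/\ 0 < l, 0 < d & forall u, MM u ->
  n2 mu u <= M -> Edir u <= M -> exists x, d < `|avg l u x|].
Proof.
have [be [Cb [be0 _ Hbe]]] := manifold_bounds N2 af pV.
pose M1 := `|M| + 1.
have M10 : 0 < M1 by rewrite ltr_wpDl.
pose M2 := @sobolev_const R N * M1 `^ (p / 2).
have M20 : 0 <= M2 by rewrite mulr_ge0 ?powR_ge0 ?sobolev_const_ge0.
have [a aE a1] : exists2 a : R, a = 2^-1 * (1 - th) * (N%:R - 2) & 0 < a by exists (2^-1 * (1 -
  th) * (N%:R - 2)).
(* Two error terms are each allotted a be / 4: this [e] serves the first, the choice of [l] below
   the second. *)
pose e := a * be / (4 * N%:R * (M1 + M2)).
have M120 : 0 < M1 + M2 by rewrite ltr_wpDr.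
have e0 : 0 < e by rewrite divr_gt0 ?mulr_gt0.
have [kp [C [kp0 C0 H]]] := primitive_vanish N2 af e0.
pose l := Num.min 1 (a * be / (4 * N%:R * C * M1)).
have l0 : 0 < l by rewrite lt_min ltr01 divr_gt0 ?mulr_gt0.
exists l, (kp / 2); split => //; first by rewrite divr_gt0.
move=> u Mu nM EM; apply: contrapT => /forallNP hx.
have [Hu nu Pu] := Mu; have [hbe _] := Hbe u Mu.
have MM1 : M <= M1 by rewrite (le_trans (ler_norm _))// lerDl.
have EM1 := le_trans EM MM1.
have hF : `|\int[mu]_x F (u x)| <= e * (n2 mu u + np u) + C * (l ^+ 2 * Edir u).
  by apply: H => // x; rewrite leNgt; apply/negP; exact: hx.
have h1 := pohozaev_lower N2 f pV Hu; rewrite Pu /Bf -aE in h1.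
have npM : np u <= M2 by exact: np_le Hu EM1.
have s1 : e * (n2 mu u + np u) <= e * (M1 + M2).
  by rewrite ler_pM2l//; apply: lerD => //; exact: le_trans nM MM1.
have s2 : l ^+ 2 * Edir u <= l * M1.
  apply: ler_pM => //; [exact: sqr_ge0|exact: Edir_ge0|].
  by rewrite expr2 ger_pMl// ge_min lexx.
have s3 : l * M1 <= a * be / (4 * N%:R * C).
  have -> : a * be / (4 * N%:R * C) = a * be / (4 * N%:R * C * M1) * M1.
    by move: (a * be) => y; clearbody M1; field; rewrite !gt_eqF.
  by rewrite ler_pM2r// ge_min lexx orbT.
have s4 : N%:R * (e * (M1 + M2)) = a * be / 4.
  rewrite /e; move: M120; move: (M1 + M2) (a * be) => y1 y2 hy; field; rewrite !gt_eqF//.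
have s5 : N%:R * (C * (l ^+ 2 * Edir u)) <= a * be / 4.
  have -> : a * be / 4 = N%:R * (C * (a * be / (4 * N%:R * C))).
    by move: (a * be) => y; field; rewrite !gt_eqF.
  by rewrite !ler_pM2l//; exact: le_trans s2 s3.
have s6 : N%:R * \int[mu]_x F (u x) <= a * be / 2.
  have := ler_wpM2l (ltW N0) (le_trans (ler_norm _) hF).
  have := ler_wpM2l (ltW N0) s1; move: s4 s5; rewrite !mulrDr.
  move: (N%:R * (e * M1)) (N%:R * (e * M2)) (N%:R * (e * n2 mu u)) (N%:R * (e * np u)) (N%:R * (C
    * (l ^+ 2 * Edir u))) (a * be) (N%:R * \int[mu]_x F (u x)) => *; lra.
have s7 : a * be <= a * Edir u by rewrite ler_pM2l.
have s8 : 0 <= N%:R * (2^-1 * Vinf * n2 mu u).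
  by rewrite mulr_ge0 ?(ltW N0)// mulr_ge0 ?n2_ge0// mulr_ge0// ltW.
have s9 : 0 < a * be by rewrite mulr_gt0.
move: h1; rewrite mulrBr; move: s6 s7 s8 s9.
by move: (a * be) (a * Edir u) (N%:R * (2^-1 * Vinf * n2 mu u)) (N%:R * \int[mu]_x F (u x)) => *;
  lra.
Qed.

Section Sequence.
Context {U : set_system nat} {UU : UltraFilter U} (UF : \oo `<=` U).

(** Covers both cases of [minimiser_exists], [g] being [u] or its translates: energies are evaluated
    on [u], the weak limit on [g]. The last hypothesis supplies the limit [L] of the deficits, which
    is that of [w] without translation and 0 when [u] itself vanishes locally. *)
Lemma minimiser_of_sequence (u g : nat -> 'rV[R]_N -> R) (M c : R) w (S : nat -> set nat) :
  (forall n, MM (u n)) -> (forall n, energy V f (u n) <= c + margin n) ->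
  (forall n, [/\ H1 (g n), n2 mu (g n) <= M, Edir (g n) <= M, Edir (g n) =
    Edir (u n) & BB (g n) = BB (u n)]) ->
  H1 w -> ~ {ae mu, forall x, w x = 0} ->
  (forall h, sqint mu h -> ip mu (g n) h @[n --> U] --> ip mu w h) ->
  (forall h, H1 h -> Dip (g n) h @[n --> U] --> Dip w h) ->
  (forall j, U (S j)) -> 0 < c -> (forall u, MM u -> c <= energy V f u) ->
  (forall t (sg : nat -> nat), 0 < t -> (forall j, S j (sg j)) ->
    (forall r : R, \int[mu]_x (\1_(cube r) x * (g (sg j) x - w x) ^+ 2) @[j --> \oo] --> (0 : R))
      ->
    exists2 L : R, L <= \int[mu]_x ((Vinf - V (t *: x)) * (w x * w x)) &
      \int[mu]_x ((Vinf - V (t *: x)) * (u (sg j) x * u (sg j) x)) @[j --> \oo] --> L) ->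
  exists2 u, MM u & energy V f u <= c.
Proof.
move=> Mu uc gP Hw nw gw Dw US c0 cM key.
have Hg n : H1 (g n) by have [] := gP n.
have gn n : n2 mu (g n) <= M by have [] := gP n.
have gE n : Edir (g n) <= M by have [] := gP n.
have eE n : Edir (g n) = Edir (u n) by have [] := gP n.
have eB n : BB (g n) = BB (u n) by have [] := gP n.
(* Indices at least [j], so that the energy bound holds with [margin j]. *)
pose S' j := S j `&` [set n | (j <= n)%N].
have US' j : U (S' j) by apply: filterI => //; apply: UF; exact: nbhs_infty_ge.
have [sg [e [b [sgS [ve vb] gEe gBb loc]]]] := splitting N2 af pV Hg gn gE Hw gw Dw US'.
have Hu n : H1 (u n) by have [] := Mu n.
apply: (minimiser_of_limit N2 af pV Hw nw _ ve vb _ _ c0 cM).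
- by move=> j; exact: H1B.
- move=> t t0.
  have [||L Lw Lu] := key t sg t0 => //; first by move=> j; have [] := sgS j.
  have lim : energy V f (dilation t (u (sg j))) @[j --> \oo] -->
      2^-1 * (t ^+ N.-2 * (Edir w + e)) + t ^+ N * (BB w + b) - 2^-1 * (t ^+ N * L).
    under eq_fun do rewrite energy_dilation_deficit// -eE -eB.
    apply: cvgB; last by apply: cvgMr; exact: cvgMr.
    by apply: cvgD; [apply: cvgMr; exact: cvgMr|exact: cvgMr].
  (* A point of M maximises its fibre, so the energy of u_t is at most c + margin for every [t]; the
     bound passes to the limit profile. *)
  have limc : 2^-1 * (t ^+ N.-2 * (Edir w + e)) + t ^+ N * (BB w + b) - 2^-1 * (t ^+ N * L) <= c.
    have hc : c + margin j @[j --> \oo] --> c.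
      by rewrite -[X in _ --> X]addr0; apply: cvgD; [exact: cvg_cst|exact: margin_cvg].
    apply: (ler_cvg_to lim hc); apply: nearW => j.
    apply: (le_trans (manifold_max_le N2 af pV (Mu _) t0)); apply: (le_trans (uc _)).
    rewrite lerD2l lef_pV2 ?posrE// ler_nat ltnS; by have [] := sgS j.
  rewrite energy_dilation_deficit//.
  have hL : t ^+ N * L <= t ^+ N * \int[mu]_x ((Vinf - V (t *: x)) * (w x * w x)).
    by rewrite ler_pM2l ?exprn_gt0.
  move: limc hL; rewrite !mulrDr.
  move: (t ^+ N * L) (t ^+ N * \int[mu]_x ((Vinf - V (t *: x)) * (w x * w x))) (t ^+ N.-2 * Edir
    w) (t ^+ N.-2 * e) (t ^+ N * BB w) (t ^+ N * b) => *; lra.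
- have lim : (2^-1 * (1 - th) * (N%:R - 2) * Edir (g (sg j)) +
  N%:R * BB (g (sg j))) @[j --> \oo] -->
     2^-1 * (1 - th) * (N%:R - 2) * (Edir w + e) + N%:R * (BB w + b).
    by apply: cvgD; exact: cvgMr.
  apply: (cvgr_to_le lim); apply: nearW => j; rewrite eE eB.
  have [_ _ Pu] := Mu (sg j); have := pohozaev_lower N2 f pV (Hu (sg j)); by rewrite Pu.
Qed.

End Sequence.

Lemma minimiser_exists (s0 : R) : 0 < s0 -> 2^-1 * Vinf * s0 ^+ 2 < F s0 ->
  exists u, [/\ MM u, forall w, MM w -> energy V f u <= energy V f w & 0 < energy V f u].
Proof.
move=> s00 hs0.
have [be [Cb [be0 Cb0 Hbe]]] := manifold_bounds N2 af pV.
pose al := (1 - th) / N%:R.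
have al0 : 0 < al by rewrite divr_gt0.
have low u : MM u -> al * Edir u <= energy V f u.
  by move=> [Hu _ Pu]; have := energy_lower N2 af pV Hu; rewrite Pu mul0r addr0.
pose A := [set energy V f u | u in MM].
have A0 : A !=set0.
  have [u Hu Bu] := Lambda_nonempty N2 af pV s00 hs0.
  by have [t _ Mt] := fiber_max N2 af pV Hu Bu; exists (energy V f (dilation t u)),
    (dilation t u).
have lbA : lbound A (al * be).
  move=> _ [u Mu <-]; apply: le_trans (low u Mu); rewrite ler_pM2l//.
  by have [] := Hbe u Mu.
have hA : has_inf A by split => //; exists (al * be).
have [c [c0 cM adh]] : exists c : R, [/\ 0 < c, forall u, MM u -> c <= energy V f u &
    forall n, exists u, MM u /\ energy V f u <= c + margin n].
  exists (inf A); split.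
  - by apply: lt_le_trans (lb_le_inf A0 lbA); exact: mulr_gt0.
  - by move=> u Mu; apply: ge_inf; [exists (al * be)|exists u].
  - move=> n; have [_ [u Mu <-] hu] := inf_adherent (margin_gt0 n) hA.
    by exists u; split; [exact: Mu|exact: ltW hu].
suff [u Mu uc] : exists2 u, MM u & energy V f u <= c.
  exists u; split; [exact: Mu|move=> w Mw; exact: le_trans uc (cM _ Mw)|].
  exact: lt_le_trans c0 (cM _ Mu).
have [u uP] := choice adh.
have Mu n : MM (u n) by have [] := uP n.
have uc n : energy V f (u n) <= c + margin n by have [] := uP n.
have Hu n : H1 (u n) by have [] := Mu n.
(* The energy bounds the Dirichlet part through [energy_lower], and this bounds the L2 norm through
   [manifold_bounds]. *)
pose M1 := (c + 1) / al.
have E1 n : Edir (u n) <= M1.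
  rewrite /M1 ler_pdivlMr// mulrC; apply: (le_trans (low _ (Mu n))); apply: (le_trans (uc n)).
  by rewrite lerD2l margin_le1.
have M10 : 0 <= M1 by exact: le_trans (Edir_ge0 _) (E1 0%N).
pose M := M1 + Cb * M1 `^ (p / 2).
have EM n : Edir (u n) <= M.
  by apply: (le_trans (E1 n)); rewrite lerDl; exact: mulr_ge0 (ltW Cb0) (powR_ge0 _ _).
have nM n : n2 mu (u n) <= M.
  have [_ h] := Hbe _ (Mu n); apply: (le_trans h); apply: ler_wpDl => //.
  rewrite ler_pM2l//; apply: ge0_ler_powR;
    [|by rewrite nnegrE Edir_ge0|by rewrite nnegrE|exact: E1].
  by rewrite divr_ge0// ltW// (lt_trans _ p2).
have [U [UU UF]] := @ultraFilterLemma nat \oo _.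
have FU : ProperFilter U by exact: ultra_proper.
have [w [Hw uw Dw]] := @weak_compact_H1 R U UU N u M Hu nM EM.
have sw := H1_sqint Hw.
have [w0|nw] := pselect {ae mu, forall x, w x = 0}; last first.
  apply: (@minimiser_of_sequence U UU UF u u M c w (fun=> setT)) => //.
  - by move=> j; exact: filterT.
  - move=> t sg t0 _ loc; exists (\int[mu]_x ((Vinf - V (t *: x)) * (w x * w x))) => //.
    have sv j : sqint mu (fun x => u (sg j) x - w x) by apply: sqintB => //; exact: H1_sqint.
    have nv j : n2 mu (fun x => u (sg j) x - w x) <= 2 * M + 2 * n2 mu w.
      have := n2_parallelogram_le (H1_sqint (Hu (sg j))) (sqintN sw); rewrite n2N;
        have := nM (sg j).
      by move: (n2 mu (fun x => u (sg j) x - w x)) (n2 mu (u (sg j))) (n2 mu w) => a1 a2 a3; lra.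
    have := weight_split (deficit_weight t0) sw sv nv loc.
    have wE (y z : R) : y + (z - y) = z by rewrite addrC subrK.
    by under eq_fun do under eq_int do rewrite !wE.
have u0 h : sqint mu h -> ip mu (u n) h @[n --> U] --> (0 : R).
  move=> sh; have <- : ip mu w h = 0; last exact: uw.
  rewrite (@ae_eq_ip _ _ _ mu w (fun=> 0) h)//; last exact: sqint_measurable sh.
    by rewrite /ip; under eq_int do rewrite mul0r; exact: int0.
  exact: sqint_measurable sw.
(* The weak limit is zero: the functions are recentred where an average exceeds [d]. Averages are
   weakly continuous, so the new weak limit is not zero. *)
have [l [d [l0 d0 nvan]]] := nonvanishing M.
have [xs xsP] := choice (fun n => nvan _ (Mu n) (nM n) (EM n)).
pose g n x := u n (x + xs n).
have Hg n : H1 (g n) by exact: H1_translate.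
have ng n : n2 mu (g n) = n2 mu (u n) by exact: n2_translate (H1_sqint (Hu n)).
have Eg n : Edir (g n) = Edir (u n) by exact: Edir_translate.
have Bg n : BB (g n) = BB (u n).
  by rewrite /Bf ng (int_translate (xs n) (intg_primitive N2 af (Hu n))).
have gn n : n2 mu (g n) <= M by rewrite ng.
have gE n : Edir (g n) <= M by rewrite Eg.
have [w' [Hw' gw' Dw']] := @weak_compact_H1 R U UU N g M Hg gn gE.
have sw' := H1_sqint Hw'.
have nw' : ~ {ae mu, forall x, w' x = 0}.
  move=> w'0; have sk := @sqint_avg_kernel R N l 0 l0.
  have lim := gw' _ sk.
  have ip0 : ip mu w' (fun y => chi (l^-1 *: (y - 0))) = 0.
    rewrite (@ae_eq_ip _ _ _ mu w' (fun=> 0))//; last exact: sqint_measurable sk.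
      by rewrite /ip; under eq_int do rewrite mul0r; exact: int0.
    exact: sqint_measurable sw'.
  rewrite ip0 in lim.
  have dl : 0 < d * l ^+ N by rewrite mulr_gt0// exprn_gt0.
  have hnear := cvgr0_norm_lt _ lim _ dl; have [n hn] := filter_ex (hnear FU).
  have := xsP n; rewrite -[xs n]add0r avg_translate avg_ip//; last exact: H1_sqint (Hg n).
  rewrite normrM ger0_norm ?exprn_ge0 ?invr_ge0 ?(ltW l0)// exprVn mulrC ltr_pdivlMr ?exprn_gt0//.
  by rewrite ltNge (ltW hn).
(* The original functions tend to 0 locally, so their deficits tend to L = 0, which is at most the
   nonnegative deficit of [w']. *)
pose S j := [set n | \int[mu]_x (\1_(cube j%:R) x * u n x ^+ 2) <= margin j].
apply: (@minimiser_of_sequence U UU UF u g M c w' S) => //.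
- by move=> j; apply: (rellich _ (margin_gt0 j) Hu EM u0).
- move=> t sg t0 Ssg _; exists 0.
    apply: int_ge0 => x; rewrite -expr2; apply: mulr_ge0 (sqr_ge0 _); by rewrite subr_ge0.
  apply: (weight_vanish (deficit_weight t0) (fun j => H1_sqint (Hu (sg j))) (fun j =>
    nM (sg j))) => r.
  exact: (local_cvg0 (fun j => H1_sqint (Hu (sg j)))).
Qed.

End MinimiserExistence.

(** * The minimiser is a critical point *)

(** Here J s t is the energy of the perturbed function at scale [t]. Near t = 1 the slope is at most
    D(1)/2 and beats the error; elsewhere the gap a rho is bounded below and, by [rho_coercive],
    dominates all terms of size s (1 + t^N) for small [s]. *)
Lemma fiber_perturbation (R : realType) (N : nat) (N2 : (2 < N)%N) (J : R -> R -> R) (D : R ->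
  R) (c a K : R) :
  0 < a -> 0 <= K -> {for (1 : R), continuous D} -> D 1 < 0 ->
  (forall t : R, 0 < t -> D t <= K * (1 + t ^+ N)) ->
  (forall e : R, 0 < e -> exists2 d : R, 0 < d & forall s t : R, 0 < s < d -> 0 < t ->
     J s t <= c - a * rho N t + s * D t + e * s * (1 + t ^+ N)) ->
  exists2 d : R, 0 < d & forall s t : R, 0 < s < d -> 0 < t -> J s t < c.
Proof.
move=> a0 K0 cD D1 DK H.
have N0 : 0 < N%:R :> R by rewrite ltr0n (leq_trans _ N2).
have D2 : D 1 < D 1 / 2 by move: D1; lra.
have [r /= r0 hr] : \forall t \near (1 : R), D t < D 1 / 2 by apply: cvgr_lt cD _ _.
(* The bound 1/2 keeps 1 - dl positive and [t] below 2, whence t^N <= 2^N near 1. *)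
pose dl := Num.min (r / 2) 2^-1.
have dl0 : 0 < dl by rewrite lt_min divr_gt0//= invr_gt0.
have dlr : dl < r by rewrite gt_min; apply/orP; left; move: r0; lra.
have dl1 : dl <= 2^-1 by rewrite ge_min lexx orbT.
have hn (t : R) : `|t - 1| <= dl -> D t <= D 1 / 2.
  by move=> ht; apply/ltW/hr; rewrite /= distrC; exact: le_lt_trans dlr.
pose P := 1 + 2 ^+ N : R.
have P0 : 0 < P by rewrite addr_gt0// exprn_gt0.
pose e := Num.min 1 (- D 1 / (4 * P)).
have e0 : 0 < e by rewrite lt_min ltr01 divr_gt0 ?mulr_gt0// oppr_gt0.
have e1 : e <= 1 by rewrite ge_min lexx.
have eP : e * P <= - D 1 / 4.
  apply: le_trans (_ : - D 1 / (4 * P) * P <= _); first by rewrite ler_pM2r// ge_min lexx orbT.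
  by rewrite le_eqVlt; apply/orP; left; apply/eqP; field; rewrite gt_eqF.
have [d1 d10 h1] := H e e0.
have [A A0 hA] := @rho_coercive R N N2.
have lo1 : 0 < 1 - dl by move: dl1; lra.
have hi1 : 0 < 1 + dl by move: dl0; lra.
pose m := Num.min (rho N (1 - dl)) (rho N (1 + dl)).
have m0 : 0 < m.
  rewrite lt_min; apply/andP; split; apply: (rho_gt0 N2) => //.
    by rewrite -subr_eq0 addrAC subrr add0r oppr_eq0 gt_eqF.
  by rewrite -subr_eq0 addrAC subrr add0r gt_eqF.
have [rm1 rm2] := @rho_mono R N N2.
have far (t : R) : 0 < t -> dl < `|t - 1| -> m <= rho N t.
  move=> t0; rewrite ltr_normr => /orP[ht|ht]; rewrite ge_min; apply/orP; [right|left].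
    by apply: rm1; move: dl0 ht; lra.
  by apply: rm2 => //; move: dl0 ht; lra.
pose K1 := K + 1.
have K10 : 0 < K1 by rewrite ltr_wpDl.
(* Away from 1 half of a rho absorbs the part of s K1 (1 + t^N) proportional to [rho], by the second
   bound; the other half, at least a m / 2, absorbs the constant 1 + A, by the third. *)
pose d := Num.min d1 (Num.min (a / (4 * N%:R * K1)) (a * m / (2 * K1 * (1 + A)))).
have A1 : 0 < 1 + A by rewrite addr_gt0.
have d0 : 0 < d by rewrite !lt_min d10 !divr_gt0// !mulr_gt0.
exists d => // s t /andP[s0 sd] t0.
move: sd; rewrite !lt_min => /and3P[sd1 sd2 sd3].
have sd : 0 < s < d1 by rewrite s0.
apply: (le_lt_trans (h1 s t sd t0)).
have r0' := rho_ge0 N2 t0.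
have ar := mulr_ge0 (ltW a0) r0'.
have tN0 : 0 < 1 + t ^+ N by rewrite ltr_wpDr// exprn_ge0// ltW.
have [nt|ft] := leP `|t - 1| dl.
  have tP : 1 + t ^+ N <= P.
    rewrite lerD2l; apply: lerXn2r; rewrite ?nnegrE ?(ltW t0)//.
    by move: (ler_normlP _ _ nt) => -[]; move: dl1; lra.
  have q1 := ler_wpM2l (ltW s0) (hn t nt).
  have q2 : e * s * (1 + t ^+ N) <= s * (- D 1 / 4).
    rewrite [e * s]mulrC -mulrA ler_pM2l//; apply: le_trans eP; by rewrite ler_pM2l.
  have q3 : 0 < s * - D 1 by rewrite mulr_gt0// oppr_gt0.
  move: q1 q2 q3 ar; rewrite !mulrA !mulrN.
  by move: (a * rho N t) (s * D t) (e * s * (1 + t ^+ N)) (s * D 1) => *; lra.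
have mr := far t t0 ft.
have q1 : s * D t + e * s * (1 + t ^+ N) <= s * (K1 * (1 + t ^+ N)).
  have -> : s * (K1 * (1 + t ^+ N)) = s * (K * (1 + t ^+ N)) + 1 * s * (1 + t ^+ N).
    by rewrite /K1; move: (t ^+ N) => y; ring.
  apply: lerD; first by rewrite ler_pM2l//; exact: DK.
  by rewrite ler_pM2r// ler_pM2r.
have q2 : s * (K1 * (1 + t ^+ N)) <= s * K1 * (1 + A) + s * K1 * (2 * N%:R * rho N t).
  rewrite mulrA -mulrDr; apply: ler_wpM2l; first by rewrite mulr_ge0 ?ltW.
  by rewrite -addrA lerD2l; exact: hA.
have q3 : s * K1 * (2 * N%:R * rho N t) <= a * rho N t / 2.
  have -> : s * K1 * (2 * N%:R * rho N t) = s * (4 * N%:R * K1) * rho N t / 2.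
    by move: (rho N t) => y; field.
  rewrite ler_pM2r ?invr_gt0//; apply: ler_wpM2r => //.
  by rewrite -ler_pdivlMr ?mulr_gt0// ltW.
have q4 : s * K1 * (1 + A) < a * rho N t / 2.
  apply: lt_le_trans (_ : a * m / 2 <= _); last by rewrite ler_pM2r ?invr_gt0// ler_pM2l.
  have -> : s * K1 * (1 + A) = s * (2 * K1 * (1 + A)) / 2 by field.
  by rewrite ltr_pM2r ?invr_gt0// -ltr_pdivlMr// !mulr_gt0.
move: q1 q2 q3 q4.
by move: (a * rho N t) (s * D t) (e * s * (1 + t ^+ N)) (s * (K1 * (1 + t ^+ N))) (s * K1 * (1 +
  A)) (s * K1 * (2 * N%:R * rho N t)) => *; lra.
Qed.

(** The comparison needed in [minimiser_dir_deriv_ge0] on plain reals, with m = t^(N-2), n = t^N and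
    the other letters standing for integrals. *)
Lemma perturbed_fiber_bound (R : realType) (I ar E Ep Dp A B Q m n F0 Fs J Jp s e : R) :
  2^-1 * (m * E + n * J) - n * F0 <= I - ar ->
  s ^+ 2 * (Q * (1 + n)) <= e * s * (1 + n) ->
  s ^+ 2 * (m * Ep + n * Jp) <= s ^+ 2 * (Q * (1 + n)) ->
  - (n * (Fs - F0 - s * B)) <= e / 2 * s * (1 + n) ->
  2^-1 * (m * (E + 2 * s * Dp + s ^+ 2 * Ep) + n * (J + 2 * s * A + s ^+ 2 * Jp)) - n * Fs
  <= I - ar + s * (m * Dp + n * A - n * B) + e * s * (1 + n).
Proof. by lra. Qed.

Section CriticalPoint.
Context {R : realType} {N : nat} (N2 : (2 < N)%N) (f : R -> R).
Local Notation p := (critical_exponent R N).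
Context (af : admissible (p - 1) f).
Context (V : 'rV[R]_N -> R) (Vinf th : R) (pV : potential V Vinf th).
Implicit Types (u w h phi : 'rV[R]_N -> R) (x y : 'rV[R]_N) (s t : R).
Local Notation mu := (lebesgue_rV R N).
Local Notation F := (primitive f).
Local Notation BB := (@Bf R N f Vinf).
Local Notation MM := (pohozaev_manifold V f).

Let N20 : 0 < N%:R - 2 :> R. Proof. by rewrite subr_gt0 ltr_nat. Qed.
Let th1 : 0 < 1 - th. Proof. by rewrite subr_gt0; case: pV => _ _ _ [_ /andP[]]. Qed.
Let Vi0 : 0 < Vinf. Proof. by case: pV => _ _ _ []. Qed.
Let V0 x : 0 <= V x. Proof. by case: pV => _ /(_ x)/andP[]. Qed.
Let VV x : V x <= Vinf. Proof. by case: pV => _ /(_ x)/andP[]. Qed.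
Let nV x : `|V x| <= Vinf. Proof. by rewrite ger0_norm. Qed.
Let cV : continuous V. Proof. exact: continuous_V pV. Qed.
Let a0 : 0 < 2^-1 * (1 - th) * (N%:R - 2). Proof. by rewrite !mulr_gt0// invr_gt0. Qed.

Definition dir_deriv u phi : R :=
  Dip u phi + \int[mu]_x (V x * (u x * phi x)) - \int[mu]_x (f (u x) * phi x).

Lemma dir_derivN u phi : H1 u -> H1 phi -> dir_deriv u (fun x => -1 * phi x) = - dir_deriv u phi.
Proof.
move=> Hu Hp; rewrite /dir_deriv (DipZr (-1) Hu Hp).
have i1 := intg_bsq (measurable_V pV) nV (H1_sqint Hu) (H1_sqint Hp).
have i2 := intg_fM N2 af Hu Hp.
have -> : \int[mu]_x (V x * (u x * (-1 * phi x))) = - \int[mu]_x (V x * (u x * phi x)).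
  rewrite -intN//; apply: eq_int => x; move: (V x) (u x) (phi x) => *; ring.
have -> : \int[mu]_x (f (u x) * (-1 * phi x)) = - \int[mu]_x (f (u x) * phi x).
  rewrite -intN//; apply: eq_int => x; move: (f (u x)) (phi x) => *; ring.
by rewrite mulN1r; move: (Dip u phi) => y; ring.
Qed.

Lemma int_weight_expand (b : 'rV[R]_N -> R) (C s : R) u phi :
  measurable_fun [set: 'rV[R]_N] b -> (forall x, `|b x| <= C) -> sqint mu u -> sqint mu phi ->
  \int[mu]_x (b x * ((u x + s * phi x) * (u x + s * phi x))) =
  \int[mu]_x (b x * (u x * u x)) + 2 * s * \int[mu]_x (b x * (u x * phi x)) +
    s ^+ 2 * \int[mu]_x (b x * (phi x * phi x)).
Proof.
move=> mb bC su sp.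
have i1 := intg_bsq mb bC su su; have i2 := intg_bsq mb bC su sp; have i3 := intg_bsq mb bC sp sp.
rewrite -(intZ (2 * s) i2) -(intZ (s ^+ 2) i3).
rewrite -(intD i1 (intgZ _ i2)) -(intD (intgD i1 (intgZ _ i2)) (intgZ _ i3)).
apply: eq_int => x; move: (b x) (u x) (phi x) => *; ring.
Qed.

Lemma Edir_expand s u phi : H1 u -> H1 phi ->
  Edir (fun x => u x + s * phi x) = Edir u + 2 * s * Dip u phi + s ^+ 2 * Edir phi.
Proof. by move=> Hu Hp; rewrite EdirD ?EdirZ ?DipZr ?mulrA//; exact: H1Z. Qed.

Lemma n2_expand s u phi : sqint mu u -> sqint mu phi ->
  n2 mu (fun x => u x + s * phi x) = n2 mu u + 2 * s * ip mu u phi + s ^+ 2 * n2 mu phi.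
Proof.
move=> su sp; rewrite n2D ?n2Z//; last exact: sqintZ.
by rewrite ipC ipZl// [ip mu phi u]ipC mulrA.
Qed.

Lemma primitive_expand_int u phi (e : R) : H1 u -> H1 phi -> 0 < e -> exists2 d : R, 0 < d &
  forall s, 0 < s < d ->
  `|\int[mu]_x F (u x + s * phi x) - \int[mu]_x F (u x) - s * \int[mu]_x (f (u x) * phi x)| <=
    e * s.
Proof.
move=> Hu Hp e0.
pose K := 1 + (Edir phi + n2 mu phi).
have q0 : 0 <= Edir phi + n2 mu phi by rewrite addr_ge0 ?Edir_ge0 ?n2_ge0.
have K1 : 1 <= K by rewrite lerDl.
have K0 : 0 < K by exact: lt_le_trans K1.
have eK : 0 < e / K by rewrite divr_gt0.
have [d d0 H] := primitive_frechet N2 af Hu eK.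
exists (d / K); first by rewrite divr_gt0.
move=> s /andP[s0 sd].
have -> : s * \int[mu]_x (f (u x) * phi x) = \int[mu]_x (f (u x) * (s * phi x)).
  rewrite -(intZ s (intg_fM N2 af Hu Hp)); apply: eq_int => x; move: (f (u x)) (phi x) => *; ring.
have -> : e * s = e / K * (s * K) by field; rewrite gt_eqF.
apply: H; first exact: H1Z.
  by rewrite mulr_gt0//= -ltr_pdivlMr.
rewrite EdirZ// n2Z; last exact: H1_sqint.
rewrite -mulrDr exprMn ler_pM2l ?exprn_gt0//.
apply: (@le_trans _ _ K); first by rewrite lerDr.
by rewrite expr2 ler_peMl// ltW.
Qed.

Lemma minimiser_dir_deriv_ge0 u phi : MM u -> (forall w, MM w -> energy V f u <= energy V f w) ->
  H1 phi -> 0 <= dir_deriv u phi.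
Proof.
move=> Mu umin Hp; rewrite leNgt; apply/negP => neg.
have [Hu nu _] := Mu; have su := H1_sqint Hu; have sp := H1_sqint Hp.
have E0 := Edir_gt0 N2 Hu nu.
pose Hs s : H1 (fun x => u x + s * phi x) := H1D Hu (H1Z s Hp).
pose A t := \int[mu]_x (V (t *: x) * (u x * phi x)).
pose B := \int[mu]_x (f (u x) * phi x).
(* The derivative at s = 0 of the energy of u + s phi dilated by [t]; at t = 1 it is
   [dir_deriv u phi]. *)
pose D t := t ^+ N.-2 * Dip u phi + t ^+ N * A t - t ^+ N * B.
have iup : intg mu (fun x => u x * phi x) := sqintM su sp.
have mVt t : measurable_fun [set: 'rV[R]_N] (fun x => V (t *: x)) by exact: measurable_scale.
have ivt t u1 u2 : sqint mu u1 -> sqint mu u2 -> `|\int[mu]_x (V (t *: x) * (u1 x * u2 x))| <=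
  Vinf * \int[mu]_x `|u1 x * u2 x|.
  move=> s1 s2; have i12 := intg_norm (sqintM s1 s2); rewrite -(intZ Vinf i12).
  apply: int_norm_le; [exact: intg_bsq (mVt t) (fun x => nV _) s1 s2|exact: intgZ|].
  by move=> x; rewrite normrM; exact: ler_wpM2r.
have tN1 t : 0 < t -> t ^+ N.-2 <= 1 + t ^+ N.
  move=> t0; have [t1|t1] := leP t 1.
    have h1 : t ^+ N.-2 <= 1 by apply: exprn_ile1 => //; exact: ltW.
    by apply: (le_trans h1); rewrite lerDl exprn_ge0// ltW.
  apply: ler_wpDl => //; apply: ler_weXn2l; first exact: ltW.
  by rewrite -subn2 leq_subr.
pose K := `|Dip u phi| + Vinf * \int[mu]_x `|u x * phi x| + `|B|.
have I0 : 0 <= Vinf * \int[mu]_x `|u x * phi x| by rewrite mulr_ge0 ?(ltW Vi0)//; exact: int_ge0.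
have K0 : 0 <= K by rewrite !addr_ge0.
have DK t : 0 < t -> D t <= K * (1 + t ^+ N).
  move=> t0; have tN0 : 0 <= t ^+ N by rewrite exprn_ge0// ltW.
  have tm0 : 0 <= t ^+ N.-2 by rewrite exprn_ge0// ltW.
  have q1 : t ^+ N.-2 * Dip u phi <= (1 + t ^+ N) * `|Dip u phi|.
    apply: (le_trans (ler_wpM2l tm0 (ler_norm _))); apply: ler_wpM2r => //; exact: tN1.
  have tle : t ^+ N <= 1 + t ^+ N by rewrite lerDr.
  have q2 : t ^+ N * A t <= (1 + t ^+ N) * (Vinf * \int[mu]_x `|u x * phi x|).
    apply: (le_trans (ler_wpM2l tN0 (le_trans (ler_norm _) (ivt t u phi su sp)))).
    exact: ler_wpM2r.
  have q3 : - (t ^+ N * B) <= (1 + t ^+ N) * `|B|.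
    rewrite -mulrN; apply: (le_trans (ler_wpM2l tN0 (ler_norm _))); rewrite normrN.
    exact: ler_wpM2r.
  by rewrite [leRHS]mulrC /K !mulrDr; apply: lerD => //; apply: lerD.
have cD : {for (1 : R), continuous D}.
  have cA : A t @[t --> (1 : R)] --> A 1 by apply: (continuous_int_scale cV nV iup).
  have cX (n : nat) : t ^+ n @[t --> (1 : R)] --> (1 : R) ^+ n by exact: exprn_continuous.
  apply: cvgB; last by apply: cvgM; [exact: cX|exact: cvg_cst].
  by apply: cvgD; apply: cvgM; [exact: cX|exact: cvg_cst|exact: cX|exact: cA].
have D1 : D 1 < 0.
  move: neg; rewrite /dir_deriv /D !expr1n !mul1r /A.
  by under [in X in _ -> X]eq_int do rewrite scale1r.
set a := 2^-1 * (1 - th) * (N%:R - 2) * Edir u.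
have aE0 : 0 < a by rewrite mulr_gt0.
have [|d d0 Hd] := @fiber_perturbation R N N2 (fun s t => energy V f (dilation t (fun x => u x +
  s * phi x))) D
    (energy V f u) a K aE0 K0 cD D1 DK.
  move=> e e0; have e2 : 0 < e / 2 by rewrite divr_gt0.
  have [d d0 hd] := primitive_expand_int Hu Hp e2.
  pose Q := Edir phi + Vinf * \int[mu]_x `|phi x * phi x| + 1.
  have Ip0 : 0 <= Vinf * \int[mu]_x `|phi x * phi x| by rewrite mulr_ge0 ?(ltW Vi0)//;
    exact: int_ge0.
  have Q0 : 0 < Q by rewrite ltr_wpDl// addr_ge0 ?Edir_ge0.
  exists (Num.min d (e / Q)); first by rewrite lt_min d0 divr_gt0.
  move=> s t /andP[s0]; rewrite lt_min => /andP[sd sQ] t0.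
  have sd' : 0 < s < d by rewrite s0.
  have rem := hd s sd'.
  have tN0 : 0 <= t ^+ N by rewrite exprn_ge0// ltW.
  have tm0 : 0 <= t ^+ N.-2 by rewrite exprn_ge0// ltW.
  have mt := manifold_max N2 af pV Mu t0.
  rewrite (energy_dilation N2 af pV t0 Hu) in mt.
  rewrite (energy_dilation N2 af pV t0 (Hs s)) Edir_expand//.
  rewrite (int_weight_expand s (mVt t) (fun x => nV _) su sp) -/(A t).
  have sQ' : s * Q <= e by rewrite -ler_pdivlMr// ltW.
  have q1 : t ^+ N.-2 * Edir phi + t ^+ N * \int[mu]_x (V (t *: x) * (phi x * phi x)) <= Q * (1 +
    t ^+ N).
    have h1 : t ^+ N.-2 * Edir phi <= (1 + t ^+ N) * Edir phi by rewrite ler_wpM2r ?Edir_ge0//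
      tN1.
    have h2 : t ^+ N * \int[mu]_x (V (t *: x) * (phi x * phi x)) <= (1 +
      t ^+ N) * (Vinf * \int[mu]_x `|phi x * phi x|).
      apply: (le_trans (ler_wpM2l tN0 (le_trans (ler_norm _) (ivt t phi phi sp sp)))).
      by apply: ler_wpM2r => //; rewrite lerDr.
    rewrite [leRHS]mulrC /Q mulrDr mulr1; apply: ler_wpDr; first by rewrite addr_ge0.
    by rewrite mulrDr; exact: lerD.
  have q2 : s ^+ 2 * (Q * (1 + t ^+ N)) <= e * s * (1 + t ^+ N).
    rewrite mulrA; apply: ler_wpM2r; first by rewrite addr_ge0.
    by rewrite expr2 -mulrA mulrC ler_pM2r.
  have q3 := ler_wpM2l (sqr_ge0 s) q1.
  have q4 : - (t ^+ N * (\int[mu]_x F (u x + s * phi x) - \int[mu]_x F (u x) - s * B)) <=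
    e / 2 * s * (1 + t ^+ N).
    rewrite -mulrN [leRHS]mulrC; apply: (le_trans (ler_wpM2l tN0 (ler_norm _))); rewrite normrN.
    apply: (le_trans (ler_wpM2l tN0 rem)); apply: ler_wpM2r; last by rewrite lerDr.
    by rewrite mulr_ge0// ltW.
  have aE : a * rho N t = 2^-1 * (1 - th) * (N%:R - 2) * rho N t * Edir u by rewrite /a mulrAC.
  rewrite -aE in mt; rewrite /D.
  exact: (perturbed_fiber_bound (Dip u phi) (A t) mt q2 q3 q4).
(* For small [s] the perturbed function is still in Lambda, so its fibre meets M at a point whose
   energy is at least that of [u], against the strict bound just obtained. [K'] bounds the rate at
   which [Bf] moves. *)
pose K' := Vinf * (`|ip mu u phi| + n2 mu phi) + `|B| + 1.
have np0 := n2_ge0 mu phi.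
have K'0 : 0 < K' by rewrite ltr_wpDl// addr_ge0// mulr_ge0 ?(ltW Vi0)// addr_ge0.
have Bu : BB u < 0 by have /(Lambda_Bf N2 af)[] := manifold_Lambda N2 af pV Mu.
have [d2 d20 hd2] := primitive_expand_int Hu Hp (ltr01 : 0 < 1 :> R).
pose s := Num.min (Num.min d d2) (Num.min 1 (- BB u / K')) / 2.
have m0 : 0 < Num.min (Num.min d d2) (Num.min 1 (- BB u / K')).
  by rewrite !lt_min d0 d20 ltr01/= divr_gt0// oppr_gt0.
have s0 : 0 < s by rewrite divr_gt0.
have sm : s < Num.min (Num.min d d2) (Num.min 1 (- BB u / K')) by rewrite /s; move: m0; lra.
move: sm; rewrite !lt_min => /andP[/andP[sd sd2] /andP[s1 sB]].
rewrite ltr_pdivlMr// in sB.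
have Bs : BB (fun x => u x + s * phi x) < 0.
  have s02 : 0 < s < d2 by rewrite s0.
  have := hd2 s s02; rewrite mul1r => /ler_normlP[hF _].
  have hB : - (s * B) <= s * `|B| by rewrite -mulrN ler_pM2l// -normrN; exact: ler_norm.
  have hi : s * ip mu u phi <= s * `|ip mu u phi| by rewrite ler_pM2l//; exact: ler_norm.
  have hn : s ^+ 2 * n2 mu phi <= s * n2 mu phi.
    by rewrite ler_wpM2r// expr2 ger_pMl// ltW.
  have hi' := ler_wpM2l (ltW Vi0) hi; have hn' := ler_wpM2l (ltW Vi0) hn.
  have hn0 : 0 <= Vinf * (s * n2 mu phi) by rewrite mulr_ge0 ?(ltW Vi0)// mulr_ge0// ltW.
  move: sB; rewrite /K' /Bf (n2_expand s su sp) !mulrDr mulr1.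
  move: hF hB hi' hn' hn0; rewrite -/B.
  move: (n2 mu u) (n2 mu phi) (`|ip mu u phi|) (ip mu u phi) (`|B|) (B) (\int[mu]_x F (u x))
    (\int[mu]_x F (u x + s * phi x)) (s) => *; lra.
have [t t0 Mt] := fiber_max N2 af pV (Hs s) Bs.
have s0d : 0 < s < d by rewrite s0.
by have := Hd s t s0d t0; rewrite ltNge (umin _ Mt).
Qed.

Lemma minimiser_dir_deriv0 u phi : MM u -> (forall w, MM w -> energy V f u <= energy V f w) ->
  H1 phi -> dir_deriv u phi = 0.
Proof.
move=> Mu um Hp; have [Hu _ _] := Mu; apply/eqP; rewrite eq_le; apply/andP; split.
  rewrite -oppr_ge0 -dir_derivN//; exact: minimiser_dir_deriv_ge0 (H1Z _ Hp).
exact: minimiser_dir_deriv_ge0.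
Qed.

Lemma H1norm_sqr h : H1 h -> H1norm h ^+ 2 = Edir h + n2 mu h.
Proof.
move=> Hh; rewrite /H1norm sqr_sqrtr; last first.
  by apply: int_ge0 => x; rewrite addr_ge0// sqr_ge0.
by rewrite intD//; [exact: intg_enorm_wgrad|exact: sqint_sqr (H1_sqint Hh)].
Qed.

Lemma energy_expand u h : H1 u -> H1 h ->
  energy V f (u \+ h) - energy V f u = dir_deriv u h
   + 2^-1 * (Edir h + \int[mu]_x (V x * (h x * h x)))
   - (\int[mu]_x F (u x + h x) - \int[mu]_x F (u x) - \int[mu]_x (f (u x) * h x)).
Proof.
move=> Hu Hh; have su := H1_sqint Hu; have sh := H1_sqint Hh.
have EQ : (u \+ h) = (fun x => u x + 1 * h x) by apply/funext => x; rewrite /= mul1r.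
rewrite EQ (energyE f pV (H1D Hu (H1Z 1 Hh))) (energyE f pV Hu) (Edir_expand 1 Hu Hh).
rewrite (int_weight_expand 1 (measurable_V pV) nV su sh) /dir_deriv expr1n mulr1 !mul1r.
have -> : \int[mu]_x F (u x + 1 * h x) = \int[mu]_x F (u x + h x).
  by apply: eq_int => x; rewrite mul1r.
move: (Edir u) (Edir h) (Dip u h) (\int[mu]_x F (u x)) (\int[mu]_x F (u x + h x))
  (\int[mu]_x (f (u x) * h x)) (\int[mu]_x (V x * (h x * h x))) (\int[mu]_x (V x * (u x * h x)))
  (\int[mu]_x (V x * (u x * u x))) => *; by field.
Qed.

Lemma minimiser_critical u : MM u -> (forall w, MM w -> energy V f u <= energy V f w) ->
  critical_point (energy V f) u.
Proof.
move=> Mu um; have [Hu _ _] := Mu; split => // e e0.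
have e2 : 0 < e / 2 by rewrite divr_gt0.
have [d1 d10 H] := primitive_frechet N2 af Hu e2.
have V1 : 0 < 1 + Vinf by rewrite addr_gt0.
pose d := Num.min d1 (e / (1 + Vinf)).
have d0 : 0 < d by rewrite lt_min d10 divr_gt0.
exists d => // h Hh hd.
have n0 : 0 <= H1norm h by rewrite sqrtr_ge0.
(* [primitive_frechet] wants a positive size while the norm of [h] may be 0, so the estimate is made
   for every [s] above the norm and [s] is then brought down to it. *)
have key s : H1norm h < s -> s < d -> `|energy V f (u \+ h) - energy V f u - 0| <= e * s.
  move=> hs sd; have s0 : 0 < s by exact: le_lt_trans hs.
  move: sd; rewrite lt_min => /andP[sd1 sV]; rewrite ltr_pdivlMr// in sV.
  have q2 : Edir h + n2 mu h <= s ^+ 2.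
    rewrite -H1norm_sqr//; apply: lerXn2r; rewrite ?nnegrE ?(ltW s0)//; exact: ltW.
  have s01 : 0 < s < d1 by rewrite s0.
  have rem := H h s Hh s01 q2.
  rewrite subr0 energy_expand// (minimiser_dir_deriv0 Mu um Hh) add0r.
  apply: (le_trans (ler_normB _ _)).
  have sh := H1_sqint Hh.
  have J0 : 0 <= \int[mu]_x (V x * (h x * h x)).
    by apply: int_ge0 => x; rewrite -expr2; exact: mulr_ge0 (V0 x) (sqr_ge0 _).
  have J1 : \int[mu]_x (V x * (h x * h x)) <= Vinf * n2 mu h.
    rewrite /n2 -(intZ Vinf (sqint_sqr sh)).
    apply: int_le; [exact: (intg_bsq (measurable_V pV) nV sh sh)|exact: intgZ (sqint_sqr sh)|].
    by move=> x; rewrite -expr2; apply: ler_wpM2r => //; exact: sqr_ge0.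
  have Eh0 := Edir_ge0 h; have nh0 := n2_ge0 mu h.
  have q3 : Edir h + \int[mu]_x (V x * (h x * h x)) <= e * s.
    apply: (@le_trans _ _ ((1 + Vinf) * s ^+ 2)); last first.
      by rewrite expr2 mulrA ler_pM2r// mulrC ltW.
    apply: (@le_trans _ _ ((1 + Vinf) * (Edir h + n2 mu h))); last by rewrite ler_pM2l.
    rewrite mulrDl mul1r; have := mulr_ge0 (ltW Vi0) Eh0; move: J1; rewrite mulrDr.
    by move: (Vinf * Edir h) (Vinf * n2 mu h) (Edir h) (n2 mu h) nh0 (\int[mu]_x (V x * (h x * h
      x))) => *; lra.
  have hh0 : 0 <= 2^-1 * (Edir h + \int[mu]_x (V x * (h x * h x))).
    by rewrite mulr_ge0// ?invr_ge0// addr_ge0.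
  rewrite (ger0_norm hh0).
  move: q3 rem; move: (Edir h + \int[mu]_x (V x * (h x * h x))) (`|_|) => *; lra.
apply/ler_addgt0Pr => eta eta0.
pose s := Num.min (H1norm h + eta / e) ((H1norm h + d) / 2).
have h1 : H1norm h < s.
  rewrite lt_min ltrDl divr_gt0//=; move: hd; move: (H1norm h) (d) => *; lra.
have h2 : s < d.
  by rewrite gt_min; apply/orP; right; move: hd; move: (H1norm h) (d) => *; lra.
apply: (le_trans (key s h1 h2)).
have -> : e * H1norm h + eta = e * (H1norm h + eta / e).
  by move: (H1norm h) => y; field; rewrite gt_eqF.
by rewrite ler_pM2l// ge_min lexx.
Qed.

End CriticalPoint.

(** * From the hypotheses of the theorem to their working form *)

Lemma admissible_of_growth (R : realType) (N : nat) (f : R -> R) : (2 < N)%N -> continuous f ->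
  (exists C0 : R, 0 < C0 /\ forall t : R, `|f t| <= C0 * (1 +
    `|t| `^ (critical_exponent R N - 1))) ->
  f t / t @[t --> 0^'] --> (0 : R) ->
  `|f t| / `|t| `^ ((N%:R + 2) / (N%:R - 2)) @[t --> +oo] --> (0 : R) ->
  `|f t| / `|t| `^ ((N%:R + 2) / (N%:R - 2)) @[t --> -oo] --> (0 : R) ->
  admissible (critical_exponent R N - 1) f.
Proof.
move=> N2 fc [C0 [C00 fC]] f0 fp fn.
have N20 : 0 < N%:R - 2 :> R by rewrite subr_gt0 ltr_nat.
have qE : (N%:R + 2) / (N%:R - 2) = critical_exponent R N - 1.
  by rewrite /critical_exponent; move: N20; move: (N%:R : R) => n n0; field; rewrite gt_eqF.
rewrite qE in fp fn; move: fC fp fn; set q := critical_exponent R N - 1 => fC fp fn.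
have q1 : 1 < q by have := critical_exponent_gt2 N2 (R := R); rewrite /q; lra.
have small' (e : R) : 0 < e -> exists2 d : R, 0 < d & forall t : R, t != 0 -> `|t| < d ->
  `|f t| <= e * `|t|.
  move=> e0; have [d /= d0 hd] := cvgr0_norm_le _ f0 _ e0.
  exists d => // t t0 td; have := hd t; rewrite /= sub0r normrN => /(_ td t0).
  by rewrite normf_div ler_pdivrMr ?normr_gt0.
(* The limit of f(t)/t is taken over nonzero [t], so the value at 0 has to come from continuity. *)
have f00 : f 0 = 0.
  apply/eqP/negPn/negP => nf; have nf0 : 0 < `|f 0| by rewrite normr_gt0.
  have nf2 : 0 < `|f 0| / 2 by rewrite divr_gt0.
  have [d d0 hd] := small' 1 ltr01.
  have /cvgrPdist_le/(_ _ nf2)[d' /= d'0 hd'] := fc 0.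
  pose t := Num.min (Num.min d d') `|f 0| / 3.
  have m0 : 0 < Num.min (Num.min d d') `|f 0| by rewrite !lt_min d0 d'0.
  have t0 : 0 < t by rewrite divr_gt0.
  have tm : t < Num.min (Num.min d d') `|f 0| by rewrite /t; move: m0; lra.
  have tf : 3 * t <= `|f 0| by rewrite /t mulrC divfK// ge_min lexx orbT.
  move: tm; rewrite !lt_min => /andP[/andP[td td'] _].
  have h1 := hd t (lt0r_neq0 t0); rewrite mul1r (gtr0_norm t0) in h1.
  have h2 := hd' t; rewrite /= sub0r normrN (gtr0_norm t0) in h2.
  have h3 := ler_distD (f t) (f 0) 0; rewrite !subr0 in h3.
  by move: h3 (h1 td) (h2 td') tf t0; lra.
have small (e : R) : 0 < e -> exists2 d : R, 0 < d & forall t : R, `|t| <= d -> `|f t| <=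
  e * `|t|.
  move=> e0; have [d d0 hd] := small' e e0; exists (d / 2); first by rewrite divr_gt0.
  move=> t td; have [->|t0] := eqVneq t 0; first by rewrite f00 normr0 mulr0.
  by apply: hd => //; move: d0 td; lra.
split => //.
- have [d d0 hd] := small 1 ltr01.
  (* For |t| <= d smallness at 0 gives |f t| <= |t|; for |t| > d the constant term [C0] is at most
     (C0 / d) |t|. *)
  exists (1 + C0 + C0 / d); first by rewrite !addr_gt0// divr_gt0.
  move=> t; have a0 := normr_ge0 t; have b0 := powR_ge0 `|t| q.
  have Cd : 0 < C0 / d by rewrite divr_gt0.
  have [td|td] := leP `|t| d.
    apply: (le_trans (hd t td)).
    have h1 : 0 <= (C0 + C0 / d) * `|t| by rewrite mulr_ge0// addr_ge0// ltW.
    have h2 : 0 <= (1 + C0 + C0 / d) * `|t| `^ q by rewrite mulr_ge0// !addr_ge0// ltW.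
    move: h1 h2; rewrite !mulrDr !mulrDl; move: (`|t| `^ q) (C0 / d) => *; lra.
  apply: (le_trans (fC t)).
  have h1 : C0 <= C0 / d * `|t| by rewrite mulrAC -mulrA ler_peMr ?(ltW C00)// ler_pdivlMr//
    mul1r ltW.
  have h2 : 0 <= (1 + C0) * `|t| by rewrite mulr_ge0// addr_ge0// ltW.
  have h3 : 0 <= (1 + C0 / d) * `|t| `^ q by rewrite mulr_ge0// addr_ge0// ltW.
  move: h1 h2 h3; rewrite !mulrDr !mulrDl; move: (`|t| `^ q) (C0 / d) => *; lra.
- move=> e e0.
  have [M1 [M1r h1]] := cvgr0_norm_le _ fp _ e0.
  have [M2 [M2r h2]] := cvgr0_norm_le _ fn _ e0.
  exists (`|M1| + `|M2| + 1); first by rewrite ltr_wpDl// addr_ge0.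
  move=> t Mt.
  have t0 : 0 < `|t| by apply: lt_le_trans Mt; rewrite ltr_wpDl// addr_ge0.
  have tq : 0 < `|t| `^ q by exact: powR_gt0.
  have key : `| `|f t| / `|t| `^ q | <= e -> `|f t| <= e * `|t| `^ q.
    by rewrite ger0_norm ?ler_pdivrMr// divr_ge0// ltW.
  apply: key; have := ler_norm M1; have := ler_norm (- M2); rewrite normrN => l2 l1.
  have := normr_ge0 M1; have := normr_ge0 M2 => p1 p2'.
  have [tp|tn] := leP 0 t.
    by apply: h1; rewrite (ger0_norm tp) in Mt; move: Mt l1 p1; lra.
  by apply: h2; rewrite (ltr0_norm tn) in Mt; move: Mt l2 p2'; lra.
Qed.

Lemma potential_of_monotone (R : realType) (N : nat) (V : 'rV[R]_N -> R) (Vinf theta : R) :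
  class_C 1 V -> (forall x, 0 <= V x) ->
  (forall e : R, 0 < e -> exists r : R, forall y, r < enorm y -> `|V y - Vinf| < e) ->
  0 < Vinf -> (forall x, V x <= Vinf) -> 0 <= theta < 1 ->
  (forall x : 'rV[R]_N, x != 0 ->
     let Q (t : R) :=
       N%:R * (V x - V (t *: x))
       + (dotv (grad V x) x - dotv (grad V (t *: x)) (t *: x))
       + (N%:R - 2) ^+ 3 * theta / (4 * t ^+ 2 * enorm x ^+ 2)
         * (t ^+ 2 - 1) in
     (forall t : R, 1 <= t -> 0 <= Q t) /\
     (forall t : R, 0 < t < 1 -> Q t <= 0)) ->
  potential V Vinf theta.
Proof.
move=> VC V0 Vl Vi VV th H; split => // [x|x t x0 Q]; first by rewrite V0 VV.
have QE : 0 < t -> Q = N%:R * (V x - V (t *: x))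
       + (dotv (grad V x) x - dotv (grad V (t *: x)) (t *: x))
       + (N%:R - 2) ^+ 3 * theta / (4 * t ^+ 2 * enorm x ^+ 2) * (t ^+ 2 - 1).
  move=> t0; rewrite /Q /kV [(4 * _ * _)^-1]invfM.
  move: (V x) (V (t *: x)) (dotv (grad V x) x) (dotv (grad V (t *: x)) (t *: x)) ((enorm x ^+
    2)^-1) ((N%:R - 2) ^+ 3) => *.
  by field; rewrite gt_eqF.
have [h1 h2] := H x x0; split => ht.
  by rewrite QE ?(lt_le_trans ltr01 ht)//; exact: h1.
by rewrite QE; [exact: h2|case/andP: ht].
Qed.

Theorem theorem1p2 (R : realType) (N : nat) (hN : (3 <= N)%N)
  (V : 'rV[R]_N -> R) (Vinf : R) (f : R -> R)
  (* (a) *)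
  (V_C1 : class_C 1 V)
  (V_ge0 : forall x, 0 <= V x)
  (V_lim : forall e : R, 0 < e ->
     exists r : R, forall y, r < enorm y -> `|V y - Vinf| < e)
  (Vinf_gt0 : 0 < Vinf)
  (V_le : forall x, V x <= Vinf)
  (* (b) *)
  (V_mono : exists theta : R, 0 <= theta < 1 /\
     forall x : 'rV[R]_N, x != 0 ->
     let Q (t : R) :=
       N%:R * (V x - V (t *: x))
       + (dotv (grad V x) x - dotv (grad V (t *: x)) (t *: x))
       + (N%:R - 2) ^+ 3 * theta / (4 * t ^+ 2 * enorm x ^+ 2)
         * (t ^+ 2 - 1) in
     (forall t : R, 1 <= t -> 0 <= Q t) /\
     (forall t : R, 0 < t < 1 -> Q t <= 0))
  (* (c) *)
  (f_cont : continuous f)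
  (f_growth : exists C0 : R, 0 < C0 /\ forall t : R,
     `|f t| <= C0 * (1 + `|t| `^ (critical_exponent R N - 1)))
  (f_o0 : f t / t @[t --> 0^'] --> (0 : R))
  (f_opinfty : `|f t| / `|t| `^ ((N%:R + 2) / (N%:R - 2)) @[t --> +oo]
                 --> (0 : R))
  (f_oninfty : `|f t| / `|t| `^ ((N%:R + 2) / (N%:R - 2)) @[t --> -oo]
                 --> (0 : R))
  (F_s0 : exists s0 : R, 0 < s0 /\ 2^-1 * Vinf * s0 ^+ 2 < primitive f s0) :
  exists ubar : 'rV[R]_N -> R,
    [/\ weak_solution V f ubar,
        (energy V f ubar)%:E =
          ereal_inf [set (energy V f u)%:E | u in pohozaev_manifold V f],
        (* the maximum over t > 0 is attained, hence equals the supremum *)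
        forall u, Lambda Vinf f u -> exists2 t0 : R, 0 < t0 &
          forall t : R, 0 < t ->
            energy V f (dilation t u) <= energy V f (dilation t0 u),
        (energy V f ubar)%:E =
          ereal_inf [set ereal_sup [set (energy V f (dilation t u))%:E
                                   | t in [set t : R | 0 < t]]
                    | u in Lambda Vinf f]
      & 0 < energy V f ubar].
Proof.
have [theta [th Vm]] := V_mono; have [s0 [s00 hs0]] := F_s0.
have af := admissible_of_growth hN f_cont f_growth f_o0 f_opinfty f_oninfty.
have pV := potential_of_monotone V_C1 V_ge0 V_lim Vinf_gt0 V_le th Vm.
have [u [Mu umin upos]] := minimiser_exists hN af pV s00 hs0.
have attained w : Lambda Vinf f w -> exists2 t0 : R,
  0 < t0 & pohozaev_manifold V f (dilation t0 w).
  by move=> Lw; have [Hw Bw] := (Lambda_Bf hN af Vinf w).1 Lw; exact: (fiber_max hN af pV Hw Bw).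
exists u; split.
- exact: (minimiser_critical hN af pV Mu umin).
- apply/eqP; rewrite eq_le; apply/andP; split.
    by apply: le_ereal_inf_tmp => _ [w Mw <-]; rewrite lee_fin; exact: umin.
  by apply: ereal_inf_lbound; exists u.
- move=> w Lw; have [t0 t00 Mt0] := attained w Lw; exists t0; [exact: t00|move=> t tp].
  have -> : dilation t w = dilation (t / t0) (dilation t0 w).
    by rewrite dilation_comp divfK//; exact: lt0r_neq0.
  exact: (manifold_max_le hN af pV Mt0 (divr_gt0 tp t00)).
- apply/eqP; rewrite eq_le; apply/andP; split.
    apply: le_ereal_inf_tmp => _ [w Lw <-]; have [t0 t00 Mt0] := attained w Lw.
    apply: (@le_trans _ _ (energy V f (dilation t0 w))%:E).
      by rewrite lee_fin; exact: umin.
    by apply: ereal_sup_ubound; exists t0.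
  apply: (@le_trans _ _ (ereal_sup [set (energy V f (dilation t u))%:E | t in [set t : R | 0 <
    t]])).
    by apply: ereal_inf_lbound; exists u; [exact: (manifold_Lambda hN af pV Mu)|].
  apply: ge_ereal_sup => _ [t t0 <-]; rewrite lee_fin; exact: (manifold_max_le hN af pV Mu t0).
- exact: upos.
Qed.
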